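(* Let $(M,g,\mathcal F)$ be a compact connected foliated Riemannian manifold (without boundary) of nonnegative transversal Ricci curvature, and let $(M',g',\mathcal F')$ be a foliated Riemannian manifold of nonpositive transversal sectional curvature. If $\phi:(M,\mathcal F)\to(M',\mathcal F')$ is transversally harmonic, then $\phi$ is transversally totally geodesic, i.e. $\tilde\nabla_{\rm tr}d_T\phi=0$. Furthermore: (1) If the transversal Ricci curvature ${\rm Ric}^Q$ of $\mathcal F$ is positive somewhere, then $\phi$ is transversally constant, i.e. $d\phi(TM)\subset L'$; equivalently, $\phi(M)$ is contained in a leaf of $\mathcal F'$. (2) If the transversal sectional curvature $K^{Q'}$ of $\mathcal F'$ is negative at some point, then either $\phi$ is transversally constant or $\phi(M)$ is a transversally geodesic closed curve.
   Context: A foliated Riemannian manifold $(M,g,\mathcal F)$ is a smooth manifold with a foliation $\mathcal F$ of dimension $p$ and codimension $q$ and a bundle-like metric $g$ (so $\mathcal F$ is a Riemannian foliation). $L\subset TM$ is the tangent bundle of $\mathcal F$, $Q=TM/L$ the normal bundle, $\pi:TM\to Q$ the projection, and $\sigma:Q\to L^\perp$ the bundle map with $\pi\circ\sigma=\mathrm{id}$; $Q$ is identified with $L^\perp$ via $\sigma$, with metric $g_Q(s,t)=g(\sigma(s),\sigma(t))$. The transverse Levi-Civita connection $\nabla$ on $Q$ is given by $\nabla_Xs=\pi([X,\sigma(s)])$ for $X\in\Gamma L$ and $\nabla_Xs=\pi(\nabla^M_X\sigma(s))$ for $X\in\Gamma L^\perp$, where $\nabla^M$ is the Levi-Civita connection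 of $g$. Its curvature is $R^Q(X,Y)=[\nabla_X,\nabla_Y]-\nabla_{[X,Y]}$; the transversal sectional curvature $K^Q$ and the transversal Ricci operator ${\rm Ric}^Q(s)=\sum_aR^Q(s,E_a)E_a$ are formed from $R^Q$ and $g_Q$ in the usual way. Corresponding objects on $M'$ carry a prime. A local orthonormal basic frame $\{E_a\}_{a=1}^q$ of $Q$ is a local orthonormal frame whose elements are projections $\pi(Y)$ of local vector fields $Y$ with $[Y,Z]\in\Gamma L$ for all $Z\in\Gamma L$. A smooth map $\phi:M\to M'$ is foliated if $d\phi(L)\subset L'$. Then $d_T\phi:=\pi'\circ d\phi\circ\sigma:Q\to Q'$ is a section of $Q^*\otimes\phi^{-1}Q'$. Let $\nabla^\phi$ be the pull-back to $\phi^{-1}Q'$ of the transverse Levi-Civita connection of $Q'$, and $\tilde\nabla$ the induced connection on $Q^*\otimes\phi^{-1}Q'$. Set $(\tilde\nabla_{\rm tr}d_T\phi)(X,Y)=(\tilde\nabla_Xd_T\phi)(Y)$ for $X,Y\in\Gamma Q$; $\phi$ is transversally totally geodesic if $\tilde\nabla_{\rm tr}d_T\phi=0$. The transversal tension field is $\tau_b(\phi)=\sum_{a=1}^q(\tilde\nabla_{E_a}d_T\phi)(E_a)$, and a smooth foliated map $\phi$ is transversally harmonic if $\tau_b(\phi)=0$. The phrase ''$\phi(M)$ is a transversally geodesic closed curve'' is understood transversally, i.e. modulo the leaves of $\mathcal F'$: the image of $\phi(M)$ in the leaf space $M'/\mathcal F'$ is a closed geodesic, where geodesics are taken in the local quotient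 manifolds of $\mathcal F'$ with the metric induced by $g_{Q'}$.
   Formalization: In (2), ''negative at some point'' is taken to mean negative at some point of φ(M); for a point of M' away from φ(M) the claim fails, e.g. for a flat totally geodesic 2-torus in a warped product T²×R that is negatively curved only elsewhere. *)

(* Defs.v *)
From HB Require Import structures.
From Stdlib Require Import Relations.Relation_Operators.
From mathcomp Require Import all_boot all_order all_algebra.
From mathcomp Require Import all_classical all_reals all_analysis.

Set Implicit Arguments.
Unset Strict Implicit.
Unset Printing Implicit Defensive.

Import Order.TTheory GRing.Theory Num.Theory numFieldNormedType.Exports.

Local Open Scope classical_set_scope.
Local Open Scope ring_scope.

(** Vectors are rows: a bilinear form with matrix [B] is [v *m B *m w^T]. For a
    C^1 map [F], the differential of [F] at [u] applied to [v] is ['D_v F u]. *)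

Section Calculus.
Variable R : realType.

Definition bform n (B : 'M[R]_n) (v w : 'rV[R]_n) : R := (v *m B *m w^T) 0 0.

Definition partial n (k : 'I_n) (f : 'rV[R]_n -> R) : 'rV[R]_n -> R :=
  fun u => 'D_(delta_mx 0 k) f u.

(* C^infinity on an open set [U]: all iterated partial derivatives exist and
   are continuous on [U]. *)
Definition smooth_on n (U : set 'rV[R]_n) (f : 'rV[R]_n -> R) : Prop :=
  forall (s : seq 'I_n) (u : 'rV[R]_n), U u ->
    {for u, continuous (foldr (@partial n) f s)} /\
    forall k : 'I_n, derivable (foldr (@partial n) f s) u (delta_mx 0 k).

Definition smooth_map_on n m (U : set 'rV[R]_n) (F : 'rV[R]_n -> 'rV[R]_m) :=
  forall k : 'I_m, smooth_on U (fun u => F u 0 k).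

Definition lie_bracket n (X Y : 'rV[R]_n -> 'rV[R]_n) : 'rV[R]_n -> 'rV[R]_n :=
  fun u => 'D_(X u) Y u - 'D_(Y u) X u.

(* The vector [c] determined by
   [2 G(c, z) = (D_v G)(w, z) + (D_w G)(v, z) - (D_z G)(v, w)] for all [z],
   i.e. [c^k = sum_ij Gamma^k_ij v^i w^j]. *)
Definition christoffel n (G : 'rV[R]_n -> 'M[R]_n) (u v w : 'rV[R]_n)
    : 'rV[R]_n :=
  (\row_(l < n) (2^-1 * (bform ('D_v G u) w (delta_mx 0 l)
                         + bform ('D_w G u) v (delta_mx 0 l)
                         - bform ('D_(delta_mx 0 l) G u) v w)))
  *m invmx (G u).

Definition levi_civita n (G : 'rV[R]_n -> 'M[R]_n)
    (X Y : 'rV[R]_n -> 'rV[R]_n) : 'rV[R]_n -> 'rV[R]_n :=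
  fun u => 'D_(X u) Y u + christoffel G u (X u) (Y u).

End Calculus.

(** Transverse geometry in a foliated chart: on an open subset of R^(p+q), the
    leaf directions [L] are the vectors [v] with [rsubmx v = 0], the projection
    [pi : TM -> Q] is [rsubmx], and [G] is the matrix of the metric. *)

Section TransverseGeometry.
Variables (R : realType) (p q : nat).
Variable G : 'rV[R]_(p + q) -> 'M[R]_(p + q).
Implicit Types (u v : 'rV[R]_(p + q)) (X Y : 'rV[R]_(p + q) -> 'rV[R]_(p + q)).
Implicit Types (s : 'rV[R]_(p + q) -> 'rV[R]_q) (a b c : 'rV[R]_q).

(* Matrix of [sigma : Q -> L^perp]: if [ulsubmx (G u) = A] and
   [dlsubmx (G u) = D], then [(x, a)] is orthogonal to [L] iff
   [x *m A + a *m D = 0]. *)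
Definition sigma_mx u : 'M[R]_(q, p + q) :=
  row_mx (- (dlsubmx (G u) *m invmx (ulsubmx (G u)))) 1%:M.

Definition sigma s : 'rV[R]_(p + q) -> 'rV[R]_(p + q) :=
  fun u => s u *m sigma_mx u.

Definition transverse_metric u : 'M[R]_q :=
  sigma_mx u *m G u *m (sigma_mx u)^T.

Definition horizontal X : 'rV[R]_(p + q) -> 'rV[R]_(p + q) :=
  sigma (fun u => rsubmx (X u)).

Definition leafwise X : 'rV[R]_(p + q) -> 'rV[R]_(p + q) :=
  fun u => X u - horizontal X u.

(* The transverse Levi-Civita connection [nabla_X s]. *)
Definition nablaQ X s : 'rV[R]_(p + q) -> 'rV[R]_q :=
  fun u => rsubmx (lie_bracket (leafwise X) (sigma s) u)
           + rsubmx (levi_civita G (horizontal X) (sigma s) u).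

Definition curvatureQ X Y s : 'rV[R]_(p + q) -> 'rV[R]_q :=
  fun u => nablaQ X (nablaQ Y s) u - nablaQ Y (nablaQ X s) u
           - nablaQ (lie_bracket X Y) s u.

(* [R^Q(a, b)c] at [u]; by tensoriality, any extension of [a], [b], [c] to
   local sections of Q may be used. *)
Definition RQ u a b c : 'rV[R]_q :=
  curvatureQ (sigma (cst a)) (sigma (cst b)) (cst c) u.

Definition KQ u a b : R :=
  let g := bform (transverse_metric u) in
  g (RQ u a b b) a / (g a a * g b b - g a b ^+ 2).

Definition orthonormal_frame u (E : 'I_q -> 'rV[R]_q) : Prop :=
  forall a b : 'I_q, bform (transverse_metric u) (E a) (E b) = (a == b)%:R.

(* The transversal Ricci operator, computed in the frame [E]. *)
Definition RicQ (E : 'I_q -> 'rV[R]_q) u c : 'rV[R]_q :=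
  \sum_(a < q) RQ u c (E a) (E a).

(* The metric induced on the local quotient manifold (an open subset of R^q)
   through the plaque of [u]. *)
Definition local_quotient_metric u : 'rV[R]_q -> 'M[R]_q :=
  fun y => transverse_metric (row_mx (lsubmx u) y).

End TransverseGeometry.

(** The transversal second fundamental form of a foliated map with local
    representative [F], between foliated charts with metrics [G] and [G']. *)

Section TransverseMaps.
Variables (R : realType) (p q p' q' : nat).
Variables (G : 'rV[R]_(p + q) -> 'M[R]_(p + q)).
Variables (G' : 'rV[R]_(p' + q') -> 'M[R]_(p' + q')).
Variable F : 'rV[R]_(p + q) -> 'rV[R]_(p' + q').

(* [d_T phi] applied to a section of Q, as a section of [phi^-1 Q']. *)
Definition dT (Y : 'rV[R]_(p + q) -> 'rV[R]_q) : 'rV[R]_(p + q) -> 'rV[R]_q' :=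
  fun u => rsubmx ('D_(sigma G Y u) F u).

(* The pull-back connection on [phi^-1 Q']: for [s = sum_b s^b e'_b o phi],
   [nabla^phi_X s = sum_b X(s^b) e'_b + s^b nabla'_(d phi X) e'_b]. *)
Definition nabla_phi (X : 'rV[R]_(p + q) -> 'rV[R]_(p + q))
    (s : 'rV[R]_(p + q) -> 'rV[R]_q') : 'rV[R]_(p + q) -> 'rV[R]_q' :=
  fun u => 'D_(X u) s u + nablaQ G' (cst ('D_(X u) F u)) (cst (s u)) (F u).

Definition nabla_dT (X Y : 'rV[R]_(p + q) -> 'rV[R]_q)
    : 'rV[R]_(p + q) -> 'rV[R]_q' :=
  fun u => nabla_phi (sigma G X) (dT Y) u - dT (nablaQ G (sigma G X) Y) u.

(* The value on [a], [b] at [u]; [nabla_dT] is tensorial in both arguments. *)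
Definition second_fundamental_form u (a b : 'rV[R]_q) : 'rV[R]_q' :=
  nabla_dT (cst a) (cst b) u.

(* Being the trace of a tensor, [tau_b] at [u] only depends on the value at
   [u] of the orthonormal basic frame, which may be any orthonormal basis. *)
Definition tension_field (E : 'I_q -> 'rV[R]_q) u : 'rV[R]_q' :=
  \sum_(a < q) second_fundamental_form u (E a) (E a).

End TransverseMaps.

(** A smooth manifold (Hausdorff, second countable, nonempty, without boundary)
    with a foliation of dimension [p] and codimension [q], given by a foliated
    atlas: the differentials of the coordinate changes preserve R^p x 0. *)

Record foliated_manifold (R : realType) (p q : nat) := FoliatedManifold {
  fspace :> ptopologicalType;
  fspace_hausdorff : hausdorff_space fspace;
  fspace_second_countable : @second_countable fspace;
  chart_index : Type;
  dom : chart_index -> set fspace;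
  cod : chart_index -> set 'rV[R]_(p + q);
  chart : chart_index -> fspace -> 'rV[R]_(p + q);
  param : chart_index -> 'rV[R]_(p + q) -> fspace;
  dom_open : forall i, open (dom i);
  cod_open : forall i, open (cod i);
  dom_cover : forall x, exists i, dom i x;
  chart_cod : forall i x, dom i x -> cod i (chart i x);
  param_dom : forall i u, cod i u -> dom i (param i u);
  chartK : forall i x, dom i x -> param i (chart i x) = x;
  paramK : forall i u, cod i u -> chart i (param i u) = u;
  chart_continuous : forall i x, dom i x -> {for x, continuous (chart i)};
  param_continuous : forall i u, cod i u -> {for u, continuous (param i)};
  transition_smooth : forall i j,
    smooth_map_on [set u | cod i u /\ dom j (param i u)] (chart j \o param i);
  transition_foliated : forall i j u (v : 'rV[R]_(p + q)),
    cod i u -> dom j (param i u) ->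
    rsubmx v = 0 -> rsubmx ('D_v (chart j \o param i) u) = 0
}.

Arguments dom {R p q} f i x : rename.
Arguments cod {R p q} f i u : rename.
Arguments chart {R p q} f i x : rename.
Arguments param {R p q} f i u : rename.

(* [metric i] is the matrix of [g] in the chart [i]. The metric is bundle-like
   when the induced metric on Q is constant along the leaves. *)
Record foliated_riemannian_manifold (R : realType) (p q : nat) :=
  FoliatedRiemannianManifold {
  fbase :> foliated_manifold R p q;
  metric : chart_index fbase -> 'rV[R]_(p + q) -> 'M[R]_(p + q);
  metric_smooth : forall i k l, smooth_on (cod fbase i) (fun u => metric i u k l);
  metric_sym : forall i u, cod fbase i u -> (metric i u)^T = metric i u;
  metric_pos : forall i u v, cod fbase i u -> v != 0 -> 0 < bform (metric i u) v v;
  metric_compat : forall i j u v w,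
    cod fbase i u -> dom fbase j (param fbase i u) ->
    let t := chart fbase j \o param fbase i in
    bform (metric j (t u)) ('D_v t u) ('D_w t u) = bform (metric i u) v w;
  metric_bundle_like : forall i u (v : 'rV[R]_(p + q)), cod fbase i u ->
    rsubmx v = 0 -> 'D_v (transverse_metric (metric i)) u = 0
}.

Arguments metric {R p q} f i u : rename.

Section Leaves.
Variables (R : realType) (p q : nat) (M : foliated_manifold R p q).

(* [x] and [y] are joined by a segment in a plaque of some chart; leaves are
   the equivalence classes generated by this relation. *)
Definition plaque_segment (x y : M) : Prop :=
  exists i, [/\ dom M i x, dom M i y,
    rsubmx (chart M i x) = rsubmx (chart M i y) &
    forall t : R, 0 <= t <= 1 ->
      cod M i ((1 - t) *: chart M i x + t *: chart M i y)].

Definition same_leaf (x y : M) : Prop := clos_refl_sym_trans M plaque_segment x y.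

Definition leaf (x : M) : set M := [set y | same_leaf x y].

Definition leaf_saturation (A : set M) : set M := \bigcup_(x in A) leaf x.

End Leaves.

Section TransverseCurvatureConditions.
Variables (R : realType) (p q : nat) (M : foliated_riemannian_manifold R p q).

Definition transverse_ricci_nonneg_at (x : M) : Prop :=
  forall i, dom M i x ->
  forall E : 'I_q -> 'rV[R]_q, orthonormal_frame (metric M i) (chart M i x) E ->
  forall c : 'rV[R]_q,
    0 <= bform (transverse_metric (metric M i) (chart M i x))
           (RicQ (metric M i) E (chart M i x) c) c.

Definition transverse_ricci_pos_at (x : M) : Prop :=
  forall i, dom M i x ->
  forall E : 'I_q -> 'rV[R]_q, orthonormal_frame (metric M i) (chart M i x) E ->
  forall c : 'rV[R]_q, c != 0 ->
    0 < bform (transverse_metric (metric M i) (chart M i x))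
          (RicQ (metric M i) E (chart M i x) c) c.

(* [row_free (col_mx a b)]: [a] and [b] span a plane. *)
Definition transverse_sectional_nonpos_at (x : M) : Prop :=
  forall i, dom M i x ->
  forall a b : 'rV[R]_q, row_free (col_mx a b) ->
    KQ (metric M i) (chart M i x) a b <= 0.

Definition transverse_sectional_neg_at (x : M) : Prop :=
  forall i, dom M i x ->
  forall a b : 'rV[R]_q, row_free (col_mx a b) ->
    KQ (metric M i) (chart M i x) a b < 0.

(* A curve whose image in the leaf space is a geodesic: its projections to the
   local quotient manifolds satisfy the geodesic equation. *)
Definition transverse_geodesic (c : R -> M) : Prop :=
  continuous c /\
  forall i t, dom M i (c t) ->
    let y : R -> 'rV[R]_q := fun s => rsubmx (chart M i (c s)) in
    [/\ \forall s \near t, derivable y s 1,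
        derivable (derive1 y) t 1 &
        derive1 (derive1 y) t
        + christoffel (local_quotient_metric (metric M i) (chart M i (c t)))
            (y t) (derive1 y t) (derive1 y t) = 0].

Definition transversally_regular (c : R -> M) : Prop :=
  forall i t, dom M i (c t) ->
    derive1 (fun s => rsubmx (chart M i (c s)) : 'rV[R]_q) t != 0.

(* The image of [A] in the leaf space is a (nonconstant) closed geodesic,
   i.e. the image of a geodesic which is periodic in the leaf space. *)
Definition transversally_geodesic_closed_curve (A : set M) : Prop :=
  exists (c : R -> M) (T : R),
    [/\ transverse_geodesic c, transversally_regular c, 0 < T,
        forall t, same_leaf (c (t + T)) (c t) &
        leaf_saturation A = leaf_saturation (range c)].

End TransverseCurvatureConditions.

Section FoliatedMaps.
Variables (R : realType) (p q p' q' : nat).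
Variables (M : foliated_riemannian_manifold R p q).
Variables (M' : foliated_riemannian_manifold R p' q').
Variable phi : M -> M'.

Definition local_rep i j : 'rV[R]_(p + q) -> 'rV[R]_(p' + q') :=
  fun u => chart M' j (phi (param M i u)).

Definition local_dom i j : set 'rV[R]_(p + q) :=
  [set u | cod M i u /\ dom M' j (phi (param M i u))].

Definition smooth_mapping : Prop :=
  continuous phi /\ forall i j, smooth_map_on (local_dom i j) (local_rep i j).

Definition foliated_mapping : Prop :=
  forall i j u (v : 'rV[R]_(p + q)), local_dom i j u ->
    rsubmx v = 0 -> rsubmx ('D_v (local_rep i j) u) = 0.

Definition transversally_totally_geodesic : Prop :=
  forall i j u, local_dom i j u -> forall a b : 'rV[R]_q,
    second_fundamental_form (metric M i) (metric M' j) (local_rep i j) u a b = 0.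

Definition transversally_harmonic : Prop :=
  forall i j u, local_dom i j u ->
  forall E : 'I_q -> 'rV[R]_q, orthonormal_frame (metric M i) u E ->
    tension_field (metric M i) (metric M' j) (local_rep i j) E u = 0.

(* [d phi (TM)] is contained in [L']. *)
Definition transversally_constant : Prop :=
  forall i j u (v : 'rV[R]_(p + q)), local_dom i j u ->
    rsubmx ('D_v (local_rep i j) u) = 0.

End FoliatedMaps.

(* Main.v *)
Require Import Defs.
From HB Require Import structures.
From Stdlib Require Import Relations.Relation_Operators.
From mathcomp Require Import all_boot all_order all_algebra.
From mathcomp Require Import all_classical all_reals all_analysis.
From mathcomp Require Import ring lra.

Set Implicit Arguments.
Unset Strict Implicit.
Unset Printing Implicit Defensive.

Import Order.TTheory GRing.Theory Num.Theory numFieldNormedType.Exports.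

Local Open Scope classical_set_scope.
Local Open Scope ring_scope.

(** For a transversally harmonic map the Weitzenboeck formula expresses half of the transverse
    Laplacian of the energy density e = |d_T phi|^2 as |nabla d_T phi|^2 plus a Ricci term of M
    minus a sectional curvature term of M', all contributions being nonnegative. As e is constant
    along the leaves, in a chart it is subharmonic for the elliptic operator obtained by adding the
    second derivatives in the leaf directions; by the strong maximum principle and compactness e is
    constant, and the three terms vanish. Hence phi is totally geodesic, and constant if the Ricci
    curvature is positive somewhere.

    If the curvature of M' is negative at phi(x), then d_T phi has rank at most one at x. The traces
    of A and A^2 with A = (d_T phi)^* d_T phi are constant, so the rank is at most one everywhere.
    If phi is not constant, then locally phi = Y o h with Y a geodesic of unit speed and |dh| =
    |d_T phi|; here h is unique up to sign and constant and can be completed to coordinates.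
    Consider curves in M along which the functions h have unit speed: their images are geodesics,
    and modulo level sets of the functions h they form a flow. By compactness such a curve is
    recurrent, hence its image is periodic modulo leaves, and by connectedness of M it meets every
    class. *)

(** * Calculus on open subsets of R^n *)

(** The local quotients carry Riemannian metrics, but the leaf space of [M'] may fail to be
    Hausdorff, so the closed geodesic cannot be produced as a curve in a quotient: periodicity has
    to be found on [M], modulo leaves. There the functions h of different boxes agree only up to
    sign and constant, so they do not define a global unit vector field that could be integrated.
    Curves are therefore glued from coordinate segments of one short duration in finitely many
    boxes. Finiteness yields a time during which all curves issuing from nearby points stay in one
    box, a substitute for continuous dependence on initial data; with it, the relation of lying on
    one level is carried along the curves for all times. The coordinates completed from h are only
    shown to have a Lipschitz inverse. That a function whose differential vanishes with dh is
    constant on the levels of h is then proved along Lipschitz paths, after subtracting a multiple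
    of h. *)

Section Lines.
Variables (R : realType) (V W : normedModType R).

Lemma derive_line (f : V -> W) (w v : V) (t : R) :
  'D_1 (fun s : R => f (w + s *: v)) t = 'D_v f (w + t *: v).
Proof.
rewrite /derive; set F := (X in lim (X @ _) = _).
set F' := (X in _ = lim (X @ _)).
suff -> : F = F' by [].
apply/funext => h; rewrite /F /F' /=.
by congr (_ *: (f _ - _)); rewrite [h *: (1 : R)]mulr1 scalerDl addrCA.
Qed.

Lemma derivable_line (f : V -> W) (w v : V) (t : R) :
  derivable f (w + t *: v) v <-> derivable (fun s : R => f (w + s *: v)) t 1.
Proof.
rewrite /derivable; set F := (X in cvg (X @ _) <-> _).
set F' := (X in _ <-> cvg (X @ _)).
suff -> : F = F' by [].
apply/funext => h; rewrite /F /F' /=.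
by congr (_ *: (f _ - _)); rewrite [h *: (1 : R)]mulr1 scalerDl addrCA.
Qed.

Lemma is_derive_line (f : V -> W) (w v : V) (t : R) :
  derivable f (w + t *: v) v ->
  is_derive t 1 (fun s : R => f (w + s *: v)) ('D_v f (w + t *: v)).
Proof.
by move=> fd; apply: DeriveDef; [exact/derivable_line|exact: derive_line].
Qed.

End Lines.

Section MeanValue.
Variables (R : realType) (V : normedModType R).

(** Both signs of [t] are covered at once, so the intermediate point is located by an absolute value
    instead of an interval. *)
Lemma mean_value_line (f : V -> R) (w v : V) (t : R) :
  (forall s : R, `|s| <= `|t| -> derivable f (w + s *: v) v) ->
  exists2 s : R, `|s| <= `|t| & f (w + t *: v) - f w = t * 'D_v f (w + s *: v).
Proof.
move=> fd.
pose g (s : R) : R := f (w + s *: v).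
have gd s : `|s| <= `|t| -> is_derive (s : R) (1 : R) g ('D_v f (w + s *: v)).
  by move=> st; apply: is_derive_line; exact: fd.
have gc a b : (forall s, s \in `[a, b] -> `|s| <= `|t|) ->
    {within `[a, b], continuous g}.
  move=> ab; apply: derivable_within_continuous => s sab.
  by have [] := gd s (ab s sab).
have [t0|t0] := leP 0 t.
- have H s : s \in `[0, t] -> `|s| <= `|t|.
    by rewrite in_itv/= => /andP[s0 st]; rewrite !ger0_norm.
  have H' s : s \in `]0, t[ -> `|s| <= `|t|.
    by move=> /subset_itv_oo_cc; exact: H.
  have [s st] := MVT_segment t0 (fun s ss => gd s (H' s ss)) (gc _ _ H).
  rewrite subr0 => e; exists s; first exact: H.
  by rewrite mulrC -e /g scale0r addr0.
- have H s : s \in `[t, 0] -> `|s| <= `|t|.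
    by rewrite in_itv/= => /andP[s0 st]; rewrite !ler0_norm ?lerN2 ?(ltW t0).
  have H' s : s \in `]t, 0[ -> `|s| <= `|t|.
    by move=> /subset_itv_oo_cc; exact: H.
  have [s st] := MVT_segment (ltW t0) (fun s ss => gd s (H' s ss)) (gc _ _ H).
  rewrite sub0r => e; exists s; first exact: H.
  by move: e; rewrite /g scale0r addr0 mulrN mulrC -[f w - _]opprB => /oppr_inj.
Qed.

End MeanValue.

Lemma near_normP (R : realType) (V : normedModType R) (P : V -> Prop) (u : V) :
  (\forall w \near u, P w) <->
  exists2 d : R, 0 < d & forall w, `|w - u| < d -> P w.
Proof.
split=> [/nbhs_ballP[d/= d0 dP]|[d d0 dP]].
  by exists d => // w wd; apply: dP; rewrite -ball_normE/= distrC.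
by apply/nbhs_ballP; exists d => // w; rewrite -ball_normE/= distrC; exact: dP.
Qed.

Lemma near_all (T : topologicalType) n (P : 'I_n -> T -> Prop) (x : T) :
  (forall i, \forall y \near x, P i y) -> \forall y \near x, forall i, P i y.
Proof. by move=> H; apply: (@filter_forall T 'I_n P (nbhs x)). Qed.

Section PointwiseContinuity.
Variables (R : realType) (T : topologicalType).
Implicit Types (f g : T -> R) (x : T).

Lemma cont_cst (c : R) x : {for x, continuous (fun _ : T => c)}.
Proof. exact: cst_continuous. Qed.

Lemma contD f g x : {for x, continuous f} -> {for x, continuous g} ->
  {for x, continuous (fun y => f y + g y)}.
Proof. by move=> cf cg; exact: (cvgD cf cg). Qed.

Lemma contN f x : {for x, continuous f} -> {for x, continuous (fun y => - f y)}.
Proof. by move=> cf; exact: (cvgN cf). Qed.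

Lemma contB f g x : {for x, continuous f} -> {for x, continuous g} ->
  {for x, continuous (fun y => f y - g y)}.
Proof. by move=> cf cg; exact: (cvgB cf cg). Qed.

Lemma contM f g x : {for x, continuous f} -> {for x, continuous g} ->
  {for x, continuous (fun y => f y * g y)}.
Proof. by move=> cf cg; exact: (cvgM cf cg). Qed.

Lemma contV f x : f x != 0 -> {for x, continuous f} ->
  {for x, continuous (fun y => (f y)^-1)}.
Proof. by move=> f0 cf; exact: (cvgV f0 cf). Qed.

Lemma cont_sum (I : Type) (r : seq I) (P : pred I) (F : I -> T -> R) x :
  (forall i, P i -> {for x, continuous (F i)}) ->
  {for x, continuous (fun y => \sum_(i <- r | P i) F i y)}.
Proof.
move=> cF; elim: r => [|i r IH].
  rewrite (_ : (fun _ => _) = (fun=> 0)); first exact: cont_cst.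
  by apply/funext => y; rewrite big_nil.
rewrite (_ : (fun _ => _) = (fun y => (if P i then F i y else 0) +
   \sum_(i <- r | P i) F i y)); last first.
  by apply/funext => y; rewrite big_cons; case: ifP => //; rewrite add0r.
apply: contD => //; case Pi: (P i); [exact: cF|exact: cont_cst].
Qed.

End PointwiseContinuity.

Section C1.
Variables (R : realType).

Lemma row_delta_sum n (h : 'rV[R]_n) : h = \sum_(i < n) h 0 i *: delta_mx 0 i.
Proof. by rewrite {1}(row_sum_delta h). Qed.

Lemma normr_coord m n (h : 'M[R]_(m, n)) i j : `|h i j| <= `|h|.
Proof.
by rewrite [leRHS]/Num.Def.normr/= mx_normrE; exact: (le_bigmax _ _ (i, j)).
Qed.

Lemma norm_mx_le m n (h : 'M[R]_(m, n)) (e : R) : 0 <= e ->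
  (forall i j, `|h i j| <= e) -> `|h| <= e.
Proof.
move=> e0 H; rewrite [leLHS]/Num.Def.normr/= mx_normrE.
by rewrite (bigmax_le _ e0) // => -[i j] _; exact: H.
Qed.

Lemma norm_mx_lt m n (h : 'M[R]_(m, n)) (e : R) : 0 < e ->
  (forall i j, `|h i j| < e) -> `|h| < e.
Proof.
move=> e0 H; rewrite [ltLHS]/Num.Def.normr/= mx_normrE.
by apply/bigmax_ltP; split => // -[i j] _; exact: H.
Qed.

(** The increment is split into steps along the axes; the mean value theorem turns each step into a
    partial derivative at a nearby point, which continuity at [u] compares with its value at [u]. *)
Lemma differentiable_of_partials n (f : 'rV[R]_n -> R) (u : 'rV[R]_n) :
  (\forall w \near u, forall k, derivable f w (delta_mx 0 k)) ->
  (forall k, {for u, continuous (partial k f)}) ->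
  differentiable f u.
Proof.
move=> fd fc.
pose df (h : 'rV[R]_n) : R := \sum_(k < n) h 0 k * partial k f u.
have dfl : linear df.
  move=> a x y; rewrite /df scaler_sumr -big_split/=; apply: eq_bigr => k _.
  by rewrite !mxE mulrDl; congr (_ + _); rewrite -mulrA.
pose dfL := GRing.isLinear.Build _ _ _ _ df dfl.
pose dfl' : {linear 'rV[R]_n -> R} := HB.pack df dfL.
have dfc : continuous dfl'.
  rewrite /= /df => x; apply: cont_sum => k _; apply: contM.
    exact: coord_continuous.
  exact: cont_cst.
have key : f \o shift u = cst (f u) + dfl' +o_ (0 : 'rV[R]_n) id.
  apply/eqaddoP => e e0 /=.
  (* There are [n] steps; dividing by [n.+1] also covers [n = 0]. *)
  have e'0 : 0 < e / n.+1%:R by rewrite divr_gt0.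
  have : \forall w \near u, (forall k, derivable f w (delta_mx 0 k)) /\
      (forall k, `|partial k f w - partial k f u| <= e / n.+1%:R).
    have H : \forall w \near u, forall k : 'I_n,
        `|partial k f w - partial k f u| <= e / n.+1%:R.
      apply: near_all => k; have := fc k => /cvgrPdist_le/(_ _ e'0).
      by apply: filterS => w; rewrite distrC.
    by apply: filterS2 fd H => w ? ?; split.
  move=> /near_normP[d d0 dP].
  have fdd w : `|w - u| < d -> forall k, derivable f w (delta_mx 0 k).
    by move=> /dP[].
  have fcd k w : `|w - u| < d -> `|partial k f w - partial k f u| <= e / n.+1%:R.
    by move=> /dP[].
  apply: ((@near_normP R 'rV[R]_n _ 0).2 _); exists d => // h; rewrite subr0 => hd.
  (* [tr k] keeps the first [k] coordinates of [h], so that consecutive points differ along one axis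
     only. *)
  pose tr (k : nat) : 'rV[R]_n := \row_i (if (i < k)%N then h 0 i else 0).
  have trh k : `|tr k| <= `|h|.
    apply: norm_mx_le => // i j; rewrite mxE; case: ifPn => _.
      by rewrite (le_trans _ (normr_coord h 0 j)).
    by rewrite normr0.
  have trS (k : 'I_n) : tr k.+1 = tr k + h 0 k *: delta_mx 0 k.
    apply/rowP => i; rewrite !mxE/= ltnS leq_eqVlt; case: eqVneq => [/val_inj ->|ik].
      by rewrite ltnn eqxx/= mulr1 add0r.
    by rewrite -(inj_eq val_inj)/= (negbTE ik) mulr0 addr0.
  have tr0 : tr 0 = 0 by apply/rowP => i; rewrite !mxE.
  have trn : tr n = h by apply/rowP => i; rewrite !mxE ltn_ord.
  have step k : (k <= n)%N -> `|f (tr k + u) - f u -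
      \sum_(i < n | (i < k)%N) h 0 i * partial i f u| <= k%:R * (e / n.+1%:R * `|h|).
    elim: k => [_|k IH kn].
      by rewrite tr0 add0r subrr big1 ?subr0 ?normr0 ?mul0r// => i; rewrite ltn0.
    set K := Ordinal kn.
    have nk (s : R) : `|s| <= `|h 0 K| -> `|tr k + u + s *: delta_mx 0 K - u| < d.
      move=> sk; rewrite addrAC addrK (le_lt_trans _ hd)//.
      apply: norm_mx_le => // i j; rewrite !mxE ord1 eqxx /=.
      case: (ltnP j k) => jk.
        by rewrite -(inj_eq val_inj)/= ltn_eqF// mulr0 addr0 normr_coord.
      rewrite add0r; case: (j == _); rewrite ?mulr1 ?mulr0 ?normr0//.
      by rewrite (le_trans sk)// normr_coord.
    have [s sk E] := mean_value_line (fun s sk => fdd _ (nk s sk) K).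
    rewrite (bigD1 K)//= (trS K) /=.
    rewrite (_ : \sum_(_ < n | _) _ = \sum_(i < n | (i < k)%N) h 0 i * partial i f u); last first.
      apply: eq_bigl => i; rewrite ltnS leq_eqVlt -(inj_eq val_inj)/=.
      by case: ltngtP => //.
    have -> : tr k + h 0 K *: delta_mx 0 K + u = tr k + u + h 0 K *: delta_mx 0 K.
      by rewrite addrAC.
    have -> : f (tr k + u + h 0 K *: delta_mx 0 K) =
       f (tr k + u) + h 0 K * 'D_(delta_mx 0 K) f
          (tr k + u + s *: delta_mx 0 K) by rewrite -E; ring.
    set D1 := 'D_ _ f _; set D2 := partial _ _ _; set S := \sum_(_ < _ | _) _.
    rewrite (_ : _ - _ = (f (tr k + u) - f u - S) + h 0 K * (D1 - D2)); last by ring.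
    apply: le_trans (ler_normD _ _) _.
    rewrite -natr1 mulrDl mul1r; apply: lerD; first exact: IH (ltnW kn).
    rewrite normrM mulrC; apply: ler_pM => //; last exact: normr_coord.
    exact: fcd (nk s sk).
  have := step n (leqnn n); rewrite trn.
  rewrite (eq_bigl xpredT); last by move=> i; rewrite ltn_ord.
  rewrite -addrA -opprD => /le_trans; apply.
  rewrite mulrA ler_wpM2r// mulrCA ler_piMr ?(ltW e0)//.
  by rewrite ler_pdivrMr ?ltr0n// mul1r ler_nat.
have dE := @diff_unique _ _ _ f dfl' u dfc key.
apply/diff_locallyP; split; rewrite dE //.
Qed.

End C1.

Section SmoothFunctions.
Variable R : realType.

(** Finite order of differentiability, for inductions that lose one derivative at each step, such as
    those for products, inverses and composites. *)
Fixpoint Ck n (k : nat) (U : set 'rV[R]_n) (f : 'rV[R]_n -> R) : Prop :=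
  (forall u, U u -> {for u, continuous f}) /\
  if k is k'.+1 then
    forall i, (forall u, U u -> derivable f u (delta_mx 0 i)) /\
      Ck k' U (partial i f)
  else True.

(** [foldr] applies the last letter of a word first, so the recursion of [Ck] peels words from the
    right. *)
Lemma smooth_onP n (U : set 'rV[R]_n) f :
  smooth_on U f <-> forall k, Ck k U f.
Proof.
split=> [+ k|H s].
- elim: k f => [|k IH] f sf /=; first by split=> // u Uu; have [] := sf [::] u Uu.
  split; first by move=> u Uu; have [] := sf [::] u Uu.
  move=> i; split; first by move=> u Uu; have [_] := sf [::] u Uu; apply.
  by apply: IH => s u Uu; have := sf (rcons s i) u Uu; rewrite foldr_rcons.
- move: (H (size s).+1); elim/last_ind: s f {H} => [|s i IH] f H u Uu.
    by have [cf df] := H; split; [exact: cf|move=> k; have [+ _] := df k; exact].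
  rewrite foldr_rcons; apply: IH => //.
  by move: H; rewrite size_rcons => -[_ /(_ i)[]].
Qed.

Lemma Ck_continuous n k (U : set 'rV[R]_n) f u : Ck k U f -> U u ->
  {for u, continuous f}.
Proof. by case: k => [|k] [+ _]; exact. Qed.

Lemma CkW n k (U : set 'rV[R]_n) f : Ck k.+1 U f -> Ck k U f.
Proof.
elim: k f => [|k IH] f [cf df]; split => // i; have [di ci] := df i.
by split => //; exact: IH.
Qed.

Lemma CkS n k (U V : set 'rV[R]_n) f : V `<=` U -> Ck k U f -> Ck k V f.
Proof.
move=> VU; elim: k f => [|k IH] f [cf df]; split => //; try by move=> u /VU; exact: cf.
by move=> i; have [di ci] := df i; split; [move=> u /VU; exact: di|exact: IH].
Qed.

Lemma open_near (T : topologicalType) (U : set T) u : open U -> U u ->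
  \forall w \near u, U w.
Proof. by move=> oU Uu; apply: open_nbhs_nbhs; split. Qed.

Lemma near_eq_on (T : topologicalType) (W : Type) (U : set T) (f g : T -> W) u :
  open U -> (forall w, U w -> f w = g w) -> U u -> \forall w \near u, f w = g w.
Proof. by move=> oU fg Uu; apply: filterS (open_near oU Uu). Qed.

Lemma eq_on_continuous (T W : topologicalType) (U : set T) (f g : T -> W) u :
  open U -> (forall w, U w -> f w = g w) -> U u -> {for u, continuous f} ->
  {for u, continuous g}.
Proof.
move=> oU fg Uu cf; rewrite /prop_for /continuous_at -fg//.
by apply: cvg_trans cf; apply: near_eq_cvg; exact: near_eq_on Uu.
Qed.

Lemma eq_on_derive (V W : normedModType R) (U : set V) (f g : V -> W) u v :
  open U -> (forall w, U w -> f w = g w) -> U u -> 'D_v f u = 'D_v g u.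
Proof. by move=> oU fg Uu; apply: near_eq_derive; exact: near_eq_on Uu. Qed.

Lemma eq_on_derivable (V W : normedModType R) (U : set V) (f g : V -> W) u v :
  open U -> (forall w, U w -> f w = g w) -> U u -> derivable f u v ->
  derivable g u v.
Proof. by move=> oU fg Uu; apply: near_eq_derivable; exact: near_eq_on Uu. Qed.

Lemma eq_Ck n k (U : set 'rV[R]_n) f g : open U -> (forall u, U u -> f u = g u) ->
  Ck k U f -> Ck k U g.
Proof.
move=> oU; elim: k f g => [|k IH] f g fg [cf df]; split => //;
  try by move=> u Uu; exact: (eq_on_continuous oU fg Uu (cf u Uu)).
move=> i; have [di ci] := df i; split=> [u Uu|].
  exact: (eq_on_derivable oU fg Uu (di u Uu)).
by apply: IH ci => u Uu; exact: (eq_on_derive _ oU fg Uu).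
Qed.

Lemma Ck_differentiable n k (U : set 'rV[R]_n) f u : open U -> Ck k.+1 U f -> U u ->
  differentiable f u.
Proof.
move=> oU [cf df] Uu; apply: differentiable_of_partials => [|i].
  by apply: filterS (open_near oU Uu) => w Uw i; have [+ _] := df i; exact.
by have [_ ci] := df i; exact: Ck_continuous ci Uu.
Qed.

Lemma derive_partial n (f : 'rV[R]_n -> R) u v : differentiable f u ->
  'D_v f u = \sum_(i < n) v 0 i * partial i f u.
Proof.
move=> df; rewrite deriveE// {1}(row_delta_sum v) linear_sum/=; apply: eq_bigr => i _.
by rewrite linearZ/= /partial deriveE.
Qed.

Lemma deriveZ_dir (V W : normedModType R) (f : V -> W) u v c : differentiable f u ->
  'D_(c *: v) f u = c *: 'D_v f u.
Proof. by move=> df; rewrite !deriveE// linearZ. Qed.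

Lemma deriveD_dir (V W : normedModType R) (f : V -> W) u v w : differentiable f u ->
  'D_(v + w) f u = 'D_v f u + 'D_w f u.
Proof. by move=> df; rewrite !deriveE// linearD. Qed.

Lemma deriveB_dir (V W : normedModType R) (f : V -> W) u v w : differentiable f u ->
  'D_(v - w) f u = 'D_v f u - 'D_w f u.
Proof. by move=> df; rewrite !deriveE// linearB. Qed.

Lemma derive_sum_dir (V W : normedModType R) I (r : seq I) P (f : V -> W) u (v : I -> V) :
  differentiable f u ->
  'D_(\sum_(i <- r | P i) v i) f u = \sum_(i <- r | P i) 'D_(v i) f u.
Proof.
by move=> df; rewrite deriveE// linear_sum; apply: eq_bigr => i _; rewrite deriveE.
Qed.

Lemma differentiable_mx (V : normedModType R) m n (F : V -> 'M[R]_(m, n)) u :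
  (forall i j, differentiable (fun w => F w i j) u) -> differentiable F u.
Proof.
move=> dF.
have -> : F = (fun w => \sum_(i < m) (fun w => \sum_(j < n)
   (fun w => F w i j *: (delta_mx i j : 'M[R]_(m, n))) w) w).
  by apply/funext => w; rewrite {1}(matrix_sum_delta (F w)).
have H k (f : 'I_k -> V -> 'M[R]_(m, n)) : (forall i, differentiable (f i) u) ->
    differentiable (fun w => \sum_(i < k) f i w) u.
  move=> df; rewrite (_ : (fun _ => _) = \sum_(i < k) f i).
    exact: differentiable_sum.
  by apply/funext => w; rewrite fct_sumE.
by apply: (H) => i; apply: H => j; exact: differentiableZl.
Qed.

Lemma differentiable_mxE (V : normedModType R) m n (F : V -> 'M[R]_(m, n)) u i j :
  differentiable F u -> differentiable (fun w => F w i j) u.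
Proof.
move=> dF; apply: (@differentiable_comp _ _ _ _ F (fun M : 'M[R]_(m, n) => M i j)) => //.
exact: differentiable_coord.
Qed.

Lemma derive_mxE (V : normedModType R) m n (F : V -> 'M[R]_(m, n)) u v i j :
  derivable F u v -> ('D_v F u) i j = 'D_v (fun w => F w i j) u.
Proof. by move=> dF; rewrite derive_mx// mxE. Qed.

Lemma derive_comp (V W Z : normedModType R) (F : V -> W) (f : W -> Z) u v :
  differentiable F u -> differentiable f (F u) ->
  'D_v (fun w => f (F w)) u = 'D_('D_v F u) f (F u).
Proof.
move=> dF df; rewrite -[fun w => _]/(f \o F) !deriveE//.
  by rewrite diff_comp.
exact: differentiable_comp.
Qed.

Lemma Ck_cst n k (U : set 'rV[R]_n) c : Ck k U (fun=> c).
Proof.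
elim: k c => [|k IH] c; split => //; try by move=> u _; exact: cont_cst.
move=> i; split=> [u _|]; first exact: derivable_cst.
rewrite (_ : partial _ _ = fun=> 0); first exact: IH.
by apply/funext => u; rewrite /partial derive_cst.
Qed.

Lemma is_derive_coord m n (u v : 'M[R]_(m, n)) i j :
  is_derive u v (fun w : 'M[R]_(m, n) => w i j : R) (v i j).
Proof.
apply: DeriveDef; first by apply: diff_derivable; exact: differentiable_coord.
by rewrite -(@derive_mxE _ _ _ id)// derive_id.
Qed.

Lemma Ck_coord n k (U : set 'rV[R]_n) j : Ck k U (fun u => u 0 j).
Proof.
case: k => [|k]; split => //; try by move=> u _; exact: coord_continuous.
move=> i; split=> [u _|]; first by have [] := is_derive_coord u (delta_mx 0 i) 0 j.
rewrite (_ : partial _ _ = fun=> (delta_mx 0 i : 'rV_n) 0 j); first exact: Ck_cst.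
by apply/funext => u; rewrite /partial (@derive_val _ _ _ _ _ _ _ (is_derive_coord _ _ _ _)).
Qed.

Lemma CkD n k (U : set 'rV[R]_n) f g : open U -> Ck k U f -> Ck k U g ->
  Ck k U (fun u => f u + g u).
Proof.
move=> oU; elim: k f g => [|k IH] f g [cf df] [cg dg]; split=> //;
  try by move=> u Uu; apply: contD; [exact: cf|exact: cg].
move=> i; have [dfi cfi] := df i; have [dgi cgi] := dg i; split=> [u Uu|].
  by apply: derivableD; [exact: dfi|exact: dgi].
apply: eq_Ck (IH _ _ cfi cgi) => // u Uu; rewrite /partial.
by rewrite (@deriveD _ _ _ f g)//; [exact: dfi|exact: dgi].
Qed.

Lemma CkM n k (U : set 'rV[R]_n) f g : open U -> Ck k U f -> Ck k U g ->
  Ck k U (fun u => f u * g u).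
Proof.
move=> oU; elim: k f g => [|k IH] f g cf cg.
  by split=> // u Uu; apply: contM; [have [+ _] := cf|have [+ _] := cg]; exact.
split; first by move=> u Uu; apply: contM; [have [+ _] := cf|have [+ _] := cg]; exact.
move=> i; have [_ /(_ i)[dfi cfi]] := cf; have [_ /(_ i)[dgi cgi]] := cg.
split=> [u Uu|]; first by apply: derivableM; [exact: dfi|exact: dgi].
apply: eq_Ck (CkD oU (IH _ _ (CkW cf) cgi) (IH _ _ (CkW cg) cfi)) => // u Uu.
by rewrite /partial (@deriveM _ _ f g)//; [exact: dfi|exact: dgi].
Qed.

Lemma CkN n k (U : set 'rV[R]_n) f : open U -> Ck k U f -> Ck k U (fun u => - f u).
Proof.
move=> oU cf; apply: eq_Ck (CkM oU (Ck_cst k U (-1)) cf) => // u _.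
by rewrite mulN1r.
Qed.

Lemma CkV n k (U : set 'rV[R]_n) f : open U -> (forall u, U u -> f u != 0) ->
  Ck k U f -> Ck k U (fun u => (f u)^-1).
Proof.
move=> oU f0; elim: k f f0 => [|k IH] f f0 cf.
  by split=> // u Uu; apply: contV; [exact: f0|have [+ _] := cf; exact].
split; first by move=> u Uu; apply: contV; [exact: f0|have [+ _] := cf; exact].
move=> i; have [_ /(_ i)[dfi cfi]] := cf.
split=> [u Uu|]; first by apply: derivableV; [exact: f0|exact: dfi].
have cV := IH f f0 (CkW cf).
apply: eq_Ck (CkN oU (CkM oU (CkM oU cV cV) cfi)) => // u Uu.
rewrite /partial deriveV//; [|exact: f0|exact: dfi].
by rewrite -exprVn expr2 -[_ *: _]/(_ * _) mulNr.
Qed.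

Lemma Ck_sum n k (U : set 'rV[R]_n) I (r : seq I) (P : pred I)
    (f : I -> 'rV[R]_n -> R) : open U ->
  (forall i, P i -> Ck k U (f i)) -> Ck k U (fun u => \sum_(i <- r | P i) f i u).
Proof.
move=> oU cf; elim: r => [|i r IH].
  by apply: eq_Ck (Ck_cst k U 0) => // u _; rewrite big_nil.
case Pi: (P i); last by apply: eq_Ck IH => // u _; rewrite big_cons Pi.
by apply: eq_Ck (CkD oU (cf i Pi) IH) => // u _; rewrite big_cons Pi.
Qed.

Lemma Ck_prod n k (U : set 'rV[R]_n) I (r : seq I) (P : pred I)
    (f : I -> 'rV[R]_n -> R) : open U ->
  (forall i, P i -> Ck k U (f i)) -> Ck k U (fun u => \prod_(i <- r | P i) f i u).
Proof.
move=> oU cf; elim: r => [|i r IH].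
  by apply: eq_Ck (Ck_cst k U 1) => // u _; rewrite big_nil.
case Pi: (P i); last by apply: eq_Ck IH => // u _; rewrite big_cons Pi.
by apply: eq_Ck (CkM oU (cf i Pi) IH) => // u _; rewrite big_cons Pi.
Qed.

Lemma cont_mx (T : topologicalType) m n (F : T -> 'M[R]_(m, n)) u :
  (forall i j, {for u, continuous (fun w => F w i j)}) -> {for u, continuous F}.
Proof.
move=> cF; apply/cvgrPdist_lt => e e0.
have H : \forall w \near u, forall i j, `|F u i j - F w i j| < e.
  apply: near_all => i; apply: near_all => j.
  by have /cvgrPdist_lt/(_ _ e0) := cF i j.
apply: filterS H => w H; apply: norm_mx_lt => // i j.
by rewrite !mxE; exact: H.
Qed.

Lemma cont_mxE (T : topologicalType) m n (F : T -> 'M[R]_(m, n)) u i j :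
  {for u, continuous F} -> {for u, continuous (fun w => F w i j)}.
Proof.
move=> cF; apply: (@continuous_comp _ _ _ F (fun M : 'M[R]_(m, n) => M i j)) => //.
exact: coord_continuous.
Qed.

Lemma Ck_differentiable_mx n k m (U : set 'rV[R]_n) (F : 'rV[R]_n -> 'rV[R]_m) u :
  open U -> (forall j, Ck k.+1 U (fun u => F u 0 j)) -> U u -> differentiable F u.
Proof.
move=> oU cF Uu; apply: differentiable_mx => i j; rewrite ord1.
exact: Ck_differentiable oU (cF j) Uu.
Qed.

Lemma Ck_comp n m k (U : set 'rV[R]_n) (V : set 'rV[R]_m) f (F : 'rV[R]_n -> 'rV[R]_m) :
  open U -> open V -> (forall u, U u -> V (F u)) ->
  (forall j, Ck k U (fun u => F u 0 j)) -> Ck k V f -> Ck k U (fun u => f (F u)).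
Proof.
move=> oU oV UV; elim: k f => [|k IH] f cF cf.
  split=> // u Uu; have [+ _] := cf => /(_ _ (UV u Uu)) cfu.
  apply: continuous_comp => //; apply: cont_mx => i j; rewrite ord1.
  exact: Ck_continuous (cF j) Uu.
have dF u : U u -> differentiable F u by exact: Ck_differentiable_mx.
have df v : V v -> differentiable f v by move=> Vv; exact: Ck_differentiable oV cf Vv.
split=> [u Uu|i].
  apply: differentiable_continuous; apply: differentiable_comp; first exact: dF.
  by apply: df; exact: UV.
split=> [u Uu|].
  apply: diff_derivable; apply: differentiable_comp; first exact: dF.
  by apply: df; exact: UV.
have cF' j : Ck k U (fun u => F u 0 j) by exact: CkW.
apply: (@eq_Ck _ _ _ (fun u => \sum_(j < m) partial i (fun w => F w 0 j) u *
    partial j f (F u))) => // [u Uu|].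
  rewrite /partial (derive_comp _ (dF u Uu) (df _ (UV u Uu))).
  rewrite (derive_partial _ (df _ (UV u Uu))); apply: eq_bigr => j _.
  by rewrite derive_mxE//; apply: diff_derivable; exact: dF.
apply: Ck_sum => // j _; apply: CkM => //.
  by have [_ /(_ i)[]] := cF j.
by apply: IH => //; have [_ /(_ j)[]] := cf.
Qed.

Lemma derive_translate (V W : normedModType R) (f : V -> W) (c u v : V) :
  'D_v (fun x => f (x + c)) u = 'D_v f (u + c).
Proof.
rewrite /derive; set A := (X in lim (X @ _) = _).
set B := (X in _ = lim (X @ _)); suff -> : A = B by [].
by apply/funext => h; rewrite /A /B /=; congr (_ *: (f _ - _)); rewrite -!addrA.
Qed.

Lemma derivable_translate (V W : normedModType R) (f : V -> W) (c u v : V) :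
  derivable (fun x => f (x + c)) u v <-> derivable f (u + c) v.
Proof.
rewrite /derivable; set A := (X in cvg (X @ _) <-> _).
set B := (X in _ <-> cvg (X @ _)); suff -> : A = B by [].
by apply/funext => h; rewrite /A /B /=; congr (_ *: (f _ - _)); rewrite -!addrA.
Qed.

(** Schwarz's theorem through the second difference of [f] with step [s]: two uses of the mean value
    theorem write it as [s * s] times a mixed derivative at a nearby point, in either order of the
    two directions. *)
Lemma partialC n (U : set 'rV[R]_n) f u i j : open U -> Ck 2 U f -> U u ->
  partial i (partial j f) u = partial j (partial i f) u.
Proof.
move=> oU cf Uu.
pose e k : 'rV[R]_n := delta_mx 0 k.
have ne k : `|e k| <= 1.
  by apply: norm_mx_le => // a b; rewrite mxE; case: (_ && _); rewrite ?normr1 ?normr0.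
have df k w : U w -> derivable f w (e k) by have [_ /(_ k)[+ _]] := cf; exact.
have ddf k l w : U w -> derivable (partial k f) w (e l).
  by have [_ /(_ k)[_ [_ /(_ l)[+ _]]]] := cf; exact.
have c2 k l : {for u, continuous (partial k (partial l f))}.
  by have [_ /(_ l)[_ [_ /(_ k)[_ [+ _]]]]] := cf; exact.
have [d d0 dU] := (near_normP _ _).1 (open_near oU Uu).
have key k l s : 0 < s -> s + s < d -> exists2 w, `|w - u| <= s + s &
    f (u + s *: e k + s *: e l) - f (u + s *: e k) - f (u + s *: e l) + f u =
    s * (s * partial l (partial k f) w).
  move=> s0 sd.
  have inU a b : `|a| <= s -> `|b| <= s -> `|u + a *: e k + b *: e l - u| <= s + s.
    move=> as_ bs; rewrite -[u + _ + _]addrA [u + _]addrC addrK.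
    apply: le_trans (ler_normD _ _) _; rewrite !normrZ; apply: lerD.
      by apply: le_trans (ler_wpM2l _ (ne k)) _; rewrite ?mulr1.
    by apply: le_trans (ler_wpM2l _ (ne l)) _; rewrite ?mulr1.
  have inU' a b : `|a| <= s -> `|b| <= s -> U (u + a *: e k + b *: e l).
    by move=> as_ bs; apply: dU; apply: le_lt_trans sd; exact: inU.
  have ns : `|s| = s by rewrite gtr0_norm.
  pose g w := f (w + s *: e l) - f w.
  have s_s : `|s| <= s by rewrite ns.
  have o_s : `|0 : R| <= s by rewrite normr0 ltW.
  have gd a : `|a| <= `|s| -> is_derive (u + a *: e k) (e k) g
      (partial k f (u + a *: e k + s *: e l) - partial k f (u + a *: e k)).
    rewrite ns => as_; apply: is_deriveB; last first.
      apply: DeriveDef => //; apply: df; rewrite -[u + _]addr0 -(scale0r (e l)).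
      exact: inU'.
    have dd : derivable f (u + a *: e k + s *: e l) (e k) by apply: df; exact: inU'.
    by split; [exact/derivable_translate|exact: derive_translate].
  have [a as_ Ea] := mean_value_line (fun a as_ => @ex_derive _ _ _ _ _ _ _ (gd a as_)).
  rewrite ns in as_.
  have [b bs Eb] := @mean_value_line R _ (partial k f) (u + a *: e k) (e l) s
    (fun b bs => ddf k l _ (inU' a b as_ (le_trans bs s_s))).
  exists (u + a *: e k + b *: e l); first by apply: inU => //; rewrite -ns.
  rewrite [partial l _ _]/partial -Eb.
  transitivity (g (u + s *: e k) - g u); first by rewrite /g; ring.
  rewrite Ea; congr (_ * _); apply: (@derive_val _ _ _ _ _ _ _ (gd a _)).
  by rewrite ns.
apply/eqP; rewrite -subr_eq0 -normr_le0; apply/ler_addgt0Pr => eps eps0.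
rewrite add0r.
have eps2 : 0 < eps / 2 by rewrite divr_gt0.
have /cvgrPdist_lt/(_ _ eps2)/near_normP[d1 d10 H1] := c2 i j.
have /cvgrPdist_lt/(_ _ eps2)/near_normP[d2 d20 H2] := c2 j i.
(* The intermediate points lie within [s + s] of [u], so any factor below one half would serve. *)
pose s := Num.min d (Num.min d1 d2) / 3.
have m0 : 0 < Num.min d (Num.min d1 d2) by rewrite !lt_min d0 d10.
have s0 : 0 < s by rewrite divr_gt0.
have ss : s + s < Num.min d (Num.min d1 d2) by rewrite /s; lra.
move: ss; rewrite !lt_min => /and3P[sd sd1 sd2]; clearbody s.
have [w1 w1u E1] := key i j s s0 sd.
have [w2 w2u E2] := key j i s s0 sd.
have E : partial j (partial i f) w1 = partial i (partial j f) w2.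
  have sn0 : s != 0 by rewrite gt_eqF.
  apply: (mulfI sn0); apply: (mulfI sn0); apply: etrans (esym E1) _.
  by apply: etrans _ E2; rewrite [u + _ + s *: e i]addrAC; ring.
have := H1 _ (le_lt_trans w2u sd1).
have := H2 _ (le_lt_trans w1u sd2).
rewrite E => A B.
move: A B; move: (partial j (partial i f) u) (partial i (partial j f) u).
move: (partial i (partial j f) w2) => c a b ac bc.
apply: le_trans (ler_distD c _ _) _.
rewrite (splitr eps); apply: lerD; first exact: ltW bc.
by rewrite distrC; exact: ltW ac.
Qed.

End SmoothFunctions.

Section SmoothClosure.
Variables (R : realType) (n : nat) (U : set 'rV[R]_n).
Hypothesis oU : open U.
Implicit Types f g : 'rV[R]_n -> R.

Lemma smooth_eq f g : (forall u, U u -> f u = g u) -> smooth_on U f -> smooth_on U g.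
Proof. by move=> fg /smooth_onP sf; apply/smooth_onP => k; exact: eq_Ck (sf k). Qed.

Lemma smooth_cst c : smooth_on U (fun=> c).
Proof. by apply/smooth_onP => k; exact: Ck_cst. Qed.

Lemma smooth_coord j : smooth_on U (fun u => u 0 j).
Proof. by apply/smooth_onP => k; exact: Ck_coord. Qed.

Lemma smoothD f g : smooth_on U f -> smooth_on U g -> smooth_on U (fun u => f u + g u).
Proof. by move=> /smooth_onP sf /smooth_onP sg; apply/smooth_onP => k; exact: CkD. Qed.

Lemma smoothM f g : smooth_on U f -> smooth_on U g -> smooth_on U (fun u => f u * g u).
Proof. by move=> /smooth_onP sf /smooth_onP sg; apply/smooth_onP => k; exact: CkM. Qed.

Lemma smoothN f : smooth_on U f -> smooth_on U (fun u => - f u).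
Proof. by move=> /smooth_onP sf; apply/smooth_onP => k; exact: CkN. Qed.

Lemma smoothB f g : smooth_on U f -> smooth_on U g -> smooth_on U (fun u => f u - g u).
Proof. by move=> sf sg; exact: (smoothD sf (smoothN sg)). Qed.

Lemma smoothV f : (forall u, U u -> f u != 0) -> smooth_on U f ->
  smooth_on U (fun u => (f u)^-1).
Proof. by move=> f0 /smooth_onP sf; apply/smooth_onP => k; exact: CkV. Qed.

Lemma smooth_sum I (r : seq I) (P : pred I) (f : I -> 'rV[R]_n -> R) :
  (forall i, P i -> smooth_on U (f i)) -> smooth_on U (fun u => \sum_(i <- r | P i) f i u).
Proof.
move=> sf; apply/smooth_onP => k; apply: Ck_sum => // i Pi.
by have /smooth_onP := sf i Pi.
Qed.

Lemma smooth_prod I (r : seq I) (P : pred I) (f : I -> 'rV[R]_n -> R) :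
  (forall i, P i -> smooth_on U (f i)) -> smooth_on U (fun u => \prod_(i <- r | P i) f i u).
Proof.
move=> sf; apply/smooth_onP => k; apply: Ck_prod => // i Pi.
by have /smooth_onP := sf i Pi.
Qed.

Lemma smooth_partial i f : smooth_on U f -> smooth_on U (partial i f).
Proof.
by move=> /smooth_onP sf; apply/smooth_onP => k; have [_ /(_ i)[]] := sf k.+1.
Qed.

Lemma smooth_comp m (V : set 'rV[R]_m) h (F : 'rV[R]_n -> 'rV[R]_m) : open V ->
  (forall u, U u -> V (F u)) -> smooth_map_on U F -> smooth_on V h ->
  smooth_on U (fun u => h (F u)).
Proof.
move=> oV UV sF /smooth_onP sf; apply/smooth_onP => k; apply: Ck_comp (sf k) => //.
by move=> j; have /smooth_onP := sF j.
Qed.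

Lemma smooth_differentiable f u : smooth_on U f -> U u -> differentiable f u.
Proof. by move=> /smooth_onP/(_ 1%N) sf; exact: (Ck_differentiable oU sf). Qed.

Lemma smooth_continuous f u : smooth_on U f -> U u -> {for u, continuous f}.
Proof. by move=> /smooth_onP/(_ 0%N) sf; exact: (Ck_continuous sf). Qed.

Lemma smooth_partialC f u i j : smooth_on U f -> U u ->
  partial i (partial j f) u = partial j (partial i f) u.
Proof. by move=> /smooth_onP/(_ 2%N) sf; exact: (partialC _ _ oU sf). Qed.

Definition mxsmooth k l (A : 'rV[R]_n -> 'M[R]_(k, l)) :=
  forall i j, smooth_on U (fun u => A u i j).

Lemma mxsmooth_differentiable k l (A : 'rV[R]_n -> 'M[R]_(k, l)) u :
  mxsmooth A -> U u -> differentiable A u.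
Proof.
by move=> sA Uu; apply: differentiable_mx => i j; exact: smooth_differentiable.
Qed.

Lemma eq_mxsmooth k l (A B : 'rV[R]_n -> 'M[R]_(k, l)) :
  (forall u, U u -> A u = B u) -> mxsmooth A -> mxsmooth B.
Proof. by move=> AB sA i j; apply: smooth_eq (sA i j) => u /AB ->. Qed.

Lemma mxsmooth_cst k l (A : 'M[R]_(k, l)) : mxsmooth (fun=> A).
Proof. by move=> i j; exact: smooth_cst. Qed.

Lemma mxsmoothD k l (A B : 'rV[R]_n -> 'M[R]_(k, l)) :
  mxsmooth A -> mxsmooth B -> mxsmooth (fun u => A u + B u).
Proof.
move=> sA sB i j; apply: smooth_eq (smoothD (sA i j) (sB i j)) => u _.
by rewrite mxE.
Qed.

Lemma mxsmoothN k l (A : 'rV[R]_n -> 'M[R]_(k, l)) :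
  mxsmooth A -> mxsmooth (fun u => - A u).
Proof. by move=> sA i j; apply: smooth_eq (smoothN (sA i j)) => u _; rewrite mxE. Qed.

Lemma mxsmoothB k l (A B : 'rV[R]_n -> 'M[R]_(k, l)) :
  mxsmooth A -> mxsmooth B -> mxsmooth (fun u => A u - B u).
Proof. by move=> sA sB; exact: (mxsmoothD sA (mxsmoothN sB)). Qed.

Lemma mxsmoothZ k l (c : 'rV[R]_n -> R) (A : 'rV[R]_n -> 'M[R]_(k, l)) :
  smooth_on U c -> mxsmooth A -> mxsmooth (fun u => c u *: A u).
Proof. by move=> sc sA i j; apply: smooth_eq (smoothM sc (sA i j)) => u _; rewrite mxE. Qed.

Lemma mxsmooth_sum k l I (r : seq I) (P : pred I) (A : I -> 'rV[R]_n -> 'M[R]_(k, l)) :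
  (forall i, P i -> mxsmooth (A i)) -> mxsmooth (fun u => \sum_(i <- r | P i) A i u).
Proof.
move=> sA i j; apply: smooth_eq (smooth_sum r (fun a Pa => sA a Pa i j)) => u _.
by rewrite summxE.
Qed.

Lemma mxsmooth_tr k l (A : 'rV[R]_n -> 'M[R]_(k, l)) :
  mxsmooth A -> mxsmooth (fun u => (A u)^T).
Proof. by move=> sA i j; apply: smooth_eq (sA j i) => u _; rewrite mxE. Qed.

Lemma mxsmooth_mul k l m (A : 'rV[R]_n -> 'M[R]_(k, l)) (B : 'rV[R]_n -> 'M[R]_(l, m)) :
  mxsmooth A -> mxsmooth B -> mxsmooth (fun u => A u *m B u).
Proof.
move=> sA sB i j; apply: smooth_eq (smooth_sum (index_enum 'I_l) (P := xpredT)
  (fun a _ => smoothM (sA i a) (sB a j))) => u _.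
by rewrite mxE.
Qed.

Lemma mxsmooth_det k (A : 'rV[R]_n -> 'M[R]_k) :
  mxsmooth A -> smooth_on U (fun u => \det (A u)).
Proof.
move=> sA; rewrite /determinant; apply: smooth_sum => s _; apply: smoothM.
  exact: smooth_cst.
by apply: smooth_prod => i _; exact: sA.
Qed.

Lemma mxsmooth_inv k (A : 'rV[R]_n -> 'M[R]_k) :
  (forall u, U u -> A u \in unitmx) -> mxsmooth A -> mxsmooth (fun u => invmx (A u)).
Proof.
move=> uA sA.
apply: (@eq_mxsmooth _ _ (fun u => (\det (A u))^-1 *: \adj (A u))).
  by move=> u Uu; rewrite /invmx uA.
apply: mxsmoothZ.
  apply: smoothV; last exact: mxsmooth_det.
  by move=> u /uA; rewrite unitmxE unitfE.
move=> i j; apply: (@smooth_eq (fun u => (-1) ^+ (j + i) * \det (row' j (col' i (A u))))).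
  by move=> u _; rewrite mxE.
apply: smoothM; first exact: smooth_cst.
by apply: mxsmooth_det => a b; apply: smooth_eq (sA (lift j a) (lift i b)) => u _; rewrite !mxE.
Qed.

Lemma mxsmooth_row k l (A : 'rV[R]_n -> 'rV[R]_k) (B : 'rV[R]_n -> 'rV[R]_l) :
  mxsmooth A -> mxsmooth B -> mxsmooth (fun u => row_mx (A u) (B u)).
Proof.
move=> sA sB i j; case: (split_ordP j) => a ->.
  by apply: smooth_eq (sA i a) => u _; rewrite row_mxEl.
by apply: smooth_eq (sB i a) => u _; rewrite row_mxEr.
Qed.

End SmoothClosure.

Section MatrixDerivative.
Variables (R : realType) (V : normedModType R).

Lemma derivable_mulmx k l m (A : V -> 'M[R]_(k, l)) (B : V -> 'M[R]_(l, m)) u v :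
  derivable A u v -> derivable B u v -> derivable (fun w => A w *m B w) u v.
Proof.
move=> /derivable_mxP dA /derivable_mxP dB; apply/derivable_mxP => i j.
rewrite (_ : (fun _ => _) = \sum_(a < l) (fun w => A w i a * B w a j)).
  apply: derivable_sum => a; exact: derivableM.
by apply/funext => w; rewrite mxE fct_sumE.
Qed.

Lemma derive_mulmx k l m (A : V -> 'M[R]_(k, l)) (B : V -> 'M[R]_(l, m)) u v :
  derivable A u v -> derivable B u v ->
  'D_v (fun w => A w *m B w) u = 'D_v A u *m B u + A u *m 'D_v B u.
Proof.
move=> dA dB; apply/matrixP => i j; rewrite derive_mxE; last exact: derivable_mulmx.
have [/derivable_mxP dA' /derivable_mxP dB'] := (dA, dB).
rewrite (_ : (fun _ => _) = \sum_(a < l) (fun w => A w i a * B w a j)); last first.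
  by apply/funext => w; rewrite mxE fct_sumE.
rewrite derive_sum => [|a]; last exact: derivableM.
rewrite !mxE -big_split/=; apply: eq_bigr => a _.
rewrite (@deriveM _ _ (fun w => A w i a) (fun w => B w a j) _ _ (dA' i a) (dB' a j)).
by rewrite (derive_mxE _ _ dA) (derive_mxE _ _ dB) addrC; congr (_ + _); exact: mulrC.
Qed.

Lemma derive_mulmxr k l m (A : 'M[R]_(k, l)) (B : V -> 'M[R]_(l, m)) u v :
  derivable B u v -> 'D_v (fun w => A *m B w) u = A *m 'D_v B u.
Proof.
move=> dB; rewrite (@derive_mulmx _ _ _ (fun=> A) B)//.
by rewrite derive_cst mul0mx add0r.
Qed.

Lemma derivable_trmx k l (A : V -> 'M[R]_(k, l)) u v :
  derivable A u v -> derivable (fun w => (A w)^T) u v.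
Proof.
move=> /derivable_mxP dA; apply/derivable_mxP => i j.
by rewrite (_ : (fun _ => _) = fun w => A w j i)//; apply/funext => w; rewrite mxE.
Qed.

Lemma derive_trmx k l (A : V -> 'M[R]_(k, l)) u v :
  derivable A u v -> 'D_v (fun w => (A w)^T) u = ('D_v A u)^T.
Proof.
move=> dA; apply/matrixP => i j; rewrite derive_mxE; last exact: derivable_trmx.
rewrite !mxE derive_mxE//; congr ('D_v _ u).
by apply/funext => w; rewrite mxE.
Qed.

Lemma derivable_rsubmx k a b (A : V -> 'M[R]_(k, a + b)) u v :
  derivable A u v -> derivable (fun w => rsubmx (A w)) u v.
Proof.
move=> /derivable_mxP dA; apply/derivable_mxP => i j.
by rewrite (_ : (fun _ => _) = fun w => A w i (rshift a j))//; apply/funext => w; rewrite mxE.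
Qed.

Lemma derive_rsubmx k a b (A : V -> 'M[R]_(k, a + b)) u v :
  derivable A u v -> 'D_v (fun w => rsubmx (A w)) u = rsubmx ('D_v A u).
Proof.
move=> dA; apply/matrixP => i j; rewrite derive_mxE; last exact: derivable_rsubmx.
rewrite !mxE derive_mxE//; congr ('D_v _ u).
by apply/funext => w; rewrite mxE.
Qed.

End MatrixDerivative.

(* Functions smooth on [U] and taking outside of [U] their value at a fixed
   point [u0] of [U] form a ring in which equality is equality on [U]. *)
Section SmoothRing.
Variables (R : realType) (n : nat) (U : set 'rV[R]_n) (u0 : 'rV[R]_n).
Hypotheses (oU : open U) (Uu0 : U u0).

Definition smooth_pred : {pred 'rV[R]_n -> R} :=
  fun f => `[< smooth_on U f /\ forall u, ~ U u -> f u = f u0 >].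

Lemma smooth_subring : GRing.subring_closed smooth_pred.
Proof.
split; first by apply/asboolP; split=> //; exact: smooth_cst.
- move=> f g /asboolP[sf f0] /asboolP[sg g0]; apply/asboolP.
  split; first exact: (smoothB oU sf sg).
  by move=> u nUu; rewrite -[LHS]/(f u - g u) f0// g0.
- move=> f g /asboolP[sf f0] /asboolP[sg g0]; apply/asboolP.
  split; first exact: (smoothM oU sf sg).
  by move=> u nUu; rewrite -[LHS]/(f u * g u) f0// g0.
Qed.

HB.instance Definition _ :=
  GRing.isSubringClosed.Build ('rV[R]_n -> R) smooth_pred smooth_subring.

(** The proofs [o] and [i] index the type so that the ring instances and operations built on them
    can be inferred from it. *)
Record sring (o : open U) (i : U u0) :=
  Sring {smooth_val :> 'rV[R]_n -> R; _ : smooth_val \in smooth_pred}.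

HB.instance Definition _ := [isSub of sring oU Uu0 for @smooth_val oU Uu0].
HB.instance Definition _ := [Choice of sring oU Uu0 by <:].
HB.instance Definition _ := [SubChoice_isSubComNzRing of sring oU Uu0 by <:].

Lemma sring_smooth (f : sring oU Uu0) : smooth_on U f.
Proof. by case: f => f /= /asboolP[]. Qed.

Lemma sringP (f g : sring oU Uu0) : (forall u, U u -> f u = g u) -> f = g.
Proof.
move=> fg; apply: val_inj; apply/funext => u.
have [Uu|nUu] := pselect (U u); first exact: fg.
case: f g fg => f /= /[dup] /asboolP[_ f0] fP [g /= /[dup] /asboolP[_ g0] gP] /= fg.
by rewrite f0// g0// fg.
Qed.

Lemma to_sring_subproof f : smooth_on U f ->
  (fun u => if `[< U u >] then f u else f u0) \in smooth_pred.
Proof.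
move=> sf; apply/asboolP; split=> [|u nUu]; last by rewrite (asboolF nUu) asboolT.
by apply: (smooth_eq oU _ sf) => u Uu; rewrite asboolT.
Qed.

Definition to_sring f (sf : smooth_on U f) : sring oU Uu0 :=
  Sring oU Uu0 (to_sring_subproof sf).

Lemma to_sringE f (sf : smooth_on U f) u : U u -> to_sring sf u = f u.
Proof. by move=> Uu /=; rewrite asboolT. Qed.

End SmoothRing.

Section SmoothDerivations.
Variables (R : realType) (n : nat) (U : set 'rV[R]_n) (u0 : 'rV[R]_n).
Variables (oU : open U) (Uu0 : U u0).
Notation A := (sring oU Uu0).

Definition sderiv k (f : A) : A := to_sring oU Uu0 (smooth_partial k (sring_smooth f)).

Lemma sderivE k (f : A) u : U u -> sderiv k f u = partial k f u.
Proof. exact: to_sringE. Qed.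

Lemma sring_differentiable (f : A) u : U u -> differentiable f u.
Proof. by move=> Uu; exact: smooth_differentiable (sring_smooth f) Uu. Qed.

Lemma sring_derivable (f : A) u v : U u -> derivable f u v.
Proof. by move=> Uu; apply: diff_derivable; exact: sring_differentiable. Qed.

Lemma sderivD k (f g : A) : sderiv k (f + g) = sderiv k f + sderiv k g.
Proof.
apply: sringP => u Uu; rewrite -[RHS]/(sderiv k f u + sderiv k g u).
rewrite (sderivE k f Uu) (sderivE k g Uu) (sderivE k (f + g) Uu).
have -> : smooth_val (f + g) = (smooth_val f + smooth_val g)%R by [].
by rewrite /partial (deriveD (@sring_derivable f u _ Uu) (@sring_derivable g u _ Uu)).
Qed.

Lemma sderivM k (f g : A) : sderiv k (f * g) = sderiv k f * g + f * sderiv k g.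
Proof.
apply: sringP => u Uu; rewrite -[RHS]/(sderiv k f u * g u + f u * sderiv k g u).
rewrite (sderivE k f Uu) (sderivE k g Uu) (sderivE k (f * g) Uu).
rewrite [RHS]addrC [X in _ + X]mulrC.
have -> : smooth_val (f * g) = (smooth_val f * smooth_val g)%R by [].
by rewrite /partial (deriveM (@sring_derivable f u _ Uu) (@sring_derivable g u _ Uu)).
Qed.

Lemma sderivC k l (f : A) : sderiv k (sderiv l f) = sderiv l (sderiv k f).
Proof.
apply: sringP => u Uu.
have E i j : partial i (sderiv j f) u = partial i (partial j f) u.
  by apply: (eq_on_derive _ oU _ Uu) => w Uw; exact: sderivE.
rewrite (sderivE k _ Uu) (sderivE l _ Uu) E E.
exact: (smooth_partialC oU _ _ (sring_smooth f) Uu).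
Qed.

Definition seval u (f : A) : R := f u.

Lemma seval_is_zmod u : zmod_morphism (seval u). Proof. by []. Qed.
Lemma seval_is_monoid u : monoid_morphism (seval u). Proof. by []. Qed.

HB.instance Definition _ u := GRing.isZmodMorphism.Build A R (seval u) (seval_is_zmod u).
HB.instance Definition _ u := GRing.isMonoidMorphism.Build A R (seval u) (seval_is_monoid u).

Definition to_sringmx k l (B : 'rV[R]_n -> 'M[R]_(k, l)) (sB : mxsmooth U B) : 'M[A]_(k, l) :=
  \matrix_(i, j) to_sring oU Uu0 (sB i j).

Lemma to_sringmxE k l (B : 'rV[R]_n -> 'M[R]_(k, l)) (sB : mxsmooth U B) u : U u ->
  map_mx (seval u) (to_sringmx sB) = B u.
Proof. by move=> Uu; apply/matrixP => i j; rewrite !mxE [LHS]to_sringE. Qed.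

Lemma sringmxP k l (X Y : 'M[A]_(k, l)) :
  (forall u, U u -> map_mx (seval u) X = map_mx (seval u) Y) -> X = Y.
Proof.
move=> XY; apply/matrixP => i j; apply: sringP => u Uu.
by have /matrixP/(_ i j) := XY u Uu; rewrite !mxE.
Qed.

Lemma seval_sderiv_mx k l i (B : 'rV[R]_n -> 'M[R]_(k, l)) (sB : mxsmooth U B) u : U u ->
  map_mx (seval u) (map_mx (sderiv i) (to_sringmx sB)) = 'D_(delta_mx 0 i) B u.
Proof.
move=> Uu; apply/matrixP => a b; rewrite !mxE [LHS]sderivE// derive_mxE; last first.
  by apply: diff_derivable; exact: (mxsmooth_differentiable oU sB).
by apply: (eq_on_derive _ oU _ Uu) => w Uw; rewrite [LHS]to_sringE.
Qed.

End SmoothDerivations.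

Arguments seval : simpl never.

Section MxDerive.
Variables (R : realType) (n : nat) (U : set 'rV[R]_n) (oU : open U).

Lemma mxsmooth_deriveX k l (X : 'rV[R]_n -> 'rV[R]_n) (B : 'rV[R]_n -> 'M[R]_(k, l)) :
  mxsmooth U X -> mxsmooth U B -> mxsmooth U (fun u => 'D_(X u) B u).
Proof.
move=> sX sB i j.
apply: (smooth_eq oU _ (smooth_sum oU (index_enum 'I_n) (P := xpredT)
   (fun a _ => smoothM oU (sX 0 a) (smooth_partial a (sB i j))))).
move=> u Uu; rewrite derive_mxE; last first.
  by apply: diff_derivable; exact: (mxsmooth_differentiable oU sB).
by rewrite derive_partial//; exact: (smooth_differentiable oU (sB i j)).
Qed.

End MxDerive.

Section MatrixLinearity.
Variable A : pzRingType.

Lemma trD m n (X Y : 'M[A]_(m, n)) : (X + Y)^T = X^T + Y^T.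
Proof. by apply/matrixP => i j; rewrite !mxE. Qed.

Lemma trN m n (X : 'M[A]_(m, n)) : (- X)^T = - X^T.
Proof. by apply/matrixP => i j; rewrite !mxE. Qed.

Lemma rowD m n (X Y : 'M[A]_(m, n)) i : row i (X + Y) = row i X + row i Y.
Proof. by apply/rowP => j; rewrite !mxE. Qed.

Lemma rowN m n (X : 'M[A]_(m, n)) i : row i (- X) = - row i X.
Proof. by apply/rowP => j; rewrite !mxE. Qed.

Lemma rowZ m n x (X : 'M[A]_(m, n)) i : row i (x *: X) = x *: row i X.
Proof. by apply/rowP => j; rewrite !mxE. Qed.

Lemma row0E m n i : row i (0 : 'M[A]_(m, n)) = 0.
Proof. by apply/rowP => j; rewrite !mxE. Qed.

Lemma row_sumE m n I (r : seq I) P (F : I -> 'M[A]_(m, n)) i :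
  row i (\sum_(j <- r | P j) F j) = \sum_(j <- r | P j) row i (F j).
Proof.
apply/rowP => k; rewrite !(mxE, summxE); apply: eq_bigr => j _; rewrite mxE //.
Qed.

Lemma mxtraceNE n (X : 'M[A]_n) : \tr (- X) = - \tr X.
Proof. by rewrite /mxtrace -sumrN; apply: eq_bigr => i _; rewrite mxE. Qed.

End MatrixLinearity.

(* The Weitzenboeck formula is an identity of differential algebra: it is proved over a
   commutative ring with commuting derivations, and applied to the ring of functions smooth on a
   chart. There [Ga] and [C] are the connection matrices of Q and of the pull-back of Q', [g]
   (with inverse [gi]) and [H] the matrices of the metrics. *)
Section Weitzenboeck.
Variables (A : comNzRingType) (q m : nat) (d : 'I_q -> A -> A).
Hypothesis dD : forall k x y, d k (x + y) = d k x + d k y.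
Hypothesis dM : forall k x y, d k (x * y) = d k x * y + x * d k y.
Hypothesis dC : forall k l x, d k (d l x) = d l (d k x).

Lemma d0 k : d k 0 = 0.
Proof. by apply: (addrI (d k 0)); rewrite -dD !addr0. Qed.

Lemma dN k x : d k (- x) = - d k x.
Proof. by apply/eqP; rewrite -addr_eq0 -dD addNr d0. Qed.

Lemma d_sum k I (r : seq I) P (F : I -> A) :
  d k (\sum_(i <- r | P i) F i) = \sum_(i <- r | P i) d k (F i).
Proof. by apply: (big_morph (d k)); [exact: dD|exact: d0]. Qed.

Definition mxd k a b (X : 'M[A]_(a, b)) := map_mx (d k) X.

Lemma mxdD k a b (X Y : 'M[A]_(a, b)) : mxd k (X + Y) = mxd k X + mxd k Y.
Proof. by apply/matrixP => i j; rewrite !mxE dD. Qed.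

Lemma mxd0 k a b : mxd k (0 : 'M[A]_(a, b)) = 0.
Proof. by apply/matrixP => i j; rewrite !mxE d0. Qed.

Lemma mxdN k a b (X : 'M[A]_(a, b)) : mxd k (- X) = - mxd k X.
Proof. by apply/matrixP => i j; rewrite !mxE dN. Qed.

Lemma mxdM k a b c (X : 'M[A]_(a, b)) (Y : 'M[A]_(b, c)) :
  mxd k (X *m Y) = mxd k X *m Y + X *m mxd k Y.
Proof.
apply/matrixP => i j; rewrite !mxE d_sum -big_split/=; apply: eq_bigr => l _.
by rewrite dM !mxE.
Qed.

Lemma mxdZ k a b x (X : 'M[A]_(a, b)) : mxd k (x *: X) = d k x *: X + x *: mxd k X.
Proof. by apply/matrixP => i j; rewrite !mxE dM. Qed.

Lemma mxd_sum k a b I (r : seq I) P (F : I -> 'M[A]_(a, b)) :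
  mxd k (\sum_(i <- r | P i) F i) = \sum_(i <- r | P i) mxd k (F i).
Proof. exact: (big_morph _ (@mxdD k a b) (mxd0 k a b)). Qed.

Lemma mxd_tr k a b (X : 'M[A]_(a, b)) : mxd k X^T = (mxd k X)^T.
Proof. by apply/matrixP => i j; rewrite !mxE. Qed.

Lemma mxd_row k a b (X : 'M[A]_(a, b)) i : mxd k (row i X) = row i (mxd k X).
Proof. by apply/matrixP => i' j; rewrite !mxE. Qed.

Lemma d_mxtrace k a (X : 'M[A]_a) : d k (\tr X) = \tr (mxd k X).
Proof. by rewrite /mxtrace d_sum; apply: eq_bigr => i _; rewrite mxE. Qed.

Lemma mxdC k l a b (X : 'M[A]_(a, b)) : mxd k (mxd l X) = mxd l (mxd k X).
Proof. by apply/matrixP => i j; rewrite !mxE dC. Qed.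

Variables (Ga : 'I_q -> 'M[A]_q) (C : 'I_q -> 'M[A]_m).
Variables (g gi : 'M[A]_q) (H : 'M[A]_m).
Hypothesis gi_g : gi *m g = 1%:M.
Hypothesis g_gi : g *m gi = 1%:M.
Hypothesis gT : g^T = g.
Hypothesis HT : H^T = H.
Hypothesis Ga_compat : forall k, mxd k g = Ga k *m g + (Ga k *m g)^T.
Hypothesis C_compat : forall k, mxd k H = C k *m H + (C k *m H)^T.
Hypothesis Ga_sym : forall k i, row i (Ga k) = row k (Ga i).

Lemma giT : gi^T = gi.
Proof.
have : gi^T *m g = 1%:M by rewrite -{1}gT -trmx_mul g_gi trmx1.
by move=> e; rewrite -[gi^T]mulmx1 -g_gi mulmxA e mul1mx.
Qed.

Lemma mxd1 k a : mxd k (1%:M : 'M[A]_a) = 0.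
Proof.
have /eqP := mxdM k (1%:M : 'M[A]_a) (1%:M : 'M[A]_a).
by rewrite !mulmx1 mul1mx -subr_eq subrr => /eqP.
Qed.

Lemma mxd_gi k : mxd k gi = - (gi *m Ga k + (gi *m Ga k)^T).
Proof.
have : mxd k gi *m g + gi *m mxd k g = 0 by rewrite -mxdM gi_g mxd1.
move=> /(congr1 (mulmx^~ gi)); rewrite mulmxDl -mulmxA g_gi mulmx1 mul0mx.
move/eqP; rewrite addr_eq0 => /eqP ->; congr (- _).
rewrite Ga_compat mulmxDr mulmxDl -!mulmxA g_gi mulmx1 !trmx_mul gT giT.
by congr (_ + _); rewrite !mulmxA gi_g mul1mx.
Qed.

(** Covariant derivative of a section of the tensor product of the dual of Q with the pull-back of
    Q'. Rows are indexed by the frame of Q and columns by that of Q', so [C] acts on the right and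
    the dual of [Ga] on the left. *)
Definition nab k (X : 'M[A]_(q, m)) := mxd k X + X *m C k - Ga k *m X.
Definition ip (X Y : 'M[A]_(q, m)) := \tr (gi *m X *m H *m Y^T).

Lemma ipC X Y : ip X Y = ip Y X.
Proof.
by rewrite /ip -mxtrace_tr !trmx_mul trmxK HT giT !mulmxA [LHS]mxtrace_mulC !mulmxA.
Qed.

Lemma ipDl X X' Y : ip (X + X') Y = ip X Y + ip X' Y.
Proof. by rewrite /ip mulmxDr !mulmxDl mxtraceD. Qed.

Lemma ipNl X Y : ip (- X) Y = - ip X Y.
Proof. by rewrite /ip mulmxN !mulNmx mxtraceNE. Qed.

Lemma ip0l Y : ip 0 Y = 0.
Proof. by rewrite /ip mulmx0 !mul0mx mxtrace0. Qed.

Lemma ipZl x X Y : ip (x *: X) Y = x * ip X Y.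
Proof. by rewrite /ip -scalemxAr -!scalemxAl mxtraceZ. Qed.

Lemma ip_suml I (r : seq I) P (F : I -> 'M[A]_(q, m)) Y :
  ip (\sum_(i <- r | P i) F i) Y = \sum_(i <- r | P i) ip (F i) Y.
Proof. by apply: (big_morph (ip^~ Y)); [move=> ? ?; exact: ipDl|exact: ip0l]. Qed.

Lemma d_ip k X Y : d k (ip X Y) = ip (nab k X) Y + ip X (nab k Y).
Proof.
have dX Z : mxd k Z = nab k Z - Z *m C k + Ga k *m Z.
  by apply/matrixP => a b; rewrite !mxE; ring.
rewrite /ip d_mxtrace !mxdM mxd_gi mxd_tr C_compat [mxd k X]dX [mxd k Y]dX.
rewrite !(mulmxDl, mulmxDr, mulNmx, mulmxN, trD, trN, trmx_mul).
rewrite giT HT !mulmxA.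
rewrite !(mxtraceD, mxtraceNE) (mxtrace_mulC _ (Ga k)^T) !mulmxA.
ring.
Qed.

Variable phi : 'rV[A]_m.
Definition dphi : 'M[A]_(q, m) := \matrix_(i, j) d i (phi 0 j).
Hypothesis C_sym : forall k i, row i dphi *m C k = row k dphi *m C i.
Definition II k := nab k dphi.

(** Symmetry combines the commutation of the derivations with the vanishing torsion of both
    connections, expressed by [Ga_sym] and [C_sym]. *)
Lemma II_sym k i : row i (II k) = row k (II i).
Proof.
rewrite /II /nab !rowD !rowN !row_mul C_sym; congr (_ + _ - _).
  by apply/rowP => j; rewrite !mxE dC.
by rewrite Ga_sym.
Qed.

Definition hess (f : A) l k := d l (d k f) - \sum_i Ga l k i * d i f.
Definition lap f := \sum_l \sum_k gi l k * hess f l k.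
Definition en := ip dphi dphi.
(** Second covariant derivative of [dphi]; the last sum differentiates the index [k] as a
    covector. *)
Definition T l k := nab l (II k) - \sum_i Ga l k i *: II i.
(** Connection matrices act on rows from the right, so the two products come in the order opposite
    to that of the usual commutator. *)
Definition curv q' (B : 'I_q -> 'M[A]_q') l i :=
  mxd l (B i) - mxd i (B l) + B i *m B l - B l *m B i.

Lemma d_en k : d k en = ip (II k) dphi *+ 2.
Proof. by rewrite /en d_ip [in X in _ + X]ipC mulr2n. Qed.

Lemma hess_en l k : hess en l k = (ip (T l k) dphi + ip (II k) (II l)) *+ 2.
Proof.
rewrite /hess d_en mulr2n dD d_ip /T ipDl ipNl ip_suml.
under eq_bigr do rewrite d_en.
rewrite (eq_bigr (fun i => ip (Ga l k i *: II i) dphi *+ 2)); last first.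
  by move=> i _; rewrite ipZl mulrnAr.
rewrite sumrMnl -/(II l) !mulr2n.
set x := ip _ _; set y := ip _ _; set z := \sum_(_ < _) _.
ring.
Qed.

Lemma T_sym l k i : row i (T l k) = row k (T l i).
Proof.
(* An opaque name for [II], so that unfolding [nab] affects the outer derivative only. *)
have [J EJ] : {J | J = II} by exists II.
have Js k' i' : row i' (J k') = row k' (J i') by rewrite EJ II_sym.
have F l' k' i' : row i' (T l' k') = mxd l' (row i' (J k')) + row i' (J k') *m C l'
   - \sum_j Ga l' i' j *: row k' (J j) - \sum_j Ga l' k' j *: row i' (J j).
  rewrite /T -EJ /nab !(rowD, rowN) !row_mul mxd_row row_sumE; congr (_ - _ - _).
    rewrite mulmx_sum_row; apply: eq_bigr => j _.
    by rewrite mxE Js.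
  by apply: eq_bigr => j _; rewrite rowZ.
by rewrite !F Js addrAC.
Qed.

(** Ricci's commutation identity. The sums over [Ga l i] and [Ga i l] cancel because the connection
    of Q is torsion free. *)
Lemma ricci_id l i : T l i - T i l = dphi *m curv C l i - curv Ga l i *m dphi.
Proof.
rewrite /T (eq_bigr (fun j => Ga i l j *: II j)); last first.
  by move=> j _; have /rowP/(_ j) := Ga_sym l i; rewrite !mxE => ->.
rewrite opprB addrA subrK.
rewrite /II /nab /curv !(mxdD, mxdN, mxdM) (mxdC l i).
rewrite !(mulmxDl, mulmxDr, mulNmx, mulmxN) !mulmxA.
by apply/matrixP => a b; rewrite !mxE; ring.
Qed.

Hypothesis harmonic : \sum_l \sum_k gi l k *: row k (II l) = 0.

(** The trace of [II] is identically zero and [gi] is parallel, so the trace of the covariant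
    derivative of [II] is zero as well. *)
Lemma trace_T i : \sum_l \sum_k gi l k *: row k (T i l) = 0.
Proof.
have [J EJ] : {J | J = II} by exists II.
rewrite /T -EJ.
have : mxd i (\sum_l \sum_k gi l k *: row k (J l)) +
   (\sum_l \sum_k gi l k *: row k (J l)) *m C i = 0.
  by rewrite EJ harmonic mxd0 mul0mx addr0.
rewrite mxd_sum mulmx_suml -big_split/= => E; rewrite -[RHS]E {E}.
have dgi l k : d i (gi l k) =
    - (\sum_j gi l j * Ga i j k) - (\sum_j gi k j * Ga i j l).
  by have /matrixP/(_ l k) := mxd_gi i; rewrite !mxE opprD.
apply/eqP; rewrite -subr_eq0 -sumrB; apply/eqP.
(* [A1] and [A2] come from the derivative of [gi], [B1] and [B2] from the connection acting on the
   two indices of [II]; renaming the summation indices cancels them in pairs. *)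
pose A1 l k := (\sum_j gi l j * Ga i j k) *: row k (J l).
pose A2 l k := (\sum_j gi k j * Ga i j l) *: row k (J l).
pose B1 l k := gi l k *: (\sum_j Ga i k j *: row j (J l)).
pose B2 l k := gi l k *: (\sum_j Ga i l j *: row k (J j)).
rewrite (eq_bigr (fun l => \sum_k (A1 l k + A2 l k - B1 l k - B2 l k))); last first.
  move=> l _; rewrite mxd_sum mulmx_suml -big_split/= -sumrB.
  apply: eq_bigr => k _.
  rewrite mxdZ -scalemxAl mxd_row dgi /nab !(rowD, rowN) row_sumE !row_mul.
  rewrite [row k (Ga i) *m _]mulmx_sum_row.
  rewrite (eq_bigr (fun j => (Ga i k j) *: row j (J l))); last first.
    by move=> j _; rewrite mxE.
  rewrite [\sum_j row k _](eq_bigr (fun j => (Ga i l j) *: row k (J j))); last first.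
    by move=> j _; rewrite rowZ.
  rewrite /A1 /A2 /B1 /B2; apply/rowP => a.
  move: (\sum_j gi l j * _) (\sum_j gi k j * _) (\sum_j _) (\sum_j _) => x y z w.
  by rewrite !mxE; ring.
under eq_bigr do rewrite !sumrB big_split/=.
rewrite !sumrB big_split/= /A1 /A2 /B1 /B2.
have E1 : \sum_l \sum_k (\sum_j gi l j * Ga i j k) *: row k (J l) =
  \sum_l \sum_k gi l k *: (\sum_j Ga i k j *: row j (J l)).
  apply: eq_bigr => l _; under eq_bigr do rewrite scaler_suml.
  rewrite exchange_big/=; apply: eq_bigr => k _; rewrite scaler_sumr.
  by apply: eq_bigr => j _; rewrite scalerA.
have E2 : \sum_l \sum_k (\sum_j gi k j * Ga i j l) *: row k (J l) =
  \sum_l \sum_k gi l k *: (\sum_j Ga i l j *: row k (J j)).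
  rewrite exchange_big/= [RHS]exchange_big/=; apply: eq_bigr => k _.
  under eq_bigr do rewrite scaler_suml.
  rewrite exchange_big/=; apply: eq_bigr => l _; rewrite scaler_sumr.
  apply: eq_bigr => j _; rewrite scalerA; congr (_ * _ *: _).
  by have /matrixP/(_ l k) := giT; rewrite mxE.
by rewrite E1 E2 -addrA -opprD subrr.
Qed.

(** [T_sym] exchanges the row index with an index of differentiation, [ricci_id] then commutes the
    two derivatives at the cost of curvature, and what remains is the derivative of the vanishing
    tension field. *)
Lemma weitzenboeck : lap en = (\sum_l \sum_k gi l k * ip (II k) (II l) +
  ip (\matrix_i \sum_l \sum_k gi l k *:
        row k (dphi *m curv C l i - curv Ga l i *m dphi)) dphi) *+ 2.
Proof.
rewrite /lap; under eq_bigr do (under eq_bigr do rewrite hess_en mulrnAr mulrDr).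
under eq_bigr do rewrite sumrMnl big_split/=.
rewrite sumrMnl big_split/= addrC; congr ((_ + _) *+ 2).
under eq_bigr do (under eq_bigr do rewrite -ipZl).
under eq_bigr do rewrite -ip_suml.
rewrite -ip_suml; congr (ip _ _); apply/row_matrixP => i; rewrite rowK row_sumE.
transitivity (\sum_l \sum_k gi l k *:
    row k (dphi *m curv C l i - curv Ga l i *m dphi) +
  \sum_l \sum_k gi l k *: row k (T i l)); last by rewrite trace_T addr0.
rewrite -big_split/=; apply: eq_bigr => l _.
rewrite row_sumE -big_split/=; apply: eq_bigr => k _.
by rewrite rowZ T_sym -scalerDr -rowD -ricci_id subrK.
Qed.

(** All factors of [P] are parallel, so its derivative is a commutator with the transpose of [Ga k];
    the trace of the square does not see commutators. *)
Lemma parallel_trace_sq : (forall k, II k = 0) -> forall k,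
  d k (\tr (gi *m dphi *m H *m dphi^T *m (gi *m dphi *m H *m dphi^T))) = 0.
Proof.
move=> II0 k; have [P EP] : {P | P = gi *m dphi *m H *m dphi^T} by eexists.
have dS : mxd k dphi = - (dphi *m C k) + Ga k *m dphi.
  by apply/eqP; rewrite -subr_eq0 opprD opprK addrA; apply/eqP; exact: II0.
have dP : mxd k P = P *m (Ga k)^T - (Ga k)^T *m P.
  rewrite EP !mxdM mxd_gi mxd_tr C_compat dS.
  rewrite !(mulmxDl, mulmxDr, mulNmx, mulmxN, trD, trN, trmx_mul).
  rewrite giT HT !mulmxA; apply/matrixP => a b; rewrite !mxE; ring.
rewrite -EP d_mxtrace mxdM dP mulmxBl mulmxBr !mxtraceD !mxtraceNE.
by rewrite -[(Ga k)^T *m P *m P]mulmxA [\tr ((Ga k)^T *m _)]mxtrace_mulC !mulmxA; ring.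
Qed.

End Weitzenboeck.

(** * The transverse connection in a chart *)

Section BilinearForms.
Variables (R : realType) (n : nat).
Implicit Types (B : 'M[R]_n) (v w : 'rV[R]_n).

Lemma bformE B v w : bform B v w = (v *m B *m w^T) 0 0. Proof. by []. Qed.

Lemma bformDl B v v' w : bform B (v + v') w = bform B v w + bform B v' w.
Proof. by rewrite /bform !mulmxDl mxE. Qed.

Lemma bformZl B c v w : bform B (c *: v) w = c * bform B v w.
Proof. by rewrite /bform -!scalemxAl mxE. Qed.

Lemma bformNl B v w : bform B (- v) w = - bform B v w.
Proof. by rewrite /bform !mulNmx mxE. Qed.

Lemma bform0l B w : bform B 0 w = 0.
Proof. by rewrite /bform !mul0mx mxE. Qed.

Lemma bformDr B v w w' : bform B v (w + w') = bform B v w + bform B v w'.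
Proof. by rewrite /bform trD mulmxDr mxE. Qed.

Lemma bformZr B c v w : bform B v (c *: w) = c * bform B v w.
Proof. by rewrite /bform linearZ/= -scalemxAr mxE. Qed.

Lemma bform0r B v : bform B v 0 = 0.
Proof. by rewrite /bform trmx0 mulmx0 mxE. Qed.

Lemma bform_suml B I (r : seq I) P (F : I -> 'rV[R]_n) w :
  bform B (\sum_(i <- r | P i) F i) w = \sum_(i <- r | P i) bform B (F i) w.
Proof. by rewrite /bform !mulmx_suml summxE. Qed.

Lemma bform_sumr B I (r : seq I) P (F : I -> 'rV[R]_n) v :
  bform B v (\sum_(i <- r | P i) F i) = \sum_(i <- r | P i) bform B v (F i).
Proof.
apply: (big_morph (bform B v)); [by move=> ? ?; exact: bformDr|exact: bform0r].
Qed.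

Lemma bformC B v w : B^T = B -> bform B v w = bform B w v.
Proof.
move=> Bs; have : (v *m B *m w^T)^T = w *m B *m v^T.
  by rewrite !trmx_mul trmxK Bs mulmxA.
by move=> /matrixP/(_ 0 0); rewrite mxE.
Qed.

Lemma bform_mul k (B : 'M[R]_n) (P Q : 'M[R]_(k, n)) (v w : 'rV[R]_k) :
  bform B (v *m P) (w *m Q) = (v *m (P *m B *m Q^T) *m w^T) 0 0.
Proof. by rewrite /bform trmx_mul !mulmxA. Qed.

Lemma bform_delta B i j : bform B (delta_mx 0 i) (delta_mx 0 j) = B i j.
Proof.
by rewrite /bform -rowE trmx_delta -colE !mxE.
Qed.

Lemma bform_coord B v w : bform B v w = \sum_i \sum_j v 0 i * w 0 j * B i j.
Proof.
rewrite {1}(row_delta_sum v) bform_suml; apply: eq_bigr => i _.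
rewrite {1}(row_delta_sum w) bform_sumr; apply: eq_bigr => j _.
by rewrite bformZl bformZr bform_delta mulrA.
Qed.

Definition posdef B := forall v, v != 0 -> 0 < bform B v v.

Lemma posdef_unit B : posdef B -> B \in unitmx.
Proof.
move=> pB; rewrite unitmxE unitfE; apply/negP => /eqP/eqP/det0P[v v0 vB].
by have := pB v v0; rewrite /bform vB mul0mx mxE ltxx.
Qed.

Lemma posdef_eq0 B v : posdef B -> (bform B v v == 0) = (v == 0).
Proof.
move=> pB; have [->|v0] := eqVneq v 0; first by rewrite bform0l eqxx.
by rewrite gt_eqF// pB.
Qed.

Lemma bform_injl B v w : B \in unitmx -> (forall z, bform B v z = bform B w z) -> v = w.
Proof.
move=> uB H; apply: (can_inj (mulmxK uB)); apply/rowP => j.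
have := H (delta_mx 0 j); rewrite /bform trmx_delta -!colE.
by rewrite [in X in X -> _]mxE [in X in _ = X -> _]mxE.
Qed.

(* [christoffel], with an arbitrary [D] in place of the derivative of the metric. *)
Definition chr B (D : 'rV[R]_n -> 'M[R]_n) v w : 'rV[R]_n :=
  (\row_(l < n) (2^-1 * (bform (D v) w (delta_mx 0 l)
                         + bform (D w) v (delta_mx 0 l)
                         - bform (D (delta_mx 0 l)) v w))) *m invmx B.

Lemma chrP B (D : 'rV[R]_n -> 'M[R]_n) v w z : B \in unitmx ->
  (forall x : 'rV[R]_n, D x = \sum_i x 0 i *: D (delta_mx 0 i)) ->
  bform B (chr B D v w) z = 2^-1 * (bform (D v) w z + bform (D w) v z - bform (D z) v w).
Proof.
move=> uB Dl; rewrite [LHS]/bform /chr mulmxKV//.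
rewrite [in LHS]mxE.
have F x y : bform (D z) x y = \sum_i z 0 i * bform (D (delta_mx 0 i)) x y.
  rewrite [LHS]/bform Dl mulmx_sumr mulmx_suml summxE; apply: eq_bigr => i _.
  by rewrite -scalemxAr -scalemxAl mxE.
have F2 M x : bform M x z = \sum_i z 0 i * bform M x (delta_mx 0 i).
  by rewrite {1}(row_delta_sum z) bform_sumr; apply: eq_bigr => i _; rewrite bformZr.
rewrite F (F2 (D v)) (F2 (D w)).
rewrite -big_split/= -sumrB mulr_sumr; apply: eq_bigr => i _.
by rewrite !mxE; ring.
Qed.

Section ChrLinear.
Variables (B : 'M[R]_n) (D : 'rV[R]_n -> 'M[R]_n).
Hypothesis uB : B \in unitmx.
Hypothesis Dl : forall x : 'rV[R]_n, D x = \sum_i x 0 i *: D (delta_mx 0 i).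

Lemma chrDl v v' w : chr B D (v + v') w = chr B D v w + chr B D v' w.
Proof.
have DD x y : D (x + y) = D x + D y.
  rewrite [LHS]Dl (Dl x) (Dl y) -big_split/=; apply: eq_bigr => i _.
  by rewrite mxE scalerDl.
have bD (M N : 'M[R]_n) x y : bform (M + N) x y = bform M x y + bform N x y.
  by rewrite /bform mulmxDr mulmxDl mxE.
apply: (bform_injl uB) => z.
by rewrite bformDl !chrP// DD bD !bformDl; ring.
Qed.

Lemma chrZl c v w : chr B D (c *: v) w = c *: chr B D v w.
Proof.
have DZ x : D (c *: x) = c *: D x.
  rewrite [LHS]Dl (Dl x) scaler_sumr; apply: eq_bigr => i _.
  by rewrite mxE scalerA.
have bZ (M : 'M[R]_n) x y : bform (c *: M) x y = c * bform M x y.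
  by rewrite /bform -scalemxAr -scalemxAl mxE.
apply: (bform_injl uB) => z.
by rewrite bformZl !chrP// DZ bZ !bformZl; ring.
Qed.

Hypothesis DT : forall x, (D x)^T = D x.

Lemma chrC v w : chr B D v w = chr B D w v.
Proof.
apply: (bform_injl uB) => z; rewrite !chrP// (bformC w v (DT z)).
by congr (_ * (_ - _)); rewrite addrC.
Qed.

Lemma chr_compat v w z : bform B (chr B D v w) z + bform B (chr B D v z) w =
  bform (D v) w z.
Proof.
rewrite !chrP// (bformC z w (DT v)) (bformC v w (DT z)) (bformC v z (DT w)).
by field.
Qed.

End ChrLinear.

End BilinearForms.

Lemma christoffel_chr (R : realType) n (G : 'rV[R]_n -> 'M[R]_n) u v w :
  christoffel G u v w = chr (G u) (fun x => 'D_x G u) v w.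
Proof. by []. Qed.

Lemma rsubD (R : pzRingType) m p q (X Y : 'M[R]_(m, p + q)) :
  rsubmx (X + Y) = rsubmx X + rsubmx Y.
Proof. by apply/matrixP => i j; rewrite !mxE. Qed.

Lemma rsubB (R : pzRingType) m p q (X Y : 'M[R]_(m, p + q)) :
  rsubmx (X - Y) = rsubmx X - rsubmx Y.
Proof. by apply/matrixP => i j; rewrite !mxE. Qed.

Lemma derive_slice (R : realType) p q (W : normedModType R)
    (f : 'rV[R]_(p + q) -> W) u (a : 'rV[R]_q) :
  'D_a (fun y => f (row_mx (lsubmx u) y)) (rsubmx u) = 'D_(row_mx 0 a) f u.
Proof.
rewrite /derive; set F := (X in lim (X @ _) = _).
set F' := (X in _ = lim (X @ _)); suff -> : F = F' by [].
apply/funext => h; rewrite /F /F' /= hsubmxK; congr (_ *: (f _ - _)).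
by rewrite -[in RHS](hsubmxK u) scale_row_mx add_row_mx scaler0 add0r.
Qed.

Section TransverseChart.
Variables (R : realType) (p q : nat).
Variables (O : set 'rV[R]_(p + q)) (G : 'rV[R]_(p + q) -> 'M[R]_(p + q)).

(** The properties of [metric i] detached from the manifold, so that they can be restricted to the
    open set on which a map has a local representative. *)
Record chart_metric : Prop := ChartMetric {
  cm_open : open O;
  cm_smooth : mxsmooth O G;
  cm_sym : forall u, O u -> (G u)^T = G u;
  cm_pos : forall u, O u -> posdef (G u);
  cm_bundle_like : forall u (v : 'rV[R]_(p + q)), O u ->
    rsubmx v = 0 -> 'D_v (transverse_metric G) u = 0 }.

Hypothesis cm : chart_metric.
Let oO : open O := cm_open cm.

Notation sg := (sigma_mx G).
Notation gb := (transverse_metric G).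

Lemma rsub_sigma u (a : 'rV[R]_q) : rsubmx (a *m sg u) = a.
Proof. by rewrite /sigma_mx mul_mx_row row_mxKr mulmx1. Qed.

Lemma bform_ul u (x : 'rV[R]_p) :
  bform (ulsubmx (G u)) x x = bform (G u) (row_mx x 0) (row_mx x 0).
Proof.
rewrite /bform -[in RHS](submxK (G u)) mul_row_block !mul0mx !addr0 tr_row_mx.
by rewrite mul_row_col trmx0 mulmx0 addr0.
Qed.

Lemma ul_unit u : O u -> ulsubmx (G u) \in unitmx.
Proof.
move=> Ou; apply: posdef_unit => x x0; rewrite bform_ul; apply: (cm_pos cm) => //.
apply: contra_neq x0 => e.
by rewrite -(row_mxKl x (0 : 'rV[R]_q)) e; apply/rowP => j; rewrite !mxE.
Qed.

Lemma sigma_horizontal k u (x : 'M[R]_(k, p)) : O u ->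
  sg u *m G u *m (row_mx x 0)^T = 0.
Proof.
move=> Ou; rewrite -[X in _ *m X *m _](submxK (G u)) /sigma_mx mul_row_block tr_row_mx mul_row_col.
by rewrite trmx0 mulmx0 addr0 mulNmx -mulmxA mulVmx ?ul_unit// mulmx1 mul1mx addNr mul0mx.
Qed.

Lemma sigma_horizontalT k u (x : 'M[R]_(k, p)) : O u ->
  row_mx x 0 *m G u *m (sg u)^T = 0.
Proof.
move=> Ou; apply: trmx_inj; rewrite !trmx_mul trmxK trmx0 (cm_sym cm)// mulmxA.
exact: sigma_horizontal.
Qed.

Lemma row_mx_lsub k (v : 'M[R]_(k, p + q)) : rsubmx v = 0 -> v = row_mx (lsubmx v) 0.
Proof. by move=> v0; rewrite -[LHS]hsubmxK v0. Qed.

Lemma sg_smooth : mxsmooth O sg.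
Proof.
have sG := cm_smooth cm.
have sub k l (f : 'I_k -> 'I_(p + q)) (h : 'I_l -> 'I_(p + q)) (B : 'rV[R]_(p + q) -> 'M[R]_(k, l)) :
    (forall u i j, B u i j = G u (f i) (h j)) -> mxsmooth O B.
  by move=> E i j; apply: (smooth_eq oO _ (sG (f i) (h j))) => u _; rewrite E.
have s1 : mxsmooth O (fun u => dlsubmx (G u)).
  by apply: (sub _ _ (@rshift p q) (@lshift p q)) => u i j; rewrite !mxE.
have s2 : mxsmooth O (fun u => ulsubmx (G u)).
  by apply: (sub _ _ (@lshift p q) (@lshift p q)) => u i j; rewrite !mxE.
have s3 := mxsmooth_inv oO ul_unit s2.
have s4 := mxsmoothN oO (mxsmooth_mul oO s1 s3).
move=> i j; rewrite /sigma_mx; case: (split_ordP j) => a ->.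
  by apply: (smooth_eq oO _ (s4 i a)) => u _; rewrite row_mxEl.
apply: (@smooth_eq _ _ _ oO (fun=> (1%:M : 'M[R]_q) i a)); last exact: smooth_cst.
by move=> u _; rewrite row_mxEr.
Qed.

Lemma gb_smooth : mxsmooth O gb.
Proof.
have sG := cm_smooth cm; have ss := sg_smooth.
exact: (mxsmooth_mul oO (mxsmooth_mul oO ss sG) (mxsmooth_tr oO ss)).
Qed.

Lemma gbT u : O u -> (gb u)^T = gb u.
Proof. by move=> Ou; rewrite /transverse_metric !trmx_mul trmxK (cm_sym cm)// mulmxA. Qed.

Lemma bform_gb u a b : bform (gb u) a b = bform (G u) (a *m sg u) (b *m sg u).
Proof. by rewrite bform_mul. Qed.

Lemma gb_pos u : O u -> posdef (gb u).
Proof.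
move=> Ou a a0; rewrite bform_gb; apply: (cm_pos cm) => //.
by apply: contra_neq a0 => e; rewrite -(rsub_sigma u a) e; apply/rowP => j; rewrite !mxE.
Qed.

Lemma gb_unit u : O u -> gb u \in unitmx.
Proof. by move=> Ou; exact/posdef_unit/gb_pos. Qed.

(** The difference between [c] and the lift of its transverse part is tangent to the leaves, hence
    orthogonal to every horizontal vector. *)
Lemma bform_horizontal u (c : 'rV[R]_(p + q)) a : O u ->
  bform (G u) c (a *m sg u) = bform (gb u) (rsubmx c) a.
Proof.
move=> Ou; have -> : c = rsubmx c *m sg u + row_mx (lsubmx (c - rsubmx c *m sg u)) 0.
  by rewrite -row_mx_lsub ?rsubB ?rsub_sigma ?subrr// addrC subrK.
rewrite bformDl -bform_gb; set r := row_mx _ _.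
have -> : bform (G u) r (a *m sg u) = 0.
  by rewrite /bform trmx_mul !mulmxA /r sigma_horizontalT// mul0mx mxE.
by rewrite addr0 rsubD rsub_sigma row_mxKr addr0.
Qed.

Definition chris u a b := christoffel (local_quotient_metric G u) (rsubmx u) a b.

Lemma chris_chr u a b :
  chris u a b = chr (gb u) (fun v => 'D_(row_mx 0 v) gb u) a b.
Proof.
have e : local_quotient_metric G u (rsubmx u) = gb u.
  by rewrite /local_quotient_metric hsubmxK.
have d : (fun c => 'D_c (local_quotient_metric G u) (rsubmx u)) =
    (fun c => 'D_(row_mx 0 c) gb u).
  by apply/funext => c; exact: derive_slice.
exact: (f_equal2 (fun B D => chr B D a b) e d).
Qed.

Lemma derive_gb_lin u (x : 'rV[R]_q) : O u -> 'D_(row_mx 0 x) gb u =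
  \sum_i x 0 i *: 'D_(row_mx 0 (delta_mx 0 i)) gb u.
Proof.
move=> Ou; have dg : differentiable gb u by exact: (mxsmooth_differentiable oO gb_smooth Ou).
have -> : row_mx 0 x = \sum_i x 0 i *: row_mx (0 : 'rV[R]_p) (delta_mx 0 i : 'rV[R]_q).
  apply/rowP => j; rewrite summxE; case: (split_ordP j) => a ->.
    by rewrite row_mxEl mxE big1// => i _; rewrite mxE row_mxEl mxE mulr0.
  rewrite row_mxEr {1}(row_delta_sum x) summxE; apply: eq_bigr => i _.
  by rewrite [RHS]mxE row_mxEr mxE.
by rewrite derive_sum_dir//; apply: eq_bigr => i _; rewrite deriveZ_dir.
Qed.

Lemma chrisP u a b z : O u -> bform (gb u) (chris u a b) z =
  2^-1 * (bform ('D_(row_mx 0 a) gb u) b z + bform ('D_(row_mx 0 b) gb u) a z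
          - bform ('D_(row_mx 0 z) gb u) a b).
Proof.
move=> Ou; rewrite chris_chr chrP//; first exact: gb_unit.
by move=> x; exact: derive_gb_lin.
Qed.

(** This is the bundle-like condition: the leaf part of [v] contributes nothing. *)
Lemma derive_gb_rsub u v : O u -> 'D_v gb u = 'D_(row_mx 0 (rsubmx v)) gb u.
Proof.
move=> Ou; have dg : differentiable gb u by exact: (mxsmooth_differentiable oO gb_smooth Ou).
have -> : v = row_mx (lsubmx v) 0 + row_mx 0 (rsubmx v).
  by rewrite add_row_mx addr0 add0r hsubmxK.
rewrite deriveD_dir// (cm_bundle_like cm)// ?row_mxKr// add0r.
by rewrite rsubD !row_mxKr add0r.
Qed.

(** The right block of [sigma_mx] is constant, so the derivative of [sigma_mx] takes values in L,
    which is orthogonal to horizontal vectors; only the derivative of [G] survives. *)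
Lemma derive_gb_sigma u v : O u ->
  'D_v gb u = sg u *m 'D_v G u *m (sg u)^T.
Proof.
move=> Ou; have ds : derivable sg u v.
  by apply: diff_derivable; exact: (mxsmooth_differentiable oO sg_smooth Ou).
have dG : derivable G u v.
  by apply: diff_derivable; exact: (mxsmooth_differentiable oO (cm_smooth cm) Ou).
have -> : 'D_v gb u = ('D_v sg u *m G u + sg u *m 'D_v G u) *m (sg u)^T +
    sg u *m G u *m ('D_v sg u)^T.
  rewrite /transverse_metric derive_mulmx; last first.
  - exact: derivable_trmx.
  - exact: derivable_mulmx.
  by rewrite derive_mulmx// derive_trmx.
have r0 : rsubmx ('D_v sg u) = 0.
  rewrite -derive_rsubmx// (_ : (fun _ => _) = cst (1%:M : 'M[R]_q)) ?derive_cst//.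
  by apply/funext => w; rewrite /sigma_mx row_mxKr.
rewrite (row_mx_lsub r0) mulmxDl sigma_horizontalT// add0r.
by rewrite sigma_horizontal// addr0.
Qed.

(** Both sides satisfy the same Koszul formula: on horizontal vectors the derivatives of [G] are
    those of the transverse metric, by the two preceding lemmas. *)
Lemma rsub_christoffel u a b : O u ->
  rsubmx (christoffel G u (a *m sg u) (b *m sg u)) = chris u a b.
Proof.
move=> Ou; apply: (bform_injl (gb_unit Ou)) => z.
rewrite -bform_horizontal// chrisP//.
have dG : differentiable G u by exact: (mxsmooth_differentiable oO (cm_smooth cm) Ou).
rewrite christoffel_chr chrP; last 2 first.
- exact/posdef_unit/(cm_pos cm).
- move=> x; rewrite {1}(row_delta_sum x) derive_sum_dir//.
  by apply: eq_bigr => i _; rewrite deriveZ_dir.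
have E c v w : bform ('D_(c *m sg u) G u) (v *m sg u) (w *m sg u) =
    bform ('D_(row_mx 0 c) gb u) v w.
  have e1 := derive_gb_sigma (c *m sg u) Ou.
  have e2 := derive_gb_rsub (c *m sg u) Ou.
  by rewrite bform_mul -e1 e2 rsub_sigma.
by congr (_ * (_ + _ - _)); exact: E.
Qed.

(** The two cases in the definition of the transverse connection merge: [leafwise X] has no
    transverse component, hence neither have its derivatives, and the bracket contributes just the
    derivative of [s] along the leaf part of [X]. *)
Lemma nablaQE X s u : O u -> differentiable X u -> differentiable s u ->
  nablaQ G X s u = 'D_(X u) s u + chris u (rsubmx (X u)) (s u).
Proof.
move=> Ou dX ds.
have dsg : differentiable sg u by exact: (mxsmooth_differentiable oO sg_smooth Ou).
have dsig (t : 'rV[R]_(p + q) -> 'rV[R]_q) v : differentiable t u -> derivable (sigma G t) u v.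
  by move=> dt; apply: derivable_mulmx; exact: diff_derivable.
have rsig (t : 'rV[R]_(p + q) -> 'rV[R]_q) v : differentiable t u ->
    rsubmx ('D_v (sigma G t) u) = 'D_v t u.
  move=> dt; rewrite -derive_rsubmx; last exact: dsig.
  by congr ('D_v _ u); apply/funext => w; rewrite /sigma rsub_sigma.
have drX : differentiable (fun w => rsubmx (X w)) u.
  apply: (@differentiable_comp _ _ _ _ X (fun M => rsubmx M)) => //.
  exact: differentiable_rsubmx.
have dhX v : derivable (horizontal G X) u v by exact: dsig.
have dlX v : derivable (leafwise G X) u v.
  by apply: derivableB => //; exact: diff_derivable.
have rl : rsubmx ('D_(sigma G s u) (leafwise G X) u) = 0.
  rewrite -derive_rsubmx// (_ : (fun _ => _) = cst 0) ?derive_cst//.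
  by apply/funext => w; rewrite /leafwise rsubB /horizontal /sigma rsub_sigma subrr.
have e1 : rsubmx (lie_bracket (leafwise G X) (sigma G s) u) =
    'D_(leafwise G X u) s u.
  by rewrite /lie_bracket rsubB rl subr0; exact: rsig.
have e2 : rsubmx (levi_civita G (horizontal G X) (sigma G s) u) =
    'D_(horizontal G X u) s u + chris u (rsubmx (X u)) (s u).
  rewrite /levi_civita rsubD; congr (_ + _); first exact: rsig.
  exact: rsub_christoffel.
rewrite /nablaQ e1 e2 addrA; congr (_ + _).
have e3 := deriveD_dir (leafwise G X u) (horizontal G X u) ds.
by apply: etrans (esym e3) _; congr ('D_ _ _ _); rewrite /leafwise subrK.
Qed.

End TransverseChart.

Lemma derive_invmx (R : realType) (V : normedModType R) n (B : V -> 'M[R]_n) u v :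
  (\forall w \near u, B w \in unitmx) -> derivable B u v ->
  derivable (fun w => invmx (B w)) u v ->
  'D_v (fun w => invmx (B w)) u = - (invmx (B u) *m 'D_v B u *m invmx (B u)).
Proof.
move=> uB dB dI.
have uBu : B u \in unitmx by exact: nbhs_singleton uB.
have : 'D_v (fun w => B w *m invmx (B w)) u = 0.
  rewrite (@near_eq_derive _ _ _ _ (cst 1%:M)) ?derive_cst//.
  by apply: filterS uB => w /mulmxV.
rewrite derive_mulmx// => /(congr1 (mulmx (invmx (B u)))).
rewrite mulmxDr mulmx0 mulKmx// !mulmxA => /eqP.
by rewrite addrC addr_eq0 => /eqP.
Qed.

Lemma row_mx0_delta (R : pzRingType) p q k :
  row_mx 0 (delta_mx 0 k) = delta_mx 0 (rshift p k) :> 'rV[R]_(p + q).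
Proof.
apply/rowP => j; rewrite mxE; case: split_ordP => a ->; rewrite !mxE eqxx /=.
  by rewrite eq_lrshift.
by rewrite (inj_eq (@rshift_inj _ _)).
Qed.

Section TransverseConnection.
Variables (R : realType) (p q : nat).
Variables (O : set 'rV[R]_(p + q)) (G : 'rV[R]_(p + q) -> 'M[R]_(p + q)).
Hypothesis cm : chart_metric O G.
Let oO : open O := cm_open cm.
Notation gb := (transverse_metric G).
Notation hd k := (sderiv (rshift p k)).

Lemma gbi_smooth : mxsmooth O (fun u => invmx (gb u)).
Proof. exact: (mxsmooth_inv oO (gb_unit cm) (gb_smooth cm)). Qed.

Lemma derive_gbT u v : O u -> ('D_v gb u)^T = 'D_v gb u.
Proof.
move=> Ou; rewrite -derive_trmx; last first.
  by apply: diff_derivable; exact: (mxsmooth_differentiable oO (gb_smooth cm) Ou).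
by apply: (eq_on_derive _ oO _ Ou) => w Ow; exact: (gbT cm).
Qed.

Lemma chrisDl u a a' b : O u -> chris G u (a + a') b = chris G u a b + chris G u a' b.
Proof.
move=> Ou; rewrite !chris_chr.
exact: (chrDl (gb_unit cm Ou) (fun x => derive_gb_lin cm x Ou)).
Qed.

Lemma chrisZl u c a b : O u -> chris G u (c *: a) b = c *: chris G u a b.
Proof.
move=> Ou; rewrite !chris_chr.
exact: (chrZl (gb_unit cm Ou) (fun x => derive_gb_lin cm x Ou)).
Qed.

Lemma chrisC u a b : O u -> chris G u a b = chris G u b a.
Proof.
move=> Ou; rewrite !chris_chr.
exact: (chrC (gb_unit cm Ou) (fun x => derive_gb_lin cm x Ou) (fun x => derive_gbT _ Ou)).
Qed.

Lemma chris_compat u a b c : O u ->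
  bform (gb u) (chris G u a b) c + bform (gb u) (chris G u a c) b =
  bform ('D_(row_mx 0 a) gb u) b c.
Proof.
move=> Ou; rewrite !chris_chr.
exact: (chr_compat (gb_unit cm Ou) (fun x => derive_gb_lin cm x Ou) (fun x => derive_gbT _ Ou)).
Qed.

Lemma chris0l u b : O u -> chris G u 0 b = 0.
Proof. move=> Ou; have := chrisZl 0 0 b Ou; rewrite !scale0r; exact. Qed.

Lemma chris_suml u I (r : seq I) P (f : I -> 'rV[R]_q) b : O u ->
  chris G u (\sum_(i <- r | P i) f i) b = \sum_(i <- r | P i) chris G u (f i) b.
Proof.
move=> Ou; apply: (big_morph (fun a => chris G u a b)).
  by move=> a a'; exact: chrisDl.
exact: chris0l.
Qed.

Definition Gam k u : 'M[R]_q := \matrix_i chris G u (delta_mx 0 k) (delta_mx 0 i).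

Lemma chrisE u a b : O u -> chris G u a b = \sum_k a 0 k *: (b *m Gam k u).
Proof.
move=> Ou; rewrite {1}(row_delta_sum a) chris_suml//; apply: eq_bigr => k _.
rewrite chrisZl//; congr (_ *: _); rewrite chrisC// {1}(row_delta_sum b) chris_suml//.
rewrite mulmx_sum_row; apply: eq_bigr => i _.
by rewrite chrisZl// rowK chrisC.
Qed.

Lemma Gam_sym k i u : O u -> row i (Gam k u) = row k (Gam i u).
Proof. by move=> Ou; rewrite !rowK chrisC. Qed.

Lemma Gam_compat k u : O u ->
  'D_(delta_mx 0 (rshift p k)) gb u = Gam k u *m gb u + (Gam k u *m gb u)^T.
Proof.
move=> Ou; apply/matrixP => i j.
have E a b : (Gam k u *m gb u) a b = bform (gb u) (chris G u (delta_mx 0 k) (delta_mx 0 a)) (delta_mx 0 b).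
  have -> : chris G u (delta_mx 0 k) (delta_mx 0 a) = row a (Gam k u) by rewrite rowK.
  by rewrite /bform -row_mul trmx_delta -colE !mxE.
rewrite mxE [X in _ = _ + X]mxE !E -row_mx0_delta.
by rewrite -(bform_delta ('D_(row_mx 0 (delta_mx 0 k)) gb u)) (chris_compat _ _ _ Ou).
Qed.

(** An explicit expression in derivatives of the transverse metric, from which smoothness and
    constancy along the leaves are read off. *)
Lemma GamE k u : O u -> Gam k u = (\matrix_(i, l) (2^-1 *
  (partial (rshift p k) (fun w => gb w i l) u + partial (rshift p i) (fun w => gb w k l) u
   - partial (rshift p l) (fun w => gb w k i) u))) *m invmx (gb u).
Proof.
move=> Ou; apply/row_matrixP => i; rewrite rowK chris_chr row_mul; congr (_ *m _).
have d v : derivable gb u v.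
  by apply: diff_derivable; exact: (mxsmooth_differentiable oO (gb_smooth cm) Ou).
have E a b c : bform ('D_(row_mx 0 (delta_mx 0 a)) gb u) (delta_mx 0 b) (delta_mx 0 c) =
    partial (rshift p a) (fun w => gb w b c) u.
  by rewrite bform_delta row_mx0_delta; exact: derive_mxE.
by apply/rowP => l; rewrite !mxE; congr (_ * (_ + _ - _)); exact: E.
Qed.

Lemma Gam_smooth k : mxsmooth O (Gam k).
Proof.
apply: (eq_mxsmooth oO (fun u Ou => esym (GamE k Ou))).
apply: (mxsmooth_mul oO _ gbi_smooth) => i l.
have s a b c := smooth_partial (rshift p a) (gb_smooth cm b c).
apply: (smooth_eq oO _ (smoothM oO (smooth_cst 2^-1)
   (smoothB oO (smoothD oO (s k i l) (s i k l)) (s l k i)))).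
by move=> u _; rewrite mxE.
Qed.

Lemma gb_basic v u : O u -> rsubmx v = 0 -> 'D_v gb u = 0.
Proof. exact: (cm_bundle_like cm). Qed.

Lemma gbi_basic v u : O u -> rsubmx v = 0 -> 'D_v (fun w => invmx (gb w)) u = 0.
Proof.
move=> Ou v0; rewrite derive_invmx.
- by rewrite gb_basic// mulmx0 mul0mx oppr0.
- by apply: filterS (open_near oO Ou) => w Ow; exact: (gb_unit cm).
- by apply: diff_derivable; exact: (mxsmooth_differentiable oO (gb_smooth cm) Ou).
- by apply: diff_derivable; exact: (mxsmooth_differentiable oO gbi_smooth Ou).
Qed.

(** Mixed derivatives commute, and the leaf derivatives of [f] vanish on the whole open set. *)
Lemma partial_basic (U : set 'rV[R]_(p + q)) (f : 'rV[R]_(p + q) -> R) k :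
  open U -> smooth_on U f ->
  (forall u v, U u -> rsubmx v = 0 -> 'D_v f u = 0) ->
  (forall u v, U u -> rsubmx v = 0 -> 'D_v (partial k f) u = 0).
Proof.
move=> oU sf bf u v Uu v0.
rewrite derive_partial; last exact: (smooth_differentiable oU (smooth_partial k sf) Uu).
apply: big1 => i _; case: (split_ordP i) => a ->; last first.
  by have /rowP/(_ a) := v0; rewrite !mxE => ->; rewrite mul0r.
rewrite (smooth_partialC oU _ _ sf Uu) [X in _ * X](_ : _ = 0) ?mulr0//.
rewrite {1}/partial (@eq_on_derive _ _ _ U _ (cst 0))// ?derive_cst// => w Uw.
by apply: bf => //; apply/rowP => j; rewrite !mxE eq_sym eq_lrshift andbF.
Qed.

Lemma Gam_basic k v u : O u -> rsubmx v = 0 -> 'D_v (Gam k) u = 0.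
Proof.
move=> Ou v0; rewrite (eq_on_derive _ oO (@GamE k) Ou).
have sg i j := gb_smooth cm i j.
have bg i j w v' : O w -> rsubmx v' = 0 -> 'D_v' (fun w => gb w i j) w = 0.
  move=> Ow v'0; rewrite -derive_mxE ?gb_basic ?mxE//.
  by apply: diff_derivable; exact: (mxsmooth_differentiable oO (gb_smooth cm) Ow).
have pd a i j : derivable (partial (rshift p a) (fun w => gb w i j)) u v.
  by apply: diff_derivable; exact: (smooth_differentiable oO (smooth_partial _ (sg i j)) Ou).
have pb a i j : 'D_v (partial (rshift p a) (fun w => gb w i j)) u = 0.
  by apply: (@partial_basic O _ (rshift p a) oO (sg i j)) => // w v' Ow v'0; exact: bg.
pose F a b c : 'rV[R]_(p + q) -> R := partial (rshift p a) (fun w => gb w b c).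
pose f i l w : R := F k i l w + F i k l w - F l k i w.
have dF a b c : is_derive u v (F a b c) 0 by apply: DeriveDef; [exact: pd|exact: pb].
have fd i l : derivable (fun w => 2^-1 * f i l w) u v /\
    'D_v (fun w => 2^-1 * f i l w) u = 0.
  have [d1 e1] := is_deriveB (is_deriveD (dF k i l) (dF i k l)) (dF l k i).
  have -> : (fun w => 2^-1 * f i l w) = 2^-1 *: (F k i l + F i k l - F l k i) by [].
  split; first exact: derivableZ.
  by rewrite (deriveZ _ d1) e1 addr0 subr0 scaler0.
pose M w : 'M[R]_q := \matrix_(i, l) (2^-1 * f i l w).
rewrite -[LHS]/('D_v (fun w => M w *m invmx (gb w)) u).
have dM : derivable M u v.
  apply/derivable_mxP => i l; rewrite (_ : (fun _ => _) = (fun w => 2^-1 * f i l w)).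
    by have [] := fd i l.
  by apply/funext => w; rewrite mxE.
have DM : 'D_v M u = 0.
  apply/matrixP => i l; rewrite derive_mxE// (_ : (fun _ => _) = (fun w => 2^-1 * f i l w)).
    by rewrite mxE; have [_ ->] := fd i l.
  by apply/funext => w; rewrite mxE.
have dI : derivable (fun w => invmx (gb w)) u v.
  by apply: diff_derivable; exact: (mxsmooth_differentiable oO gbi_smooth Ou).
by rewrite (derive_mulmx dM dI) DM gbi_basic// mul0mx mulmx0 addr0.
Qed.

Lemma derive_basic (W : normedModType R) (f : 'rV[R]_(p + q) -> W) u v :
  differentiable f u -> (forall w, rsubmx w = 0 -> 'D_w f u = 0) ->
  'D_v f u = \sum_k rsubmx v 0 k *: 'D_(delta_mx 0 (rshift p k)) f u.
Proof.
move=> df bf; have -> : v = row_mx (lsubmx v) 0 + row_mx 0 (rsubmx v).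
  by rewrite add_row_mx addr0 add0r hsubmxK.
rewrite deriveD_dir// bf ?row_mxKr// add0r rsubD !row_mxKr add0r.
have -> : row_mx 0 (rsubmx v) = \sum_k rsubmx v 0 k *: delta_mx 0 (rshift p k) :> 'rV[R]_(p + q).
  apply/rowP => j; rewrite summxE; case: (split_ordP j) => a ->.
    by rewrite row_mxEl mxE big1// => i _; rewrite !mxE eq_lrshift andbF mulr0.
  rewrite row_mxEr {1}(row_delta_sum (rsubmx v)) summxE; apply: eq_bigr => i _.
  by rewrite !mxE (inj_eq (@rshift_inj _ _)).
by rewrite derive_sum_dir//; apply: eq_bigr => k _; rewrite deriveZ_dir.
Qed.

(** Coordinate curvature of Q, acting on rows from the right: the curvature operator of the
    coordinate directions [k] and [l] sends [c] to [c *m Om k l u]. *)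
Definition Om k l u : 'M[R]_q := 'D_(delta_mx 0 (rshift p k)) (Gam l) u -
  'D_(delta_mx 0 (rshift p l)) (Gam k) u + Gam l u *m Gam k u - Gam k u *m Gam l u.

Lemma sigma_cst_smooth a : mxsmooth O (sigma G (cst a)).
Proof. exact: (mxsmooth_mul oO (mxsmooth_cst a) (sg_smooth cm)). Qed.

Lemma chris_smooth b c : mxsmooth O (fun w => chris G w b c).
Proof.
apply: (eq_mxsmooth oO (fun u Ou => esym (chrisE b c Ou))).
apply: mxsmooth_sum => // k _; apply: (mxsmoothZ oO (smooth_cst _)).
exact: (mxsmooth_mul oO (mxsmooth_cst c) (Gam_smooth k)).
Qed.

Lemma derive_chris u v b c : O u -> 'D_v (fun w => chris G w b c) u =
  \sum_l \sum_k rsubmx v 0 k * b 0 l *: (c *m 'D_(delta_mx 0 (rshift p k)) (Gam l) u).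
Proof.
move=> Ou; rewrite (eq_on_derive _ oO (fun u Ou => chrisE b c Ou) Ou).
have dG l : differentiable (Gam l) u by exact: (mxsmooth_differentiable oO (Gam_smooth l) Ou).
have dl l w : derivable (fun w => c *m Gam l w) u w.
  by apply: derivable_mulmx; [exact: derivable_cst|exact: diff_derivable].
rewrite (_ : (fun _ => _) = \sum_l (fun w => b 0 l *: (c *m Gam l w))); last first.
  by apply/funext => w; rewrite fct_sumE.
rewrite derive_sum; last by move=> l; exact: derivableZ.
apply: eq_bigr => l _.
rewrite (@deriveZ _ _ _ (fun w => c *m Gam l w))//.
rewrite derive_mulmxr; last exact: diff_derivable.
rewrite (derive_basic _ (dG l)); last by move=> w w0; exact: Gam_basic.
rewrite mulmx_sumr scaler_sumr; apply: eq_bigr => k _.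
by rewrite -scalemxAr scalerA mulrC.
Qed.

Lemma nablaQ_sigma_cst u a b : O u -> nablaQ G (sigma G (cst a)) (cst b) u = chris G u a b.
Proof.
move=> Ou; rewrite (nablaQE cm Ou); last exact: differentiable_cst.
  by rewrite derive_cst add0r /sigma rsub_sigma.
exact: (mxsmooth_differentiable oO (sigma_cst_smooth a) Ou).
Qed.

Lemma RQE u a b c : O u ->
  RQ G u a b c = \sum_k \sum_l (a 0 k * b 0 l) *: (c *m Om k l u).
Proof.
move=> Ou; rewrite /RQ /curvatureQ.
have ds d : differentiable (sigma G (cst d)) u.
  exact: (mxsmooth_differentiable oO (sigma_cst_smooth d) Ou).
have D x y : nablaQ G (sigma G (cst x)) (nablaQ G (sigma G (cst y)) (cst c)) u =
   'D_(x *m sigma_mx G u) (fun w => chris G w y c) u + chris G u x (chris G u y c).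
  have dn : differentiable (nablaQ G (sigma G (cst y)) (cst c)) u.
    apply: (mxsmooth_differentiable oO _ Ou).
    apply: (eq_mxsmooth oO _ (chris_smooth y c)) => w Ow.
    by rewrite nablaQ_sigma_cst.
  have e v : 'D_v (nablaQ G (sigma G (cst y)) (cst c)) u = 'D_v (fun w => chris G w y c) u.
    by apply: (eq_on_derive _ oO _ Ou) => w Ow; exact: nablaQ_sigma_cst.
  rewrite (nablaQE cm Ou (ds x) dn) e (nablaQ_sigma_cst y c Ou).
  by rewrite [rsubmx _]rsub_sigma.
(* The bracket of the lifts of two constant sections is tangent to the leaves, and a constant
   section is parallel along the leaves. *)
have D3 : nablaQ G (lie_bracket (sigma G (cst a)) (sigma G (cst b))) (cst c) u = 0.
  have sab x y : mxsmooth O (fun u => 'D_(sigma G (cst x) u) (sigma G (cst y)) u).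
    by apply: mxsmooth_deriveX => //; exact: sigma_cst_smooth.
  have dl : differentiable (lie_bracket (sigma G (cst a)) (sigma G (cst b))) u.
    exact: (mxsmooth_differentiable oO (mxsmoothB oO (sab a b) (sab b a)) Ou).
  rewrite (nablaQE cm Ou dl); last exact: differentiable_cst.
  rewrite derive_cst add0r.
  have r0 x v : rsubmx ('D_v (sigma G (cst x)) u) = 0.
    rewrite -derive_rsubmx; last exact: diff_derivable.
    rewrite (_ : (fun _ => _) = cst x) ?derive_cst//.
    by apply/funext => w; rewrite /sigma rsub_sigma.
  by rewrite /lie_bracket rsubB !r0 subr0 chris0l.
rewrite D3 subr0 !D !derive_chris// !rsub_sigma.
have E x y : chris G u x (chris G u y c) = \sum_k \sum_l x 0 k * y 0 l *: (c *m Gam l u *m Gam k u).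
  rewrite chrisE//; apply: eq_bigr => k _; rewrite chrisE// mulmx_suml scaler_sumr.
  by apply: eq_bigr => l _; rewrite -scalemxAl scalerA.
rewrite !E opprD [X in X + _ + _]exchange_big/= addrACA.
rewrite [X in _ - X + _](_ : _ = \sum_k \sum_l (a 0 k * b 0 l) *:
   (c *m 'D_(delta_mx 0 (rshift p l)) (Gam k) u)); last first.
  by apply: eq_bigr => k _; apply: eq_bigr => l _; rewrite mulrC.
rewrite [X in _ + (_ - X)](_ : _ = \sum_k \sum_l (a 0 k * b 0 l) *: (c *m Gam k u *m Gam l u)); last first.
  by rewrite exchange_big/=; apply: eq_bigr => k _; apply: eq_bigr => l _; rewrite mulrC.
rewrite -!sumrB -big_split/=; apply: eq_bigr => k _.
rewrite -!sumrB -big_split/=; apply: eq_bigr => l _.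
rewrite /Om !(mulmxDr, mulmxN) !(scalerDr, scalerN) !mulmxA -!addrA.
by congr (_ + (_ + _)).
Qed.

End TransverseConnection.

Lemma map_mxT (A B : Type) (f : A -> B) m n (X : 'M[A]_(m, n)) :
  map_mx f X^T = (map_mx f X)^T.
Proof. by apply/matrixP => i j; rewrite !mxE. Qed.

Lemma row_entry (A : Type) m n (X : 'M[A]_(m, n)) i j : row i X 0 j = X i j.
Proof. by rewrite mxE. Qed.

Lemma leibniz_entry (R : comPzRingType) n m k (s t : R) (X : 'M[R]_(n, m)) (f : 'I_k -> R)
    (K : 'I_k -> 'M[R]_(n, m)) x y :
  s *: ((\sum_c f c *: K c) x y : R^o) + X x y *: (t : R^o) =
  (t *: X + \sum_c (f c * s) *: K c) x y.
Proof.
have sc (a b : R) : a *: (b : R^o) = a * b by [].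
rewrite !sc [RHS]mxE !summxE [X in _ = X + _]mxE [t * _]mulrC addrC; congr (_ + _).
rewrite mulr_sumr; apply: eq_bigr => c _; rewrite !mxE; by rewrite mulrA [s * _]mulrC.
Qed.

Lemma exchange_scale (R : comPzRingType) (V : lmodType R) k (f h : 'I_k -> R)
    (M : 'I_k -> 'I_k -> V) :
  \sum_c \sum_c' (f c * h c') *: M c c' = \sum_c \sum_c' (h c * f c') *: M c' c.
Proof.
by rewrite exchange_big/=; apply: eq_bigr => c _; apply: eq_bigr => c' _; rewrite mulrC.
Qed.

(** * Foliated maps in charts *)

Section ChartMaps.
Variables (R : realType) (p q p' q' : nat).
Variables (U : set 'rV[R]_(p + q)) (G : 'rV[R]_(p + q) -> 'M[R]_(p + q)).
Variables (O' : set 'rV[R]_(p' + q')) (G' : 'rV[R]_(p' + q') -> 'M[R]_(p' + q')).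
Variable F : 'rV[R]_(p + q) -> 'rV[R]_(p' + q').

Record chart_map : Prop := ChartMap {
  cmap_smooth : smooth_map_on U F;
  cmap_dom : forall u, U u -> O' (F u);
  cmap_foliated : forall u (v : 'rV[R]_(p + q)), U u ->
    rsubmx v = 0 -> rsubmx ('D_v F u) = 0 }.

Hypotheses (cm : chart_metric U G) (cm' : chart_metric O' G') (cF : chart_map).
Let oU : open U := cm_open cm.
Let oO' : open O' := cm_open cm'.
Notation gb := (transverse_metric G).
Notation gbi := (fun u => invmx (transverse_metric G u)).
Notation gb' := (transverse_metric G').
Notation e_ k := (delta_mx 0 (rshift p k)).

(* [tmap] is the transverse part of [F], [S] the matrix of [d_T phi] acting on rows, [Hm] the
   metric and [Cm] the connection of the pull-back of Q', [IIm k] the matrix of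
   [nabla_(e_k) d_T phi]. *)
Definition tmap w := rsubmx (F w).
Notation phi := tmap.

Lemma F_mxsmooth : mxsmooth U F.
Proof. by move=> i j; rewrite ord1; exact: cmap_smooth. Qed.

Lemma F_differentiable u : U u -> differentiable F u.
Proof. exact: (mxsmooth_differentiable oU F_mxsmooth). Qed.

Lemma phi_smooth : mxsmooth U phi.
Proof.
by move=> i j; apply: (smooth_eq oU _ (F_mxsmooth i (rshift p' j))) => u _; rewrite mxE.
Qed.

Lemma phi_differentiable u : U u -> differentiable phi u.
Proof. exact: (mxsmooth_differentiable oU phi_smooth). Qed.

Lemma derive_phi u v : U u -> 'D_v phi u = rsubmx ('D_v F u).
Proof. by move=> Uu; apply: derive_rsubmx; exact/diff_derivable/F_differentiable. Qed.

Lemma phi_basic u v : U u -> rsubmx v = 0 -> 'D_v phi u = 0.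
Proof. by move=> Uu v0; rewrite derive_phi//; exact: cmap_foliated. Qed.

Definition S u : 'M[R]_(q, q') := \matrix_k 'D_(e_ k) phi u.

Lemma derive_phiS u v : U u -> 'D_v phi u = rsubmx v *m S u.
Proof.
move=> Uu; rewrite (derive_basic v (phi_differentiable Uu)); last first.
  by move=> w w0; exact: phi_basic.
by rewrite mulmx_sum_row; apply: eq_bigr => k _; rewrite rowK.
Qed.

Lemma S_smooth : mxsmooth U S.
Proof.
move=> k j; apply: (smooth_eq oU _ (smooth_partial (rshift p k) (phi_smooth 0 j))).
move=> u Uu; rewrite mxE derive_mxE//; exact/diff_derivable/phi_differentiable.
Qed.

Lemma S_basic u v : U u -> rsubmx v = 0 -> 'D_v S u = 0.
Proof.
move=> Uu v0; apply/matrixP => k j; rewrite derive_mxE; last first.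
  exact/diff_derivable/(mxsmooth_differentiable oU S_smooth).
have e w : U w -> S w k j = partial (rshift p k) (fun w => phi w 0 j) w.
  by move=> Uw; rewrite mxE derive_mxE//; exact/diff_derivable/phi_differentiable.
rewrite (eq_on_derive v oU e Uu) [RHS]mxE.
apply: (@partial_basic _ _ _ U _ (rshift p k) oU (phi_smooth 0 j)) => // {v v0} {}u v {}Uu v0.
rewrite -derive_mxE ?phi_basic ?mxE//; exact/diff_derivable/phi_differentiable.
Qed.

Lemma derive_comp_basic k l (B : 'rV[R]_(p' + q') -> 'M[R]_(k, l)) u v : U u ->
  mxsmooth O' B -> (forall u v, O' u -> rsubmx v = 0 -> 'D_v B u = 0) ->
  'D_v (fun w => B (F w)) u =
  \sum_c ('D_v phi u) 0 c *: 'D_(delta_mx 0 (rshift p' c)) B (F u).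
Proof.
move=> Uu sB bB; have OFu := cmap_dom cF Uu.
have dB : differentiable B (F u) by exact: (mxsmooth_differentiable oO' sB).
rewrite (derive_comp v (F_differentiable Uu) dB) (derive_basic _ dB); last first.
  by move=> w w0; exact: bB.
by rewrite derive_phi.
Qed.

Lemma mxsmooth_comp k l (B : 'rV[R]_(p' + q') -> 'M[R]_(k, l)) :
  mxsmooth O' B -> mxsmooth U (fun u => B (F u)).
Proof.
move=> sB i j; exact: (smooth_comp oU oO' (cmap_dom cF) (cmap_smooth cF) (sB i j)).
Qed.

Definition Hm u := gb' (F u).
Definition Cm k u : 'M[R]_q' := \sum_c S u k c *: Gam G' c (F u).

Lemma Hm_smooth : mxsmooth U Hm.
Proof. exact: mxsmooth_comp (gb_smooth cm'). Qed.

Lemma Cm_smooth k : mxsmooth U (Cm k).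
Proof.
apply: mxsmooth_sum => // c _; apply: (mxsmoothZ oU (S_smooth k c)).
exact: mxsmooth_comp (Gam_smooth cm' c).
Qed.

Lemma chris_Cm k u b : U u -> chris G' (F u) (row k (S u)) b = b *m Cm k u.
Proof.
move=> Uu; rewrite (chrisE cm' _ _ (cmap_dom cF Uu)) /Cm mulmx_sumr.
by apply: eq_bigr => c _; rewrite mxE scalemxAr.
Qed.

Lemma Cm_sym k i u : U u -> row i (S u) *m Cm k u = row k (S u) *m Cm i u.
Proof. by move=> Uu; rewrite -!chris_Cm// (chrisC cm' _ _ (cmap_dom cF Uu)). Qed.

Lemma derive_e k u : U u -> 'D_(e_ k) phi u = row k (S u).
Proof. by move=> Uu; rewrite rowK. Qed.

Lemma Hm_compat k u : U u ->
  'D_(e_ k) Hm u = Cm k u *m Hm u + (Cm k u *m Hm u)^T.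
Proof.
move=> Uu; have OFu := cmap_dom cF Uu.
rewrite /Hm (derive_comp_basic _ Uu (gb_smooth cm')); last by move=> w v Ow; exact: (cm_bundle_like cm').
rewrite derive_e// /Cm !mulmx_suml linear_sum -big_split/=; apply: eq_bigr => c _.
by rewrite (Gam_compat cm' c OFu) mxE -scalemxAl linearZ/= scalerDr.
Qed.

Definition IIm k u : 'M[R]_(q, q') := 'D_(e_ k) S u + S u *m Cm k u - Gam G k u *m S u.
(** Curvature of the pull-back connection, in the coordinate directions of the source. *)
Definition Om' l i u : 'M[R]_q' :=
  'D_(e_ l) (Cm i) u - 'D_(e_ i) (Cm l) u + Cm i u *m Cm l u - Cm l u *m Cm i u.

Lemma derive_S_sym k i j u : U u -> ('D_(e_ k) S u) i j = ('D_(e_ i) S u) k j.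
Proof.
move=> Uu.
have dS v : derivable S u v by exact/diff_derivable/(mxsmooth_differentiable oU S_smooth).
apply: etrans (derive_mxE i j (dS (e_ k))) _.
apply: etrans _ (esym (derive_mxE k j (dS (e_ i)))).
have e a w : U w -> S w a j = partial (rshift p a) (fun w => phi w 0 j) w.
  by move=> Uw; rewrite mxE derive_mxE//; exact/diff_derivable/phi_differentiable.
rewrite (eq_on_derive _ oU (e i) Uu) (eq_on_derive _ oU (e k) Uu).
exact: (smooth_partialC oU _ _ (phi_smooth 0 j) Uu).
Qed.

(** The derivatives of [S] enter symmetrically in [l] and [i] and drop out, so only the pulled-back
    curvature of Q' is left. *)
Lemma Om'E l i u : U u ->
  Om' l i u = \sum_c \sum_c' (S u l c * S u i c') *: Om G' c c' (F u).
Proof.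
move=> Uu; have OFu := cmap_dom cF Uu.
have dS : differentiable S u by exact: (mxsmooth_differentiable oU S_smooth).
have dGa c : differentiable (fun w => Gam G' c (F w)) u.
  exact: (mxsmooth_differentiable oU (mxsmooth_comp (Gam_smooth cm' c))).
have D a b : 'D_(e_ a) (Cm b) u = \sum_c ('D_(e_ a) S u) b c *: Gam G' c (F u) +
    \sum_c \sum_c' (S u a c * S u b c') *: 'D_(delta_mx 0 (rshift p' c)) (Gam G' c') (F u).
  have dSZ c : differentiable (fun w => S w b c *: Gam G' c (F w)) u.
    apply: differentiable_mx => x y.
    have -> : (fun w => (S w b c *: Gam G' c (F w)) x y) =
       (fun w => S w b c * Gam G' c (F w) x y) by apply/funext => w; rewrite mxE.
    apply: differentiableM; first exact: differentiable_mxE.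
    exact: (differentiable_mxE x y (dGa c)).
  rewrite /Cm (_ : (fun _ => _) = \sum_c (fun w => S w b c *: Gam G' c (F w))); last first.
    by apply/funext => w; rewrite fct_sumE.
  rewrite derive_sum; last by move=> c; exact: diff_derivable.
  rewrite exchange_big/= -big_split/=; apply: eq_bigr => c _.
  have Gc := derive_comp_basic (e_ a) Uu (Gam_smooth cm' c)
    (fun w v Ow v0 => Gam_basic cm' c Ow v0).
  apply/matrixP => x y; rewrite derive_mxE; last exact: diff_derivable.
  have -> : (fun w => (S w b c *: Gam G' c (F w)) x y) =
       (fun w => S w b c) * (fun w => Gam G' c (F w) x y).
    by apply/funext => w; rewrite mxE.
  have d1 : derivable (fun w => S w b c) u (e_ a).
    exact/diff_derivable/differentiable_mxE.
  have d2 : derivable (fun w => Gam G' c (F w) x y) u (e_ a).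
    exact/diff_derivable/(differentiable_mxE x y (dGa c)).
  rewrite (deriveM d1 d2) -derive_mxE; last exact: diff_derivable.
  rewrite -derive_mxE; last exact: diff_derivable.
  have {}Gc : 'D_(e_ a) (fun w => Gam G' c (F w)) u =
      \sum_c' S u a c' *: 'D_(delta_mx 0 (rshift p' c')) (Gam G' c) (F u).
    by rewrite Gc derive_e//; apply: eq_bigr => c' _; rewrite row_entry.
  rewrite Gc; exact: leibniz_entry.
have M a b : Cm a u *m Cm b u = \sum_c \sum_c' (S u a c * S u b c') *: (Gam G' c (F u) *m Gam G' c' (F u)).
  rewrite /Cm mulmx_suml; apply: eq_bigr => c _; rewrite mulmx_sumr.
  by apply: eq_bigr => c' _; rewrite -scalemxAl -scalemxAr scalerA.
have E c : ('D_(e_ l) S u) i c = ('D_(e_ i) S u) l c.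
  exact: derive_S_sym.
rewrite /Om' !D; under eq_bigr do rewrite E.
rewrite opprD addrACA subrr add0r !M.
rewrite [X in _ - X + _](_ : _ = \sum_c \sum_c' (S u l c * S u i c') *:
   'D_(delta_mx 0 (rshift p' c')) (Gam G' c) (F u)); last first.
  exact: exchange_scale.
rewrite [X in _ + X - _](_ : _ = \sum_c \sum_c' (S u l c * S u i c') *:
   (Gam G' c' (F u) *m Gam G' c (F u))); last first.
  exact: exchange_scale.
rewrite -!sumrB -big_split/= -sumrB; apply: eq_bigr => c _.
rewrite -!sumrB -big_split/= -sumrB; apply: eq_bigr => c' _.
by rewrite /Om !(scalerDr, scalerN).
Qed.

Lemma dT_cst b u : U u -> dT G F (cst b) u = b *m S u.
Proof.
move=> Uu; rewrite /dT -derive_phi// derive_phiS// /sigma rsub_sigma//.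
Qed.

Lemma second_fundamental_formE u a b : U u ->
  second_fundamental_form G G' F u a b = \sum_k a 0 k *: (b *m IIm k u).
Proof.
move=> Uu; have OFu := cmap_dom cF Uu.
have dS : differentiable S u by exact: (mxsmooth_differentiable oU S_smooth).
rewrite /second_fundamental_form /nabla_dT /nabla_phi.
have e3 : dT G F (nablaQ G (sigma G (cst a)) (cst b)) u = \sum_k a 0 k *: (b *m Gam G k u *m S u).
  rewrite /dT -derive_phi// derive_phiS// [rsubmx _]rsub_sigma.
  rewrite (nablaQ_sigma_cst cm _ _ Uu) (chrisE cm _ _ Uu) mulmx_suml.
  by apply: eq_bigr => k _; rewrite -scalemxAl.
have e1 v : 'D_v (dT G F (cst b)) u = b *m 'D_v S u.
  rewrite (eq_on_derive v oU (dT_cst b) Uu) derive_mulmxr//.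
  exact: diff_derivable.
have e2 v s : nablaQ G' (cst v) (cst s) (F u) = chris G' (F u) (rsubmx v) s.
  rewrite (nablaQE cm' OFu); [|exact: differentiable_cst|exact: differentiable_cst].
  by rewrite derive_cst add0r.
rewrite e3 e1 e2 (dT_cst _ Uu) -derive_phi// derive_phiS// [rsubmx _]rsub_sigma.
rewrite (derive_basic _ dS); last by move=> w w0; exact: S_basic.
rewrite [rsubmx _]rsub_sigma mulmx_sumr.
have -> : chris G' (F u) (a *m S u) (b *m S u) = \sum_k a 0 k *: (b *m S u *m Cm k u).
  rewrite mulmx_sum_row (chris_suml cm' _ _ _ _ OFu); apply: eq_bigr => k _.
  by rewrite (chrisZl cm' _ _ _ OFu) chris_Cm.
rewrite -big_split/= -sumrB; apply: eq_bigr => k _.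
by rewrite /IIm mulmxBr mulmxDr scalerBr scalerDr -scalemxAr !mulmxA.
Qed.

Definition energy u : R := \tr (gbi u *m S u *m Hm u *m (S u)^T).
(** The curvature term of the Weitzenboeck formula, in the form in which it is paired with [S]. *)
Definition Zm u : 'M[R]_(q, q') := \matrix_i \sum_l \sum_k gbi u l k *:
  row k (S u *m Om' l i u - Om G l i u *m S u).

Section AtPoint.
Variables (u0 : 'rV[R]_(p + q)) (Uu0 : U u0).
Notation A := (sring oU Uu0).
Notation hd := (fun k : 'I_q => @sderiv R _ U u0 oU Uu0 (rshift p k)).
Notation toA := (to_sringmx oU Uu0).

Let gR := toA (gb_smooth cm).
Let giR := toA (gbi_smooth cm).
Let HR := toA Hm_smooth.
Let GaR k := toA (Gam_smooth cm k).
Let CR k := toA (Cm_smooth k).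
Let phiR : 'rV[A]_q' := toA phi_smooth.

Let hdD k x y : hd k (x + y) = hd k x + hd k y. Proof. exact: sderivD. Qed.
Let hdM k x y : hd k (x * y) = hd k x * y + x * hd k y. Proof. exact: sderivM. Qed.
Let hdC k l x : hd k (hd l x) = hd l (hd k x). Proof. exact: sderivC. Qed.

Let gi_g : giR *m gR = 1%:M.
Proof.
apply: sringmxP => u Uu; rewrite map_mxM map_mx1 !to_sringmxE// mulVmx//.
exact: (gb_unit cm).
Qed.
Let g_gi : gR *m giR = 1%:M.
Proof.
apply: sringmxP => u Uu; rewrite map_mxM map_mx1 !to_sringmxE// mulmxV//.
exact: (gb_unit cm).
Qed.
Let gT : gR^T = gR.
Proof. by apply: sringmxP => u Uu; rewrite map_mxT !to_sringmxE// (gbT cm). Qed.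
Let HT : HR^T = HR.
Proof.
by apply: sringmxP => u Uu; rewrite map_mxT !to_sringmxE// (gbT cm' (cmap_dom cF Uu)).
Qed.
Let Ga_compat k : mxd hd k gR = GaR k *m gR + (GaR k *m gR)^T.
Proof.
apply: sringmxP => u Uu; rewrite map_mxD map_mxT map_mxM !to_sringmxE//.
by rewrite [LHS]seval_sderiv_mx// (Gam_compat cm).
Qed.
Let C_compat k : mxd hd k HR = CR k *m HR + (CR k *m HR)^T.
Proof.
apply: sringmxP => u Uu; rewrite map_mxD map_mxT map_mxM !to_sringmxE//.
by rewrite [LHS]seval_sderiv_mx// Hm_compat.
Qed.
Let Ga_sym k i : row i (GaR k) = row k (GaR i).
Proof.
by apply: sringmxP => u Uu; rewrite !map_row !to_sringmxE// (Gam_sym cm).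
Qed.
Let dphiE u : U u -> map_mx (seval u) (dphi hd phiR) = S u.
Proof.
move=> Uu; apply/matrixP => k j; rewrite !mxE.
have /matrixP/(_ 0 j) := seval_sderiv_mx oU Uu0 (rshift p k) phi_smooth Uu.
by rewrite !mxE.
Qed.
Let dphi_to : dphi hd phiR = toA S_smooth.
Proof. by apply: sringmxP => u Uu; rewrite dphiE// to_sringmxE. Qed.
Let C_sym k i : row i (dphi hd phiR) *m CR k = row k (dphi hd phiR) *m CR i.
Proof.
apply: sringmxP => u Uu; rewrite !map_mxM !map_row dphiE// !to_sringmxE//.
exact: Cm_sym.
Qed.

Let IIE k u : U u -> map_mx (seval u) (II hd GaR CR phiR k) = IIm k u.
Proof.
move=> Uu; rewrite /II /nab map_mxB map_mxD !map_mxM dphiE// !to_sringmxE//.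
by congr (_ + _ - _); rewrite dphi_to; exact: seval_sderiv_mx.
Qed.

Let curvE l i u : U u -> map_mx (seval u) (curv hd CR l i) = Om' l i u.
Proof.
move=> Uu; rewrite /curv !(map_mxB, map_mxD) !map_mxM !to_sringmxE//.
by congr (_ - _ + _ - _); exact: seval_sderiv_mx.
Qed.

Let curvGE l i u : U u -> map_mx (seval u) (curv hd GaR l i) = Om G l i u.
Proof.
move=> Uu; rewrite /curv !(map_mxB, map_mxD) !map_mxM !to_sringmxE//.
by congr (_ - _ + _ - _); exact: seval_sderiv_mx.
Qed.

Let trE n (X : 'M[A]_n) u : seval u (\tr X) = \tr (map_mx (seval u) X).
Proof. by rewrite trace_map_mx. Qed.

Let ipE X Y u : U u -> seval u (ip giR HR X Y) =
  \tr (gbi u *m map_mx (seval u) X *m Hm u *m (map_mx (seval u) Y)^T).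
Proof.
by move=> Uu; rewrite /ip trE !map_mxM map_mxT (to_sringmxE oU Uu0 (gbi_smooth cm) Uu)
  (to_sringmxE oU Uu0 Hm_smooth Uu).
Qed.

Let enE u : U u -> en hd giR HR phiR u = energy u.
Proof.
by move=> Uu; rewrite -[LHS]/(seval u _) /en (ipE _ _ Uu) (dphiE Uu).
Qed.

(** The identity holds in the ring of functions smooth on [U] and is evaluated at [u0]. Harmonicity
    is assumed on all of [U] because the proof differentiates it. *)
Lemma weitzenboeck_at :
  (forall u, U u -> \sum_l \sum_k gbi u l k *: row k (IIm l u) = 0) ->
  \sum_l \sum_k gbi u0 l k *
    (partial (rshift p l) (partial (rshift p k) energy) u0
     - \sum_i Gam G l u0 k i * partial (rshift p i) energy u0) =
  (\sum_l \sum_k gbi u0 l k * \tr (gbi u0 *m IIm k u0 *m Hm u0 *m (IIm l u0)^T)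
   + \tr (gbi u0 *m Zm u0 *m Hm u0 *m (S u0)^T)) *+ 2.
Proof.
move=> hF.
have hR : \sum_l \sum_k giR l k *: row k (II hd GaR CR phiR l) = 0.
  apply: sringmxP => u Uu; rewrite map_mx0 -[RHS](hF u Uu) raddf_sum/=.
  apply: eq_bigr => l _; rewrite raddf_sum/=; apply: eq_bigr => k _.
  rewrite map_mxZ map_row IIE//; congr (_ *: _).
  by have /matrixP/(_ l k) := to_sringmxE oU Uu0 (gbi_smooth cm) Uu; rewrite !mxE.
have := weitzenboeck hdD hdM hdC gi_g g_gi gT HT Ga_compat C_compat Ga_sym C_sym hR.
move=> /(congr1 (seval u0)); rewrite /lap rmorph_sum/=.
have giE l k : seval u0 (giR l k) = gbi u0 l k.
  by have /matrixP/(_ l k) := to_sringmxE oU Uu0 (gbi_smooth cm) Uu0; rewrite !mxE.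
have GaE a l k : seval u0 (GaR a l k) = Gam G a u0 l k.
  by have /matrixP/(_ l k) := to_sringmxE oU Uu0 (Gam_smooth cm a) Uu0; rewrite !mxE.
have d1 k u : U u -> hd k (en hd giR HR phiR) u = partial (rshift p k) energy u.
  by move=> Uu; rewrite sderivE//; exact: (eq_on_derive _ oU enE Uu).
have d2 l k : seval u0 (hd l (hd k (en hd giR HR phiR))) =
    partial (rshift p l) (partial (rshift p k) energy) u0.
  by rewrite [LHS]sderivE//; exact: (eq_on_derive _ oU (d1 k) Uu0).
move=> E; apply: etrans (etrans E _).
  apply: eq_bigr => l _; rewrite rmorph_sum/=; apply: eq_bigr => k _.
  rewrite rmorphM/= giE /hess rmorphB/= d2 rmorph_sum/=; congr (_ * (_ - _)).
  by apply: eq_bigr => i _; rewrite rmorphM/= GaE; congr (_ * _); rewrite -d1.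
rewrite rmorphMn rmorphD/= rmorph_sum/=; congr ((_ + _) *+ 2).
  apply: eq_bigr => l _; rewrite rmorph_sum/=; apply: eq_bigr => k _.
  rewrite rmorphM/= giE; congr (_ * _); apply: etrans (ipE _ _ Uu0) _.
  by congr (\tr (_ *m _ *m _ *m _^T)); exact: IIE.
apply: etrans (ipE _ _ Uu0) _; rewrite (dphiE Uu0); congr (\tr (_ *m _ *m _ *m _)).
apply/row_matrixP => i; rewrite -map_row !rowK raddf_sum/=; apply: eq_bigr => l _.
rewrite raddf_sum/=; apply: eq_bigr => k _.
rewrite map_mxZ; congr (_ *: _); first exact: giE.
rewrite map_row; congr (row k _); rewrite map_mxB !map_mxM (dphiE Uu0).
by rewrite (_ : map_mx _ _ = Om' l i u0) ?[X in _ - X *m _](_ : _ = Om G l i u0)//; [exact: curvGE|exact: curvE].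
Qed.

Lemma parallel_trace_sq_at : (forall k u, U u -> IIm k u = 0) -> forall k,
  partial (rshift p k) (fun u => \tr (gbi u *m S u *m Hm u *m (S u)^T *m
    (gbi u *m S u *m Hm u *m (S u)^T))) u0 = 0.
Proof.
move=> II0 k.
have IIR j : II hd GaR CR phiR j = 0.
  by apply: sringmxP => u Uu; rewrite IIE// II0// map_mx0.
have := parallel_trace_sq hdD hdM gi_g g_gi gT HT Ga_compat C_compat IIR k.
move=> /(congr1 (seval u0)); rewrite rmorph0 [LHS]sderivE// => E.
apply: etrans E; apply: (eq_on_derive _ oU _ Uu0) => u Uu.
rewrite -[RHS]/(seval u _) trE !map_mxM map_mxT (dphiE Uu).
by rewrite (to_sringmxE oU Uu0 (gbi_smooth cm) Uu) (to_sringmxE oU Uu0 Hm_smooth Uu).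
Qed.

End AtPoint.

End ChartMaps.

(** * Positive definite forms and orthonormal bases *)

Section PositiveDefinite.
Variable R : realType.

Lemma posdef_congr n m (B : 'M[R]_n) (L : 'M[R]_(m, n)) : posdef B ->
  (forall v : 'rV_m, v *m L = 0 -> v = 0) -> posdef (L *m B *m L^T).
Proof.
move=> pB Linj v v0; rewrite -[X in 0 < X]/((v *m (L *m B *m L^T) *m v^T) 0 0).
rewrite -bform_mul; apply: pB; apply: contra_neq v0; exact: Linj.
Qed.

(** Induction on the dimension: [L] normalizes the first basis vector and clears the rest of its row
    and column, leaving the Schur complement, which is again positive definite. *)
Lemma gram_schmidt n (B : 'M[R]_n) : posdef B -> B^T = B ->
  exists P : 'M[R]_n, P *m B *m P^T = 1%:M.
Proof.
elim: n B => [|n IH] B pB sB; first by exists 1%:M; rewrite [LHS]flatmx0 [RHS]flatmx0.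
rewrite -[n.+1]/(1 + n)%N in B pB sB *.
pose a := B 0 0; pose b : 'cV[R]_n := dlsubmx B; pose D : 'M[R]_n := drsubmx B.
have a0 : 0 < a.
  rewrite /a -bform_delta; apply: pB; apply/eqP => /rowP/(_ 0)/eqP.
  by rewrite !mxE eqxx oner_eq0.
have ulB : ulsubmx B = a%:M.
  by apply/matrixP => i j; rewrite !ord1 !mxE eqxx /a; congr (B _ _); apply: val_inj.
have urB : ursubmx B = b^T by rewrite /b trmx_dlsub sB.
pose L : 'M[R]_(1 + n) := block_mx (Num.sqrt a)^-1%:M 0 (- a^-1 *: b) 1%:M.
have sa0 : Num.sqrt a != 0 by rewrite sqrtr_eq0 -ltNge.
have Linj (v : 'rV[R]_(1 + n)) : v *m L = 0 -> v = 0.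
  rewrite -(hsubmxK v) mul_row_block mulmx0 add0r mulmx1 => /eqP.
  rewrite row_mx_eq0 => /andP[+ /eqP e]; rewrite e mul0mx addr0 => /eqP e1.
  have : lsubmx v *m (Num.sqrt a)^-1%:M *m (Num.sqrt a)%:M = 0 by rewrite e1 mul0mx.
  by rewrite -mulmxA -scalar_mxM mulVf// mulmx1 => ->; rewrite row_mx0.
have EB : L *m B *m L^T = block_mx 1%:M 0 0 (D - a^-1 *: (b *m b^T)).
  rewrite -{1}(submxK B) ulB urB -/b -/D /L tr_block_mx !mulmx_block.
  rewrite !tr_scalar_mx !trmx0 !mul0mx !mulmx0 !addr0 !mul1mx !mulmx1.
  have sa2 : Num.sqrt a * Num.sqrt a = a by rewrite -expr2 sqr_sqrtr// ltW.
  have an0 : a != 0 by rewrite gt_eqF.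
  have bE k : b k 0 = B (rshift 1 k) (lshift n ord0) by rewrite !mxE.
  move: (Num.sqrt a) sa0 sa2 => r r0 ra.
  congr block_mx; apply/matrixP => i j; rewrite ?ord1 !mxE ?big_ord1 ?mxE ?eqxx ?mulr1n;
    rewrite ?big_ord1 ?mxE ?eqxx ?mulr1n -?bE -?ra; field; rewrite ?r0//.
have [P' EP'] : exists P' : 'M[R]_n, P' *m (D - a^-1 *: (b *m b^T)) *m P'^T = 1%:M.
  apply: IH; last by rewrite trD trN linearZ/= trmx_mul trmxK /D trmx_drsub sB.
  have := posdef_congr pB Linj; rewrite EB => pE v v0.
  have := pE (row_mx 0 v); rewrite /bform mul_row_block !mul0mx !mulmx0 !add0r.
  rewrite tr_row_mx mul_row_col trmx0 mulmx0 add0r; apply.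
  by apply: contra_neq v0 => /eqP; rewrite row_mx_eq0 => /andP[_ /eqP].
exists (block_mx 1%:M 0 0 P' *m L); rewrite trmx_mul !mulmxA -[_ *m L *m B]mulmxA.
rewrite -[X in X *m _]mulmxA [L *m B *m _]EB tr_block_mx !mulmx_block.
rewrite !trmx0 trmx1 !mul0mx !mulmx0 !addr0 !add0r !mul1mx EP' ?mul0mx.
by rewrite [RHS]scalar_mx_block.
Qed.

Lemma orthonormal_factor n (B : 'M[R]_n) : posdef B -> B^T = B ->
  exists2 P : 'M[R]_n, P *m B *m P^T = 1%:M & invmx B = P^T *m P.
Proof.
move=> pB sB; have [P EP] := gram_schmidt pB sB; exists P => //.
have uP : P \in unitmx by have /mulmx1_unit[] : P *m (B *m P^T) = 1%:M by rewrite mulmxA.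
have uB := posdef_unit pB.
have e : B *m (P^T *m P) = 1%:M.
  by rewrite mulmxA; have /mulmx1C : P *m (B *m P^T) = 1%:M by rewrite mulmxA.
by rewrite -[RHS]mul1mx -(mulVmx uB) -mulmxA e mulmx1.
Qed.

Lemma mxtrace_mul_tr n m (X : 'M[R]_(n, m)) : \tr (X *m X^T) = \sum_i \sum_j X i j ^+ 2.
Proof.
rewrite /mxtrace; apply: eq_bigr => i _; rewrite mxE; apply: eq_bigr => j _.
by rewrite mxE expr2.
Qed.

Lemma mxtrace_mul_tr_ge0 n m (X : 'M[R]_(n, m)) : 0 <= \tr (X *m X^T).
Proof.
by rewrite mxtrace_mul_tr; apply: sumr_ge0 => i _; apply: sumr_ge0 => j _; exact: sqr_ge0.
Qed.

Lemma mxtrace_mul_tr_eq0 n m (X : 'M[R]_(n, m)) : \tr (X *m X^T) = 0 -> X = 0.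
Proof.
rewrite mxtrace_mul_tr => /eqP; rewrite psumr_eq0 => [|i _]; last first.
  by apply: sumr_ge0 => j _; exact: sqr_ge0.
move=> /allP H; apply/matrixP => i j; rewrite mxE.
have := H i; rewrite mem_index_enum => /(_ isT); rewrite psumr_eq0 => [|? _]; last exact: sqr_ge0.
by move=> /allP/(_ j); rewrite mem_index_enum => /(_ isT); rewrite sqrf_eq0 => /eqP.
Qed.

Lemma row_free2P n (a b : 'rV[R]_n) (x y : R) : row_free (col_mx a b) ->
  x *: a + y *: b = 0 -> x = 0 /\ y = 0.
Proof.
move=> fab xy; have : row_mx x%:M y%:M *m col_mx a b = 0.
  by rewrite mul_row_col !mul_scalar_mx.
move/eqP; rewrite mulmx_free_eq0// row_mx_eq0 => /andP[/eqP/matrixP/(_ 0 0) + /eqP/matrixP/(_ 0 0)].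
by rewrite !mxE eqxx !mulr1n.
Qed.

Lemma not_row_free2 n (a b : 'rV[R]_n) : ~~ row_free (col_mx a b) ->
  exists x y : R, ((x != 0) || (y != 0)) /\ x *: a + y *: b = 0.
Proof.
rewrite -kermx_eq0 => /rowV0Pn[v /sub_kermxP vab v0].
exists (v 0 (lshift 1 0)), (v 0 (rshift 1 0)); split.
  apply/negPn/negP; rewrite negb_or !negbK => /andP[/eqP e1 /eqP e2].
  move/negP: v0; apply; apply/eqP/rowP => j; rewrite mxE; case: (split_ordP j) => i ->; rewrite ord1 //.
rewrite -[RHS]vab -[in RHS](hsubmxK v) mul_row_col.
have e1 := mx11_scalar (lsubmx v); have e2 := mx11_scalar (rsubmx v).
have -> : v 0 (lshift 1 0) = lsubmx v 0 0 by rewrite mxE.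
have -> : v 0 (rshift 1 0) = rsubmx v 0 0 by rewrite mxE.
by rewrite [X in X *m _ + _]e1 [X in _ + X *m _]e2 !mul_scalar_mx.
Qed.

Lemma cauchy_schwarz_strict n (B : 'M[R]_n) (a b : 'rV[R]_n) : posdef B -> B^T = B ->
  row_free (col_mx a b) -> 0 < bform B a a * bform B b b - bform B a b ^+ 2.
Proof.
move=> pB sB fab.
have b0 : b != 0.
  apply/eqP => b0; have e : 0 *: a + 1 *: b = 0 by rewrite b0 scaler0 scale0r addr0.
  by have [_ /eqP] := row_free2P fab e; rewrite oner_eq0.
have bb0 : 0 < bform B b b by exact: pB.
(* A multiple of the component of [a] orthogonal to [b]; its square norm is [bform B b b] times the
   Gram determinant of [a] and [b]. *)
pose c := bform B b b *: a + (- bform B a b) *: b.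
have c0 : c != 0.
  apply/eqP => /(row_free2P fab)[+ _] => e; by rewrite e ltxx in bb0.
have := pB c c0.
rewrite /c bformDl !bformDr !bformZl !bformZr (bformC b a sB).
move: (bform B a a) (bform B b b) (bform B a b) bb0 => x y z y0.
move=> H; have : 0 < y * (x * y - z ^+ 2) by move: H; congr (0 < _); ring.
by rewrite pmulr_rgt0.
Qed.

End PositiveDefinite.

(** * Algebra of the transverse curvature *)

Section Curvature.
Variables (R : realType) (p q : nat).
Variables (O : set 'rV[R]_(p + q)) (G : 'rV[R]_(p + q) -> 'M[R]_(p + q)).
Hypothesis cm : chart_metric O G.
Variables (u : 'rV[R]_(p + q)) (Ou : O u).
Notation RQ := (RQ G u).

Lemma Om_anti k l : Om G k l u = - Om G l k u.
Proof.
rewrite /Om; move: ('D__ (Gam G l) u) ('D__ (Gam G k) u) => X Y.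
by apply/matrixP => i j; rewrite !mxE; ring.
Qed.

Lemma RQ_anti a b c : RQ a b c = - RQ b a c.
Proof.
rewrite !(RQE cm _ _ _ Ou) exchange_big/= -sumrN; apply: eq_bigr => k _.
rewrite -sumrN; apply: eq_bigr => l _.
by rewrite Om_anti mulmxN scalerN mulrC.
Qed.

Lemma RQ_aa a c : RQ a a c = 0.
Proof.
apply/eqP; rewrite -[_ == 0]orFb -[false](@pnatr_eq0 R 2) -scaler_eq0 scaler_nat mulr2n.
by rewrite {1}RQ_anti addNr.
Qed.

Lemma RQDl a a' b c : RQ (a + a') b c = RQ a b c + RQ a' b c.
Proof.
rewrite !(RQE cm _ _ _ Ou) -big_split/=; apply: eq_bigr => k _.
rewrite -big_split/=; apply: eq_bigr => l _.
by rewrite mxE mulrDl scalerDl.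
Qed.

Lemma RQZl x a b c : RQ (x *: a) b c = x *: RQ a b c.
Proof.
rewrite !(RQE cm _ _ _ Ou) scaler_sumr; apply: eq_bigr => k _.
rewrite scaler_sumr; apply: eq_bigr => l _.
by rewrite mxE scalerA mulrA.
Qed.

Lemma RQ0l b c : RQ 0 b c = 0.
Proof. by have := RQZl 0 0 b c; rewrite !scale0r. Qed.

Lemma RQ_suml I (r : seq I) P (f : I -> 'rV[R]_q) b c :
  RQ (\sum_(i <- r | P i) f i) b c = \sum_(i <- r | P i) RQ (f i) b c.
Proof.
apply: (big_morph (fun a => RQ a b c)); [by move=> ? ?; exact: RQDl|exact: RQ0l].
Qed.

Lemma RQ_dependent a b c : ~~ row_free (col_mx a b) -> RQ a b c = 0.
Proof.
move=> /not_row_free2[x [y [+ e]]].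
have ea : x *: a = - (y *: b) by apply/eqP; rewrite -addr_eq0 e.
have eb : y *: b = - (x *: a) by rewrite ea opprK.
have sN v w d : RQ (- v) w d = - RQ v w d by rewrite -scaleN1r RQZl scaleN1r.
case/orP => nz; apply: (scalerI nz); rewrite scaler0.
  by rewrite -RQZl ea sN RQZl RQ_aa scaler0 oppr0.
by rewrite RQ_anti scalerN -RQZl eb sN RQZl RQ_aa scaler0 !oppr0.
Qed.

(** The sectional curvature is constrained on independent pairs only; on dependent ones the
    curvature form itself vanishes. *)
Lemma sectional_nonpos_bform a b :
  (forall a b : 'rV[R]_q, row_free (col_mx a b) -> KQ G u a b <= 0) ->
  bform (transverse_metric G u) (RQ a b b) a <= 0.
Proof.
move=> H; have [fab|nfab] := boolP (row_free (col_mx a b)); last first.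
  by rewrite RQ_dependent// bform0l.
have := H a b fab; rewrite /KQ.
have D0 := cauchy_schwarz_strict (gb_pos cm Ou) (gbT cm Ou) fab.
by rewrite pmulr_lle0// invr_gt0.
Qed.

Lemma sectional_neg_bform a b :
  (forall a b : 'rV[R]_q, row_free (col_mx a b) -> KQ G u a b < 0) ->
  row_free (col_mx a b) -> bform (transverse_metric G u) (RQ a b b) a < 0.
Proof.
move=> H fab; have := H a b fab; rewrite /KQ.
have D0 := cauchy_schwarz_strict (gb_pos cm Ou) (gbT cm Ou) fab.
by rewrite pmulr_llt0// invr_gt0.
Qed.

Lemma RicQ_sum (E : 'I_q -> 'rV[R]_q) I (r : seq I) P (x : I -> R) (f : I -> 'rV[R]_q) :
  RicQ G E u (\sum_(i <- r | P i) x i *: f i) = \sum_(i <- r | P i) x i *: RicQ G E u (f i).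
Proof.
rewrite /RicQ; transitivity (\sum_a \sum_(i <- r | P i) x i *: RQ (f i) (E a) (E a)).
  apply: eq_bigr => a _; apply: etrans (RQ_suml _ _ _ _ _) _.
  by apply: eq_bigr => i _; exact: RQZl.
by rewrite exchange_big/=; apply: eq_bigr => i _; rewrite scaler_sumr.
Qed.

End Curvature.

(** * Matrices of rank at most one, traces in orthonormal frames *)

Section RankOne.
Variable R : realType.

Lemma psumr_all0 (I : finType) (F : I -> R) : (forall i, 0 <= F i) -> \sum_i F i = 0 ->
  forall i, F i = 0.
Proof.
move=> F0 FS i; apply/eqP; move/eqP: FS; rewrite psumr_eq0 => [/allP/(_ i)|//].
by rewrite mem_index_enum; apply.
Qed.

Lemma mul_col_entry n m k (A : 'M[R]_(n, m)) (B : 'M[R]_(m, k)) i c :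
  (A *m col c B) i 0 = (A *m B) i c.
Proof. by rewrite !mxE; apply: eq_bigr => j _; rewrite mxE. Qed.

Definition rank_le1 n m (X : 'M[R]_(n, m)) :=
  forall i j c d, X i c * X j d = X i d * X j c.

Lemma rank_le1_mull n m k (L : 'M[R]_(k, n)) (X : 'M[R]_(n, m)) :
  rank_le1 X -> rank_le1 (L *m X).
Proof.
move=> rX i j c d; rewrite !mxE !mulr_suml; apply: eq_bigr => a _.
rewrite !mulr_sumr; apply: eq_bigr => b _.
by rewrite mulrACA rX mulrACA.
Qed.

Lemma rank_le1_tr n m (X : 'M[R]_(n, m)) : rank_le1 X -> rank_le1 X^T.
Proof. by move=> rX i j c d; rewrite !mxE rX mulrC. Qed.

Lemma rank_le1_mulr n m k (L : 'M[R]_(m, k)) (X : 'M[R]_(n, m)) :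
  rank_le1 X -> rank_le1 (X *m L).
Proof.
move=> rX; rewrite -[X *m L]trmxK trmx_mul.
by apply: rank_le1_tr; apply: rank_le1_mull; exact: rank_le1_tr.
Qed.

(** Lagrange's identity: in the expanded squares both square terms have the same sum, and the mixed
    terms give the trace of the square. *)
Lemma sum_sqr_minors n m (X : 'M[R]_(n, m)) :
  \sum_i \sum_j \sum_c \sum_d (X i c * X j d - X i d * X j c) ^+ 2 =
  (\tr (X *m X^T) ^+ 2 - \tr (X *m X^T *m (X *m X^T))) *+ 2.
Proof.
have e1 : \tr (X *m X^T) ^+ 2 = \sum_i \sum_j \sum_c \sum_d (X i c * X j d) ^+ 2.
  rewrite mxtrace_mul_tr expr2 mulr_suml; apply: eq_bigr => i _.
  rewrite mulr_sumr; apply: eq_bigr => j _.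
  rewrite mulr_suml; apply: eq_bigr => c _.
  by rewrite mulr_sumr; apply: eq_bigr => d _; rewrite exprMn.
have e2 : \tr (X *m X^T *m (X *m X^T)) =
    \sum_i \sum_j \sum_c \sum_d (X i c * X j d) * (X i d * X j c).
  have sX : (X *m X^T)^T = X *m X^T by rewrite trmx_mul trmxK.
  rewrite -{2}sX mxtrace_mul_tr; apply: eq_bigr => i _; apply: eq_bigr => j _.
  have -> : (X *m X^T) i j = \sum_c X i c * X j c.
    by rewrite mxE; apply: eq_bigr => c _; rewrite mxE.
  rewrite expr2 mulr_suml; apply: eq_bigr => c _.
  by rewrite mulr_sumr; apply: eq_bigr => d _; ring.
rewrite e1 e2 mulr2n.
have e3 : \sum_i \sum_j \sum_c \sum_d (X i c * X j d) ^+ 2 =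
    \sum_i \sum_j \sum_c \sum_d (X i d * X j c) ^+ 2.
  by apply: eq_bigr => i _; apply: eq_bigr => j _; rewrite exchange_big.
rewrite {2}e3 -!sumrB -big_split/=; apply: eq_bigr => i _.
rewrite -!sumrB -big_split/=; apply: eq_bigr => j _.
rewrite -!sumrB -big_split/=; apply: eq_bigr => c _.
rewrite -!sumrB -big_split/=; apply: eq_bigr => d _.
ring.
Qed.

(* By [sum_sqr_minors], rank at most one is an equality between invariants of the eigenvalues
   which are constant along a totally geodesic map. *)
Lemma rank_le1_trace n m (X : 'M[R]_(n, m)) :
  rank_le1 X <-> \tr (X *m X^T *m (X *m X^T)) = \tr (X *m X^T) ^+ 2.
Proof.
split=> [rX|e].
  apply/eqP; rewrite eq_sym -subr_eq0 -[_ == 0]orFb -[false](@pnatr_eq0 R 2).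
  rewrite -mulf_eq0 mulr_natl -sum_sqr_minors; apply/eqP.
  do 4!(apply: big1 => ? _); by rewrite rX subrr expr0n.
have := sum_sqr_minors X; rewrite e subrr mul0rn => H i j c d.
apply/eqP; rewrite -subr_eq0 -sqrf_eq0; apply/eqP.
move: d; apply: (psumr_all0 (F := fun d => _)) => [d|]; first exact: sqr_ge0.
move: c; apply: (psumr_all0 (F := fun c => _)) => [c|]; first by apply: sumr_ge0 => ? _; exact: sqr_ge0.
move: j; apply: (psumr_all0 (F := fun j => _)) => [j|]; first by do 2!(apply: sumr_ge0 => ? _); exact: sqr_ge0.
move: i; apply: (psumr_all0 (F := fun i => _)) => [i|//]; by do 3!(apply: sumr_ge0 => ? _); exact: sqr_ge0.
Qed.

Lemma rank_le1_rows n m (X : 'M[R]_(n, m)) :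
  (forall i j, ~~ row_free (col_mx (row i X) (row j X))) -> rank_le1 X.
Proof.
move=> H i j c d; have [x [y [nz /rowP e]]] := not_row_free2 (H i j).
have := e c; have := e d; rewrite !mxE => ed ec.
have xy : x != 0 -> x * (X i c * X j d - X i d * X j c) = 0.
  move=> _; transitivity ((x * X i c + y * X j c) * X j d - (x * X i d + y * X j d) * X j c).
    by ring.
  by rewrite ed ec; ring.
have yx : y * (X i c * X j d - X i d * X j c) = 0.
  transitivity ((x * X i d + y * X j d) * X i c - (x * X i c + y * X j c) * X i d).
    by ring.
  by rewrite ed ec; ring.
apply/eqP; rewrite -subr_eq0; case/orP: nz => z0.
  by have /eqP := xy z0; rewrite mulf_eq0 (negPf z0).
by move/eqP: yx; rewrite mulf_eq0 (negPf z0).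
Qed.

Lemma square_factor n (B : 'M[R]_n) : posdef B -> B^T = B ->
  exists2 K : 'M[R]_n, B = K *m K^T & K \in unitmx.
Proof.
move=> pB sB; have [P EP _] := orthonormal_factor pB sB.
have uP : P \in unitmx by have /mulmx1_unit[] : P *m (B *m P^T) = 1%:M by rewrite mulmxA.
exists (invmx P); last by rewrite unitmx_inv.
apply: (can_inj (mulKmx uP)); rewrite mulmxA mulmxV// mul1mx trmx_inv.
have uPT : P^T \in unitmx by rewrite unitmx_tr.
by apply: (can_inj (mulmxK uPT)); rewrite EP mulVmx.
Qed.

(** Contraction with an inverse metric of the form [P^T *m P] becomes a sum over the frame formed by
    the rows of [P]. *)
Lemma trace_form_sum q m (P : 'M[R]_q) (X : 'I_q -> 'M[R]_(q, m)) (B : 'M[R]_q) (C : 'M[R]_m) :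
  \sum_l \sum_k (P^T *m P) l k * \tr (B *m X k *m C *m (X l)^T) =
  \sum_a \tr (B *m (\sum_k P a k *: X k) *m C *m (\sum_k P a k *: X k)^T).
Proof.
transitivity (\sum_a \sum_l \sum_k P a l * P a k * \tr (B *m X k *m C *m (X l)^T)).
  rewrite [RHS]exchange_big/=; apply: eq_bigr => l _; rewrite [RHS]exchange_big/=; apply: eq_bigr => k _.
  by rewrite mxE mulr_suml; apply: eq_bigr => a _; rewrite mxE.
apply: eq_bigr => a _.
rewrite [(\sum_k P a k *: X k)^T]raddf_sum/= mulmx_sumr raddf_sum/=; apply: eq_bigr => l _.
rewrite linearZ/= -scalemxAr mxtraceZ !mulmx_sumr !mulmx_suml raddf_sum/= mulr_sumr; apply: eq_bigr => k _.
by rewrite -scalemxAr -!scalemxAl mxtraceZ mulrA.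
Qed.

Lemma trace_form_square q m (P : 'M[R]_q) (K : 'M[R]_m) (X : 'M[R]_(q, m)) :
  \tr (P^T *m P *m X *m (K *m K^T) *m X^T) =
  \tr ((P *m X *m K) *m (P *m X *m K)^T).
Proof.
by rewrite !trmx_mul -!mulmxA mxtrace_mulC !mulmxA.
Qed.

Lemma trace_form_square2 q m (P : 'M[R]_q) (K : 'M[R]_m) (X : 'M[R]_(q, m)) :
  let M := P^T *m P *m X *m (K *m K^T) *m X^T in
  let N := P *m X *m K in
  \tr (M *m M) = \tr (N *m N^T *m (N *m N^T)).
Proof.
by move=> M N; rewrite /M /N !trmx_mul -!mulmxA mxtrace_mulC !mulmxA.
Qed.

Lemma bform_rows n m (C : 'M[R]_m) (X Z : 'M[R]_(n, m)) i j :
  bform C (row i Z) (row j X) = (Z *m C *m X^T) i j.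
Proof.
rewrite /bform -row_mul mxE [RHS]mxE; apply: eq_bigr => k _.
by rewrite [row i _ 0 k]mxE ![_^T _ _]mxE [row j _ 0 k]mxE.
Qed.

Lemma trace_rows q m (P : 'M[R]_q) (C : 'M[R]_m) (X Z : 'M[R]_(q, m)) :
  \tr (P^T *m P *m Z *m C *m X^T) = \sum_b bform C (row b (P *m Z)) (row b (P *m X)).
Proof.
rewrite -!mulmxA mxtrace_mulC !mulmxA /mxtrace; apply: eq_bigr => b _.
by rewrite bform_rows trmx_mul !mulmxA.
Qed.

Lemma frame_expand q (g P : 'M[R]_q) (r : 'rV[R]_q) (w : 'cV[R]_q) :
  g *m (P^T *m P) = 1%:M ->
  (r *m w) 0 0 = \sum_b (P *m w) b 0 * bform g r (row b P).
Proof.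
move=> e; rewrite -{1}[r]mulmx1 -e !mulmxA -mulmxA mxE.
apply: eq_bigr => b _; rewrite mulrC; congr (_ * _).
by rewrite /bform mxE [RHS]mxE; apply: eq_bigr => j _; rewrite !mxE.
Qed.

End RankOne.

Section FrameSums.
Variables (R : comNzRingType) (q m : nat).

Lemma frame_trace_rows (P : 'M[R]_q) (X : 'I_q -> 'I_q -> 'M[R]_(q, m)) b :
  \sum_i P b i *: (\sum_l \sum_k (P^T *m P) l k *: row k (X l i)) =
  \sum_a \sum_l \sum_i (P a l * P b i) *: (row a P *m X l i).
Proof.
transitivity (\sum_i \sum_l \sum_k \sum_a (P a l * P b i * P a k) *: row k (X l i)).
  apply: eq_bigr => i _; rewrite scaler_sumr; apply: eq_bigr => l _.
  rewrite scaler_sumr; apply: eq_bigr => k _.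
  rewrite mxE scalerA mulr_sumr scaler_suml; apply: eq_bigr => a _.
  by rewrite mxE; congr (_ *: _); ring.
transitivity (\sum_i \sum_l \sum_a (P a l * P b i) *: (row a P *m X l i)).
  apply: eq_bigr => i _; apply: eq_bigr => l _; rewrite exchange_big/=; apply: eq_bigr => a _.
  rewrite mulmx_sum_row scaler_sumr; apply: eq_bigr => k _.
  by rewrite scalerA mxE.
under eq_bigr do rewrite exchange_big/=.
rewrite exchange_big/=; apply: eq_bigr => a _; exact: exchange_big.
Qed.

Lemma frame_pullback (P : 'M[R]_q) (S : 'M[R]_(q, m)) (s : 'rV[R]_m)
    (O : 'I_m -> 'I_m -> 'M[R]_m) a b :
  \sum_l \sum_i (P a l * P b i) *: (s *m (\sum_c \sum_d (S l c * S i d) *: O c d)) =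
  \sum_c \sum_d ((P *m S) a c * (P *m S) b d) *: (s *m O c d).
Proof.
transitivity (\sum_l \sum_i \sum_c \sum_d (P a l * S l c * (P b i * S i d)) *: (s *m O c d)).
  apply: eq_bigr => l _; apply: eq_bigr => i _; rewrite mulmx_sumr scaler_sumr.
  apply: eq_bigr => c _; rewrite mulmx_sumr scaler_sumr; apply: eq_bigr => d _.
  by rewrite -scalemxAr scalerA; congr (_ *: _); ring.
transitivity (\sum_c \sum_d \sum_l \sum_i (P a l * S l c * (P b i * S i d)) *: (s *m O c d)).
  under eq_bigr do rewrite exchange_big/=; rewrite exchange_big/=; apply: eq_bigr => c _.
  under eq_bigr do rewrite exchange_big/=; exact: exchange_big.
apply: eq_bigr => c _; apply: eq_bigr => d _; rewrite !mxE mulr_suml scaler_suml.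
by apply: eq_bigr => l _; rewrite mulr_sumr scaler_suml.
Qed.

End FrameSums.

(** * Signs in the Weitzenboeck formula at a point *)

Section Pointwise.
Variables (R : realType) (p q p' q' : nat).
Variables (U : set 'rV[R]_(p + q)) (G : 'rV[R]_(p + q) -> 'M[R]_(p + q)).
Variables (O' : set 'rV[R]_(p' + q')) (G' : 'rV[R]_(p' + q') -> 'M[R]_(p' + q')).
Variable F : 'rV[R]_(p + q) -> 'rV[R]_(p' + q').
Hypotheses (cm : chart_metric U G) (cm' : chart_metric O' G') (cF : chart_map U O' F).
Notation gb := (transverse_metric G).
Notation gbi := (fun u => invmx (transverse_metric G u)).
Notation S := (S F).
Notation Hm := (Hm G' F).
Notation Zm := (Zm G G' F).
Notation IIm := (IIm G G' F).
Notation energy := (energy G G' F).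

(** In the frame of the rows of [P] the contractions in [Zm] become traces: of the curvature of Q'
    along the image of the frame, and of the curvature of Q, which is the Ricci operator. *)
Lemma row_Zm (P : 'M[R]_q) u b : U u -> gbi u = P^T *m P ->
  row b (P *m Zm u) =
  \sum_a RQ G' (F u) (row a (P *m S u)) (row b (P *m S u)) (row a (P *m S u))
  + RicQ G (fun a => row a P) u (row b P) *m S u.
Proof.
move=> Uu eP; have OFu := cmap_dom cF Uu.
have -> : RicQ G (fun a => row a P) u (row b P) *m S u =
    \sum_a - (RQ G u (row a P) (row b P) (row a P) *m S u).
  rewrite /RicQ mulmx_suml; apply: eq_bigr => a _.
  by rewrite (RQ_anti cm Uu) mulNmx.
have -> : row b (P *m Zm u) = \sum_i P b i *: row i (Zm u).
  by rewrite row_mul mulmx_sum_row; apply: eq_bigr => i _; rewrite mxE.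
transitivity (\sum_i P b i *: (\sum_l \sum_k (P^T *m P) l k *:
    row k (S u *m Om' G' F l i u - Om G l i u *m S u))).
  by apply: eq_bigr => i _; rewrite rowK eP.
rewrite frame_trace_rows -big_split/=; apply: eq_bigr => a _.
transitivity (\sum_l \sum_i (P a l * P b i) *: (row a (P *m S u) *m Om' G' F l i u)
   - \sum_l \sum_i (P a l * P b i) *: (row a P *m Om G l i u *m S u)).
  rewrite -sumrB; apply: eq_bigr => l _; rewrite -sumrB; apply: eq_bigr => i _.
  by rewrite -scalerBr mulmxBr row_mul !mulmxA.
congr (_ - _).
  transitivity (\sum_l \sum_i (P a l * P b i) *: (row a (P *m S u) *m
      (\sum_c \sum_d (S u l c * S u i d) *: Om G' c d (F u)))).
    by apply: eq_bigr => l _; apply: eq_bigr => i _; rewrite (Om'E cm cm' cF l i Uu).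
  rewrite frame_pullback (RQE cm' _ _ _ OFu); apply: eq_bigr => c _; apply: eq_bigr => d _.
  by rewrite !row_entry.
rewrite (RQE cm _ _ _ Uu) mulmx_suml; apply: eq_bigr => l _.
rewrite mulmx_suml; apply: eq_bigr => i _.
by rewrite -scalemxAl !row_entry.
Qed.

Lemma trace_Zm (P : 'M[R]_q) u : U u -> gbi u = P^T *m P ->
  \tr (gbi u *m Zm u *m Hm u *m (S u)^T) =
  \sum_b \sum_a bform (Hm u) (RQ G' (F u) (row a (P *m S u)) (row b (P *m S u))
     (row a (P *m S u))) (row b (P *m S u))
  + \sum_b bform (Hm u) (RicQ G (fun a => row a P) u (row b P) *m S u) (row b (P *m S u)).
Proof.
move=> Uu eP; have := trace_rows P (Hm u) (S u) (Zm u); rewrite -eP => E.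
apply: etrans E _; rewrite -big_split/=; apply: eq_bigr => b _.
rewrite row_Zm// bformDl; congr (_ + _); exact: bform_suml.
Qed.

(** The columns of [K] split the metric of Q' into squares. The vectors [v] are the gradients of the
    corresponding components of [d_T phi], and the Ricci term becomes a sum of values of a quadratic
    form, to which the curvature hypothesis applies. *)
Lemma RicQ_form (P : 'M[R]_q) (K : 'M[R]_q') u : U u ->
  gb u *m (P^T *m P) = 1%:M -> Hm u = K *m K^T ->
  let E := fun a => row a P in
  \sum_b bform (Hm u) (RicQ G E u (row b P) *m S u) (row b (P *m S u)) =
  \sum_c let v := (P^T *m P *m col c (S u *m K))^T in bform (gb u) (RicQ G E u v) v.
Proof.
move=> Uu eP eK E.
transitivity (\sum_b \sum_c (RicQ G E u (row b P) *m col c (S u *m K)) 0 0 *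
    (P *m col c (S u *m K)) b 0).
  apply: eq_bigr => b _; rewrite /bform eK !mulmxA -mulmxA -trmx_mul mxE; apply: eq_bigr => c _.
  by rewrite !mul_col_entry !mulmxA -row_mul [_^T _ _]mxE row_entry.
rewrite exchange_big/=; apply: eq_bigr => c _.
move: (col c (S u *m K)) => w.
have ev : (P^T *m P *m w)^T = \sum_b (P *m w) b 0 *: row b P.
  rewrite -mulmxA trmx_mul trmxK mulmx_sum_row; apply: eq_bigr => b _.
  by rewrite mxE.
rewrite {1}ev (RicQ_sum cm Uu) bform_suml; apply: eq_bigr => b _.
rewrite bformZl mulrC; congr (_ * _).
rewrite (frame_expand _ _ eP) ev bform_sumr; apply: eq_bigr => b' _.
by rewrite bformZr.
Qed.

Hypothesis harmonic : forall u, U u -> \sum_l \sum_k gbi u l k *: row k (IIm l u) = 0.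

Definition transverse_laplacian (f : 'rV[R]_(p + q) -> R) u :=
  \sum_l \sum_k gbi u l k * (partial (rshift p l) (partial (rshift p k) f) u
     - \sum_i Gam G l u k i * partial (rshift p i) f u).

Lemma frame_exists u : U u -> exists2 P : 'M[R]_q,
  orthonormal_frame G u (fun a => row a P) &
  [/\ gbi u = P^T *m P, gb u *m (P^T *m P) = 1%:M & P \in unitmx].
Proof.
move=> Uu; have [P EP eP] := orthonormal_factor (gb_pos cm Uu) (gbT cm Uu).
exists P; first by move=> a b; rewrite bform_rows EP mxE.
by split=> //; [rewrite -eP mulmxV// (gb_unit cm Uu)|
  have /mulmx1_unit[] : P *m (gb u *m P^T) = 1%:M by rewrite mulmxA].
Qed.

Section Signs.
Variables (u : 'rV[R]_(p + q)) (Uu : U u).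
Hypothesis ricci : forall E : 'I_q -> 'rV[R]_q, orthonormal_frame G u E ->
  forall c, 0 <= bform (gb u) (RicQ G E u c) c.
Hypothesis sectional : forall a b : 'rV[R]_q', row_free (col_mx a b) -> KQ G' (F u) a b <= 0.

Let OFu : O' (F u) := cmap_dom cF Uu.

Lemma sectional_term_ge0 a b : 0 <= bform (Hm u) (RQ G' (F u) a b a) b.
Proof.
rewrite (RQ_anti cm' OFu) bformNl oppr_ge0.
exact: (sectional_nonpos_bform cm' OFu).
Qed.

Lemma laplacian_energy (P : 'M[R]_q) (K : 'M[R]_q') :
  gbi u = P^T *m P -> gb u *m (P^T *m P) = 1%:M -> Hm u = K *m K^T ->
  transverse_laplacian energy u = (\sum_a \tr ((P *m (\sum_k P a k *: IIm k u) *m K) *m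
      (P *m (\sum_k P a k *: IIm k u) *m K)^T)
    + (\sum_b \sum_a bform (Hm u) (RQ G' (F u) (row a (P *m S u)) (row b (P *m S u))
         (row a (P *m S u))) (row b (P *m S u))
      + \sum_c let v := (P^T *m P *m col c (S u *m K))^T in
          bform (gb u) (RicQ G (fun a => row a P) u v) v)) *+ 2.
Proof.
move=> eP eP1 eK; rewrite -(RicQ_form Uu eP1 eK) -(trace_Zm Uu eP).
rewrite /transverse_laplacian (weitzenboeck_at cm cm' cF Uu harmonic); congr ((_ + _) *+ 2).
transitivity (\sum_l \sum_k (P^T *m P) l k * \tr (P^T *m P *m IIm k u *m (K *m K^T) *m (IIm l u)^T)).
  by apply: eq_bigr => l _; apply: eq_bigr => k _; rewrite -eP -eK.
by rewrite trace_form_sum; apply: eq_bigr => a _; rewrite trace_form_square.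
Qed.

Lemma laplacian_energy_terms (P : 'M[R]_q) (K : 'M[R]_q') :
  orthonormal_frame G u (fun a => row a P) ->
  [/\ 0 <= \sum_a \tr ((P *m (\sum_k P a k *: IIm k u) *m K) *m
      (P *m (\sum_k P a k *: IIm k u) *m K)^T),
    0 <= \sum_b \sum_a bform (Hm u) (RQ G' (F u) (row a (P *m S u)) (row b (P *m S u))
         (row a (P *m S u))) (row b (P *m S u)) &
    0 <= \sum_c let v := (P^T *m P *m col c (S u *m K))^T in
          bform (gb u) (RicQ G (fun a => row a P) u v) v].
Proof.
move=> oP; split.
- by apply: sumr_ge0 => a _; exact: mxtrace_mul_tr_ge0.
- by apply: sumr_ge0 => b _; apply: sumr_ge0 => a _; exact: sectional_term_ge0.
- by apply: sumr_ge0 => c _; exact: (ricci oP).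
Qed.

Lemma laplacian_energy_ge0 : 0 <= transverse_laplacian energy u.
Proof.
have [P oP [eP eP1 uP]] := frame_exists Uu.
have [K eK _] := square_factor (gb_pos cm' OFu) (gbT cm' OFu).
have [h1 h2 h3] := laplacian_energy_terms K oP.
by rewrite (laplacian_energy eP eP1 eK) mulrn_wge0// !addr_ge0.
Qed.

(** Three nonnegative terms with sum zero all vanish; as [P] and [K] are invertible, what this says
    about frame components passes to [IIm] and [S]. *)
Lemma laplacian_energy_eq0 : transverse_laplacian energy u = 0 ->
  [/\ forall k, IIm k u = 0,
    (forall E, orthonormal_frame G u E -> forall c, c != 0 -> 0 < bform (gb u) (RicQ G E u c) c) ->
      S u = 0 &
    (forall a b : 'rV[R]_q', row_free (col_mx a b) -> KQ G' (F u) a b < 0) -> rank_le1 (S u)].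
Proof.
have [P oP [eP eP1 uP]] := frame_exists Uu.
have [K eK uK] := square_factor (gb_pos cm' OFu) (gbT cm' OFu).
have [h1 h2 h3] := laplacian_energy_terms K oP.
rewrite (laplacian_energy eP eP1 eK) => /eqP; rewrite mulrn_eq0/= paddr_eq0 ?addr_ge0//.
rewrite paddr_eq0// => /andP[/eqP e1 /andP[/eqP e2 /eqP e3]]; split.
- have IIP a : \sum_k P a k *: IIm k u = 0.
    have := mxtrace_mul_tr_eq0 (psumr_all0 (fun b => mxtrace_mul_tr_ge0 _) e1 a).
    move=> e; apply: (can_inj (mulKmx uP)); apply: (can_inj (mulmxK uK)).
    by rewrite e mulmx0 mul0mx.
  move=> k; transitivity (\sum_a invmx P k a *: \sum_j P a j *: IIm j u); last first.
    by apply: big1 => a _; rewrite IIP scaler0.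
  transitivity (\sum_j (invmx P *m P) k j *: IIm j u).
    rewrite mulVmx// (bigD1 k)//= mxE eqxx scale1r big1 ?addr0// => j jk.
    by rewrite mxE eq_sym (negPf jk) scale0r.
  under [RHS]eq_bigr do rewrite scaler_sumr.
  rewrite [RHS]exchange_big/=; apply: eq_bigr => j _; rewrite mxE scaler_suml.
  by apply: eq_bigr => a _; rewrite scalerA.
- move=> rpos; apply: (can_inj (mulmxK uK)); rewrite mul0mx; apply/matrixP => i c.
  pose v := (P^T *m P *m col c (S u *m K))^T.
  have v0 : v = 0.
    apply/eqP/negPn/negP => /(rpos _ oP).
    by rewrite (psumr_all0 (fun b => ricci oP _) e3 c) ltxx.
  have : gb u *m v^T = 0 by rewrite v0 trmx0 mulmx0.
  rewrite /v trmxK mulmxA eP1 mul1mx => /matrixP/(_ i 0).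
  by rewrite !mxE.
(* Two independent rows would span a plane of negative curvature and make a summand of the vanishing
   sectional term positive. *)
- move=> sneg; have r1 : rank_le1 (P *m S u).
    apply: rank_le1_rows => i j; apply/negP => fij.
    have fji : row_free (col_mx (row j (P *m S u)) (row i (P *m S u))).
      apply/negPn/negP => /not_row_free2[x [y [nz e]]].
      rewrite addrC in e; have [ey ex] := row_free2P fij e.
      by rewrite ex ey eqxx in nz.
    have := psumr_all0 (fun b => sumr_ge0 _ (fun a _ => sectional_term_ge0 _ _)) e2 i.
    move=> /(psumr_all0 (fun a => sectional_term_ge0 _ _))/(_ j); rewrite (RQ_anti cm' OFu) bformNl => /eqP; rewrite oppr_eq0 => /eqP e.
    by have := sectional_neg_bform cm' OFu sneg fij; rewrite -[transverse_metric _ _]/(Hm u) e ltxx.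
  by rewrite -[S u](mulKmx uP); exact: rank_le1_mull.
Qed.

End Signs.

End Pointwise.

(** * The strong maximum principle *)

Lemma line_derivable (R : realType) (V W : normedModType R) (h : V -> W) (z w : V) (t : R) :
  differentiable h (z + t *: w) -> derivable (fun s : R => h (z + s *: w)) t 1.
Proof. by move=> dh; apply/(derivable_line h z w t); exact: diff_derivable. Qed.

Section SecondOrder.
Variable R : realType.

Lemma continuous_on_within (T S : topologicalType) (K : set T) (f : T -> S) :
  (forall x, K x -> {for x, continuous f}) -> {within K, continuous f}.
Proof. by move=> cf; apply: continuous_in_subspaceT => x; rewrite inE; exact: cf. Qed.

Lemma compact_max (T : topologicalType) (K : set T) (f : T -> R) : compact K -> K !=set0 ->
  (forall x, K x -> {for x, continuous f}) -> exists2 x, K x & forall y, K y -> f y <= f x.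
Proof.
move=> cK K0 cf; have [x Kx xm] := compact_EVT_max K0 cK (continuous_on_within cf).
by exists x; [rewrite inE in Kx|move=> y Ky; apply: xm; rewrite inE].
Qed.

Lemma compact_min (T : topologicalType) (K : set T) (f : T -> R) : compact K -> K !=set0 ->
  (forall x, K x -> {for x, continuous f}) -> exists2 x, K x & forall y, K y -> f x <= f y.
Proof.
move=> cK K0 cf; have [|x Kx xm] := @compact_max T K (fun y => - f y) cK K0.
  by move=> x Kx; apply: contN; exact: cf.
by exists x => // y /xm; rewrite lerN2.
Qed.

Lemma compact_upper_bound (T : topologicalType) (K : set T) (f : T -> R) : compact K ->
  (forall x, K x -> {for x, continuous f}) -> exists2 C, 0 < C & forall y, K y -> f y <= C.
Proof.
move=> cK cf; have [->|/set0P K0] := eqVneq K set0; first by exists 1.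
have [x Kx xm] := compact_max cK K0 cf; exists (Num.max 1 (f x)).
  by rewrite lt_max ltr01.
by move=> y /xm h; rewrite le_max h orbT.
Qed.

Lemma cube_compact n (u : 'rV[R]_n) (r : R) : compact [set w | `|w - u| <= r].
Proof.
apply: bounded_closed_compact.
  exists (`|u| + r); split; first exact: num_real.
  move=> x hx w /= wr; apply: ltW; apply: le_lt_trans hx.
  by rewrite -[w](subrK u) addrC (le_trans (ler_normD _ _))// lerD2l.
have -> : [set w | `|w - u| <= r] = closed_ball_ Num.norm u r.
  by apply/seteqP; split => w /=; rewrite /closed_ball_ /= distrC.
exact: closed_closed_ball_.
Qed.

(** If the second derivative were positive, the first would be positive just to the right of the
    maximum, and [f] would increase there by the mean value theorem. *)
Lemma second_derivative_at_max (f : R -> R) : (\forall s \near 0, derivable f s 1) ->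
  derivable ('D_1 f) 0 1 -> (\forall s \near 0, f s <= f 0) ->
  'D_1 f 0 = 0 /\ 'D_1 ('D_1 f) 0 <= 0.
Proof.
move=> /(@near_normP R R _ 0)[d1 d10 df] ddf /(@near_normP R R _ 0)[d2 d20 mf].
pose d := Num.min d1 d2; have d0 : 0 < d by rewrite lt_min d10.
have dd s : `|s| < d -> derivable f s 1 /\ f s <= f 0.
  by rewrite lt_min => /andP[a b]; split; [apply: df|apply: mf]; rewrite subr0.
have itvd s : s \in `](- d), d[ -> `|s| < d by rewrite in_itv/= ltr_norml.
have f'0 : 'D_1 f 0 = 0.
  suff H : is_derive (0 : R) (1 : R) f 0 by exact: derive_val.
  apply: (@derive1_at_max R f (- d) d 0).
  - by rewrite ge0_cp// ltW.
  - by move=> t /itvd/dd[].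
  - by rewrite in_itv/= oppr_lt0 d0.
  - by move=> t /itvd/dd[].
split=> //; rewrite leNgt; apply/negP => pos.
have : \forall h \near 0^', 0 < h^-1 *: ('D_1 f (h *: 1 + 0) - 'D_1 f 0).
  have nb : \forall w \near 'D_1 ('D_1 f) 0, 0 < w.
    apply/(@near_normP R R _ ('D_1 ('D_1 f) 0)); exists ('D_1 ('D_1 f) 0) => // w.
    by rewrite ltr_norml => /andP[+ _]; rewrite ltrBrDl subrr.
  have := ddf _ nb; exact.
rewrite near_withinE => /(@near_normP R R _ 0)[e e0 he].
pose s := Num.min d e / 2; have s0 : 0 < s by rewrite divr_gt0// lt_min d0.
have sd : s < Num.min d e by rewrite ltr_pdivrMr// mulr_natr mulr2n ltrDl lt_min d0.
move: sd; rewrite lt_min => /andP[sd se].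
have ins x : x \in `]0, s[ -> 0 < x < s by rewrite in_itv.
have [||c /ins/andP[c0 cs]] := @MVT R f ('D_1 f) 0 s s0.
- move=> x /ins/andP[x0 xs]; apply: DeriveDef => //.
  by have [] := dd x; rewrite // gtr0_norm// (lt_trans xs).
- apply: continuous_on_within => x; rewrite /= in_itv/= => /andP[x0 xs].
  apply: differentiable_continuous; apply/derivable1_diffP.
  by have [] := dd x; rewrite // ger0_norm// (le_lt_trans xs).
rewrite subr0 => E.
have := he c; rewrite subr0 gtr0_norm// => /(_ (lt_trans cs se)).
rewrite f'0 subr0 addr0 => /(_ (lt0r_neq0 c0)).
rewrite [_ *: 1]mulr1 [_ *: _]mulrC pmulr_lgt0 ?invr_gt0// => pc.
have : f s <= f 0 by have [] := dd s; rewrite // gtr0_norm.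
by rewrite -subr_le0 E leNgt mulr_gt0.
Qed.

Lemma second_order_sumD n (a : 'M[R]_n) (b : 'rV[R]_n) (H H1 H2 : 'I_n -> 'I_n -> R)
    (D D1 D2 : 'I_n -> R) :
  (forall l k, H l k = H1 l k + H2 l k) -> (forall k, D k = D1 k + D2 k) ->
  \sum_l \sum_k a l k * H l k + \sum_k b 0 k * D k =
  (\sum_l \sum_k a l k * H1 l k + \sum_k b 0 k * D1 k) +
  (\sum_l \sum_k a l k * H2 l k + \sum_k b 0 k * D2 k).
Proof.
move=> eH eD; rewrite [RHS]addrACA; congr (_ + _); rewrite -big_split/=; last first.
  by apply: eq_bigr => k _; rewrite -mulrDr eD.
by apply: eq_bigr => l _; rewrite -big_split/=; apply: eq_bigr => k _; rewrite -mulrDr eH.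
Qed.

Lemma second_order_sumZ n (a : 'M[R]_n) (b : 'rV[R]_n) (c : R) (H H1 : 'I_n -> 'I_n -> R)
    (D D1 : 'I_n -> R) :
  (forall l k, H l k = c * H1 l k) -> (forall k, D k = c * D1 k) ->
  \sum_l \sum_k a l k * H l k + \sum_k b 0 k * D k =
  c * (\sum_l \sum_k a l k * H1 l k + \sum_k b 0 k * D1 k).
Proof.
move=> eH eD; rewrite mulrDr !mulr_sumr; congr (_ + _); last first.
  by apply: eq_bigr => k _; rewrite eD mulrCA.
by apply: eq_bigr => l _; rewrite mulr_sumr; apply: eq_bigr => k _; rewrite eH mulrCA.
Qed.

Section Elliptic.
Variables (n : nat) (U : set 'rV[R]_n).
Hypothesis oU : open U.

Lemma smooth_dir (f : 'rV[R]_n -> R) (w : 'rV[R]_n) : smooth_on U f ->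
  smooth_on U (fun y => \sum_k w 0 k * partial k f y).
Proof.
move=> sf; apply: (smooth_sum oU) => k _.
by apply: (smoothM oU); [exact: smooth_cst|exact: smooth_partial].
Qed.

Lemma hessian_at_max (f : 'rV[R]_n -> R) z (v : 'rV[R]_n) : smooth_on U f -> U z ->
  (\forall y \near z, f y <= f z) ->
  (forall k, partial k f z = 0) /\
  \sum_l \sum_k v 0 l * v 0 k * partial l (partial k f) z <= 0.
Proof.
move=> sf Uz mf.
have D (w : 'rV[R]_n) y : U y -> 'D_w f y = \sum_k w 0 k * partial k f y.
  by move=> Uy; apply: derive_partial; exact: (smooth_differentiable oU sf).
have line (w : 'rV[R]_n) : \forall s \near (0 : R), U (z + s *: w) /\ f (z + s *: w) <= f z.
  have : {for (0 : R), continuous (fun s : R => z + s *: w)}.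
    by apply: cvgD; [exact: cvg_cst|apply: cvgZr_tmp; exact: cvg_id].
  rewrite /prop_for /continuous_at scale0r addr0 => c0.
  have := c0 _ (filterI (open_near oU Uz) mf); exact.
have main (w : 'rV[R]_n) : 'D_w f z = 0 /\ 'D_w ('D_w f) z <= 0.
  have l0 := line w.
  have dfg (s : R) : U (z + s *: w) -> derivable (fun s : R => f (z + s *: w)) s 1.
    by move=> Us; apply: (line_derivable (h := f)); exact: (smooth_differentiable oU sf).
  have gE (s : R) : 'D_1 (fun s : R => f (z + s *: w)) s = 'D_w f (z + s *: w) by exact: derive_line.
  have [g Eg] : {g | g = (fun s : R => f (z + s *: w))} by exists (fun s : R => f (z + s *: w)).
  rewrite -Eg in dfg gE.
  have dDf : differentiable ('D_w f) z.
    have sD := smooth_dir w sf.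
    have sD' : smooth_on U ('D_w f) by apply: (smooth_eq oU _ sD) => y Uy; rewrite D.
    exact: (smooth_differentiable oU sD').
  have e3 : 'D_1 (fun s : R => 'D_w f (z + s *: w)) (0 : R) = 'D_w ('D_w f) z.
    by apply: etrans (derive_line ('D_w f) z w 0) _; rewrite scale0r addr0.
  have g0 : 'D_1 g (0 : R) = 'D_w f z by apply: etrans (gE 0) _; rewrite scale0r addr0.
  have [|||e1 e2] := @second_derivative_at_max g.
  - by near=> s; apply: dfg; near: s; apply: filterS l0 => s [].
  - rewrite (_ : 'D_1 g = fun s => 'D_w f (z + s *: w)); last exact/funext.
    by apply: (line_derivable (h := 'D_w f)); rewrite scale0r addr0.
  - by rewrite Eg scale0r addr0; apply: filterS l0 => s [].
  move: e1 e2; rewrite (_ : 'D_1 g = fun s => 'D_w f (z + s *: w)); last exact/funext.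
  by move=> e1 e2; split; [apply: etrans (esym g0) _; exact: e1|rewrite -e3; exact: e2].
split=> [k|]; first by have [] := main (delta_mx 0 k).
have [_] := main v.
rewrite (eq_on_derive v oU (D v) Uz) derive_partial; last first.
  exact: (smooth_differentiable oU (smooth_dir v sf) Uz).
congr (_ <= _); apply: eq_bigr => l _.
rewrite /partial (_ : (fun y => _) = \sum_k (fun y => v 0 k * partial k f y)); last first.
  by apply/funext => y; rewrite fct_sumE.
have dk k : derivable (partial k f) z (delta_mx 0 l).
  have sk := smooth_partial k sf; apply: diff_derivable; exact: (smooth_differentiable oU sk Uz).
rewrite derive_sum => [|k]; last by apply: derivableM; [exact: derivable_cst|exact: dk].
rewrite mulr_sumr; apply: eq_bigr => k _.
rewrite (_ : (fun y => _) = (v 0 k) \*: partial k f)//.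
by rewrite deriveZ// mulrA.
Unshelve. all: by end_near. Qed.

Definition elliptic (A : 'rV[R]_n -> 'M[R]_n) (B : 'rV[R]_n -> 'rV[R]_n)
    (f : 'rV[R]_n -> R) u :=
  \sum_l \sum_k A u l k * partial l (partial k f) u + \sum_k B u 0 k * partial k f u.

Variables (A : 'rV[R]_n -> 'M[R]_n) (B : 'rV[R]_n -> 'rV[R]_n).
Hypotheses (sA : mxsmooth U A) (sB : mxsmooth U B).
Hypotheses (pA : forall u, U u -> posdef (A u)) (tA : forall u, U u -> (A u)^T = A u).

(** Writing [A] as [K *m K^T] turns the second order part into a sum of second derivatives in the
    directions of the columns of [K]; the first order part vanishes at a maximum. *)
Lemma elliptic_at_max f z : smooth_on U f -> U z -> (\forall y \near z, f y <= f z) ->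
  elliptic A B f z <= 0.
Proof.
move=> sf Uz mf; have [d0 _] := hessian_at_max (0 : 'rV[R]_n) sf Uz mf.
rewrite /elliptic [X in _ + X]big1 ?addr0 => [|k _]; last by rewrite d0 mulr0.
have [K eK _] := square_factor (pA Uz) (tA Uz).
have -> : \sum_l \sum_k A z l k * partial l (partial k f) z =
    \sum_a \sum_l \sum_k (col a K)^T 0 l * (col a K)^T 0 k * partial l (partial k f) z.
  rewrite [RHS]exchange_big/=; apply: eq_bigr => l _.
  rewrite [RHS]exchange_big/=; apply: eq_bigr => k _.
  rewrite -mulr_suml eK mxE; congr (_ * _); apply: eq_bigr => a _.
  by rewrite !mxE.
by apply: sumr_le0 => a _; have [_] := hessian_at_max (col a K)^T sf Uz mf.
Qed.

Lemma partialD f g k u : smooth_on U f -> smooth_on U g -> U u ->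
  partial k (fun w => f w + g w) u = partial k f u + partial k g u.
Proof.
move=> sf sg Uu; apply: (@deriveD _ _ _ f g); apply: diff_derivable.
  exact: (smooth_differentiable oU sf).
exact: (smooth_differentiable oU sg).
Qed.

Lemma partialZ c f k u : smooth_on U f -> U u ->
  partial k (fun w => c * f w) u = c * partial k f u.
Proof.
move=> sf Uu; apply: (@deriveZ _ _ _ f c); apply: diff_derivable.
exact: (smooth_differentiable oU sf).
Qed.

Lemma partialM f g k u : smooth_on U f -> smooth_on U g -> U u ->
  partial k (fun w => f w * g w) u = f u * partial k g u + g u * partial k f u.
Proof.
move=> sf sg Uu; apply: (@deriveM _ _ f g); apply: diff_derivable.
  exact: (smooth_differentiable oU sf).
exact: (smooth_differentiable oU sg).
Qed.

Lemma smooth_pow f N : smooth_on U f -> smooth_on U (fun w => f w ^+ N).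
Proof.
move=> sf; elim: N => [|N IH]; first exact: smooth_cst.
by apply: (smooth_eq oU _ (smoothM oU sf IH)) => u _; rewrite exprS.
Qed.

Lemma partial_pow f N k u : smooth_on U f -> U u ->
  partial k (fun w => f w ^+ N.+1) u = N.+1%:R * f u ^+ N * partial k f u.
Proof.
move=> sf Uu; elim: N => [|N IH].
  by rewrite expr0 !mul1r; apply: (eq_on_derive _ oU _ Uu) => w _; rewrite expr1.
have -> : partial k (fun w => f w ^+ N.+2) u = partial k (fun w => f w * f w ^+ N.+1) u.
  by apply: (eq_on_derive _ oU _ Uu) => w _; rewrite exprS.
rewrite (partialM _ sf (smooth_pow _ sf) Uu) IH [in RHS]mulrSr exprS; ring.
Qed.

Lemma partial2_pow f N l k u : smooth_on U f -> U u ->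
  partial l (partial k (fun w => f w ^+ N.+2)) u =
  N.+2%:R * f u ^+ N * (N.+1%:R * (partial l f u * partial k f u) + f u * partial l (partial k f) u).
Proof.
move=> sf Uu.
have e w : U w -> partial k (fun w => f w ^+ N.+2) w = N.+2%:R * (f w ^+ N.+1 * partial k f w).
  by move=> Uw; rewrite partial_pow// mulrA.
have sp := smooth_partial k sf; have sN := smooth_pow N.+1 sf.
apply: etrans (eq_on_derive _ oU e Uu) _.
rewrite -[LHS]/(partial l _ u) (partialZ _ _ (smoothM oU sN sp) Uu) (partialM _ sN sp Uu).
rewrite (partial_pow _ _ sf Uu) [f u ^+ N.+1]exprS; ring.
Qed.

Lemma ellipticD f g u : smooth_on U f -> smooth_on U g -> U u ->
  elliptic A B (fun w => f w + g w) u = elliptic A B f u + elliptic A B g u.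
Proof.
move=> sf sg Uu; apply: second_order_sumD => [l k|k]; last exact: partialD.
apply: etrans _ (partialD _ (smooth_partial k sf) (smooth_partial k sg) Uu).
by apply: (eq_on_derive _ oU _ Uu) => w Uw; exact: partialD.
Qed.

Lemma ellipticZ c f u : smooth_on U f -> U u ->
  elliptic A B (fun w => c * f w) u = c * elliptic A B f u.
Proof.
move=> sf Uu; apply: second_order_sumZ => [l k|k]; last exact: partialZ.
apply: etrans _ (partialZ _ _ (smooth_partial k sf) Uu).
by apply: (eq_on_derive _ oU _ Uu) => w Uw; exact: partialZ.
Qed.



End Elliptic.
End SecondOrder.

Lemma norm_sub_continuous (R : realType) (V : normedModType R) (y0 y : V) :
  {for y, continuous (fun z : V => `|z - y0|)}.
Proof. by apply: cvg_norm; apply: cvgB; [exact: cvg_id|exact: cvg_cst]. Qed.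

Section SquaredDistance.
Variables (R : realType) (n : nat).
Implicit Types x y c : 'rV[R]_n.

(** The norm of row vectors is the sup norm, whereas Hopf's lemma needs round balls with a smooth
    defining function. *)
Definition sqd c y : R := \sum_k (y 0 k - c 0 k) ^+ 2.

Lemma sqd_ge0 c y : 0 <= sqd c y.
Proof. by apply: sumr_ge0 => k _; exact: sqr_ge0. Qed.

Lemma sqd_eq0 c y : sqd c y = 0 -> y = c.
Proof.
move=> /psumr_all0 H; apply/rowP => k; apply/eqP; rewrite -subr_eq0 -sqrf_eq0; apply/eqP.
by apply: H => i; exact: sqr_ge0.
Qed.

Lemma sqd_gt0 c y : y != c -> 0 < sqd c y.
Proof.
by move=> yc; rewrite lt_def sqd_ge0 andbT; apply: contra_neq yc; exact: sqd_eq0.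
Qed.

Lemma norm_le_sqd c y : `|y - c| ^+ 2 <= sqd c y.
Proof.
have -> : `|y - c| ^+ 2 <= sqd c y = (`|y - c| <= Num.sqrt (sqd c y)).
  by rewrite -[in RHS](ger0_norm (normr_ge0 (y - c))) -sqrtr_sqr ler_sqrt ?sqd_ge0.
apply: norm_mx_le => [|i j]; first exact: sqrtr_ge0.
rewrite !ord1 -sqrtr_sqr ler_sqrt ?sqd_ge0// !mxE /sqd (bigD1 j)//= lerDl.
by apply: sumr_ge0 => k _; exact: sqr_ge0.
Qed.

Lemma sqd_le_norm c y : sqd c y <= n%:R * `|y - c| ^+ 2.
Proof.
rewrite -[n in n%:R]card_ord mulr_natl -sumr_const; apply: ler_sum => k _.
by rewrite -real_normK ?num_real// lerXn2r ?nnegrE//; have := normr_coord (y - c) 0 k; rewrite !mxE.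
Qed.

(** The ball about the midpoint of [c] and [b] that passes through [b] meets the sphere about [c]
    through [b] only at [b]; this follows from the parallelogram identity. *)
Lemma sqd_midpoint c b y : let m := 2^-1 *: (c + b) in y != b ->
  sqd m y <= sqd m b -> sqd c y < sqd c b.
Proof.
move=> m yb h; have : 0 < sqd b y by exact: sqd_gt0.
have e : sqd c y + sqd b y = 2 * sqd m y + 2 * sqd m b.
  rewrite /sqd !mulr_sumr -!big_split/=; apply: eq_bigr => k _; rewrite !mxE; by field.
have e2 : sqd c b = 4 * sqd m b.
  rewrite /sqd mulr_sumr; apply: eq_bigr => k _; rewrite !mxE; by field.
move: (sqd c y) (sqd b y) (sqd m y) (sqd m b) (sqd c b) e e2 h => *; lra.
Qed.

Lemma sqd_smooth (U : set 'rV[R]_n) c : open U -> smooth_on U (sqd c).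
Proof.
move=> oU; apply: (smooth_sum oU) => k _; apply: (smooth_pow oU).
by apply: (smoothB oU); [exact: smooth_coord|exact: smooth_cst].
Qed.

Lemma partial_sqd c k y : partial k (sqd c) y = 2 * (y 0 k - c 0 k).
Proof.
have sC j : smooth_on setT (fun y : 'rV[R]_n => y 0 j - c 0 j).
  by apply: (smoothB openT); [exact: smooth_coord|exact: smooth_cst].
have dC j : partial k (fun y : 'rV[R]_n => y 0 j - c 0 j) y = (j == k)%:R.
  rewrite /partial (@deriveB _ _ _ (fun y : 'rV[R]_n => y 0 j) (fun=> c 0 j)).
  - have [_ ->] := is_derive_coord y (delta_mx 0 k) 0 j.
    by rewrite derive_cst subr0 mxE eqxx.
  - by have [] := is_derive_coord y (delta_mx 0 k) 0 j.
  - exact: derivable_cst.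
rewrite /partial /sqd (_ : (fun y0 => _) = \sum_j (fun y : 'rV[R]_n => (y 0 j - c 0 j) ^+ 2)); last first.
  by apply/funext => z; rewrite fct_sumE.
have sC2 j := smooth_pow openT 2 (sC j).
rewrite derive_sum => [|j]; last exact: (diff_derivable (smooth_differentiable openT (sC2 j) I)).
rewrite (bigD1 k)//= big1 => [|j jk].
  by rewrite addr0 [LHS](partial_pow openT 1 k (sC k) I) dC eqxx mulr1 expr1.
by rewrite [LHS](partial_pow openT 1 k (sC j) I) dC (negPf jk) mulr0.
Qed.

Lemma partial2_sqd c l k y : partial l (partial k (sqd c)) y = 2 * (k == l)%:R.
Proof.
have -> : partial k (sqd c) = fun y => 2 * (y 0 k - c 0 k).
  by apply/funext => z; exact: partial_sqd.
have sC : smooth_on setT (fun y : 'rV[R]_n => y 0 k - c 0 k).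
  by apply: (smoothB openT); [exact: smooth_coord|exact: smooth_cst].
rewrite (partialZ openT 2 l sC I) /partial (@deriveB _ _ _ (fun y : 'rV[R]_n => y 0 k) (fun=> c 0 k)).
- have [_ ->] := is_derive_coord y (delta_mx 0 l) 0 k.
  by rewrite derive_cst subr0 mxE eqxx.
- by have [] := is_derive_coord y (delta_mx 0 l) 0 k.
- exact: derivable_cst.
Qed.

End SquaredDistance.

Lemma second_order_sum_barrier (R : realType) n (a : 'M[R]_n) (b x : 'rV[R]_n) (N f : R) :
  \sum_l \sum_k a l k * (N * (4 * (x 0 l * x 0 k)) - f * (2 * (k == l)%:R))
    + \sum_k b 0 k * - (f * (2 * x 0 k)) =
  N * (4 * bform a x x) - f * (2 * (\tr a + \sum_k b 0 k * x 0 k)).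
Proof.
have e l : \sum_k a l k * (k == l)%:R = a l l.
  rewrite (bigD1 l)//= eqxx mulr1 big1 ?addr0// => k kl.
  by rewrite (negPf kl) mulr0.
have -> : \sum_l \sum_k a l k * (N * (4 * (x 0 l * x 0 k)) - f * (2 * (k == l)%:R)) =
    N * (4 * bform a x x) - f * (2 * \tr a).
  rewrite bform_coord /mxtrace !mulr_sumr -sumrB; apply: eq_bigr => l _.
  rewrite -[in RHS](e l) !mulr_sumr -sumrB; apply: eq_bigr => k _; ring.
have -> : \sum_k b 0 k * - (f * (2 * x 0 k)) = - (f * (2 * \sum_k b 0 k * x 0 k)).
  by rewrite !mulr_sumr -sumrN; apply: eq_bigr => k _; ring.
ring.
Qed.

(** * Hopf's lemma and the strong maximum principle *)

Section StrongMaximum.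
Variables (R : realType) (n : nat) (U : set 'rV[R]_n).
Hypothesis oU : open U.
Variables (A : 'rV[R]_n -> 'M[R]_n) (B : 'rV[R]_n -> 'rV[R]_n).
Hypotheses (sA : mxsmooth U A) (sB : mxsmooth U B).
Hypotheses (pA : forall u, U u -> posdef (A u)) (tA : forall u, U u -> (A u)^T = A u).
Notation L := (elliptic A B).

(** A power of [K - sqd c] takes the place of the exponential that is usual in Hopf's lemma: the
    gradient term carries the additional factor [N.+1] and outweighs the others for large [N]. *)
Lemma elliptic_barrier (c : 'rV[R]_n) (K : R) N u : U u ->
  L (fun y => (K - sqd c y) ^+ N.+2) u =
  N.+2%:R * (K - sqd c u) ^+ N *
    (N.+1%:R * (4 * bform (A u) (u - c) (u - c))
     - (K - sqd c u) * (2 * (\tr (A u) + \sum_k B u 0 k * (u - c) 0 k))).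
Proof.
move=> Uu; pose f (y : 'rV[R]_n) := K - sqd c y.
have sf : smooth_on U f.
  by apply: (smoothB oU); [exact: smooth_cst|exact: sqd_smooth].
have d1 k w : U w -> partial k f w = - (2 * (w 0 k - c 0 k)).
  move=> Uw; have sN : smooth_on U (fun y => - sqd c y).
    exact: (smoothN oU (sqd_smooth _ oU)).
  rewrite (partialD oU k (smooth_cst K) sN Uw) /partial derive_cst add0r.
  rewrite (@deriveN _ _ _ (sqd c)) ?[X in - X]partial_sqd//.
  exact: (diff_derivable (smooth_differentiable oU (sqd_smooth _ oU) Uw)).
have d2 l k : partial l (partial k f) u = - (2 * (k == l)%:R).
  rewrite -(partial2_sqd c l k u).
  have e w : U w -> partial k f w = - partial k (sqd c) w.
    by move=> Uw; rewrite d1// partial_sqd.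
  apply: etrans (eq_on_derive _ oU e Uu) _.
  apply: (@deriveN _ _ _ (partial k (sqd c))).
  have sk := smooth_partial k (sqd_smooth c oU).
  exact: (diff_derivable (smooth_differentiable oU sk Uu)).
have E2 l k : partial l (partial k (fun y => f y ^+ N.+2)) u = N.+2%:R * f u ^+ N *
    (N.+1%:R * (4 * ((u - c) 0 l * (u - c) 0 k)) - f u * (2 * (k == l)%:R)).
  by rewrite (partial2_pow oU N l k sf Uu) (d1 l u Uu) (d1 k u Uu) d2 !mxE; congr (_ * _); ring.
have E1 k : partial k (fun y => f y ^+ N.+2) u =
    N.+2%:R * f u ^+ N * (- (f u * (2 * (u - c) 0 k))).
  by rewrite (partial_pow oU N.+1 k sf Uu) (d1 k u Uu) exprS !mxE; ring.
rewrite -[K - sqd c u]/(f u).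
rewrite /elliptic; move: E1 E2; rewrite -/f.
move: (f u) (u - c) => fu x E1 E2.
transitivity (N.+2%:R * fu ^+ N * (\sum_l \sum_k A u l k * (N.+1%:R * (4 * (x 0 l * x 0 k)) - fu * (2 * (k == l)%:R)) + \sum_k B u 0 k * - (fu * (2 * x 0 k)))).
  rewrite mulrDr !mulr_sumr; congr (_ + _).
    apply: eq_bigr => l _; rewrite mulr_sumr; apply: eq_bigr => k _.
    by rewrite E2 mulrCA.
  by apply: eq_bigr => k _; rewrite E1 mulrCA.
by congr (_ * _); exact: second_order_sum_barrier.
Qed.

Lemma smoothZ (a : R) h : smooth_on U h -> smooth_on U (fun u => a * h u).
Proof. by apply: (smoothM oU); exact: smooth_cst. Qed.

Lemma cube_open_sub (u : 'rV[R]_n) : U u -> exists2 r, 0 < r & forall w, `|w - u| <= r -> U w.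
Proof.
move=> Uu; have /(@near_normP R 'rV[R]_n _ u)[d d0 dU] := open_near oU Uu.
exists (d / 2); first by rewrite divr_gt0.
move=> w wd; apply: dU; apply: le_lt_trans wd _.
by rewrite ltr_pdivrMr// mulr_natr mulr2n ltrDl.
Qed.

Lemma closed_in_cube (C : set 'rV[R]_n) (P : 'rV[R]_n -> Prop) : compact C ->
  (forall y, C y -> ~ P y -> \forall z \near y, ~ P z) -> compact [set y | C y /\ P y].
Proof.
move=> cC nP; have hC : closed C by exact: compact_closed (@norm_hausdorff _ _) cC.
apply: (subclosed_compact _ cC); last by move=> y [].
move=> y cl; have Cy : C y.
  by apply: hC; apply: closureS cl => z [].
split=> //; apply: contrapT => nPy.
have [z [[Cz Pz] nPz]] := cl _ (nP y Cy nPy).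
exact: nPz.
Qed.

Lemma near_lt_cont (f g : 'rV[R]_n -> R) y : {for y, continuous f} -> {for y, continuous g} ->
  f y < g y -> \forall z \near y, f z < g z.
Proof.
move=> cf cg fg; have ch := contB cg cf.
have nb : \forall w \near (g y - f y), 0 < w.
  by apply: lt_nbhsr; rewrite subr_gt0.
have : \forall z \near y, 0 < g z - f z := ch _ nb.
by apply: filterS => z; rewrite subr_gt0.
Qed.

Variables (f : 'rV[R]_n -> R) (m : R).
Hypotheses (sf : smooth_on U f) (fm : forall u, U u -> f u <= m).
Hypothesis Lf : forall u, U u -> 0 <= L f u.

(* Hopf's boundary point lemma: a ball in the set [f < m] cannot touch [f = m]. *)
Lemma hopf_touching (y1 y0 : 'rV[R]_n) : U y0 -> f y0 = m -> y0 != y1 ->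
  (forall y, U y -> sqd y1 y <= sqd y1 y0 -> y != y0 -> f y < m) -> False.
Proof.
move=> Uy0 fy0 y01 inside.
have [r0 r00 r0U] := cube_open_sub Uy0.
have n0 : 0 < `|y0 - y1| by rewrite normr_gt0 subr_eq0.
(* At most half the distance to [y1], so that [sqd y1] has no critical point in the cube. *)
pose r := Num.min r0 (`|y0 - y1| / 2); have r_gt0 : 0 < r by rewrite lt_min r00 divr_gt0.
pose C := [set y : 'rV[R]_n | `|y - y0| <= r]; have cC : compact C by exact: cube_compact.
have CU y : C y -> U y by move=> Cy; apply: r0U; apply: le_trans Cy _; rewrite ge_min lexx.
have Cy0 : C y0 by rewrite /C/= subrr normr0 ltW.
have Cy1 y : C y -> y - y1 != 0.
  move=> Cy; apply/eqP => e; move: Cy; rewrite /C/= (_ : y = y1); last by apply/eqP; rewrite -subr_eq0 e.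
  rewrite distrC => h; have := le_trans h (_ : r <= `|y0 - y1| / 2).
  by rewrite ge_min lexx orbT => /(_ isT); lra.
have csq y : C y -> {for y, continuous (sqd y1)}.
  by move=> Cy; apply: (smooth_continuous (sqd_smooth y1 oU)); exact: CU.
have smx : mxsmooth U (fun y => y - y1).
  by apply: (mxsmoothB oU); [move=> i j; rewrite ord1; exact: smooth_coord|exact: mxsmooth_cst].
have sq : smooth_on U (fun y => bform (A y) (y - y1) (y - y1)).
  have := mxsmooth_mul oU (mxsmooth_mul oU smx sA) (mxsmooth_tr oU smx).
  by move=> /(_ 0 0); apply: smooth_eq.
have sc : smooth_on U (fun y => 2 * (\tr (A y) + \sum_k B y 0 k * (y - y1) 0 k)).
  apply: (smoothM oU); first exact: smooth_cst.
  apply: (smoothD oU); apply: (smooth_sum oU) => k _; first exact: sA.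
  by apply: (smoothM oU); [exact: sB|exact: smx].
have C0 : C !=set0 by exists y0.
have [z0 Cz0 minq] := compact_min cC C0 (fun y Cy => smooth_continuous sq (CU y Cy)).
pose q0 := bform (A z0) (z0 - y1) (z0 - y1).
have q0_gt0 : 0 < q0 by apply: (pA (CU _ Cz0)); exact: Cy1.
have [c0 c00 maxc] := compact_upper_bound cC (fun y Cy => smooth_continuous sc (CU y Cy)).
have [S0 S00 maxS] := compact_upper_bound cC csq.
(* Keeps [K - sqd y1] at least 1 on the cube. *)
pose K := S0 + 1.
have [N HN] : exists N : nat, K * c0 < N.+1%:R * (4 * q0).
  exists (Num.bound `|K * c0 / (4 * q0)|); rewrite -ltr_pdivrMr ?mulr_gt0//.
  apply: le_lt_trans (ler_norm _) _; apply: lt_trans (archi_boundP (normr_ge0 _)) _.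
  by rewrite ltr_nat.
pose w0 y := (K - sqd y1 y) ^+ N.+2.
have Ksq y : C y -> 1 <= K - sqd y1 y <= K.
  by move=> Cy; rewrite /K; have := maxS y Cy; have := sqd_ge0 y1 y; move: (sqd y1 y) => s; lra.
have sw0 : smooth_on U w0.
  apply: (smooth_pow oU); apply: (smoothB oU); [exact: smooth_cst|exact: sqd_smooth].
have Lw0 y : C y -> 0 < L w0 y.
  move=> Cy; rewrite elliptic_barrier; last exact: CU.
  have /andP[K1 KK] := Ksq y Cy.
  apply: mulr_gt0.
    by apply: mulr_gt0; [rewrite ltr0n|apply: exprn_gt0; lra].
  have := minq y Cy; rewrite -/q0; have := maxc y Cy; rewrite subr_gt0.
  move: (bform _ _ _) (2 * _) (K - _) K1 KK => a b k k1 kK bc qa.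
  have : k * b <= K * c0.
    have [b0|b0] := leP b 0.
      apply: (@le_trans _ _ 0); last by apply: mulr_ge0; [lra|exact: ltW].
      by apply: mulr_ge0_le0 => //; lra.
    by apply: ler_pM => //; lra.
  have : N.+1%:R * (4 * q0) <= N.+1%:R * (4 * a) by rewrite ler_pM2l ?ltr0n// ler_pM2l.
  by move: HN; move: (N.+1%:R * _) (N.+1%:R * _) (K * c0) (k * b) => *; lra.
pose w y := w0 y - w0 y0.
have sw : smooth_on U w by apply: (smoothB oU sw0); exact: smooth_cst.
(* The boundary of the cube is divided by the sphere about [y1] through [y0]: on the inner part [D],
   [f] stays below [m] by a margin [c1]; on the outer part the barrier [w] is negative. *)
pose D := [set y | C y /\ (`|y - y0| = r /\ sqd y1 y <= sqd y1 y0)].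
have cD : compact D.
  apply: closed_in_cube => // y Cy /not_andP[ne|/negP].
    have cn := @norm_sub_continuous R _ y0 y.
    have lt : `|y - y0| < r by rewrite lt_neqAle; apply/andP; split; [exact/eqP|exact: Cy].
    have := near_lt_cont cn (@cont_cst R _ r y) lt.
    by apply: filterS => z zr [e _]; rewrite e ltxx in zr.
  rewrite -ltNge => lt; have := near_lt_cont (@cont_cst R _ (sqd y1 y0) y) (csq y Cy) lt.
  by apply: filterS => z zr [_]; rewrite leNgt zr.
have CD y : D y -> C y by case.
have Dlt y : D y -> f y < m.
  move=> [Cy [e le]]; apply: inside => //; first exact: CU.
  by apply/eqP => ey; rewrite ey subrr normr0 in e; rewrite -e ltxx in r_gt0.
have [c1 c10 Dc1] : exists2 c1, 0 < c1 & forall y, D y -> f y <= m - c1.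
  have [D0|/set0P D0] := eqVneq D set0; first by exists 1 => // y; rewrite D0.
  have [z Dz zm] := compact_max cD D0 (fun y Dy => smooth_continuous sf (CU y (CD y Dy))).
  exists (m - f z); first by rewrite subr_gt0; exact: Dlt.
  by move=> y /zm; rewrite opprB addrC subrK.
have [W W0 wW] := compact_upper_bound cC (fun y Cy => smooth_continuous sw (CU y Cy)).
(* Small enough for [ep * w] to consume at most half of the margin. Then [g] is below [m] on the
   boundary but equals [m] at [y0], so it has an interior maximum, where its image under the
   operator is positive. *)
pose ep := c1 / (2 * W); have ep0 : 0 < ep by rewrite divr_gt0// mulr_gt0.
pose g y := f y + ep * w y.
have sew : smooth_on U (fun y => ep * w y) by exact: smoothZ.
have sg : smooth_on U g by exact: (smoothD oU).
have gb y : `|y - y0| = r -> g y < m.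
  move=> e; have Cy : C y by rewrite /C/= e.
  have [le|lt] := leP (sqd y1 y) (sqd y1 y0).
    have h1 : f y <= m - c1 by apply: Dc1.
    have h2 : ep * w y <= ep * W by rewrite ler_pM2l// wW.
    have h3 : ep * W = c1 / 2 by rewrite /ep; field; rewrite gt_eqF.
    by rewrite /g; move: h1 h2 h3; move: (f y) (ep * w y) (ep * W) => *; lra.
  have h1 : f y <= m by apply: fm; exact: CU.
  have h2 : w y < 0.
    rewrite /w /w0 subr_lt0 ltrXn2r// ?nnegrE.
    - by have /andP[+ _] := Ksq y Cy; move: (K - _) => *; lra.
    - by rewrite ltrD2l ltrN2.
  have h3 : ep * w y < 0 by rewrite pmulr_rlt0.
  by rewrite /g; move: h1 h3; move: (f y) (ep * w y) => *; lra.
have gy0 : g y0 = m by rewrite /g /w subrr mulr0 addr0.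
have [z Cz zm] := compact_max cC C0 (fun y Cy => smooth_continuous sg (CU y Cy)).
have zr : `|z - y0| < r.
  rewrite lt_neqAle; apply/andP; split; last exact: Cz.
  by apply/eqP => /gb; rewrite ltNge -gy0 zm.
have gmax : \forall y \near z, g y <= g z.
  apply/(@near_normP R 'rV[R]_n _ z); exists (r - `|z - y0|); first by rewrite subr_gt0.
  move=> y yz; apply: zm; rewrite /C/= -(subrK z y) -addrA; apply: le_trans (ler_normD _ _) _.
  by move: yz; move: (`|_|) (`|_|) => *; lra.
have := elliptic_at_max oU B pA tA sg (CU _ Cz) gmax.
rewrite (ellipticD oU A B sf sew (CU _ Cz)) (ellipticZ oU A B ep sw (CU _ Cz)).
have -> : L w z = L w0 z.
  have sn : smooth_on U (fun=> - w0 y0) by exact: smooth_cst.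
  rewrite (ellipticD oU A B sw0 sn (CU _ Cz)) [X in _ + X](_ : _ = 0) ?addr0//.
  have := ellipticZ oU A B 0 sn (CU _ Cz); rewrite mul0r => e0.
  have p0 k y : partial k (fun=> - w0 y0) y = 0 by exact: derive_cst.
  rewrite /elliptic big1 ?add0r => [|l _].
    by apply: big1 => k _; rewrite p0 mulr0.
  apply: big1 => k _; rewrite (_ : partial k _ = fun=> 0); last by apply/funext => y; exact: p0.
  by rewrite /partial derive_cst mulr0.
have := Lf (CU _ Cz); have : 0 < ep * L w0 z by rewrite mulr_gt0// Lw0.
by move: (ep * _) (L f z) => *; lra.
Qed.

(** If [f < m] at some [u1] close to [u0], let [y0] be a point of [f = m] nearest to [u1]. The ball
    about the midpoint of [u1] and [y0] meets [f = m] at [y0] only, which Hopf's lemma excludes. *)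
Lemma strong_maximum u0 : U u0 -> f u0 = m -> \forall u \near u0, f u = m.
Proof.
move=> Uu0 fu0; apply: contrapT => nnear.
have [r r0 rU] := cube_open_sub Uu0.
(* Points not farther from [u1] than [u0] in the Euclidean sense lie within [(n%:R + 1) * d] of [u1]
   in the sup norm, hence within [r] of [u0]. *)
pose d := r / (n%:R + 3); have n3 : 0 < n%:R + 3 :> R by rewrite ltr_wpDl.
have d0 : 0 < d by rewrite divr_gt0.
have [u1 u1d fu1] : exists2 u1, `|u1 - u0| < d & f u1 != m.
  apply: contrapT => h; apply: nnear; apply/(@near_normP R 'rV[R]_n _ u0); exists d => // w wd.
  by apply: contrapT => /eqP ne; apply: h; exists w.
pose C := [set y : 'rV[R]_n | `|y - u0| <= r].
have CU y : C y -> U y by exact: rU.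
have Cu y : sqd u1 y <= sqd u1 u0 -> C y.
  move=> le; have h : `|y - u1| ^+ 2 <= ((n%:R + 1) * d) ^+ 2.
    apply: le_trans (norm_le_sqd _ _) _; apply: le_trans le _.
    apply: le_trans (sqd_le_norm _ _) _; rewrite distrC exprMn.
    apply: ler_pM => //.
      by rewrite expr2; have := ler0n R n; move: (n%:R : R) => x x0; nra.
    by rewrite lerXn2r ?nnegrE// ltW.
  have {}h : `|y - u1| <= (n%:R + 1) * d.
    by rewrite -ler_sqr ?nnegrE// mulr_ge0 ?addr_ge0// ltW.
  rewrite /C/= -(subrK u1 y) -addrA; apply: le_trans (ler_normD _ _) _.
  have -> : r = (n%:R + 3) * d by rewrite /d mulrCA mulfV ?mulr1// gt_eqF.
  apply: le_trans (lerD h (ltW u1d)) _.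
  by rewrite -[X in _ + X]mul1r -mulrDl ler_pM2r// -addrA lerD2l; lra.
have cK : compact [set y | C y /\ f y = m].
  apply: closed_in_cube; first exact: cube_compact.
  move=> y Cy ne; have lt : f y < m by rewrite lt_neqAle (fm (CU _ Cy)) andbT; exact/eqP.
  have := near_lt_cont (smooth_continuous sf (CU _ Cy)) (@cont_cst R _ m y) lt.
  by apply: filterS => z zm e; rewrite e ltxx in zm.
have K0 : [set y | C y /\ f y = m] !=set0 by exists u0; split=> //; rewrite /C/= subrr normr0 ltW.
have [y0 [Cy0 fy0] ymin] : exists2 x, [set y | C y /\ f y = m] x &
    forall y, [set y | C y /\ f y = m] y -> sqd u1 x <= sqd u1 y.
  by apply: compact_min => // x [Cx _]; apply: (smooth_continuous (sqd_smooth u1 oU)); exact: CU.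
have le0 : sqd u1 y0 <= sqd u1 u0 by apply: ymin; split=> //; rewrite /C/= subrr normr0 ltW.
have y01 : y0 != u1 by apply: contra_neq fu1 => <-.
apply: (@hopf_touching (2^-1 *: (u1 + y0)) y0 (CU _ Cy0) fy0).
  apply: contra_neq y01 => e.
  have : 2 *: y0 = u1 + y0 by rewrite {1}e scalerA divff// scale1r.
  by rewrite scaler_nat mulr2n => /addIr.
move=> y Uy le ne; have lt := sqd_midpoint ne le.
rewrite lt_neqAle (fm Uy) andbT; apply/eqP => fy.
have Cy : C y by apply: Cu; apply: ltW (lt_le_trans lt le0).
by have := ymin y (conj Cy fy); rewrite leNgt lt.
Qed.

End StrongMaximum.

Lemma derive_mxtrace (R : realType) (V : normedModType R) n (X : V -> 'M[R]_n) u v :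
  derivable X u v -> 'D_v (fun w => \tr (X w)) u = \tr ('D_v X u).
Proof.
move=> dX; rewrite /mxtrace (_ : (fun w => _) = \sum_i (fun w => X w i i)); last first.
  by apply/funext => w; rewrite fct_sumE.
rewrite derive_sum => [|i]; first by apply: eq_bigr => i _; rewrite derive_mxE.
by have /derivable_mxP := dX; apply.
Qed.

Lemma derive_mulmx4_eq0 (R : realType) (V : normedModType R) k l (X1 : V -> 'M[R]_k)
    (X2 : V -> 'M[R]_(k, l)) (X3 : V -> 'M[R]_l) u v :
  derivable X1 u v -> derivable X2 u v -> derivable X3 u v ->
  'D_v X1 u = 0 -> 'D_v X2 u = 0 -> 'D_v X3 u = 0 ->
  'D_v (fun w => X1 w *m X2 w *m X3 w *m (X2 w)^T) u = 0.
Proof.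
move=> d1 d2 d3 e1 e2 e3.
have d12 := derivable_mulmx d1 d2; have d123 := derivable_mulmx d12 d3.
rewrite (derive_mulmx d123 (derivable_trmx d2)) (derive_mulmx d12 d3) (derive_mulmx d1 d2).
by rewrite (derive_trmx d2) e1 e2 e3 trmx0 !(mul0mx, mulmx0, addr0).
Qed.

Lemma posdef_block (R : realType) p q (B : 'M[R]_q) : posdef B ->
  posdef (block_mx (1%:M : 'M[R]_p) 0 0 B).
Proof.
move=> pB v v0; rewrite -(hsubmxK v) /bform mul_row_block !mulmx0 addr0 add0r mulmx1.
rewrite tr_row_mx mul_row_col mxE.
have e : (lsubmx v *m (lsubmx v)^T) 0 0 = \sum_i (lsubmx v 0 i) ^+ 2.
  by rewrite mxE; apply: eq_bigr => i _; rewrite ![_^T _ _]mxE expr2.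
rewrite e; have [r0|r0] := eqVneq (rsubmx v) 0; last first.
  apply: ltr_wpDl; first by apply: sumr_ge0 => i _; exact: sqr_ge0.
  exact: pB.
have -> : (rsubmx v *m B *m (rsubmx v)^T) 0 0 = 0 by rewrite r0 !mul0mx mxE.
rewrite addr0 lt_def sumr_ge0 ?andbT => [|i _]; last exact: sqr_ge0.
apply: contra_neq v0 => /psumr_all0 H; rewrite -(hsubmxK v) r0.
have -> : lsubmx v = 0.
  apply/rowP => i; rewrite [RHS]mxE; apply/eqP; rewrite -sqrf_eq0; apply/eqP; apply: H => j; exact: sqr_ge0.
by rewrite row_mx0.
Qed.

Lemma first_order_terms (R : comPzRingType) q (g H : 'I_q -> 'I_q -> R)
    (C : 'I_q -> 'I_q -> 'I_q -> R) (D : 'I_q -> R) :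
  \sum_l \sum_k g l k * H l k + \sum_i - (\sum_l \sum_k g l k * C l k i) * D i =
  \sum_l \sum_k g l k * (H l k - \sum_i C l k i * D i).
Proof.
have -> : \sum_i - (\sum_l \sum_k g l k * C l k i) * D i =
    - \sum_l \sum_k g l k * \sum_i C l k i * D i.
  transitivity (\sum_i \sum_l \sum_k - (g l k * C l k i * D i)).
    apply: eq_bigr => i _; rewrite mulNr mulr_suml -sumrN; apply: eq_bigr => l _.
    by rewrite mulr_suml -sumrN.
  rewrite exchange_big/= -sumrN; apply: eq_bigr => l _.
  rewrite exchange_big/= -sumrN; apply: eq_bigr => k _.
  by rewrite mulr_sumr -sumrN; apply: eq_bigr => i _; rewrite mulrA.
rewrite -sumrB; apply: eq_bigr => l _; rewrite -sumrB; apply: eq_bigr => k _.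
by rewrite mulrBr.
Qed.

(** * The energy density as a subsolution of an elliptic equation *)

Section EnergyMaximum.
Variables (R : realType) (p q p' q' : nat).
Variables (U : set 'rV[R]_(p + q)) (G : 'rV[R]_(p + q) -> 'M[R]_(p + q)).
Variables (O' : set 'rV[R]_(p' + q')) (G' : 'rV[R]_(p' + q') -> 'M[R]_(p' + q')).
Variable F : 'rV[R]_(p + q) -> 'rV[R]_(p' + q').
Hypotheses (cm : chart_metric U G) (cm' : chart_metric O' G') (cF : chart_map U O' F).
Let oU : open U := cm_open cm.
Notation gb := (transverse_metric G).
Notation gbi := (fun u => invmx (transverse_metric G u)).
Notation energy := (energy G G' F).

Lemma energy_mx_smooth : mxsmooth U (fun u => gbi u *m S F u *m Hm G' F u *m (S F u)^T).
Proof.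
apply: (mxsmooth_mul oU); last by apply: (mxsmooth_tr oU); exact: (S_smooth cm cF).
apply: (mxsmooth_mul oU); last exact: (Hm_smooth cm cm' cF).
apply: (mxsmooth_mul oU); [exact: (gbi_smooth cm)|exact: (S_smooth cm cF)].
Qed.

Lemma energy_smooth : smooth_on U energy.
Proof. by apply: (smooth_sum oU) => i _; exact: energy_mx_smooth. Qed.

Lemma energy_mx_basic u v : U u -> rsubmx v = 0 ->
  'D_v (fun u => gbi u *m S F u *m Hm G' F u *m (S F u)^T) u = 0.
Proof.
move=> Uu v0.
have dgi : derivable (fun u => gbi u) u v.
  exact: (diff_derivable (mxsmooth_differentiable oU (gbi_smooth cm) Uu)).
have dS : derivable (S F) u v.
  exact: (diff_derivable (mxsmooth_differentiable oU (S_smooth cm cF) Uu)).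
have dH : derivable (Hm G' F) u v.
  exact: (diff_derivable (mxsmooth_differentiable oU (Hm_smooth cm cm' cF) Uu)).
have gi0 := gbi_basic cm Uu v0; have S0 := S_basic cm cF Uu v0.
have H0 : 'D_v (Hm G' F) u = 0.
  rewrite /Hm (derive_comp_basic cm cm' cF v Uu (gb_smooth cm')); last first.
    by move=> w z Ow; exact: (cm_bundle_like cm').
  by apply: big1 => c _; rewrite (phi_basic cm cF Uu v0) mxE scale0r.
exact: (derive_mulmx4_eq0 dgi dS dH).
Qed.

Lemma energy_basic u v : U u -> rsubmx v = 0 -> 'D_v energy u = 0.
Proof.
move=> Uu v0; rewrite /energy derive_mxtrace ?energy_mx_basic ?mxtrace0//.
exact: (diff_derivable (mxsmooth_differentiable oU energy_mx_smooth Uu)).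
Qed.

Let A u : 'M[R]_(p + q) := block_mx 1%:M 0 0 (gbi u).
Let B u : 'rV[R]_(p + q) :=
  row_mx 0 (\row_i - \sum_l \sum_k gbi u l k * Gam G l u k i).

Let sA : mxsmooth U A.
Proof.
move=> i j; case: (split_ordP i) => i' ->; case: (split_ordP j) => j' ->.
- by apply: (smooth_eq oU _ (smooth_cst ((1%:M : 'M[R]_p) i' j'))) => u _; rewrite block_mxEul.
- by apply: (smooth_eq oU _ (smooth_cst (0 : R))) => u _; rewrite block_mxEur mxE.
- by apply: (smooth_eq oU _ (smooth_cst (0 : R))) => u _; rewrite block_mxEdl mxE.
- by apply: (smooth_eq oU _ (gbi_smooth cm i' j')) => u _; rewrite block_mxEdr.
Qed.

Let sB : mxsmooth U B.
Proof.
apply: (mxsmooth_row oU) => i j; rewrite ord1.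
  by apply: (smooth_eq oU _ (smooth_cst (0 : R))) => u _; rewrite mxE.
apply: (smooth_eq oU (f := fun u => - \sum_l \sum_k gbi u l k * Gam G l u k j)) => [u _|]; first by rewrite mxE.
apply: (smoothN oU); apply: (smooth_sum oU) => l _; apply: (smooth_sum oU) => k _.
by apply: (smoothM oU); [exact: (gbi_smooth cm)|exact: (Gam_smooth cm)].
Qed.

Let gbiT u : U u -> (gbi u)^T = gbi u.
Proof. by move=> Uu; rewrite trmx_inv (gbT cm Uu). Qed.

Let pA u : U u -> posdef (A u).
Proof.
move=> Uu; apply: posdef_block.
have ug := gb_unit cm Uu.
have := posdef_congr (L := gbi u) (gb_pos cm Uu); rewrite mulVmx// mul1mx gbiT//; apply.
by move=> v e; rewrite -[v]mulmx1 -(mulVmx ug) mulmxA e mul0mx.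
Qed.

Let tA u : U u -> (A u)^T = A u.
Proof. by move=> Uu; rewrite /A tr_block_mx gbiT// trmx1 !trmx0. Qed.

Lemma elliptic_energy u : U u -> elliptic A B energy u = transverse_laplacian G energy u.
Proof.
move=> Uu; have p0 k w : U w -> partial (lshift q k) energy w = 0.
  move=> Uw; apply: energy_basic => //; apply/rowP => j; rewrite !mxE.
  by rewrite eq_rlshift andbF.
have p02 k w i : U w -> partial i (partial (lshift q k) energy) w = 0.
  move=> Uw; rewrite /partial (eq_on_derive _ oU (g := fun=> 0) (p0 k) Uw).
  exact: derive_cst.
rewrite /elliptic big_split_ord/= big1 ?add0r => [|l _]; last first.
  rewrite big_split_ord/= !big1 ?addr0// => k _.
    by rewrite block_mxEur mxE mul0r.
  by rewrite p02// mulr0.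
rewrite [X in _ + X]big_split_ord/= [X in _ + (X + _)]big1 ?add0r => [|k _]; last first.
  by rewrite p0// mulr0.
have e1 l : \sum_k A u (rshift p l) k * partial (rshift p l) (partial k energy) u =
    \sum_k gbi u l k * partial (rshift p l) (partial (rshift p k) energy) u.
  rewrite big_split_ord/= big1 ?add0r => [|k _]; last by rewrite p02// mulr0.
  by apply: eq_bigr => k _; rewrite block_mxEdr.
rewrite (eq_bigr _ (fun l _ => e1 l)).
have e2 i : B u 0 (rshift p i) = - \sum_l \sum_k gbi u l k * Gam G l u k i.
  by rewrite row_mxEr mxE.
rewrite [X in _ + X](eq_bigr _ (fun i _ => congr1 (fun b => b * _) (e2 i))).
exact: first_order_terms.
Qed.

Lemma energy_local_max m :
  (forall u, U u -> 0 <= transverse_laplacian G energy u) ->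
  (forall u, U u -> energy u <= m) -> forall u0, U u0 -> energy u0 = m ->
  \forall u \near u0, energy u = m.
Proof.
move=> L0 le u0 Uu0 e.
apply: (strong_maximum oU sA sB pA tA energy_smooth le _ Uu0 e) => u Uu.
by rewrite elliptic_energy// L0.
Qed.

Lemma transverse_laplacian_cst m u : U u -> (\forall w \near u, energy w = m) ->
  transverse_laplacian G energy u = 0.
Proof.
move=> Uu /(@near_normP R 'rV[R]_(p + q) _ u)[d d0 dE].
have oB : open (ball u d) by exact: ball_open.
have Bu : ball u d u by exact: ballxx.
have BE w : ball u d w -> energy w = (fun=> m) w.
  by rewrite -ball_normE/= distrC => /dE.
have p0 k w : ball u d w -> partial k energy w = 0.
  by move=> Bw; rewrite /partial (eq_on_derive _ oB BE Bw); exact: derive_cst.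
have p02 k l : partial l (partial k energy) u = 0.
  rewrite /partial (eq_on_derive _ oB (g := fun=> 0) (p0 k) Bu); exact: derive_cst.
rewrite /transverse_laplacian big1// => l _; rewrite big1// => k _.
rewrite p02 sub0r big1 ?oppr0 ?mulr0// => i _.
by rewrite p0// mulr0.
Qed.

End EnergyMaximum.

(** * Change of charts and constancy of the energy *)

Lemma open_local (T : topologicalType) (A : set T) :
  (forall x, A x -> \forall y \near x, A y) -> open A.
Proof. by move=> H; rewrite openE => x Ax; exact: H. Qed.

Lemma chart_metricS (R : realType) p q (U V : set 'rV[R]_(p + q)) G :
  open V -> V `<=` U -> chart_metric U G -> chart_metric V G.
Proof.
move=> oV VU [oU sG tG pG bG]; split=> //.
- by move=> i j s u /VU; exact: sG.
- by move=> u /VU; exact: tG.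
- by move=> u /VU; exact: pG.
- by move=> u v /VU; exact: bG.
Qed.

Section Charts.
Variables (R : realType) (p q : nat) (M : foliated_riemannian_manifold R p q).

Lemma metric_chart i : chart_metric (cod M i) (metric M i).
Proof.
split; first exact: cod_open.
- by move=> k l; exact: metric_smooth.
- exact: Defs.metric_sym.
- by move=> u Ou v; exact: metric_pos.
- exact: metric_bundle_like.
Qed.

Definition overlap (i j : chart_index M) := [set u | cod M i u /\ dom M j (param M i u)].
Definition transition (i j : chart_index M) := chart M j \o param M i.

Lemma near_param i u (A : set M) : cod M i u -> open A -> A (param M i u) ->
  \forall w \near u, cod M i w /\ A (param M i w).
Proof.
move=> cu oA Au.
have H : \forall w \near u, A (param M i w).
  exact: (param_continuous cu (open_near oA Au)).
have H2 := open_near (@cod_open _ _ _ M i) cu.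
by near=> w; split; near: w.
Unshelve. all: by end_near. Qed.

Lemma overlap_open i j : open (overlap i j).
Proof. by apply: open_local => u [cu du]; exact: near_param cu (@dom_open _ _ _ M j) du. Qed.

Lemma overlap_metric i j : chart_metric (overlap i j) (metric M i).
Proof. by apply: chart_metricS (metric_chart i); [exact: overlap_open|move=> u []]. Qed.

Lemma transition_map i j : chart_map (overlap i j) (cod M j) (transition i j).
Proof.
split; first exact: transition_smooth.
- by move=> u [cu du]; exact: chart_cod.
- by move=> u v [cu du]; exact: transition_foliated.
Qed.

Lemma transition_differentiable i j u : overlap i j u -> differentiable (transition i j) u.
Proof. exact: (F_differentiable (overlap_metric i j) (transition_map i j)). Qed.

Lemma overlap_transition i j u : overlap i j u -> overlap j i (transition i j u).
Proof.
move=> [cu du]; split; first exact: chart_cod.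
by rewrite /transition /= chartK//; exact: param_dom.
Qed.

Lemma transitionK i j u : overlap i j u -> transition j i (transition i j u) = u.
Proof. by move=> [cu du]; rewrite /transition /= chartK// paramK. Qed.

Lemma derive_transitionK i j u v : overlap i j u ->
  'D_('D_v (transition j i) (transition i j u)) (transition i j) u = v.
Proof.
move=> Ou; have Ot := overlap_transition Ou.
have d1 := transition_differentiable Ot; have d2 := transition_differentiable Ou.
have e := transitionK Ou.
have := derive_comp v d1; rewrite e => /(_ _ (transition i j) d2) <-.
rewrite (eq_on_derive v (@overlap_open j i) (g := id) _ Ot) => [|w Ow]; last exact: transitionK.
by rewrite derive_id.
Qed.

Lemma horizontalP (O : set 'rV[R]_(p + q)) G (cm : chart_metric O G) u (x : 'rV[R]_(p + q)) : O u ->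
  (forall z : 'rV[R]_(p + q), rsubmx z = 0 -> bform (G u) x z = 0) ->
  x = rsubmx x *m sigma_mx G u.
Proof.
move=> Ou H; apply/eqP; rewrite -subr_eq0; set y := x - _.
have y0 : rsubmx y = 0 by rewrite rsubB rsub_sigma subrr.
rewrite -(posdef_eq0 _ (cm_pos cm Ou)) {1}/y bformDl H// add0r bformNl.
by rewrite (bformC _ _ (cm_sym cm Ou)) (bform_horizontal cm _ _ Ou) y0 bform0l oppr0.
Qed.

(** A coordinate change preserves the leaves and the metric, hence the orthogonal complement of the
    leaves too: it maps horizontal lifts to horizontal lifts, and [J] is its action on Q. *)
Lemma transition_jacobian i j u : overlap i j u -> exists J : 'M[R]_q,
  [/\ J \in unitmx,
      forall v, rsubmx ('D_v (transition i j) u) = rsubmx v *m J &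
      J *m transverse_metric (metric M j) (transition i j u) *m J^T =
        transverse_metric (metric M i) u].
Proof.
move=> Ou; have [cu du] := Ou.
have cmi := overlap_metric i j; have ct := transition_map i j.
have cmj := metric_chart j; have ctu := cmap_dom ct Ou.
have JE v : rsubmx ('D_v (transition i j) u) = rsubmx v *m S (transition i j) u.
  by rewrite -(derive_phi cmi ct)// (derive_phiS cmi ct).
move: (S _ _) JE => J JE.
have hor a : 'D_(a *m sigma_mx (metric M i) u) (transition i j) u =
    a *m J *m sigma_mx (metric M j) (transition i j u).
  have e : a *m J = rsubmx ('D_(a *m sigma_mx (metric M i) u) (transition i j) u).
    by rewrite JE rsub_sigma.
  rewrite e; apply: (horizontalP cmj ctu) => z z0.
  rewrite -(derive_transitionK z Ou).
  rewrite (metric_compat _ _ cu du) (bformC _ _ (Defs.metric_sym cu)).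
  rewrite (bform_horizontal (metric_chart i) _ _ cu).
  rewrite (cmap_foliated (transition_map j i) (overlap_transition Ou) z0).
  exact: bform0l.
have gE : J *m transverse_metric (metric M j) (transition i j u) *m J^T =
    transverse_metric (metric M i) u.
  apply/matrixP => a b; rewrite -[LHS]bform_delta -[RHS]bform_delta.
  apply: etrans (esym (bform_mul _ _ _ _ _)) _; rewrite !bform_gb -!hor.
  exact: (metric_compat _ _ cu du).
exists J; split=> //.
have := gb_unit cmi Ou; rewrite -gE -mulmxA => ug.
by have := ug; rewrite !unitmxE det_mulmx unitrM => /andP[].
Qed.

End Charts.

Section LocalRepresentatives.
Variables (R : realType) (p q p' q' : nat).
Variables (M : foliated_riemannian_manifold R p q).
Variables (M' : foliated_riemannian_manifold R p' q').
Variable phi : M -> M'.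
Hypotheses (phi_smooth : smooth_mapping phi) (phi_foliated : foliated_mapping phi).

Lemma local_dom_open i j : open (local_dom phi i j).
Proof.
have oA : open (phi @^-1` dom M' j).
  by apply: open_comp; [move=> x _; exact: phi_smooth.1|exact: dom_open].
by apply: open_local => u [cu du]; exact: near_param cu oA du.
Qed.

Lemma local_metric i j : chart_metric (local_dom phi i j) (metric M i).
Proof. by apply: chart_metricS (metric_chart i); [exact: local_dom_open|move=> u []]. Qed.

Lemma local_map i j : chart_map (local_dom phi i j) (cod M' j) (local_rep phi i j).
Proof.
split; first exact: phi_smooth.2.
- by move=> u [cu du]; exact: chart_cod.
- by move=> u v; exact: phi_foliated.
Qed.

(** The pull-back of the metric of Q' by [d_T phi], as a form on Q. *)
Definition pulled_form i j u : 'M[R]_q :=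
  S (local_rep phi i j) u *m Hm (metric M' j) (local_rep phi i j) u *m (S (local_rep phi i j) u)^T.

Definition local_energy i j :=
  energy (metric M i) (metric M' j) (local_rep phi i j).

(** The endomorphism [(d_T phi)^* d_T phi] of Q, whose traces do not depend on the charts. *)
Definition energy_mx i j u : 'M[R]_q :=
  invmx (transverse_metric (metric M i) u) *m pulled_form i j u.

Lemma local_energyE i j u : local_energy i j u = \tr (energy_mx i j u).
Proof. by rewrite /local_energy /energy /energy_mx /pulled_form !mulmxA. Qed.

Lemma local_dom_transition i i2 j j2 u : local_dom phi i j u -> overlap i i2 u ->
  dom M' j2 (phi (param M i u)) -> local_dom phi i2 j2 (transition i i2 u).
Proof.
move=> [cu du] [_ du2] dp; split; first exact: chart_cod.
by rewrite /transition /= chartK.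
Qed.

(** The local representatives are intertwined by the coordinate changes, so [S] is transformed by
    two transverse Jacobians; the one in the target is absorbed by the metric of Q'. *)
Lemma pulled_form_transition i i2 j j2 u : local_dom phi i j u -> overlap i i2 u ->
  dom M' j2 (phi (param M i u)) ->
  exists J : 'M[R]_q, [/\ J \in unitmx,
     forall v, rsubmx ('D_v (transition i i2) u) = rsubmx v *m J,
     J *m transverse_metric (metric M i2) (transition i i2 u) *m J^T =
       transverse_metric (metric M i) u &
     pulled_form i j u = J *m pulled_form i2 j2 (transition i i2 u) *m J^T].
Proof.
move=> Du Ou dp; have [J [uJ JE Jg]] := transition_jacobian Ou.
have [cu du] := Du; have [_ du2] := Ou.
pose F := local_rep phi i j; pose F2 := local_rep phi i2 j2.
have Du2 := local_dom_transition Du Ou dp.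
have O'u : overlap j j2 (F u).
  by split; [exact: chart_cod|rewrite /F /local_rep chartK].
have [J' [uJ' JE' Jg']] := transition_jacobian O'u.
have cF := local_map i j; have cF2 := local_map i2 j2.
have cm := local_metric i j; have cm2 := local_metric i2 j2.
have eF2 : transition j j2 (F u) = F2 (transition i i2 u).
  by rewrite /transition /F /F2 /local_rep /= !chartK.
have main (v : 'rV[R]_(p + q)) : rsubmx v *m J *m S F2 (transition i i2 u) = rsubmx v *m S F u *m J'.
  have dt := transition_differentiable Ou; have dF2 := F_differentiable cm2 cF2 Du2.
  have dF := F_differentiable cm cF Du; have dt' := transition_differentiable O'u.
  rewrite -JE -(derive_phiS cm2 cF2)// (derive_phi cm2 cF2)// -(derive_phiS cm cF)// (derive_phi cm cF)//.
  rewrite -JE' -(derive_comp v dt dF2) -(derive_comp v dF dt'); congr rsubmx.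
  pose V := [set w | local_dom phi i j w /\ (overlap i i2 w /\ dom M' j2 (phi (param M i w)))].
  have oV : open V.
    have oA : open (phi @^-1` dom M' j2).
      by apply: open_comp; [move=> x _; exact: phi_smooth.1|exact: dom_open].
    apply: open_local => w [Dw [Ow dw]]; have [cw _] := Ow.
    have h1 := open_near (@local_dom_open i j) Dw.
    have h2 := open_near (@overlap_open _ _ _ M i i2) Ow.
    have h3 := near_param cw oA dw.
    by near=> z; split; [near: z; exact: h1|split; [near: z; exact: h2|by have [] : cod M i z /\ dom M' j2 (phi (param M i z)) by near: z; exact: h3]].
  have Vu : V u by [].
  apply: (eq_on_derive v oV _ Vu) => w [[cw dw] [[_ dw2] dpw]].
  by rewrite /transition /F /F2 /local_rep /= !chartK.
have JS : J *m S F2 (transition i i2 u) = S F u *m J'.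
  apply/row_matrixP => k; have := main (row_mx 0 (delta_mx 0 k)).
  by rewrite row_mxKr -!mulmxA -!rowE.
exists J; split=> //.
have HE : Hm (metric M' j) F u = J' *m Hm (metric M' j2) F2 (transition i i2 u) *m J'^T.
  by rewrite /Hm -Jg' eF2.
rewrite /pulled_form -/F -/F2 HE !mulmxA -JS -!mulmxA -trmx_mul.
by rewrite -JS trmx_mul !mulmxA.
Unshelve. all: by end_near. Qed.

(** A change of charts conjugates [energy_mx] by the transpose of [J]. *)
Lemma energy_mx_transition i i2 j j2 u : local_dom phi i j u -> overlap i i2 u ->
  dom M' j2 (phi (param M i u)) ->
  \tr (energy_mx i j u) = \tr (energy_mx i2 j2 (transition i i2 u)) /\
  \tr (energy_mx i j u *m energy_mx i j u) =
  \tr (energy_mx i2 j2 (transition i i2 u) *m energy_mx i2 j2 (transition i i2 u)).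
Proof.
move=> Du Ou dp; have [J [uJ _ Jg eP]] := pulled_form_transition Du Ou dp.
have ug : transverse_metric (metric M i2) (transition i i2 u) \in unitmx.
  by apply: (gb_unit (metric_chart i2)); case: (local_dom_transition Du Ou dp).
have uJT : J^T \in unitmx by rewrite unitmx_tr.
have E : energy_mx i j u = invmx J^T *m energy_mx i2 j2 (transition i i2 u) *m J^T.
  rewrite /energy_mx eP -Jg; move: (transverse_metric _ _) (pulled_form _ _ _) ug => g P ug.
  apply: (can_inj (mulKmx uJT)).
  have uJgJ : J *m g *m J^T \in unitmx by rewrite !unitmx_mul uJ ug.
  have uJg : J *m g \in unitmx by rewrite !unitmx_mul uJ.
  apply: (can_inj (mulKmx uJg)); rewrite !mulmxA mulmxV// mul1mx.
  by rewrite -[J *m g *m J^T *m _]mulmxA mulmxV// mulmx1 -[J *m g *m _]mulmxA mulmxV// mulmx1.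
rewrite E; move: (energy_mx i2 _ _) => X; split.
  by rewrite mxtrace_mulC !mulmxA mulmxV// mul1mx.
have -> : invmx J^T *m X *m J^T *m (invmx J^T *m X *m J^T) = invmx J^T *m (X *m X) *m J^T.
  by rewrite !mulmxA -[_ *m J^T *m invmx _]mulmxA mulmxV// mulmx1.
by rewrite mxtrace_mulC !mulmxA mulmxV// mul1mx.
Qed.

End LocalRepresentatives.

Lemma connected_locally_constant (T : topologicalType) (P : T -> Prop) :
  connected [set: T] -> (forall x, \forall y \near x, P y <-> P x) ->
  forall x y, P x -> P y.
Proof.
move=> cT loc x y Px.
have E : [set z | P z] = setT.
  apply: cT; first by exists x.
  - exists [set z | P z]; last by rewrite setTI.
    by apply: open_local => z Pz; apply: filterS (loc z) => w [_ H]; exact: H.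
  - exists [set z | P z]; last by rewrite setTI.
    move=> z cl; have [w [Pw [H _]]] := cl _ (loc z); exact: H.
by have : [set z | P z] y by rewrite E.
Qed.

Lemma locally_constant (R : realType) n (U : set 'rV[R]_n) (f : 'rV[R]_n -> R) u0 : open U ->
  smooth_on U f -> (forall k u, U u -> partial k f u = 0) -> U u0 ->
  \forall u \near u0, f u = f u0.
Proof.
move=> oU sf p0 Uu0; have /(@near_normP R 'rV[R]_n _ u0)[d d0 dU] := open_near oU Uu0.
have D0 v u : U u -> differentiable f u /\ 'D_v f u = 0.
  move=> Uu; have df := smooth_differentiable oU sf Uu; split=> //.
  by rewrite derive_partial// big1// => k _; rewrite p0// mulr0.
apply/(@near_normP R 'rV[R]_n _ u0); exists d => // w wd.
have seg (s : R) : `|s| <= `|1 : R| -> U (u0 + s *: (w - u0)).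
  move=> s1; apply: dU; rewrite addrC addKr normrZ; apply: le_lt_trans wd.
  by rewrite normr1 in s1; rewrite ler_piMl.
have [|s s1] := @mean_value_line R 'rV[R]_n f u0 (w - u0) 1.
  by move=> s /seg Us; apply: diff_derivable; have [] := D0 0 _ Us.
rewrite scale1r [u0 + _]addrC subrK => e; apply/eqP; rewrite -subr_eq0; apply/eqP; apply: etrans e _.
by have [_ ->] := D0 (w - u0) _ (seg s s1); rewrite mulr0.
Qed.

(** * The Bochner argument on a compact connected manifold *)

Section Global.
Variables (R : realType) (p q p' q' : nat).
Variables (M : foliated_riemannian_manifold R p q).
Variables (M' : foliated_riemannian_manifold R p' q').
Variable phi : M -> M'.
Hypotheses (phi_smooth : smooth_mapping phi) (phi_foliated : foliated_mapping phi).
Notation F := (local_rep phi).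
Notation D := (local_dom phi).

Lemma chart_local i j x : dom M i x -> dom M' j (phi x) -> D i j (chart M i x).
Proof. by move=> dx dp; split; [exact: chart_cod|rewrite chartK]. Qed.

Lemma charts_at x : exists i j, dom M i x /\ dom M' j (phi x).
Proof. by have [i di] := dom_cover x; have [j dj] := dom_cover (phi x); exists i, j. Qed.

(** Values computed in charts chosen at each point define one function on [M], since the local
    expressions are compatible. *)
Lemma global_function (f : forall (i : chart_index M) (j : chart_index M'), 'rV[R]_(p + q) -> R) :
  (forall i i2 j j2 u, D i j u -> overlap i i2 u -> dom M' j2 (phi (param M i u)) ->
     f i j u = f i2 j2 (transition i i2 u)) ->
  exists e : M -> R, forall i j u, D i j u -> f i j u = e (param M i u).
Proof.
move=> H; have /choice[ci Hi] := charts_at; have /choice[cj Hj] := Hi.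
exists (fun x => f (ci x) (cj x) (chart M (ci x) x)) => i j u [cu du].
by have [d1 d2] := Hj (param M i u); rewrite (H i (ci (param M i u)) j (cj (param M i u))).
Qed.

Lemma transfer_near i j x (P : 'rV[R]_(p + q) -> Prop) : dom M i x ->
  (\forall u \near chart M i x, P u) -> dom M' j (phi x) ->
  \forall y \near x, dom M i y /\ dom M' j (phi y) /\ P (chart M i y).
Proof.
move=> dx nP dp.
have H1 : \forall y \near x, P (chart M i y) := chart_continuous dx nP.
have H2 := open_near (@dom_open _ _ _ M i) dx.
have H3 : \forall y \near x, dom M' j (phi y).
  exact: (phi_smooth.1 x _ (open_near (@dom_open _ _ _ M' j) dp)).
by near=> y; split; [near: y|split; near: y].
Unshelve. all: by end_near. Qed.

Hypotheses (M_compact : compact [set: M]) (M_connected : connected [set: M]).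
Hypothesis M_ricci : forall x : M, transverse_ricci_nonneg_at x.
Hypothesis M'_sectional : forall x' : M', transverse_sectional_nonpos_at x'.
Hypothesis phi_harmonic : transversally_harmonic phi.

Lemma harmonic_local i j u : D i j u -> \sum_l \sum_k
  invmx (transverse_metric (metric M i) u) l k *: row k (IIm (metric M i) (metric M' j) (F i j) l u) = 0.
Proof.
move=> Du; have cm := local_metric phi_smooth i j; have cm' := metric_chart (M := M') j.
have cF := local_map phi_smooth phi_foliated i j.
have [P oP [eP _ _]] := frame_exists cm Du.
apply: etrans _ (phi_harmonic Du oP); rewrite /tension_field eP.
transitivity (\sum_a \sum_l P a l *: (row a P *m IIm (metric M i) (metric M' j) (F i j) l u)); last first.
  apply: eq_bigr => a _; rewrite (second_fundamental_formE cm cm' cF _ _ Du).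
  by apply: eq_bigr => l _; rewrite row_entry.
move: (IIm _ _ _) => X; rewrite [RHS]exchange_big/=; apply: eq_bigr => l _.
transitivity (\sum_k \sum_a (P a l * P a k) *: row k (X l u)).
  by apply: eq_bigr => k _; rewrite mxE scaler_suml; apply: eq_bigr => a _; rewrite mxE.
rewrite exchange_big/=; apply: eq_bigr => a _.
rewrite mulmx_sum_row scaler_sumr; apply: eq_bigr => k _.
by rewrite row_entry scalerA.
Qed.

Lemma ricci_local i j u : D i j u -> forall E, orthonormal_frame (metric M i) u E ->
  forall c, 0 <= bform (transverse_metric (metric M i) u) (RicQ (metric M i) E u c) c.
Proof.
move=> [cu du] E; have := M_ricci (param_dom cu); rewrite paramK// => H; exact: H.
Qed.

Lemma sectional_local i j u : D i j u -> forall a b : 'rV[R]_q',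
  row_free (col_mx a b) -> KQ (metric M' j) (F i j u) a b <= 0.
Proof. by move=> [cu du] a b; exact: M'_sectional. Qed.

Lemma energy_constant : exists m : R, forall i j u, D i j u -> local_energy phi i j u = m.
Proof.
have [|e eE] := @global_function (fun i j => local_energy phi i j).
  move=> i i2 j j2 u Du Ou dp; rewrite !local_energyE.
  by have [] := energy_mx_transition phi_smooth phi_foliated Du Ou dp.
have se i j : smooth_on (D i j) (local_energy phi i j).
  exact: (energy_smooth (local_metric phi_smooth i j) (metric_chart (M := M') j)
    (local_map phi_smooth phi_foliated i j)).
have eX i j x : dom M i x -> dom M' j (phi x) -> e x = local_energy phi i j (chart M i x).
  by move=> dx dp; rewrite (eE _ _ _ (chart_local dx dp)) chartK.
have ce x : {for x, continuous e}.
  have [i [j [dx dp]]] := charts_at x.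
  have c1 : {for chart M i x, continuous (local_energy phi i j)}.
    exact: (smooth_continuous (se i j) (chart_local dx dp)).
  move=> A; rewrite (eX i j x dx dp) => /c1 HA.
  have := transfer_near dx HA dp; rewrite !near_simpl; apply: filterS => y [dy [dpy Ay]].
  by rewrite /= (eX i j y).
have [x0 _ xmax] := compact_max M_compact (ex_intro _ point I) (fun x _ => ce x).
exists (e x0) => i j u Du; rewrite (eE _ _ _ Du).
(* The set where the maximum is attained is closed by continuity and open by the strong maximum
   principle. *)
apply: (@connected_locally_constant M (fun x => e x = e x0) M_connected _ x0) => // x.
have [i1 [j1 [dx dp]]] := charts_at x.
have Dx := chart_local dx dp.
have [ex|nex] := pselect (e x = e x0); last first.
  have lt : e x < e x0 by rewrite lt_neqAle xmax// andbT; exact/eqP.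
  have : \forall y \near x, e y < e x0 by exact: (ce x _ (lt_nbhsl lt)).
  by apply: filterS => y ly; split=> // e1; rewrite e1 ltxx in ly.
have H : \forall u \near chart M i1 x, local_energy phi i1 j1 u = e x0.
  apply: (energy_local_max (local_metric phi_smooth i1 j1) (metric_chart (M := M') j1)
    (local_map phi_smooth phi_foliated i1 j1)) => //.
  - move=> w Dw; apply: (laplacian_energy_ge0 (local_metric phi_smooth i1 j1) (metric_chart (M := M') j1)
      (local_map phi_smooth phi_foliated i1 j1) (@harmonic_local i1 j1) Dw).
      exact: (ricci_local Dw).
    exact: (sectional_local Dw).
  - by move=> w Dw; apply: le_trans (xmax (param M i1 w) I); rewrite -(eE _ _ _ Dw).
  - by rewrite -[LHS]/(local_energy phi i1 j1 _) -eX.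
have := transfer_near dx H dp; apply: filterS => y [dy [dpy Ey]]; split=> // _.
by rewrite (eX i1 j1).
Qed.

Lemma laplacian_energy0 i j u : D i j u ->
  transverse_laplacian (metric M i) (local_energy phi i j) u = 0.
Proof.
move=> Du; have [m mE] := energy_constant.
apply: (transverse_laplacian_cst (m := m) Du).
by apply: filterS (open_near (@local_dom_open _ _ _ _ _ _ _ _ phi_smooth i j) Du) => w; exact: mE.
Qed.

Lemma bochner_local i j u : D i j u ->
  [/\ forall k, IIm (metric M i) (metric M' j) (F i j) k u = 0,
    (forall E, orthonormal_frame (metric M i) u E -> forall c, c != 0 ->
       0 < bform (transverse_metric (metric M i) u) (RicQ (metric M i) E u c) c) ->
      S (F i j) u = 0 &
    (forall a b : 'rV[R]_q', row_free (col_mx a b) -> KQ (metric M' j) (F i j u) a b < 0) ->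
      rank_le1 (S (F i j) u)].
Proof.
move=> Du; apply: (laplacian_energy_eq0 (local_metric phi_smooth i j) (metric_chart (M := M') j)
  (local_map phi_smooth phi_foliated i j) (@harmonic_local i j) Du).
- exact: (ricci_local Du).
- exact: (sectional_local Du).
- exact: (laplacian_energy0 Du).
Qed.

Lemma totally_geodesic : transversally_totally_geodesic phi.
Proof.
move=> i j u Du a b; rewrite (second_fundamental_formE (local_metric phi_smooth i j)
  (metric_chart (M := M') j) (local_map phi_smooth phi_foliated i j) _ _ Du).
by have [II0 _ _] := bochner_local Du; apply: big1 => k _; rewrite II0 mulmx0 scaler0.
Qed.

Lemma energy_factor i j u : D i j u -> exists N (P : 'M[R]_q) (K : 'M[R]_q'),
  [/\ P \in unitmx, K \in unitmx, N = P *m S (F i j) u *m K,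
      \tr (energy_mx phi i j u) = \tr (N *m N^T) &
      \tr (energy_mx phi i j u *m energy_mx phi i j u) = \tr (N *m N^T *m (N *m N^T))].
Proof.
move=> Du; have cm := local_metric phi_smooth i j; have cm' := metric_chart (M := M') j.
have cF := local_map phi_smooth phi_foliated i j; have OFu := cmap_dom cF Du.
have [P _ [eP _ uP]] := frame_exists cm Du.
have [K eK uK] := square_factor (gb_pos cm' OFu) (gbT cm' OFu).
exists (P *m S (F i j) u *m K), P, K; split=> //.
  by rewrite -trace_form_square /energy_mx /pulled_form eP -eK !mulmxA.
by rewrite -trace_form_square2 /energy_mx /pulled_form eP -eK !mulmxA.
Qed.

(** The energy is constant: if [S] vanishes at one point, the energy is zero everywhere, and zero
    energy forces [S = 0]. *)
Lemma transversally_constantP : transversally_constant phi <->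
  exists i j u, D i j u /\ S (F i j) u = 0.
Proof.
split=> [tc|[i [j [u [Du S0]]]]].
  have [i [j [dx dp]]] := charts_at point; exists i, j, (chart M i point).
  have Dx := chart_local dx dp; split=> //; apply/row_matrixP => k; rewrite row0E.
  rewrite rowK.
  rewrite (derive_phi (local_metric phi_smooth i j) (local_map phi_smooth phi_foliated i j) _ Dx).
  exact: tc.
have [m mE] := energy_constant.
have m0 : m = 0.
  rewrite -(mE i j u Du) local_energyE /energy_mx /pulled_form S0 !mul0mx mulmx0.
  exact: mxtrace0.
move=> i2 j2 u2 v Du2.
have cm := local_metric phi_smooth i2 j2; have cF := local_map phi_smooth phi_foliated i2 j2.
rewrite -(derive_phi cm cF _ Du2) (derive_phiS cm cF _ Du2).
have [N [P [K [uP uK eN e1 _]]]] := energy_factor Du2.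
have := mE i2 j2 u2 Du2; rewrite local_energyE e1 m0 => /mxtrace_mul_tr_eq0; rewrite eN => e.
have -> : S (F i2 j2) u2 = 0.
  by apply: (can_inj (mulKmx uP)); apply: (can_inj (mulmxK uK)); rewrite e mulmx0 mul0mx.
by rewrite mulmx0.
Qed.

Lemma ricci_pos_constant (x : M) : transverse_ricci_pos_at x -> transversally_constant phi.
Proof.
move=> rx; apply/transversally_constantP.
have [i [j [dx dp]]] := charts_at x; exists i, j, (chart M i x).
have Dx := chart_local dx dp; split=> //.
by have [_ H _] := bochner_local Dx; apply: H; exact: rx.
Qed.

Lemma trace_sq_constant : exists m : R, forall i j u, D i j u ->
  \tr (energy_mx phi i j u *m energy_mx phi i j u) = m.
Proof.
have [|e eE] := @global_function (fun i j u => \tr (energy_mx phi i j u *m energy_mx phi i j u)).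
  move=> i i2 j j2 u Du Ou dp.
  by have [] := energy_mx_transition phi_smooth phi_foliated Du Ou dp.
exists (e point) => i j u Du; rewrite (eE _ _ _ Du).
apply: (@connected_locally_constant M (fun x => e x = e point) M_connected _ point) => // x.
have [i1 [j1 [dx dp]]] := charts_at x; have Dx := chart_local dx dp.
have cm := local_metric phi_smooth i1 j1; have cm' := metric_chart (M := M') j1.
have cF := local_map phi_smooth phi_foliated i1 j1; have oD := cm_open cm.
pose X u := invmx (transverse_metric (metric M i1) u) *m S (F i1 j1) u *m
  Hm (metric M' j1) (F i1 j1) u *m (S (F i1 j1) u)^T.
have XE w : energy_mx phi i1 j1 w = X w by rewrite /energy_mx /pulled_form /X !mulmxA.
have sX : mxsmooth (D i1 j1) X := energy_mx_smooth cm cm' cF.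
have bX w v : D i1 j1 w -> rsubmx v = 0 -> 'D_v X w = 0 by exact: (energy_mx_basic cm cm' cF).
have pX w k : D i1 j1 w -> partial (rshift p k) (fun u => \tr (X u *m X u)) w = 0.
  move=> Dw; apply: (parallel_trace_sq_at cm cm' cF Dw) => l z Dz.
  by have [] := bochner_local Dz.
move: X XE sX bX pX => X XE sX bX pX.
have sXX := mxsmooth_mul oD sX sX.
have sf : smooth_on (D i1 j1) (fun w => \tr (X w *m X w)).
  by apply: (smooth_sum oD) => a _; exact: sXX.
have H : \forall w \near chart M i1 x, \tr (X w *m X w) = \tr (X (chart M i1 x) *m X (chart M i1 x)).
  apply: (locally_constant oD sf _ Dx) => k w Dw.
  case: (split_ordP k) => a ->; last exact: pX.
  have l0 : rsubmx (delta_mx 0 (lshift q a) : 'rV[R]_(p + q)) = 0.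
    by apply/rowP => b; rewrite !mxE eq_rlshift andbF.
  have dX : derivable X w (delta_mx 0 (lshift q a)).
    exact: (diff_derivable (mxsmooth_differentiable oD sX Dw)).
  have dXX := derivable_mulmx dX dX.
  rewrite /partial (derive_mxtrace dXX) (derive_mulmx dX dX).
  by rewrite (bX _ _ Dw l0) mul0mx mulmx0 addr0 mxtrace0.
have eX z : dom M i1 z -> dom M' j1 (phi z) -> e z = \tr (X (chart M i1 z) *m X (chart M i1 z)).
  move=> dz dpz; have := eE _ _ _ (chart_local dz dpz); rewrite chartK// XE.
  by move/esym.
have := transfer_near dx H dp; apply: filterS => y [dy [dpy Ey]].
suff eyx : e y = e x by rewrite eyx; exact: iff_refl.
by apply: etrans (eX y dy dpy) _; apply: etrans Ey _; exact: esym (eX x dx dp).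
Qed.

Lemma rank_le1_global (x : M) : transverse_sectional_neg_at (phi x) ->
  forall i j u, D i j u -> rank_le1 (S (F i j) u).
Proof.
move=> sx; have [m mE] := energy_constant; have [m2 m2E] := trace_sq_constant.
have [i0 [j0 [dx dp]]] := charts_at x; have Dx := chart_local dx dp.
have rx : rank_le1 (S (F i0 j0) (chart M i0 x)).
  have [_ _ H] := bochner_local Dx; apply: H => a b.
  by rewrite /local_rep chartK//; exact: sx.
(* Rank at most one at [x] gives this relation between two global constants, which in turn gives the
   rank bound at every point. *)
have mm : m2 = m ^+ 2.
  have [N [P [K [uP uK eN e1 e2]]]] := energy_factor Dx.
  rewrite -(mE _ _ _ Dx) -(m2E _ _ _ Dx) local_energyE e1 e2.
  by apply/rank_le1_trace; rewrite eN; apply: rank_le1_mulr; exact: rank_le1_mull.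
move=> i j u Du; have [N [P [K [uP uK eN e1 e2]]]] := energy_factor Du.
have rN : rank_le1 N.
  by apply/rank_le1_trace; rewrite -e1 -e2 -local_energyE (mE _ _ _ Du) (m2E _ _ _ Du).
have -> : S (F i j) u = invmx P *m N *m invmx K.
  by rewrite eN !mulmxA mulVmx// mul1mx mulmxK.
by apply: rank_le1_mulr; exact: rank_le1_mull.
Qed.

End Global.

(** * Leaves *)

Lemma near_comp (T U : topologicalType) (f : T -> U) x (P : U -> Prop) :
  {for x, continuous f} -> (\forall y \near f x, P y) -> \forall z \near x, P (f z).
Proof. by move=> cf nP; exact: cf _ nP. Qed.

Lemma connected_real (R : realType) : connected [set: R].
Proof. by apply/connected_intervalP => x y _ _ z _. Qed.

Lemma countable_image (T U : Type) (A : set T) (f : T -> U) : countable A -> countable (f @` A).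
Proof. by apply: sub_countable; exact: card_image_le. Qed.

Lemma countable_subset (T : Type) (A B : set T) : A `<=` B -> countable B -> countable A.
Proof. by move=> AB; apply: sub_countable; exact: subset_card_le. Qed.

(** Each value is attained on a basic open set that meets [A] in points with this value only, so
    there are at most as many values as basic sets. *)
Lemma countable_locally_constant (T : topologicalType) (U : choiceType) (A : set T) (f : T -> U) :
  @second_countable T ->
  (forall a, A a -> \forall b \near a, A b -> f b = f a) -> countable (f @` A).
Proof.
move=> [B cB [Bo Bb]] loc.
pose good (b : set T) a := A a /\ b a /\ forall a', A a' -> b a' -> f a' = f a.
have [A0|/set0P[a0 Aa0]] := eqVneq A set0.
  by rewrite A0 image_set0; exact: countable0.
have /choice[g gP] : forall b : set T, exists a, (exists a', good b a') -> good b a.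
  move=> b; have [[a ga]|ne] := pselect (exists a', good b a'); first by exists a.
  by exists a0.
apply: (@countable_subset _ _ ((f \o g) @` B)); last exact: countable_image.
move=> _ [a Aa <-]; have [b [Bb' ba] bN] := Bb a _ (loc a Aa).
have gb : good b a by split=> //; split=> // a' Aa' ba'; exact: bN.
by exists b => //=; have [Ag [bg _]] := gP b (ex_intro _ a gb); exact: bN.
Qed.

Lemma near_ball_sub (R : realType) n (U : set 'rV[R]_n) (u : 'rV[R]_n) : open U -> U u ->
  exists2 r, 0 < r & forall w, `|w - u| < r -> U w.
Proof. by move=> oU Uu; apply/(@near_normP R 'rV[R]_n _ u); exact: open_near. Qed.

Section TransverseConstancy.
Variables (R : realType) (p q p' q' : nat).
Variables (U : set 'rV[R]_(p + q)) (G : 'rV[R]_(p + q) -> 'M[R]_(p + q)).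
Variables (O' : set 'rV[R]_(p' + q')) (F : 'rV[R]_(p + q) -> 'rV[R]_(p' + q')).
Hypotheses (cm : chart_metric U G) (cF : chart_map U O' F).

Lemma tmap_segment_constant (u w : 'rV[R]_(p + q)) :
  (forall s : R, 0 <= s <= 1 -> U (u + s *: (w - u))) ->
  (forall s : R, 0 <= s <= 1 -> 'D_(w - u) (tmap F) (u + s *: (w - u)) = 0) ->
  tmap F w = tmap F u.
Proof.
move=> seg d0; apply/rowP => c; pose f (s : R) := tmap F (u + s *: (w - u)) 0 c.
have df (s : R) : 0 <= s <= 1 -> is_derive s 1 f 0.
  move=> s01; have dphi := phi_differentiable cm cF (seg s s01).
  have dc : differentiable (fun z => tmap F z 0 c) (u + s *: (w - u)).
    exact: differentiable_mxE.
  have := is_derive_line (@diff_derivable R _ _ (fun z => tmap F z 0 c) _ (w - u) dc).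
  rewrite -derive_mxE; last exact: diff_derivable.
  by rewrite d0// mxE.
have [||z z01] := @MVT R f (fun=> 0) 0 1 ltr01.
- by move=> x; rewrite in_itv/= => /andP[x0 x1]; apply: df; rewrite !ltW.
- apply: continuous_on_within => x; rewrite /= in_itv/= => /df[d _].
  exact/differentiable_continuous/derivable1_diffP.
rewrite mul0r /f scale0r addr0 scale1r [u + _]addrC subrK => /eqP.
by rewrite subr_eq0 => /eqP.
Qed.

Lemma tmap_leafwise_constant (u w : 'rV[R]_(p + q)) (r : R) :
  (forall z, `|z - u| < r -> U z) -> `|w - u| < r -> rsubmx w = rsubmx u ->
  tmap F w = tmap F u.
Proof.
move=> rU wr e; have l0 : rsubmx (w - u) = 0 by rewrite rsubB e subrr.
have seg (s : R) : 0 <= s <= 1 -> U (u + s *: (w - u)).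
  move=> /andP[s0 s1]; apply: rU; rewrite addrC addKr normrZ; apply: le_lt_trans wr.
  by rewrite ger0_norm// ler_piMl.
by apply: tmap_segment_constant => // s /seg Us; exact: (phi_basic cm cF Us l0).
Qed.

End TransverseConstancy.

Section LeafCountability.
Variables (R : realType) (p q : nat) (M : foliated_riemannian_manifold R p q).

Lemma near_chart_ball i (x : M) (r : R) : dom M i x -> 0 < r ->
  \forall y \near x, dom M i y /\ `|chart M i y - chart M i x| < r.
Proof.
move=> dx r0; have nb : \forall w \near chart M i x, `|w - chart M i x| < r.
  by apply/(@near_normP R 'rV[R]_(p + q) _ (chart M i x)); exists r.
have H : \forall y \near x, `|chart M i y - chart M i x| < r := chart_continuous dx nb.
have H2 := open_near (@dom_open _ _ _ M i) dx.
by near=> y; split; near: y.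
Unshelve. all: by end_near. Qed.

Lemma near_same_transverse i j (x : M) : dom M i x -> dom M j x ->
  \forall y \near x, [/\ dom M i y, dom M j y &
    rsubmx (chart M i y) = rsubmx (chart M i x) -> rsubmx (chart M j y) = rsubmx (chart M j x)].
Proof.
move=> dx dj; have Ox : overlap i j (chart M i x) by split; [exact: chart_cod|rewrite chartK].
have [r r0 rO] := near_ball_sub (@overlap_open _ _ _ M i j) Ox.
have := near_chart_ball dx r0; apply: filterS => y [dy yr]; split=> //.
  by have := rO _ yr; rewrite /overlap/= chartK// => -[].
move=> e; have := tmap_leafwise_constant (overlap_metric i j) (transition_map i j) rO yr e.
by rewrite /tmap /transition /= !chartK.
Qed.

(* A thin set contains no image of a nonconstant transverse curve. *)
Definition thin (C : set M) := forall j : chart_index M,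
  countable [set rsubmx (chart M j y) | y in [set y | C y /\ dom M j y]].

Lemma level_thin i (y : 'rV[R]_q) : thin [set x | dom M i x /\ rsubmx (chart M i x) = y].
Proof.
move=> j; apply: (countable_locally_constant (@fspace_second_countable _ _ _ M)).
move=> a [[da ea] dja]; have := near_same_transverse da dja.
by apply: filterS => b [db djb H] [[_ eb] _]; apply: H; rewrite ea eb.
Qed.

Lemma bigcup_thin (I : Type) (D : set I) (C : I -> set M) : countable D ->
  (forall i, D i -> thin (C i)) -> thin (\bigcup_(i in D) C i).
Proof.
move=> cD tC j; apply: (countable_subset _ (bigcup_countable cD (fun i Di => tC i Di j))).
by move=> _ [y [[i Di Ciy] dy] <-]; exists i => //; exists y.
Qed.

Lemma countable_atlas : exists2 D : set (set M), countable D & exists c : set M -> chart_index M,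
  forall x, exists2 b, D b & dom M (c b) x.
Proof.
have [B cB [Bo Bb]] := @fspace_second_countable _ _ _ M.
have i0 : chart_index M by have [i _] := cid (@dom_cover _ _ _ M point).
have /choice[c cP] : forall b : set M, exists i, (exists i', b `<=` dom M i') -> b `<=` dom M i.
  move=> b; have [[i bi]|ne] := pselect (exists i', b `<=` dom M i'); first by exists i.
  by exists i0.
exists B => //; exists c => x; have [i dx] := @dom_cover _ _ _ M x.
have [b [Bb' bx] bi] := Bb x _ (open_near (@dom_open _ _ _ M i) dx).
by exists b => //; exact: (cP b (ex_intro _ i bi)).
Qed.

(* Starting from a plaque, countably many plaques of a countable atlas are reached in each step. *)
Lemma leaf_thin (x : M) : thin (leaf x).
Proof.
have [D cD [c cP]] := countable_atlas.
pose next (C : set M) := \bigcup_(b in D) \bigcup_(y in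
  [set rsubmx (chart M (c b) z) | z in [set z | C z /\ dom M (c b) z]])
  [set z | dom M (c b) z /\ rsubmx (chart M (c b) z) = y].
pose N k := iter k next [set x]; pose Nall := \bigcup_(k in setT) N k.
have tN k : thin (N k).
  elim: k => [|k IH].
    move=> j; apply: (@countable_subset _ _ [set rsubmx (chart M j x)]); last exact: countable1.
    by move=> _ [y [-> _] <-].
  apply: bigcup_thin => // b Db; apply: bigcup_thin => [|y _]; first exact: IH.
  exact: level_thin.
have tNall : thin Nall by apply: bigcup_thin => // k _; exact: tN.
have step (b : set M) (z z' : M) : D b -> dom M (c b) z -> dom M (c b) z' ->
    rsubmx (chart M (c b) z') = rsubmx (chart M (c b) z) -> Nall z -> Nall z'.
  move=> Db dz dz' e [k _ Nk]; exists k.+1 => //; exists b => //.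
  by exists (rsubmx (chart M (c b) z)); [exists z|].
have seg z z' : plaque_segment z z' -> Nall z <-> Nall z'.
  move=> [i [dz dz' e codw]].
  pose w (t : R) := (1 - t) *: chart M i z + t *: chart M i z'.
  have wE t : w t = chart M i z + t *: (chart M i z' - chart M i z).
    by rewrite /w scalerBl scale1r scalerBr addrA addrAC.
  have rw t : rsubmx (w t) = rsubmx (chart M i z).
    rewrite wE rsubD (_ : rsubmx (t *: _) = t *: rsubmx (chart M i z' - chart M i z)); last first.
      by apply/rowP => k; rewrite !mxE.
    by rewrite rsubB e subrr scaler0 addr0.
  pose x_ t := param M i (w t).
  have cw (t : R) : {for t, continuous w}.
    have -> : w = fun t => chart M i z + t *: (chart M i z' - chart M i z) by exact/funext.
    by apply: cvgD; [exact: cvg_cst|apply: cvgZr_tmp; exact: cvg_id].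
  (* Extends the plaque segment by constants to the whole line, where connectedness shows that
     [Nall] is not left along it: nearby points lie in one level of a chart of the countable
     atlas. *)
  pose clamp (t : R) := Num.max 0 (Num.min 1 t).
  have clamp01 t : 0 <= clamp t <= 1.
    by rewrite /clamp le_max lexx/= ge_max ler01/= ge_min lexx.
  have clampE t : 0 <= t <= 1 -> clamp t = t.
    by move=> /andP[t0 t1]; rewrite /clamp min_r// max_r.
  have cclamp (t : R) : {for t, continuous clamp}.
    apply: continuous_max; first exact: cst_continuous.
    by apply: continuous_min; [exact: cst_continuous|exact: cvg_id].
  have loc (t : R) : \forall s \near t, Nall (x_ (clamp s)) <-> Nall (x_ (clamp t)).
    have cod1 := codw _ (clamp01 t); have dx1 : dom M i (x_ (clamp t)) := param_dom cod1.
    have [b Db db] := cP (x_ (clamp t)).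
    have nx := near_same_transverse dx1 db.
    have cx : {for t, continuous (fun s => x_ (clamp s))}.
      apply: (@continuous_comp _ _ _ clamp x_); first exact: cclamp.
      by apply: (@continuous_comp _ _ _ w (param M i)); [exact: cw|exact: param_continuous].
    have := near_comp cx nx; apply: filterS => s [dsi dsb H].
    have {}H : rsubmx (chart M (c b) (x_ (clamp s))) = rsubmx (chart M (c b) (x_ (clamp t))).
      by apply: H; rewrite /x_ !paramK ?rw//; exact: codw.
    by split; apply: (step b) => //; rewrite H.
  have cst := connected_locally_constant (@connected_real R) loc.
  have e0 : x_ (clamp 0) = z by rewrite clampE ?lexx ?ler01// /x_ /w subr0 scale1r scale0r addr0 chartK.
  have e1 : x_ (clamp 1) = z' by rewrite clampE ?lexx ?ler01// /x_ /w subrr scale0r scale1r add0r chartK.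
  by rewrite -e0 -e1; split; exact: cst.
move=> j; apply: countable_subset (tNall j) => _ [y [ly dy] <-]; exists y => //; split=> //.
have : Nall x <-> Nall y.
  elim: ly => [? ? /seg//|//|? ? _ IH|? ? ? _ IH1 _ IH2]; first by rewrite IH.
  by rewrite IH1.
by case=> H _; apply: H; exists 0%N.
Qed.

End LeafCountability.

(** * Transversally constant maps and leaves *)

Section TransversallyConstant.
Variables (R : realType) (p q p' q' : nat).
Variables (M : foliated_riemannian_manifold R p q).
Variables (M' : foliated_riemannian_manifold R p' q').
Variable phi : M -> M'.
Hypotheses (phi_smooth : smooth_mapping phi) (phi_foliated : foliated_mapping phi).

Lemma plaque_segment_near (x : M) j : dom M' j (phi x) ->
  \forall y \near x, dom M' j (phi y) /\ (rsubmx (chart M' j (phi y)) = rsubmx (chart M' j (phi x)) ->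
     plaque_segment (phi x) (phi y)).
Proof.
move=> dp; have [r r0 rO] := near_ball_sub (@cod_open _ _ _ M' j) (chart_cod dp).
have := near_comp (phi_smooth.1 x) (near_chart_ball dp r0); apply: filterS => y [dy yr]; split=> // e.
exists j; split=> // t /andP[t0 t1]; apply: rO.
have -> : (1 - t) *: chart M' j (phi x) + t *: chart M' j (phi y) - chart M' j (phi x) =
   t *: (chart M' j (phi y) - chart M' j (phi x)).
  by apply/rowP => k; rewrite !mxE; ring.
by rewrite normrZ ger0_norm//; apply: le_lt_trans yr; rewrite ler_piMl.
Qed.

Lemma constant_in_leaf : connected [set: M] -> transversally_constant phi ->
  exists x', range phi `<=` leaf x'.
Proof.
move=> cM tc; exists (phi point) => _ [y1 _ <-].
apply: (connected_locally_constant (P := fun y => same_leaf (phi point) (phi y)) cM _ (x := point)); last exact: rst_refl.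
move=> x; have [i [j [dx dp]]] := charts_at phi x.
have Dx := chart_local dx dp; have cm := local_metric phi_smooth i j.
have cF := local_map phi_smooth phi_foliated i j.
have [r r0 rO] := near_ball_sub (cm_open cm) Dx.
have n1 := near_chart_ball dx r0; have n2 := plaque_segment_near dp.
near=> y.
have [dy yr] : dom M i y /\ `|chart M i y - chart M i x| < r by near: y; exact: n1.
have [dpy H] : dom M' j (phi y) /\ (rsubmx (chart M' j (phi y)) = rsubmx (chart M' j (phi x)) ->
     plaque_segment (phi x) (phi y)) by near: y; exact: n2.
have {}H : plaque_segment (phi x) (phi y).
  apply: H; have seg (s : R) : 0 <= s <= 1 ->
      local_dom phi i j (chart M i x + s *: (chart M i y - chart M i x)).
    move=> /andP[s0 s1]; apply: rO; rewrite addrC addKr normrZ; apply: le_lt_trans yr.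
    by rewrite ger0_norm// ler_piMl.
  have := tmap_segment_constant cm cF seg; rewrite /tmap /local_rep !chartK//; apply.
  by move=> s s01; rewrite (derive_phi cm cF _ (seg s s01)); apply: tc; exact: seg.
have sxy : same_leaf (phi x) (phi y) by exact: rst_step.
split=> h; [apply: rst_trans h _; exact: rst_sym|exact: rst_trans h sxy].
Unshelve. all: by end_near. Qed.

Lemma interval_uncountable (a b : R) : a < b -> ~ countable `[a, b]%classic.
Proof.
move=> ab /countable_lebesgue_measure0; rewrite lebesgue_measure_itv/= lte_fin ab -EFinB.
by move=> /eqP; rewrite eqe subr_eq0 => /eqP e; rewrite e ltxx in ab.
Qed.

(** A nonzero entry of [S] would make a transverse coordinate of [phi] sweep out an interval along a
    coordinate line, whereas a leaf has only countably many transverse coordinates in a chart. *)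
Lemma in_leaf_derivative0 (x' : M') i j u : range phi `<=` leaf x' ->
  local_dom phi i j u -> S (local_rep phi i j) u = 0.
Proof.
move=> inl Du; have cm := local_metric phi_smooth i j.
have cF := local_map phi_smooth phi_foliated i j.
apply/matrixP => k c; rewrite [RHS]mxE; apply/eqP/negPn/negP => nz.
have [r r0 rO] := near_ball_sub (cm_open cm) Du.
pose e : 'rV[R]_(p + q) := delta_mx 0 (rshift p k).
pose f (t : R) := tmap (local_rep phi i j) (u + t *: e) 0 c.
have er : rsubmx e = delta_mx 0 k by apply/rowP => l; rewrite !mxE eq_rshift.
have ne : `|e| <= 1.
  by apply: norm_mx_le => // a b; rewrite !mxE; case: (_ && _); rewrite ?normr1 ?normr0 ?ler01.
have Dt (t : R) : `|t| < r -> local_dom phi i j (u + t *: e).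
  move=> tr; apply: rO; rewrite addrC addKr normrZ; apply: le_lt_trans tr.
  by rewrite -[leRHS]mulr1 ler_wpM2l.
have df (t : R) : `|t| < r -> is_derive t 1 f (S (local_rep phi i j) (u + t *: e) k c).
  move=> /Dt Ut; have dphi := phi_differentiable cm cF Ut.
  have dc : differentiable (fun z => tmap (local_rep phi i j) z 0 c) (u + t *: e).
    exact: differentiable_mxE.
  have := is_derive_line (@diff_derivable R _ _ (fun z => tmap (local_rep phi i j) z 0 c) _ e dc).
  rewrite -derive_mxE; last exact: diff_derivable.
  by rewrite (derive_phiS cm cF _ Ut) er -rowE row_entry.
have [t tr ft] : exists2 t : R, `|t| < r & f t != f 0.
  apply: contrapT => H; have f0 (t : R) : ball (0 : R) r t -> f t = f 0.
    rewrite -ball_normE/= sub0r normrN => tr.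
    by apply: contrapT => /eqP ne'; apply: H; exists t.
  have : 'D_1 f 0 = 0.
    apply: etrans (@eq_on_derive R R R (ball (0 : R) r) f (fun=> f 0) 0 1 _ f0 (ballxx _ r0)) _.
      exact: ball_open.
    exact: derive_cst.
  have [_ ->] : is_derive (0 : R) 1 f (S (local_rep phi i j) (u + 0 *: e) k c).
    by apply: df; rewrite normr0.
  by rewrite scale0r addr0 => e0; rewrite e0 eqxx in nz.
have cf (s : R) : `|s| <= `|t| -> {for s, continuous f}.
  move=> st; have [d _] := df s (le_lt_trans st tr).
  exact/differentiable_continuous/derivable1_diffP.
have ct : countable [set f s | s in [set s | `|s| <= `|t|]].
  have := @leaf_thin _ _ _ M' x' j.
  move=> /(countable_image (fun y : 'rV[R]_q' => y 0 c)); apply: countable_subset.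
  move=> _ [s st <-]; have [cs ds] := Dt s (le_lt_trans st tr).
  exists (rsubmx (chart M' j (phi (param M i (u + s *: e))))); last by [].
  by exists (phi (param M i (u + s *: e))) => //; split=> //; apply: inl; exists (param M i (u + s *: e)).
pose a := Num.min (f 0) (f t); pose b := Num.max (f 0) (f t).
have ab : a < b by rewrite /a /b; case: (ltgtP (f 0) (f t)) => // e0; rewrite e0 eqxx in ft.
apply: (interval_uncountable ab); apply: countable_subset ct => v; rewrite /= in_itv/= => vab.
pose t0 := Num.min 0 t; pose t1 := Num.max 0 t.
have t01 : t0 <= t1 by rewrite /t0 /t1 ge_min le_max lexx.
have ins s : s \in `[t0, t1] -> `|s| <= `|t|.
  by rewrite in_itv/= /t0 /t1; case: (leP 0 t) => h /andP[h1 h2]; rewrite ?(ger0_norm h) ?(ltr0_norm h) ler_norml; lra.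
have [||s sI <-] := @IVT R f t0 t1 v t01.
- by apply: continuous_on_within => s; rewrite /= => /ins; exact: cf.
- rewrite /t0 /t1; case: (leP 0 t) => h; first exact: vab.
  by rewrite minC maxC.
by exists s => //=; exact: ins.
Qed.

End TransversallyConstant.

(** * Recurrence in flow boxes *)

(** Local constants become one constant by compactness; monotonicity in [e] lets them be
    decreased. *)
Lemma compact_uniform (R : realType) (X : topologicalType) (P : R -> X -> Prop) :
  compact [set: X] -> (forall (e e' : R) z, e' <= e -> P e z -> P e' z) ->
  (forall z : X, exists2 e, 0 < e & \forall z' \near z, P e z') ->
  exists2 e, 0 < e & forall z, P e z.
Proof.
move=> /compact_near_coveringP cX mono loc.
have : \forall e \near (0 : R)^'+, [set: X] `<=` P e.
  apply: cX => z _; have [e e0 He] := loc z.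
  exists ([set z' | P e z'], [set e' | e' <= e]) => /=; last first.
    by move=> [z' e'] /= [Pz le]; exact: mono le Pz.
  by split=> //; exact: nbhs_right_le.
move=> H; have [e [e0 He]] : exists e, 0 < e /\ [set: X] `<=` P e.
  near (0 : R)^'+ => e; exists e; split; near: e; [exact: nbhs_right_gt|exact: H].
by exists e => // z; exact: He.
Unshelve. all: by end_near. Qed.

Lemma near_near_of (T : topologicalType) (x : T) (P : T -> Prop) :
  (\forall y \near x, P y) -> \forall y \near x, \forall z \near y, P z.
Proof. by move=> nP; apply: nbhs_interior. Qed.

Lemma nbhs_real_normP (R : realType) (t : R) (P : R -> Prop) :
  (\forall s \near t, P s) <-> exists2 d : R, 0 < d & forall s, `|s - t| < d -> P s.
Proof. exact: (@near_normP R R P t). Qed.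

(* In a flow box [V x] the coordinates [kap x] map onto a cube, with inverse [the x], and the
   distinguished coordinate [height x] is the arc length of the image geodesic; its level sets are
   contained in classes of a relation [sim]. Heights of different boxes agree up to sign and
   constant, so moving at unit speed in the height direction is well defined modulo levels. *)
Section FlowBoxes.
Variables (R : realType) (X : ptopologicalType) (n : nat).
Variables (V : X -> set X) (r : X -> R) (kap : X -> X -> 'rV[R]_n) (the : X -> 'rV[R]_n -> X).
Variable (ax : X -> 'I_n).

Record flow_boxes : Prop := IsFlowBoxes {
  fb_open : forall x, open (V x);
  fb_center : forall x, V x x /\ kap x x = 0;
  fb_pos : forall x, 0 < r x;
  fb_kap : forall x z, V x z -> `|kap x z| < r x;
  fb_kap_cont : forall x z, V x z -> {for z, continuous (kap x)};
  fb_the : forall x u, `|u| < r x -> V x (the x u);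
  fb_theK : forall x u, `|u| < r x -> kap x (the x u) = u;
  fb_the_cont : forall x u, `|u| < r x -> {for u, continuous (the x)};
  fb_kapK : forall x z, V x z -> the x (kap x z) = z }.

Definition height x z : R := kap x z 0 (ax x).
Definition sg (b : bool) : R := if b then 1 else -1.

Hypothesis fb : flow_boxes.
Hypothesis height_compat : forall x y z, V x z -> V y z ->
  exists b, \forall w \near z, height y w - height y z = sg b * (height x w - height x z).

Lemma sg_sq b : sg b * sg b = 1.
Proof. by case: b; rewrite /sg ?mulrNN mulr1. Qed.

Lemma norm_sg b : `|sg b| = 1.
Proof. by case: b; rewrite /sg ?normrN normr1. Qed.

Lemma sgN b : sg (~~ b) = - sg b.
Proof. by case: b; rewrite /sg ?opprK. Qed.

Lemma sg_mul a b : sg a * sg b = sg (a == b).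
Proof. by case: a; case: b; rewrite /sg ?mulrNN ?mulrN ?mulNr mulr1. Qed.

Definition translate (mu : R -> X) (t : R) : R -> X := fun s => mu (t + s).
Definition orientation x (mu : R -> X) b :=
  \forall s \near (0 : R), height x (mu s) = height x (mu 0) + sg b * s.
(** Only the height is prescribed; how the curve moves within the level sets is left free, which
    leaves room for gluing segments from different boxes. *)
Definition admissible (mu : R -> X) := (forall t, {for t, continuous mu}) /\
  forall t, exists x b, V x (mu t) /\ orientation x (translate mu t) b.

Lemma translate0 mu : translate mu 0 = mu.
Proof. by apply/funext => s; rewrite /translate add0r. Qed.

Lemma translate_translate mu t s : translate (translate mu t) s = translate mu (t + s).
Proof. by apply/funext => a; rewrite /translate addrA. Qed.

Lemma near_translate (P : X -> Prop) mu t : {for t, continuous mu} ->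
  (\forall z \near mu t, P z) -> \forall s \near (0 : R), P (mu (t + s)).
Proof.
move=> cmu /(near_comp cmu)/nbhs_real_normP[d d0 dP]; apply/nbhs_real_normP; exists d => // s.
by rewrite subr0 => sd; apply: dP; rewrite addrC addKr.
Qed.

Lemma height_cont x z : V x z -> {for z, continuous (height x)}.
Proof. by move=> Vz; apply: cont_mxE; exact: (fb_kap_cont fb). Qed.

Lemma shift_admissible mu t : admissible mu -> admissible (translate mu t).
Proof.
move=> [c o]; split=> s; last by rewrite translate_translate; exact: o.
apply: (@continuous_comp _ _ _ (fun s => t + s) mu); last exact: c.
by apply: cvgD; [exact: cvg_cst|exact: cvg_id].
Qed.

Lemma orientation_change mu x y b : {for 0, continuous mu} -> V x (mu 0) -> V y (mu 0) ->
  orientation x mu b -> exists b', orientation y mu b'.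
Proof.
move=> c Vx Vy o; have [s sP] := height_compat Vx Vy; exists (s == b).
have n1 := near_comp c sP.
near=> t; have e1 : height y (mu t) - height y (mu 0) = sg s * (height x (mu t) - height x (mu 0)).
  by near: t; exact: n1.
have e2 : height x (mu t) = height x (mu 0) + sg b * t by near: t; exact: o.
by apply/eqP; rewrite -subr_eq0 opprD addrA e1 e2 -sg_mul; apply/eqP; ring.
Unshelve. all: by end_near. Qed.

Lemma admissible_orientation mu y t : admissible mu -> V y (mu t) ->
  exists b, orientation y (translate mu t) b.
Proof.
move=> am Vy; have [_ /(_ t)[x [b [Vx o]]]] := am.
have [c _] := shift_admissible t am.
by apply: (orientation_change (c 0) _ _ o); rewrite /translate addr0.
Qed.

(** Near each time the height is affine with slope a sign. Two such functions that agree on an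
    interval coincide, so agreement with the affine function fixed at time 0 is locally constant in
    time. *)
Lemma affine_extension mu y b (eta : R) : admissible mu ->
  (forall s, `|s| < eta -> V y (mu s)) -> orientation y mu b ->
  forall s, `|s| < eta -> height y (mu s) = height y (mu 0) + sg b * s.
Proof.
move=> am stay o s se.
pose clamp (t : R) := Num.max (- `|s|) (Num.min `|s| t).
have clampP t : `|clamp t| <= `|s|.
  rewrite ler_norml /clamp le_max lexx/= ge_max ge_min lexx/= andbT.
  by have := normr_ge0 s; lra.
have clampE t : `|t| <= `|s| -> clamp t = t.
  by rewrite ler_norml => /andP[h1 h2]; rewrite /clamp min_r// max_r.
have cclamp (t : R) : {for t, continuous clamp}.
  apply: continuous_max; first exact: cst_continuous.
  by apply: continuous_min; [exact: cst_continuous|exact: cvg_id].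
(* Agreement on a neighbourhood and not just at [t], so that the slope is propagated together with
   the value. *)
pose P (t : R) := \forall t' \near t, height y (mu t') = height y (mu 0) + sg b * t'.
have loc (t : R) : `|t| < eta -> \forall t' \near t, P t' <-> P t.
  move=> te; have [bt obt] := admissible_orientation am (stay t te).
  have /nbhs_real_normP[d d0 dE] := obt.
  have dE' t' : `|t' - t| < d -> height y (mu t') = height y (mu t) + sg bt * (t' - t).
    move=> h; have := dE (t' - t); rewrite subr0 => /(_ h).
    by rewrite /translate addr0 addrC subrK.
  apply/nbhs_real_normP; exists d => // t' td; split=> [|Pt].
    move=> /nbhs_real_normP[d' d'0 d'E].
    have e1 := dE' _ td; have e2 := d'E t'; rewrite subrr normr0 in e2; have {}e2 := e2 d'0.
    pose a := Num.min (d' / 2) ((d - `|t' - t|) / 2).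
    have a0 : 0 < a by rewrite lt_min !divr_gt0// subr_gt0.
    have [a1 a2] : a <= d' / 2 /\ a <= (d - `|t' - t|) / 2.
      by rewrite /a !ge_min !lexx orbT.
    have e3 : height y (mu (t' + a)) = height y (mu t) + sg bt * (t' + a - t).
      apply: dE'; rewrite addrAC; apply: le_lt_trans (ler_normD _ _) _.
      by rewrite (gtr0_norm a0); lra.
    have e4 : height y (mu (t' + a)) = height y (mu 0) + sg b * (t' + a).
      by apply: d'E; rewrite addrC addKr gtr0_norm//; lra.
    have es : sg bt = sg b.
      have : (sg bt - sg b) * a = 0.
        have : height y (mu t) + sg bt * (t' - t) = height y (mu 0) + sg b * t' by rewrite -e1 -e2.
        have : height y (mu t) + sg bt * (t' + a - t) = height y (mu 0) + sg b * (t' + a) by rewrite -e3 -e4.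
        by move: (height _ _) (height _ _) (sg _) (sg _) => *; lra.
      by move=> /eqP; rewrite mulf_eq0 (gt_eqF a0) orbF subr_eq0 => /eqP.
    have ec : height y (mu t) = height y (mu 0) + sg b * t.
      have : height y (mu t) + sg b * (t' - t) = height y (mu 0) + sg b * t' by rewrite -es -e1 e2 es.
      by move: (height _ _) (height _ _) (sg _) => *; lra.
    apply/nbhs_real_normP; exists d => // t'' h; rewrite (dE' _ h) ec es.
    ring.
  have /nbhs_real_normP[d' d'0 d'E] := Pt.
  have es : sg bt = sg b.
    pose a := Num.min (d' / 2) (d / 2).
    have a0 : 0 < a by rewrite lt_min !divr_gt0.
    have [a1 a2] : a <= d' / 2 /\ a <= d / 2 by rewrite /a !ge_min !lexx orbT.
    have e3 : height y (mu (t + a)) = height y (mu t) + sg bt * (t + a - t).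
      by apply: dE'; rewrite addrC addKr gtr0_norm//; lra.
    have e4 : height y (mu (t + a)) = height y (mu 0) + sg b * (t + a).
      by apply: d'E; rewrite addrC addKr gtr0_norm//; lra.
    have e5 : height y (mu t) = height y (mu 0) + sg b * t by apply: d'E; rewrite subrr normr0.
    have : (sg bt - sg b) * a = 0.
      by move: e3 e4 e5; move: (height _ _) (height _ _) (height _ _) (sg _) (sg _) => *; nra.
    by move=> /eqP; rewrite mulf_eq0 (gt_eqF a0) orbF subr_eq0 => /eqP.
  have e5 : height y (mu t) = height y (mu 0) + sg b * t by apply: d'E; rewrite subrr normr0.
  apply/nbhs_real_normP; exists (d - `|t' - t|); first by rewrite subr_gt0.
  move=> t'' h; have -> : height y (mu t'') = height y (mu t) + sg bt * (t'' - t).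
    apply: dE'; rewrite -(subrK t' t'') -addrA; apply: le_lt_trans (ler_normD _ _) _.
    by move: h; move: (`|_|) (`|_|) => *; lra.
  by rewrite e5 es; ring.
have P0 : P (clamp 0) by rewrite clampE ?normr0.
have Ps : P (clamp s).
  have loc' (t : R) : \forall t' \near t, P (clamp t') <-> P (clamp t).
    by have := near_comp (cclamp t) (loc _ (le_lt_trans (clampP t) se)).
  exact: (@connected_locally_constant R (fun t => P (clamp t)) (@connected_real R) loc' 0 s P0).
move: Ps; rewrite clampE// => /nbhs_real_normP[d d0 dE].
by apply: dE; rewrite subrr normr0.
Qed.

Section Curves.
Variable G : (R -> X) -> Prop.
Hypotheses (G_adm : forall mu, G mu -> admissible mu).
Hypotheses (G_shift : forall mu t, G mu -> G (translate mu t)).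
Hypotheses (G_opp : forall mu, G mu -> G (fun s => mu (- s))).
Hypotheses (G_ex : forall z, exists2 mu, G mu & mu 0 = z).
Variable eta : R.
Hypothesis eta_gt0 : 0 < eta.
(** Plays the part of continuous dependence on the initial point: curves starting near [z0] share a
    box during a time that does not depend on [z0]. *)
Hypothesis G_stay : forall z0 : X, exists y, \forall z \near z0, forall mu, G mu -> mu 0 = z ->
  forall s, `|s| < eta -> V y (mu s).
Hypothesis X_compact : compact [set: X].
Hypothesis X_connected : connected [set: X].

Lemma G_oriented x z b : V x z -> exists mu, [/\ G mu, mu 0 = z & orientation x mu b].
Proof.
move=> Vz; have [mu Gm m0] := G_ex z.
have [|b' ob'] := admissible_orientation (t := 0) (G_adm Gm) (y := x); first by rewrite m0.
rewrite translate0 in ob'; have [e|ne] := eqVneq b b'; first by exists mu; rewrite e.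
exists (fun s => mu (- s)); split; [exact: G_opp|by rewrite oppr0|].
have -> : b = ~~ b' by case: b ne; case: (b').
move: ob' => /nbhs_real_normP[d d0 H]; apply/nbhs_real_normP; exists d => // s.
by rewrite subr0 oppr0 => sd; rewrite H ?subr0 ?normrN// sgN mulNr mulrN.
Qed.

(** Germs of heights are compared, not just values, so that related curves run in the same
    direction. *)
Definition level_related mu nu := exists x, [/\ V x (mu 0), V x (nu 0) &
  \forall s \near (0 : R), height x (mu s) = height x (nu s)].

Definition level_step mu nu := [/\ G mu, G nu & level_related mu nu].

Notation linked := (clos_refl_trans _ level_step).

Lemma level_step_sym mu nu : level_step mu nu -> level_step nu mu.
Proof.
move=> [Gm Gn [x [V1 V2 H]]]; split=> //; exists x; split=> //.
by apply: filterS H => s ->.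
Qed.

Lemma linked_sym mu nu : linked mu nu -> linked nu mu.
Proof.
elim=> [a b /level_step_sym h|a|a b c _ h1 _ h2]; [exact: rt_step|exact: rt_refl|exact: rt_trans h2 h1].
Qed.

Lemma level_step_shift x mu nu b s : G mu -> G nu ->
  (forall t, `|t| < eta -> V x (mu t)) -> (forall t, `|t| < eta -> V x (nu t)) ->
  height x (mu 0) = height x (nu 0) -> orientation x mu b -> orientation x nu b ->
  `|s| < eta -> level_step (translate mu s) (translate nu s).
Proof.
move=> Gm Gn sm sn e om on se; split; [exact: G_shift|exact: G_shift|].
exists x; split; [by rewrite /translate addr0; exact: sm|by rewrite /translate addr0; exact: sn|].
apply/nbhs_real_normP; exists (eta - `|s|); first by rewrite subr_gt0.
move=> t; rewrite subr0 => te; have st : `|s + t| < eta.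
  by apply: le_lt_trans (ler_normD _ _) _; rewrite -ltrBrDl.
rewrite /translate (affine_extension (G_adm Gm) sm om st) (affine_extension (G_adm Gn) sn on st).
by rewrite e.
Qed.

(* Moving along the straight level segment of the box, consecutive curves stay in a
   common box for the uniform time [eta]. *)
Lemma level_step_linked_shift mu nu s : level_step mu nu -> `|s| < eta ->
  linked (translate mu s) (translate nu s).
Proof.
move=> [Gm Gn [x [Vm Vn e]]] se.
pose a := kap x (mu 0); pose c := kap x (nu 0).
have ra : `|a| < r x by exact: (fb_kap fb).
have rc : `|c| < r x by exact: (fb_kap fb).
have eac : a 0 (ax x) = c 0 (ax x) by exact: (nbhs_singleton e).
pose clamp (t : R) := Num.max 0 (Num.min 1 t).
have clamp01 t : 0 <= clamp t <= 1.
  by rewrite /clamp le_max lexx/= ge_max ler01/= ge_min lexx.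
have clampE t : 0 <= t <= 1 -> clamp t = t.
  by move=> /andP[t0 t1]; rewrite /clamp min_r// max_r.
have cclamp (t : R) : {for t, continuous clamp}.
  apply: continuous_max; first exact: cst_continuous.
  by apply: continuous_min; [exact: cst_continuous|exact: cvg_id].
(* The two endpoints have equal height, so the whole segment lies in one level. *)
pose w (t : R) := a + clamp t *: (c - a).
have rw t : `|w t| < r x.
  have /andP[t0 t1] := clamp01 t.
  have -> : w t = (1 - clamp t) *: a + clamp t *: c.
    by rewrite /w scalerBl scale1r scalerBr addrA addrAC.
  apply: le_lt_trans (ler_normD _ _) _; rewrite !normrZ !ger0_norm ?subr_ge0//.
  have rm : Num.max `|a| `|c| < r x by rewrite gt_max ra.
  apply: le_lt_trans rm; have [la lc] : `|a| <= Num.max `|a| `|c| /\ `|c| <= Num.max `|a| `|c|.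
    by rewrite !le_max !lexx orbT.
  have k1 : 0 <= 1 - clamp t by rewrite subr_ge0.
  have := ler_wpM2l k1 la; have := ler_wpM2l t0 lc.
  by move: (clamp t) (`|a|) (`|c|) (Num.max _ _) => *; lra.
pose al t := the x (w t).
have cw (t : R) : {for t, continuous w}.
  by apply: cvgD; [exact: cvg_cst|apply: cvgZr_tmp; exact: cclamp].
have cal (t : R) : {for t, continuous al}.
  by apply: (@continuous_comp _ _ _ w (the x)); [exact: cw|exact: (fb_the_cont fb)].
have Val t : V x (al t) by exact: (fb_the fb).
have hal t : height x (al t) = height x (mu 0).
  rewrite /height /al (fb_theK fb)// /w !mxE -/a.
  by rewrite -[X in _ - X]/(a 0 (ax x)) eac subrr mulr0 addr0 -eac.
have al0 : al 0 = mu 0.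
  by rewrite /al /w clampE ?lexx ?ler01// scale0r addr0 (fb_kapK fb).
have al1 : al 1 = nu 0.
  by rewrite /al /w clampE ?lexx ?ler01// scale1r addrC subrK (fb_kapK fb).
have [b om] : exists b, orientation x mu b.
  have [|b ob] := admissible_orientation (t := 0) (G_adm Gm) (y := x); first by [].
  by exists b; rewrite translate0 in ob.
have on : orientation x nu b.
  near=> t; have <- : height x (mu t) = height x (nu t) by near: t; exact: e.
  have -> : height x (mu t) = height x (mu 0) + sg b * t by near: t; exact: om.
  by rewrite (nbhs_singleton e).
(* Through nearby points of the segment all curves stay in one box [y] up to time [eta]; equal
   heights and orientations in [x] are equal heights and orientations in [y]. *)
have local t : \forall t' \near t, forall nu1 nu2, G nu1 -> G nu2 -> nu1 0 = al t -> nu2 0 = al t' ->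
    orientation x nu1 b -> orientation x nu2 b -> level_step (translate nu1 s) (translate nu2 s).
  have [y stay] := G_stay (al t).
  have Vy : V y (al t).
    have [mu' Gm' m0'] := G_ex (al t).
    by rewrite -m0'; apply: (nbhs_singleton stay mu' Gm' m0'); rewrite normr0.
  have [g gP] := height_compat (Val t) Vy.
  have n1 := near_comp (cal t) stay; have n2 := near_comp (cal t) (near_near_of gP).
  near=> t'.
  have stay' : forall mu, G mu -> mu 0 = al t' -> forall s, `|s| < eta -> V y (mu s).
    by near: t'; exact: n1.
  have gP' : \forall w \near al t', height y w - height y (al t) = sg g * (height x w - height x (al t)).
    by near: t'; exact: n2.
  move=> nu1 nu2 G1 G2 e1 e2 o1 o2.
  have ht : height y (al t') = height y (al t).
    by apply/eqP; rewrite -subr_eq0 (nbhs_singleton gP') !hal subrr mulr0.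
  have tr nu' : G nu' -> orientation x nu' b -> (nu' 0 = al t \/ nu' 0 = al t') ->
      orientation y nu' (g == b).
    move=> Gn' o' e'; have [c' _] := G_adm Gn'.
    have gn : \forall w \near nu' 0, height y w - height y (al t) = sg g * (height x w - height x (al t)).
      by case: e' => ->.
    have hy : height y (nu' 0) = height y (al t) by case: e' => ->.
    have hx : height x (nu' 0) = height x (al t) by case: e' => ->; rewrite !hal.
    have n3 := near_comp (c' 0) gn; near=> k.
    have e3 : height y (nu' k) - height y (al t) = sg g * (height x (nu' k) - height x (al t)).
      by near: k; exact: n3.
    have e4 : height x (nu' k) = height x (nu' 0) + sg b * k by near: k; exact: o'.
    by rewrite hy -sg_mul; move: e3; rewrite e4 hx => /eqP; rewrite subr_eq => /eqP ->; ring.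
  apply: (@level_step_shift y nu1 nu2 (g == b)) => //.
  - by move=> k; apply: (nbhs_singleton stay) => //.
  - by move=> k; exact: stay'.
  - by rewrite e1 e2 ht.
  - by apply: tr => //; left.
  - by apply: tr => //; right.
have /choice[m mP] : forall t : R, exists m, [/\ G m, m 0 = al t & orientation x m b].
  by move=> t; exact: G_oriented.
have loc (t : R) : \forall t' \near t, linked (translate (m 0) s) (translate (m t') s) <->
    linked (translate (m 0) s) (translate (m t) s).
  near=> t'; have st : level_step (translate (m t) s) (translate (m t') s).
    have [G1 z1 o1] := mP t; have [G2 z2 o2] := mP t'.
    have H : forall nu1 nu2, G nu1 -> G nu2 -> nu1 0 = al t -> nu2 0 = al t' ->
      orientation x nu1 b -> orientation x nu2 b -> level_step (translate nu1 s) (translate nu2 s).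
      by near: t'; exact: local.
    exact: H.
  split=> h; apply: rt_trans h _; apply: rt_step => //; exact: level_step_sym.
have l01 : linked (translate (m 0) s) (translate (m 1) s).
  apply: (@connected_locally_constant R (fun t => linked (translate (m 0) s) (translate (m t) s))
    (@connected_real R) loc 0 1); exact: rt_refl.
have [G0 z0 o0] := mP 0; have [G1 z1 o1] := mP 1.
apply: rt_trans (_ : linked _ (translate (m 0) s)) _.
  apply: rt_step; apply: (nbhs_singleton (local 0)) => //; exact: esym al0.
apply: rt_trans l01 _; apply: rt_step; apply: (nbhs_singleton (local 1)) => //; exact: esym al1.
Unshelve. all: by end_near. Qed.

Lemma linked_shift_small mu nu s : linked mu nu -> `|s| < eta -> linked (translate mu s) (translate nu s).
Proof.
move=> l se; elim: l => [a b h|a|a b c _ h1 _ h2].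
- exact: level_step_linked_shift.
- exact: rt_refl.
- exact: rt_trans h1 h2.
Qed.

(** The time [t] is divided into [N] equal steps shorter than [eta]. *)
Lemma linked_shift mu nu t : linked mu nu -> linked (translate mu t) (translate nu t).
Proof.
move=> l; pose N := (Num.bound (`|t| / eta)).+1.
have tN : `|t / N%:R| < eta.
  rewrite normrM (gtr0_norm (_ : 0 < N%:R^-1)) ?invr_gt0 ?ltr0n// ltr_pdivrMr ?ltr0n//.
  have := archi_boundP (divr_ge0 (normr_ge0 t) (ltW eta_gt0)).
  rewrite ltr_pdivrMr// => h; rewrite mulrC; apply: lt_trans h _.
  by rewrite ltr_pM2r// ltr_nat.
suff H k : linked (translate mu (k%:R * (t / N%:R))) (translate nu (k%:R * (t / N%:R))).
  by have := H N; rewrite mulrCA mulfV ?mulr1 ?pnatr_eq0.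
elim: k => [|k IH]; first by rewrite mul0r !translate0.
rewrite mulrSr mulrDl mul1r -!translate_translate; exact: linked_shift_small.
Qed.

Lemma cluster_times (mu : R -> X) : exists z0 : X, forall P : X -> Prop, (\forall z \near z0, P z) ->
  forall N : nat, exists2 k : nat, (N <= k)%N & P (mu k%:R).
Proof.
have [|z0 [_ cl]] := X_compact (F := (fun k : nat => mu k%:R) @ \oo); first exact: filterT.
exists z0 => P nP N.
have FN : ((fun k : nat => mu k%:R) @ \oo) [set mu k%:R | k in [set k | (N <= k)%N]].
  by exists N => // k /= Nk; exists k.
by have [_ [[k /= Nk <-] Pk]] := cl _ _ FN nP; exists k.
Qed.

(* Three times at which a curve is close to one of its cluster points: two of them have the same
   orientation, and the curve at one is linked to a translate of the curve at the other. *)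
Theorem recurrent_curve (sim : X -> X -> Prop) :
  (forall z, sim z z) -> (forall z z' z'', sim z z' -> sim z' z'' -> sim z z'') ->
  (forall x z z', V x z -> V x z' -> height x z = height x z' -> sim z z') ->
  exists (mu : R -> X) (T : R), [/\ G mu, 0 < T, forall t, sim (mu (t + T)) (mu t) &
    forall x, exists t, sim (mu t) x].
Proof.
move=> sim_refl sim_trans sim_level.
have link_sim mu nu : linked mu nu -> sim (mu 0) (nu 0).
  elim=> [a b [_ _ [x [Va Vb e]]]|a|a b c _ h1 _ h2].
  - by apply: (sim_level x) => //; exact: (nbhs_singleton e).
  - exact: sim_refl.
  - exact: sim_trans h1 h2.
have [mu Gm _] := G_ex point.
have mid y nu nu' b d : G nu -> G nu' -> (forall s, `|s| < eta -> V y (nu s)) ->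
    V y (nu' 0) -> orientation y nu b -> orientation y nu' b ->
    height y (nu' 0) = height y (nu 0) + sg b * d -> `|d| < eta -> level_step (translate nu d) nu'.
  move=> Gn Gn' stay V' o o' e de; split=> //; first exact: G_shift.
  exists y; split=> //; first by rewrite /translate addr0; exact: stay.
  have n1 : \forall s \near (0 : R), `|d + s| < eta.
    apply/nbhs_real_normP; exists (eta - `|d|); first by rewrite subr_gt0.
    move=> s; rewrite subr0 => se; apply: le_lt_trans (ler_normD _ _) _.
    by rewrite -ltrBrDl.
  near=> s; rewrite /translate (affine_extension (G_adm Gn) stay o); last by near: s; exact: n1.
  have -> : height y (nu' s) = height y (nu' 0) + sg b * s by near: s; exact: o'.
  by rewrite e mulrDr addrA.
have [T T0 lT] : exists2 T, 0 < T & exists t0, linked (translate mu (t0 + T)) (translate mu t0).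
  have [z0 cl] := cluster_times mu; have [y stay] := G_stay z0.
  have Vy : V y z0.
    have [mu' Gm' m0'] := G_ex z0.
    by rewrite -m0'; apply: (nbhs_singleton stay mu' Gm' m0'); rewrite normr0.
  (* Two visits then differ in height by less than [2 * rho]: less than [eta], so the correcting
     shift stays in the box, and less than 1, the least distance between integer times. *)
  pose rho := Num.min eta 1 / 4; have rho0 : 0 < rho by rewrite divr_gt0// lt_min eta_gt0 ltr01.
  have nh : \forall z \near z0, `|height y z - height y z0| < rho.
    have nb : \forall v \near height y z0, `|v - height y z0| < rho by apply/nbhs_real_normP; exists rho.
    exact: near_comp (height_cont Vy) nb.
  have nN : \forall z \near z0, (forall mu', G mu' -> mu' 0 = z -> forall s, `|s| < eta -> V y (mu' s)) /\
      `|height y z - height y z0| < rho.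
    by near=> z; split; near: z.
  have [k1 _ [s1 h1]] := cl _ nN 0%N.
  have [k2 k12 [s2 h2]] := cl _ nN k1.+1.
  have [k3 k23 [s3 h3]] := cl _ nN k2.+1.
  have stayk k : (forall mu', G mu' -> mu' 0 = mu k%:R -> forall s, `|s| < eta -> V y (mu' s)) ->
      forall s, `|s| < eta -> V y (translate mu k%:R s).
    by move=> H; apply: H; [exact: G_shift|rewrite /translate addr0].
  have V_ k : (forall s, `|s| < eta -> V y (translate mu k%:R s)) -> V y (mu k%:R).
    by move=> /(_ 0); rewrite normr0 /translate addr0; apply.
  have main k l b : (k < l)%N -> (forall s, `|s| < eta -> V y (translate mu k%:R s)) ->
      (forall s, `|s| < eta -> V y (translate mu l%:R s)) ->
      `|height y (mu k%:R) - height y z0| < rho -> `|height y (mu l%:R) - height y z0| < rho ->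
      orientation y (translate mu k%:R) b -> orientation y (translate mu l%:R) b ->
      exists2 T, 0 < T & exists t0, linked (translate mu (t0 + T)) (translate mu t0).
    move=> kl Vk Vl hk hl ok ol.
    (* The time by which the earlier visit must be moved to reach the height of the later one; the
       period is [l - k - d]. *)
    pose d := sg b * (height y (mu l%:R) - height y (mu k%:R)).
    have dr : `|d| < 2 * rho.
      rewrite normrM norm_sg mul1r.
      have -> : height y (mu l%:R) - height y (mu k%:R) = (height y (mu l%:R) - height y z0)
        - (height y (mu k%:R) - height y z0) by ring.
      by apply: le_lt_trans (ler_normB _ _) _; rewrite mulr_natl mulr2n; exact: ltrD.
    have [de d1] : `|d| < eta /\ `|d| < 1.
      have : 2 * rho <= Num.min eta 1.
        by rewrite /rho; have : 0 < Num.min eta 1 by [rewrite lt_min eta_gt0 ltr01|]; move: (Num.min _ _) => *; lra.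
      by rewrite le_min => /andP[h h']; split; apply: lt_le_trans dr _.
    have st : level_step (translate (translate mu k%:R) d) (translate mu l%:R).
      apply: (mid y _ _ b) => //; [exact: G_shift|exact: G_shift|by rewrite /translate addr0; exact: V_|].
      by rewrite /translate !addr0 /d mulrA sg_sq mul1r addrC subrK.
    exists (l%:R - (k%:R + d)); last first.
      exists (k%:R + d); apply: linked_sym; apply: rt_step.
      have -> : k%:R + d + (l%:R - (k%:R + d)) = l%:R by ring.
      by rewrite translate_translate in st.
    have : (k%:R + 1 <= l%:R :> R) by rewrite natr1 ler_nat.
    by move: d1; rewrite ltr_norml => /andP[_ h]; lra.
  have [b1 o1] := admissible_orientation (G_adm Gm) (V_ _ (stayk _ s1)).
  have [b2 o2] := admissible_orientation (G_adm Gm) (V_ _ (stayk _ s2)).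
  have [b3 o3] := admissible_orientation (G_adm Gm) (V_ _ (stayk _ s3)).
  have [e|n12] := eqVneq b1 b2.
    by apply: (main k1 k2 b1) => //; [exact: stayk|exact: stayk|rewrite e].
  have [e|n13] := eqVneq b1 b3.
    apply: (main k1 k3 b1) => //; [exact: ltn_trans k12 k23|exact: stayk|exact: stayk|by rewrite e].
  have e : b2 = b3 by case: b1 b2 b3 n12 n13 {o1 o2 o3} => [] [] [].
  by apply: (main k2 k3 b2) => //; [exact: stayk|exact: stayk|rewrite e].
move: lT => [t0 lT].
exists mu, T; split=> // [t|].
  have := link_sim _ _ (linked_shift (t - t0) lT); rewrite !translate_translate /translate !addr0.
  by rewrite addrC addrA subrK [t0 + _]addrC subrK.
(* The points on curves linked to a translate of [mu]; membership is locally constant because inside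
   a box a short time shift reaches any nearby height. *)
pose A x := exists2 nu, G nu /\ nu 0 = x & exists t, linked (translate mu t) nu.
have allA x : A x.
  have A0 : A (mu 0) by exists mu => //; exists 0; rewrite translate0; exact: rt_refl.
  apply: (@connected_locally_constant X A X_connected _ (mu 0) x A0) => z0.
  have [y stay] := G_stay z0.
  have Vy : V y z0.
    have [mu' Gm' m0'] := G_ex z0.
    by rewrite -m0'; apply: (nbhs_singleton stay mu' Gm' m0'); rewrite normr0.
  have nh : \forall z \near z0, `|height y z - height y z0| < eta.
    have nb : \forall v \near height y z0, `|v - height y z0| < eta by apply/nbhs_real_normP; exists eta.
    exact: near_comp (height_cont Vy) nb.
  have go z1 z2 : (forall mu', G mu' -> mu' 0 = z1 -> forall s, `|s| < eta -> V y (mu' s)) ->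
      (forall mu', G mu' -> mu' 0 = z2 -> forall s, `|s| < eta -> V y (mu' s)) ->
      `|height y z2 - height y z1| < eta -> A z1 -> A z2.
    move=> st1 st2 h [nu [Gn n0] [t lt]].
    have V2 : V y z2.
      have [mu' Gm' m0'] := G_ex z2; rewrite -m0'; apply: (st2 mu' Gm' m0').
      by rewrite normr0.
    have V1 : V y (nu 0) by apply: st1 => //; rewrite normr0.
    have [|b ob] := admissible_orientation (t := 0) (G_adm Gn) (y := y); first exact: V1.
    rewrite translate0 in ob; have [nu' [Gn' n0' o']] := G_oriented b V2.
    pose d := sg b * (height y z2 - height y z1).
    exists nu' => //; exists (t + d); apply: rt_trans (_ : linked _ (translate nu d)) _.
      by rewrite -translate_translate; apply: linked_shift.
    apply: rt_step; apply: (mid y _ _ b) => //; first exact: (st1 nu).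
    - by rewrite n0'.
    - by rewrite n0 n0' /d mulrA sg_sq mul1r addrC subrK.
    - by rewrite normrM norm_sg mul1r.
  near=> z; have st : forall mu', G mu' -> mu' 0 = z -> forall s, `|s| < eta -> V y (mu' s).
    by near: z; exact: stay.
  have hz : `|height y z - height y z0| < eta by near: z; exact: nh.
  have st0 := nbhs_singleton stay.
  by split; apply: go => //; rewrite distrC.
move=> x; have [nu [Gn n0] [t lt]] := allA x.
by exists t; have := link_sim _ _ lt; rewrite /translate addr0 n0.
Unshelve. all: by end_near. Qed.

End Curves.

(** * Construction of flow curves from coordinate segments *)

Section Construction.
Hypothesis X_compact : compact [set: X].
Hypothesis X_hausdorff : hausdorff_space X.

Notation e_ i := (delta_mx 0 (ax i) : 'rV[R]_n).

Lemma norm_axis i (a : R) : `|a *: e_ i| <= `|a|.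
Proof.
apply: norm_mx_le => // k l; rewrite !mxE normrM; case: (_ && _); rewrite ?normr1 ?normr0 ?mulr1 ?mulr0//.
Qed.

Lemma finite_half_boxes : exists D : seq X, forall z, exists i, [/\ i \in D, V i z & `|kap i z| < r i / 2].
Proof.
have := X_compact; rewrite compact_cover => cX.
have [|z _|D _ Dc] := cX X setT (fun i => [set z | V i z /\ `|kap i z| < r i / 2]).
- move=> i _; apply: open_local => z [Vz kz].
  have n1 := open_near (@fb_open fb i) Vz.
  have nb : \forall u \near kap i z, `|u| < r i / 2.
    apply/(@near_normP R 'rV[R]_n _ (kap i z)); exists (r i / 2 - `|kap i z|); first by rewrite subr_gt0.
    move=> u h; rewrite -(subrK (kap i z) u); apply: le_lt_trans (ler_normD _ _) _.
    by rewrite -ltrBrDr.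
  have n2 := near_comp (fb_kap_cont fb Vz) nb.
  by near=> w; split; near: w.
- by exists z => //; have [Vz kz] := fb_center fb z; split=> //; rewrite kz normr0 divr_gt0// (fb_pos fb).
by exists (finmap.enum_fset D) => z; have [i Di [Vz kz]] := Dc z I; exists i.
Unshelve. all: by end_near. Qed.

(** One eighth leaves room twice: a step from a half box stays in the core of radius [3 / 4 * r i],
    and a step from the core stays in the box. *)
Lemma uniform_radius (D : seq X) : exists2 d : R, 0 < d & forall i, i \in D -> d <= r i / 8.
Proof.
elim: D => [|x D [d d0 H]]; first by exists 1.
have rx := fb_pos fb x.
exists (Num.min d (r x / 8)); first by rewrite lt_min d0 divr_gt0.
move=> i; rewrite inE => /orP[/eqP ->|/H h]; first by rewrite ge_min lexx orbT.
by rewrite ge_min h.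
Qed.

(** The core is the image of a compact cube under the inverse chart, and [X] is Hausdorff. *)
Lemma core_closed i : closed [set z | V i z /\ `|kap i z| <= 3 / 4 * r i].
Proof.
have ri := fb_pos fb i.
have r34 (u : 'rV[R]_n) : `|u| <= 3 / 4 * r i -> `|u| < r i by move=> h; apply: le_lt_trans h _; lra.
have -> : [set z | V i z /\ `|kap i z| <= 3 / 4 * r i] =
    the i @` [set u : 'rV[R]_n | `|u - 0| <= 3 / 4 * r i].
  apply/seteqP; split=> [z [Vz kz]|_ [u + <-]] /=.
    by exists (kap i z); [rewrite /= subr0|exact: (fb_kapK fb)].
  by rewrite /= subr0 => uz; split; [apply: (fb_the fb); exact: r34|rewrite (fb_theK fb)//; exact: r34].
apply: compact_closed => //; apply: continuous_compact; last exact: cube_compact.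
apply: continuous_on_within => u; rewrite /= subr0 => /r34; exact: (fb_the_cont fb).
Qed.

Variables (D : seq X) (del : R).
Hypothesis D_cover : forall z, exists i, [/\ i \in D, V i z & `|kap i z| < r i / 2].
Hypotheses (del0 : 0 < del) (del_le : forall i, i \in D -> del <= r i / 8).

(** Jumps start in the closed core, so that a point off the core of a box has a neighbourhood
    without jumps in this box. *)
Definition jump (s : R) z z' := exists i b, [/\ i \in D, V i z, `|kap i z| <= 3 / 4 * r i,
  `|s| <= del & z' = the i (kap i z + (sg b * s) *: e_ i)].

(** Only the finitely many boxes in [D] matter. Near [z0] a box either admits no jump, when [z0] is
    off its core, or is controlled by the continuity of its inverse chart. *)
Lemma jump_near (z0 : X) (P : X -> Prop) : (\forall z \near z0, P z) ->
  exists2 eta : R, 0 < eta & \forall z \near z0, forall s z', `|s| < eta -> jump s z z' -> P z'.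
Proof.
move=> nP; pose Q (eta : R) i z := V i z -> `|kap i z| <= 3 / 4 * r i ->
  forall u : 'rV[R]_n, `|u| < eta -> P (the i (kap i z + u)).
suff [eta eta0 H] : exists2 eta, 0 < eta & \forall z \near z0, forall i, i \in D -> Q eta i z.
  exists eta => //; apply: filterS H => z Qz s z' se [i [b [Di Vz kz _ ->]]].
  by apply: Qz => //; apply: le_lt_trans (norm_axis _ _) _; rewrite normrM norm_sg mul1r.
have one i : exists2 eta, 0 < eta & \forall z \near z0, Q eta i z.
  have [Kz|nK] := pselect (V i z0 /\ `|kap i z0| <= 3 / 4 * r i); last first.
    exists 1 => //; have oC := closed_openC (@core_closed i).
    by apply: filterS (open_near oC nK) => z nKz Vz kz; exfalso; apply: nKz.
  have [Vz0 kz0] := Kz; have ri := fb_pos fb i.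
  have kr : `|kap i z0| < r i by apply: le_lt_trans kz0 _; lra.
  have nP' : \forall z \near the i (kap i z0), P z by rewrite (fb_kapK fb).
  have /(@near_normP R 'rV[R]_n _ (kap i z0))[d d0 dP] := near_comp (fb_the_cont fb kr) nP'.
  exists (d / 2); first by rewrite divr_gt0.
  have nb : \forall u \near kap i z0, `|u - kap i z0| < d / 2.
    by apply/(@near_normP R 'rV[R]_n _ (kap i z0)); exists (d / 2); first by rewrite divr_gt0.
  apply: filterS (near_comp (fb_kap_cont fb Vz0) nb) => z kz _ _ u ud; apply: dP.
  by rewrite addrAC; apply: le_lt_trans (ler_normD _ _) _; move: kz ud; move: (`|_|) (`|_|) => *; lra.
elim: D => [|i D' [e e0 H]]; first by exists 1 => //; apply: nearW.
have [e' e'0 H'] := one i; exists (Num.min e e'); first by rewrite lt_min e0.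
near=> z => j; rewrite inE => /orP[/eqP ->|Dj] Vz kz u; rewrite lt_min => /andP[u1 u2].
  have Qz : Q e' i z by near: z; exact: H'.
  exact: Qz.
have Qz : forall i, i \in D' -> Q e i z by near: z; exact: H.
exact: (Qz j Dj).
Unshelve. all: by end_near. Qed.

(* Short pieces of a flow curve consist of two jumps along axes of the finitely many boxes [D],
   which makes flow curves equicontinuous. *)
Definition flow_curve (mu : R -> X) := admissible mu /\ forall t s : R, `|s| <= del ->
  exists z1 s1 s2, [/\ `|s1| <= `|s|, `|s2| <= `|s|, jump s1 (mu t) z1 & jump s2 z1 (mu (t + s))].

Lemma flow_curve_shift mu t : flow_curve mu -> flow_curve (translate mu t).
Proof.
move=> [am J]; split; first exact: shift_admissible.
by move=> t' s sd; rewrite /translate addrA; exact: J.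
Qed.

Lemma flow_curve_opp mu : flow_curve mu -> flow_curve (fun s => mu (- s)).
Proof.
move=> [[c o] J]; split; first split.
- move=> t; apply: (@continuous_comp _ _ _ -%R mu); last exact: c.
  exact: (@continuousN R R R id t (@cvg_id _ _)).
- move=> t; have [x [b [Vx ob]]] := o (- t); exists x, (~~ b); split=> //.
  move: ob => /nbhs_real_normP[d d0 H]; apply/nbhs_real_normP; exists d => // s.
  rewrite subr0 => sd; have := H (- s); rewrite subr0 normrN => /(_ sd).
  by rewrite /translate !addr0 opprD sgN mulrN mulNr.
- by move=> t s sd; rewrite opprD; have := J (- t) (- s); rewrite normrN; exact.
Qed.

(** Two uses of [jump_near], one for each jump, keep the curves in the box centered at [z0];
    compactness makes the time uniform. *)
Lemma flow_curve_stay : exists2 eta, 0 < eta & forall z0 : X, exists y, \forall z \near z0,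
  forall mu, flow_curve mu -> mu 0 = z -> forall s, `|s| < eta -> V y (mu s).
Proof.
pose P (eta : R) (z0 : X) := exists y, \forall z \near z0,
  forall mu, flow_curve mu -> mu 0 = z -> forall s, `|s| < eta -> V y (mu s).
apply: (@compact_uniform R X P) => // [e e' z le [y Hy]|z0].
  exists y; apply: filterS Hy => w H mu Gm m0 s se; apply: H => //; exact: lt_le_trans le.
have nV := open_near (@fb_open fb z0) (fb_center fb z0).1.
have [e1 e10 H1] := jump_near nV; have [e2 e20 H2] := jump_near H1.
pose eta := Num.min del (Num.min e1 e2); exists eta; first by rewrite !lt_min del0 e10.
apply: filterS (near_near_of H2) => z nz; exists z0; apply: filterS nz => w Hw mu [am J] m0 s.
rewrite !lt_min => /and3P[s1 s2 s3]; have [z1 [a1 [a2 [h1 h2 j1 j2]]]] := J 0 s (ltW s1).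
rewrite add0r m0 in j1 j2.
by apply: (Hw a1 z1 _ j1 a2 _ _ j2); [exact: le_lt_trans s3|exact: le_lt_trans s2].
Qed.

Definition piece i (u : 'rV[R]_n) b (s : R) := the i (u + (sg b * s) *: e_ i).

Section Cells.
Variables (ci : int -> X) (cu : int -> 'rV[R]_n) (cb : int -> bool).
Hypothesis cD : forall k, ci k \in D.
Hypothesis cA : forall k s, 0 <= s <= del -> `|cu k + (sg (cb k) * s) *: e_ (ci k)| <= 3 / 4 * r (ci k).
Notation c k := (piece (ci k) (cu k) (cb k)).
Hypothesis cB : forall k : int, c k del = c (k + 1) 0.
Hypothesis cC : forall k : int, \forall w \near c k del,
  sg (cb k) * (height (ci k) w - height (ci k) (c k del)) =
  sg (cb (k + 1)) * (height (ci (k + 1)) w - height (ci (k + 1)) (c k del)).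

Let r34 i (u : 'rV[R]_n) : `|u| <= 3 / 4 * r i -> `|u| < r i.
Proof. by move=> h; apply: le_lt_trans h _; have := fb_pos fb i; lra. Qed.

Lemma cell_in k s : 0 <= s <= del -> V (ci k) (c k s) /\
  kap (ci k) (c k s) = cu k + (sg (cb k) * s) *: e_ (ci k).
Proof. by move=> /(@cA k)/r34 h; split; [exact: (fb_the fb)|exact: (fb_theK fb)]. Qed.

Lemma cell_height k s : 0 <= s <= del -> height (ci k) (c k s) = height (ci k) (c k 0) + sg (cb k) * s.
Proof.
move=> s01; have [_ e] := cell_in k s01.
have lex0 : 0 <= (0 : R) <= del by apply/andP; split=> //; exact: ltW.
have [_ e0] := cell_in k lex0; rewrite /height e e0.
by rewrite !mxE !eqxx !mulr1 mulr0 addr0.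
Qed.

Lemma cell_cont k s : 0 <= s <= del -> {for s, continuous (c k)}.
Proof.
move=> s01; apply: (@continuous_comp _ _ _ (fun s => cu k + (sg (cb k) * s) *: e_ (ci k)) (the (ci k))).
  apply: cvgD; first exact: cvg_cst.
  by apply: cvgZr_tmp; apply: cvgM; [exact: cvg_cst|exact: cvg_id].
by apply: (fb_the_cont fb); apply: r34; exact: cA.
Qed.

Lemma cell_jump k s s' : 0 <= s <= del -> 0 <= s' <= del -> jump (s' - s) (c k s) (c k s').
Proof.
move=> h h'; have [Vs es] := cell_in k h; exists (ci k), (cb k); split=> //.
- by rewrite es; exact: cA.
- by rewrite ler_norml; lra.
- by rewrite es /piece -addrA -scalerDl -mulrDr [s + _]addrC subrK.
Qed.

Definition glued t := let k := Num.floor (t / del) in c k (t - k%:~R * del).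

(** At [s = del] the floor already selects the cell [k + 1], which begins where cell [k] ends. *)
Lemma gluedE k s : 0 <= s <= del -> glued (k%:~R * del + s) = c k s.
Proof.
move=> /andP[s0 sd]; move: sd; rewrite le_eqVlt => /orP[/eqP ->|sd].
  have fl : Num.floor ((k%:~R * del + del) / del) = k + 1.
    rewrite mulrDl mulfK ?gt_eqF// divff ?gt_eqF// (_ : k%:~R + 1 = (k + 1)%:~R); last by rewrite intrD.
    by apply: floor_def; rewrite lexx/= ltr_int ltrDl.
  rewrite /glued fl intrD mulrDl mul1r subrr; exact: esym (cB k).
have fl : Num.floor ((k%:~R * del + s) / del) = k.
  rewrite mulrDl mulfK ?gt_eqF//; apply: floor_def.
  have h0 : 0 <= s / del by rewrite divr_ge0// ltW.
  have h1 : s / del < 1 by rewrite ltr_pdivrMr// mul1r.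
  by rewrite intrD; apply/andP; split; [rewrite lerDl|rewrite ltrD2l].
by rewrite /glued fl [k%:~R * del + s]addrC addrK.
Qed.

Lemma cell_of t : exists k s, 0 <= s < del /\ t = (k%:~R : R) * del + s.
Proof.
exists (Num.floor (t / del)), (t - (Num.floor (t / del))%:~R * del).
have /andP[h1 h2] := floor_itv (t / del).
split; last by ring.
rewrite subr_ge0 -ler_pdivlMr// h1/= ltrBlDr.
by move: h2; rewrite intrD ltr_pdivrMr// mulrDl mul1r addrC.
Qed.

Lemma glued_left k s : 0 <= s <= del -> glued (k%:~R * del - s) = c (k - 1) (del - s).
Proof.
move=> h; rewrite -gluedE; last by lra.
by congr glued; rewrite intrD mulrDl mulN1r addrA subrK.
Qed.

(** At a node both adjacent boxes see the same signed height by [cC], so the slope is kept across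
    it. A step of length at most [del] crosses at most one node, hence two jumps suffice. *)
Lemma glued_flow : flow_curve glued.
Proof.
have lex0 : 0 <= (0 : R) <= del by apply/andP; split=> //; exact: ltW.
have led : 0 <= del <= del by apply/andP; split=> //; exact: ltW.
have near_cell t : exists x b, [/\ V x (glued t), {for t, continuous glued} & orientation x (translate glued t) b].
  have [k [s [/andP[s0 sd] ->]]] := cell_of t.
  have g0 : glued (k%:~R * del + s) = c k s by apply: gluedE; rewrite s0 ltW.
  exists (ci k), (cb k).
  have sl0 : 0 <= s <= del by rewrite s0 ltW.
  have [Vs _] := cell_in k sl0.
  move: s0; rewrite le_eqVlt => /orP[/eqP s0|s0]; last first.
    (* Strictly inside a cell, a neighbourhood of the time stays in the same cell. *)
    pose d := Num.min s (del - s); have d0 : 0 < d by rewrite lt_min s0 subr_gt0.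
    have gE a : `|a| < d -> glued (k%:~R * del + s + a) = c k (s + a).
      rewrite lt_min => /andP[]; rewrite !ltr_norml => /andP[a1 a2] /andP[a3 a4].
      by rewrite -addrA gluedE//; lra.
    split; first by rewrite g0.
      move=> A; rewrite g0 => /(@cell_cont k s sl0 A).
      rewrite !near_simpl => /nbhs_real_normP[e e0 H]; apply/nbhs_real_normP.
      exists (Num.min d e); first by rewrite lt_min d0.
      move=> t'; rewrite lt_min => /andP[td te].
      rewrite -(subrK (k%:~R * del + s) t') addrC /= gE//; apply: H.
      by rewrite addrC addKr.
    apply/nbhs_real_normP; exists d => // a; rewrite subr0 => ad.
    have sa : 0 <= s + a <= del.
      by move: ad; rewrite lt_min => /andP[]; rewrite !ltr_norml => /andP[a1 a2] /andP[a3 a4]; lra.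
    rewrite /translate addr0 gE// g0 (cell_height k sa) (cell_height k sl0).
    ring.
  rewrite -s0 addr0 in g0 *; rewrite -s0 in Vs.
  have right a : 0 <= a <= del -> glued (k%:~R * del + a) = c k a by exact: gluedE.
  have cB' : c (k - 1) del = c k 0 by rewrite cB subrK.
  have cC' := cC (k - 1); rewrite subrK cB' in cC'.
  have cc : {for k%:~R * del, continuous glued}.
    move=> A; rewrite g0 => nA.
    have n1 := @cell_cont k 0 lex0 A nA.
    have n2 : \forall a \near del, A (c (k - 1) a) by apply: (@cell_cont (k - 1) del led A); rewrite cB'.
    move: n1 n2 => /nbhs_real_normP[e1 e10 H1] /nbhs_real_normP[e2 e20 H2].
    apply/nbhs_real_normP; exists (Num.min del (Num.min e1 e2)); first by rewrite !lt_min del0 e10.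
    move=> t'; rewrite !lt_min => /and3P[td t1 t2]; rewrite /=.
    have [le|lt] := leP (k%:~R * del) t'.
      rewrite -(subrK (k%:~R * del) t') addrC right; last first.
        by move: td; rewrite ltr_norml; lra.
      by apply: H1; rewrite subr0.
    have -> : t' = k%:~R * del - (k%:~R * del - t') by rewrite opprB addrC subrK.
    rewrite glued_left; last by move: td; rewrite ltr_norml; lra.
    by apply: H2; rewrite addrAC subrr add0r opprB.
  split=> //; first by rewrite g0.
  rewrite -g0 in cC'; move: (near_comp cc cC') => /nbhs_real_normP[e e0 H]; rewrite g0 in H.
  apply/nbhs_real_normP; exists (Num.min del e); first by rewrite lt_min del0.
  move=> a; rewrite subr0 lt_min => /andP[ad ae]; rewrite /translate addr0 g0.
  have [a0|a0] := leP 0 a.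
    have ha : 0 <= a <= del by move: ad; rewrite a0 ger0_norm// => /ltW.
    by rewrite (right a ha); exact: (cell_height k ha).
  have := H (k%:~R * del + a); rewrite addrC addKr => /(_ ae).
  have ha : 0 <= del - - a <= del by move: ad; rewrite ltr_norml; lra.
  have -> : glued (k%:~R * del + a) = c (k - 1) (del - - a).
    rewrite -glued_left; last by move: ad; rewrite ltr_norml; lra.
    by rewrite opprK.
  rewrite (cell_height (k - 1) ha) -{1}cB' (cell_height (k - 1) led).
  move=> E; have : sg (cb k) * (sg (cb k) * (height (ci k) (c (k - 1) (del - - a)) - height (ci k) (c k 0))) = sg (cb k) * a.
    rewrite -E; congr (_ * _).
    transitivity (sg (cb (k - 1)) * sg (cb (k - 1)) * a); first by ring.
    by rewrite sg_sq mul1r.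
  by rewrite mulrA sg_sq mul1r => <-; ring.
split; first split.
- by move=> t; have [x [b [_ ? _]]] := near_cell t.
- by move=> t; have [x [b [Vx _ o]]] := near_cell t; exists x, b.
move=> t a ad; have [k [s [/andP[s0 sd] ->]]] := cell_of t.
have sl : 0 <= s <= del by rewrite s0 ltW.
have ge : glued (k%:~R * del + s) = c k s by exact: gluedE.
rewrite ge; have self k' s' : 0 <= s' <= del -> jump 0 (c k' s') (c k' s').
  by move=> h; have := cell_jump k' h h; rewrite subrr.
move: (ad); rewrite ler_norml => /andP[a1 a2].
have [lt|ge0] := ltP (s + a) 0.
  exists (c k 0), (- s), (a + s); split.
  - by rewrite normrN ger0_norm// ltr0_norm; lra.
  - by rewrite !ltr0_norm; lra.
  - by have := cell_jump k sl lex0; rewrite sub0r.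
  have e : glued (k%:~R * del + s + a) = c (k - 1) (del + (s + a)).
    by rewrite -addrA -[s + a]opprK glued_left ?opprK//; lra.
  have h : 0 <= del + (s + a) <= del by lra.
  by rewrite e; have := cell_jump (k - 1) led h; rewrite cB subrK addrC addKr [s + a]addrC.
have [le|gt] := leP (s + a) del.
  exists (c k (s + a)), a, 0; split=> //; first by rewrite normr0.
    have h : 0 <= s + a <= del by rewrite ge0.
    by have := cell_jump k sl h; rewrite addrC addKr.
  by rewrite -addrA gluedE ?ge0//; apply: self; rewrite ge0.
exists (c k del), (del - s), (s + a - del); split.
- by rewrite !gtr0_norm; lra.
- by rewrite !gtr0_norm; lra.
- exact: cell_jump.
have e : glued (k%:~R * del + s + a) = c (k + 1) (s + a - del).
  rewrite -gluedE; last by lra.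
  by congr glued; rewrite intrD mulrDl mul1r; ring.
have h : 0 <= s + a - del <= del by lra.
by rewrite e cB; have := cell_jump (k + 1) lex0 h; rewrite subr0.
Qed.

End Cells.

(** The current point, the center of the box used to leave it, and the direction of motion in that
    box. *)
Definition state : Type := (X * X * bool)%type.
Definition state_ok (s : state) := [/\ s.1.2 \in D, V s.1.2 s.1.1 & `|kap s.1.2 s.1.1| < r s.1.2 / 2].

(** The next box is one whose half contains the endpoint of the segment, and the new sign continues
    the motion in the same direction of height. *)
Lemma next_state : exists nx : state -> state, forall s, state_ok s -> [/\ state_ok (nx s),
  (nx s).1.1 = piece s.1.2 (kap s.1.2 s.1.1) s.2 del &
  \forall w \near (nx s).1.1, sg s.2 * (height s.1.2 w - height s.1.2 (nx s).1.1) =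
    sg (nx s).2 * (height (nx s).1.2 w - height (nx s).1.2 (nx s).1.1)].
Proof.
suff /choice[nx nxP] : forall s, exists s', state_ok s -> [/\ state_ok s',
    s'.1.1 = piece s.1.2 (kap s.1.2 s.1.1) s.2 del &
    \forall w \near s'.1.1, sg s.2 * (height s.1.2 w - height s.1.2 s'.1.1) =
      sg s'.2 * (height s'.1.2 w - height s'.1.2 s'.1.1)] by exists nx.
move=> [[z i] b]; have [ok|nok] := pselect (state_ok (z, i, b)); last by exists (z, i, b).
have [/= Di Vz kz] := ok; have ri := fb_pos fb i.
pose z' := piece i (kap i z) b del; have [j [Dj Vj kj]] := D_cover z'.
have Vi : V i z'.
  apply: (fb_the fb); apply: le_lt_trans (ler_normD _ _) _.
  have := norm_axis i (sg b * del); rewrite normrM norm_sg mul1r (gtr0_norm del0).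
  have := del_le Di; move: kz ri; move: (r i) (`|_|) (`|_|) => *; lra.
have [a aP] := height_compat Vi Vj; exists (z', j, a == b) => _; split=> //=.
apply: filterS aP => w ->.
have -> : sg b = sg (a == b) * sg a by rewrite sg_mul; case: (a); case: (b).
by rewrite mulrA.
Qed.

Lemma flow_curve_exists z : exists2 mu, flow_curve mu & mu 0 = z.
Proof.
have [nx nxP] := next_state; have [i [Di Vi ki]] := D_cover z.
pose orbit b m := iter m nx (z, i, b).
have ok b m : state_ok (orbit b m) by elim: m => // m IH; have [] := nxP _ IH.
have nP b m := nxP _ (ok b m).
(* Negative cells follow the orbit that starts in the opposite direction and are traversed
   backwards, whence the endpoint in [cu] and the negated sign in [cb]. *)
pose st k := match k with Posz m => orbit true m | Negz m => orbit false m end.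
pose e k := e_ (st k).1.2.
pose ci k := (st k).1.2.
pose cu k := if k is Negz m then kap (st k).1.2 (st k).1.1 + (sg (st k).2 * del) *: e k
  else kap (st k).1.2 (st k).1.1.
pose cb k := if k is Negz m then ~~ (st k).2 else (st k).2.
have sok k : state_ok (st k) by case: k => m; exact: ok.
have cD k : ci k \in D by have [] := sok k.
have cA k s : 0 <= s <= del -> `|cu k + (sg (cb k) * s) *: e_ (ci k)| <= 3 / 4 * r (ci k).
  move=> /andP[s0 sd]; have [_ _ ks] := sok k; have dl := del_le (cD k).
  have {}ks : `|kap (ci k) (st k).1.1| < r (ci k) / 2 := ks.
  have [a [ea a1]] : exists a : R, cu k + (sg (cb k) * s) *: e_ (ci k) = kap (ci k) (st k).1.1 + a *: e_ (ci k) /\ `|a| <= del.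
    rewrite /ci /cu /cb /e; case: k {ks dl} => m.
      by exists (sg (st m).2 * s); split=> //; rewrite normrM norm_sg mul1r ger0_norm.
    exists (sg (st (Negz m)).2 * (del - s)); split.
      by rewrite -addrA -scalerDl sgN mulrBr mulNr.
    by rewrite normrM norm_sg mul1r ger0_norm; lra.
  rewrite ea; apply: le_trans (ler_normD _ _) _; have := norm_axis (ci k) a.
  move: ks dl a1; move: (r _) (`|_|) (`|_|) (`|_|) => *; lra.
have c0 k : piece (ci k) (cu k) (cb k) 0 = if k is Negz m then (orbit false m.+1).1.1 else (st k).1.1.
  rewrite /piece mulr0 scale0r addr0 /ci /cu; case: k => m.
    by rewrite (fb_kapK fb)//; have [] := sok m.
  by have [_ -> _] := nP false m.
have c1 k : piece (ci k) (cu k) (cb k) del = if k is Posz m then (orbit true m.+1).1.1 else (st k).1.1.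
  rewrite /ci /cu /cb; case: k => m; first by have [_ -> _] := nP true m.
  rewrite /piece sgN mulNr scaleNr addrK (fb_kapK fb)//.
  by have [] := sok (Negz m).
have succ m : Negz m.+1 + 1 = Negz m by rewrite !NegzE -addn1 PoszD opprD addrNK.
have cB k : piece (ci k) (cu k) (cb k) del = piece (ci (k + 1)) (cu (k + 1)) (cb (k + 1)) 0.
  rewrite c1 c0; case: k => [m|[|m]] //; first by rewrite -PoszD addn1.
  by rewrite succ.
have cC k : \forall w \near piece (ci k) (cu k) (cb k) del,
    sg (cb k) * (height (ci k) w - height (ci k) (piece (ci k) (cu k) (cb k) del)) =
    sg (cb (k + 1)) * (height (ci (k + 1)) w - height (ci (k + 1)) (piece (ci k) (cu k) (cb k) del)).
  rewrite c1; case: k => [m|[|m]].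
  - by rewrite -PoszD addn1; have [_ _] := nP true m.
  - exact: nearW.
  - rewrite succ; have [_ _] := nP false m.
    by apply: filterS => w E; rewrite /ci /cb !sgN !mulNr E.
exists (glued ci cu cb); first exact: glued_flow.
have l0 : 0 <= (0 : R) <= del by apply/andP; split=> //; exact: ltW.
by have := gluedE cB 0 l0; rewrite mul0r addr0 c0.
Qed.

End Construction.

Theorem recurrent_flow (sim : X -> X -> Prop) :
  compact [set: X] -> connected [set: X] -> hausdorff_space X ->
  (forall z, sim z z) -> (forall z z' z'', sim z z' -> sim z' z'' -> sim z z'') ->
  (forall x z z', V x z -> V x z' -> height x z = height x z' -> sim z z') ->
  exists (mu : R -> X) (T : R), [/\ admissible mu, 0 < T, forall t, sim (mu (t + T)) (mu t) &
    forall x, exists t, sim (mu t) x].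
Proof.
move=> Xc Xcc Xh s0 s1 s2; have [D Dc] := finite_half_boxes Xc.
have [d d0 dD] := uniform_radius D.
have [eta eta0 stay] := @flow_curve_stay Xc Xh D d d0.
have [||||mu [T [Gm T0 per reach]]] := @recurrent_curve (flow_curve D d) _ _ _ _ eta eta0 stay Xc Xcc sim s0 s1 s2.
- by move=> mu [].
- by move=> mu t; exact: flow_curve_shift.
- exact: flow_curve_opp.
- move=> z; exact: (@flow_curve_exists D d Dc d0 dD z).
- by exists mu, T; split=> //; case: Gm.
Qed.

End FlowBoxes.

(** * Straightening a function *)

Lemma diff_estimate (R : realType) (V W : normedModType R) (f : V -> W) (x : V) (e : R) :
  differentiable f x -> 0 < e -> \forall y \near x, `|f y - f x - 'D_(y - x) f x| <= e * `|y - x|.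
Proof.
move=> df e0; have /diff_locallyP[_ /eqaddoP H] := df.
move: (H e e0) => /(@near_normP R V _ 0)[d d0 dH].
apply/(@near_normP R V _ x); exists d => // y yd; have := dH (y - x); rewrite subr0 => /(_ yd).
have -> : (f \o shift x - (cst (f x) + 'd f x)) (y - x) = f y - f x - 'D_(y - x) f x.
  by rewrite deriveE// -addrA -opprD !fctE /= subrK.
by [].
Qed.

(** The path [p] is only Lipschitz at [t], so there is no chain rule to use; the vanishing of the
    differential of [f] alone gives the derivative zero. *)
Lemma is_derive_critical (R : realType) (V W : normedModType R) (f : V -> W) (p : R -> V) (t K : R) :
  differentiable f (p t) -> (forall v, 'D_v f (p t) = 0) ->
  (\forall s \near t, `|p s - p t| <= K * `|s - t|) ->
  is_derive t 1 (fun s => f (p s)) (0 : W).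
Proof.
move=> df d0 /nbhs_real_normP[d d_gt0 lip].
have cp : {for t, continuous p}.
  apply/cvgrPdist_le => e e0; rewrite near_simpl; apply/nbhs_real_normP.
  have K0 : 0 < `|K| + 1 by apply: ltr_wpDl.
  exists (Num.min d (e / (`|K| + 1))); first by rewrite lt_min d_gt0 divr_gt0.
  move=> s; rewrite lt_min => /andP[/lip l]; rewrite ltr_pdivlMr// => /ltW le.
  rewrite distrC; apply: le_trans l _; apply: le_trans le; rewrite mulrC ler_wpM2l//.
  by apply: le_trans (ler_norm _) _; rewrite lerDl.
have cv : h^-1 *: (f (p (h *: 1 + t)) - f (p t)) @[h --> (0 : R)^'] --> (0 : W).
  apply/cvgrPdist_le => e e0; have K0 : 0 < `|K| + 1 by apply: ltr_wpDl.
  have e'0 : 0 < e / (`|K| + 1) by rewrite divr_gt0.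
  have := near_comp cp (diff_estimate df e'0) => /nbhs_real_normP[d' d'0 H].
  apply/nbhs_real_normP; exists (Num.min d d'); first by rewrite lt_min d_gt0.
  move=> h; rewrite subr0 lt_min => /andP[h1 h2] hn0; rewrite sub0r normrN normrZ.
  have ht : h *: (1 : R) + t - t = h by rewrite addrK [h *: 1]mulr1.
  have := H (h *: 1 + t); rewrite ht => /(_ h2); rewrite d0 subr0 => le1.
  have := lip (h *: 1 + t); rewrite ht => /(_ h1) le2.
  rewrite normfV ler_pdivrMl ?normr_gt0//; apply: le_trans le1 _.
  apply: (@le_trans _ _ (e / (`|K| + 1) * ((`|K| + 1) * `|h|))).
    rewrite ler_wpM2l ?(ltW e'0)//; apply: le_trans le2 _; rewrite ler_wpM2r//.
    by apply: le_trans (ler_norm _) _; rewrite lerDl.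
  by rewrite mulrA divfK ?gt_eqF// mulrC.
by split; [exact: cvgP cv|exact: cvg_lim cv].
Qed.

Lemma is_derive0_constant (R : realType) (f : R -> R) (a b : R) : a <= b ->
  (forall t, a <= t <= b -> is_derive t 1 f 0) -> f b = f a.
Proof.
move=> ab d0; have [||c _] := @MVT_segment R f (fun=> 0) a b ab.
- by move=> t; rewrite in_itv/= => /andP[h1 h2]; apply: d0; rewrite !ltW.
- apply: continuous_on_within => t; rewrite /= in_itv/= => h; have dt := d0 t h.
  by apply/differentiable_continuous/derivable1_diffP; exact: (@ex_derive _ _ _ _ _ _ _ dt).
- by move/eqP; rewrite mul0r subr_eq0 => /eqP.
Qed.

Section Straightening.
Variables (R : realType) (n : nat) (k : 'I_n) (u0 : 'rV[R]_n) (h : 'rV[R]_n -> R) (d a C : R).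
Hypotheses (d0 : 0 < d) (a0 : 0 < a) (C0 : 0 <= C).
Hypothesis h_diff : forall u, `|u - u0| < d -> differentiable h u.
Hypothesis h_incr : forall u, `|u - u0| < d -> a <= partial k h u.
Hypothesis h_bound : forall u v, `|u - u0| < d -> `|'D_v h u| <= C * `|v|.
Notation e_ := (delta_mx 0 k : 'rV[R]_n).

(** Coordinates centered at [u0] in which [h] replaces the coordinate [k], as in the implicit
    function theorem. *)
Definition straight (u : 'rV[R]_n) : 'rV[R]_n :=
  \row_i (if i == k then h u - h u0 else u 0 i - u0 0 i).

Lemma straight_k u : straight u 0 k = h u - h u0. Proof. by rewrite mxE eqxx. Qed.

Lemma straight_i u i : i != k -> straight u 0 i = u 0 i - u0 0 i.
Proof. by move=> /negbTE ik; rewrite mxE ik. Qed.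

Lemma ball_line (z v : 'rV[R]_n) (s t : R) : `|z - u0| < d -> `|z + t *: v - u0| < d ->
  0 <= s <= 1 -> `|z + (s * t) *: v - u0| < d.
Proof.
move=> h0 h1 /andP[s0 s1].
have -> : z + (s * t) *: v - u0 = (1 - s) *: (z - u0) + s *: (z + t *: v - u0).
  by apply/rowP => i; rewrite !mxE; ring.
apply: le_lt_trans (ler_normD _ _) _; rewrite !normrZ !ger0_norm ?subr_ge0//.
pose m := Num.max `|z - u0| `|z + t *: v - u0|.
have [m0 m1] : `|z - u0| <= m /\ `|z + t *: v - u0| <= m by rewrite /m !le_max !lexx orbT.
apply: (@le_lt_trans _ _ m); last by rewrite /m gt_max h0.
have := ler_wpM2l (_ : 0 <= 1 - s) m0; rewrite subr_ge0 => /(_ s1).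
have := ler_wpM2l s0 m1.
by move: (`|z - u0|) (`|_|) m {m0 m1 h0 h1} => x y m; lra.
Qed.

Lemma ball_mean_value (z v : 'rV[R]_n) (t : R) : `|z - u0| < d -> `|z + t *: v - u0| < d ->
  exists s, `|z + s *: v - u0| < d /\ h (z + t *: v) - h z = t * 'D_v h (z + s *: v).
Proof.
move=> h0 h1; have dd (s : R) : 0 <= s <= 1 ->
    is_derive s 1 (fun s => h (z + s *: (t *: v))) ('D_(t *: v) h (z + s *: (t *: v))).
  move=> s01; apply: is_derive_line; apply: diff_derivable; apply: h_diff.
  by rewrite scalerA; exact: ball_line.
have [||s] := @MVT_segment R (fun s => h (z + s *: (t *: v))) (fun s => 'D_(t *: v) h (z + s *: (t *: v))) 0 1 ler01.
- by move=> s; rewrite in_itv/= => /andP[s0 s1]; apply: dd; rewrite !ltW.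
- apply: continuous_on_within => s; rewrite /= in_itv/= => s01; have ds := dd s s01.
  by apply/differentiable_continuous/derivable1_diffP; exact: (@ex_derive _ _ _ _ _ _ _ ds).
rewrite in_itv/= scale1r scale0r addr0 subr0 mulr1 scalerA => s01 E; exists (s * t).
split; first exact: ball_line.
by rewrite E deriveZ_dir//; apply: h_diff; exact: ball_line.
Qed.

Lemma straight_lip u u' : `|u - u0| < d -> `|u' - u0| < d -> `|h u - h u'| <= C * `|u - u'|.
Proof.
move=> hu hu'; have := @ball_mean_value u' (u - u') 1 hu'; rewrite scale1r [u' + _]addrC subrK.
move=> /(_ hu)[s [sd ->]]; rewrite mul1r; exact: h_bound.
Qed.

Definition lipK : R := 1 + (1 + C) / a.

Lemma straight_inverse_lip u u' : `|u - u0| < d -> `|u' - u0| < d ->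
  `|u - u'| <= lipK * `|straight u - straight u'|.
Proof.
move=> hu hu'; set L := `|straight u - straight u'|.
have L0 : 0 <= L by exact: normr_ge0.
have coord i : i != k -> `|u 0 i - u' 0 i| <= L.
  move=> ik; have := normr_coord (straight u - straight u') 0 i.
  by rewrite !mxE (negbTE ik) opprB addrA subrK.
have top : `|h u - h u'| <= L.
  have := normr_coord (straight u - straight u') 0 k.
  by rewrite !mxE eqxx opprB addrA subrK.
(* Moves [u] along the axis [k] until its coordinate [k] is that of [u']. The Lipschitz bound
   compares [h u2] with [h u'], and the growth of [h] along the axis then bounds the length of the
   move. *)
pose u2 := u + (u' 0 k - u 0 k) *: e_.
have u2E i : u2 0 i = if i == k then u' 0 i else u 0 i.
  by rewrite /u2 !mxE eqxx/=; have [->|] := eqVneq i k; rewrite ?mulr1 ?mulr0 ?addr0// addrC subrK.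
have hu2 : `|u2 - u0| < d.
  apply: norm_mx_lt => // j i; rewrite ord1 mxE u2E [(- u0) _ _]mxE.
  case: ifP => _; [apply: le_lt_trans hu'|apply: le_lt_trans hu].
    by have := normr_coord (u' - u0) 0 i; rewrite !mxE.
  by have := normr_coord (u - u0) 0 i; rewrite !mxE.
have d2 : `|u2 - u'| <= L.
  apply: norm_mx_le => // j i; rewrite ord1 mxE u2E [(- u') _ _]mxE.
  by have [->|ik] := eqVneq i k; [rewrite subrr normr0|exact: coord].
have [s [sd E]] := ball_mean_value hu hu2.
have hk : `|u 0 k - u' 0 k| <= (1 + C) / a * L.
  rewrite mulrAC ler_pdivlMr// mulrC; apply: (@le_trans _ _ (`|h u2 - h u|)).
    rewrite E normrM [`|u' 0 k - _|]distrC mulrC ler_wpM2l//.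
    by apply: le_trans (ler_norm _); exact: h_incr.
  rewrite -(subrK (h u') (h u2)) -addrA; apply: le_trans (ler_normD _ _) _.
  rewrite [`|h u' - _|]distrC mulrDl mul1r addrC; apply: lerD => //.
  apply: le_trans (straight_lip hu2 hu') _; exact: ler_wpM2l.
have c0 : 0 <= (1 + C) / a by rewrite divr_ge0 ?(ltW a0)// addr_ge0.
apply: norm_mx_le => [|j i]; first by rewrite mulr_ge0// addr_ge0.
rewrite ord1 !mxE /lipK mulrDl mul1r; have [->|ik] := eqVneq i k.
  by apply: le_trans hk _; rewrite lerDr.
by apply: le_trans (coord i ik) _; rewrite lerDl mulr_ge0.
Qed.

(** The other coordinates are prescribed by [w], and the intermediate value theorem along the axis
    [k] supplies the value of [h]. *)
Lemma straight_surj : exists2 r, 0 < r & forall w : 'rV[R]_n, `|w| < r ->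
  exists2 u, `|u - u0| < d & straight u = w.
Proof.
(* The second bound makes the growth of [h] over a length [d / 2], at least [a * (d / 2)], exceed
   both the target value and the change of [h] due to displacing the base point. *)
pose r := Num.min (d / 2) (a * (d / 2) / (1 + C)).
have C1 : 0 < 1 + C by apply: ltr_pwDl.
have d2 : 0 < d / 2 by rewrite divr_gt0.
have r0 : 0 < r by rewrite lt_min d2 divr_gt0// mulr_gt0.
exists r => // w wr.
have [wd wa] : `|w| < d / 2 /\ (1 + C) * `|w| < a * (d / 2).
  by move: wr; rewrite lt_min => /andP[-> wr]; split=> //; rewrite mulrC -ltr_pdivlMr.
pose z := u0 + \row_i (if i == k then 0 else w 0 i).
have zw : `|z - u0| <= `|w|.
  rewrite /z addrC addKr; apply: norm_mx_le => // j i; rewrite ord1 mxE.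
  by case: ifP => _; [rewrite normr0|exact: normr_coord].
have zd : `|z - u0| < d by apply: le_lt_trans zw _; apply: lt_trans wd _; lra.
have ld s : `|s| <= d / 2 -> `|z + s *: e_ - u0| < d.
  move=> sd; apply: norm_mx_lt => // j i; rewrite ord1 !mxE !eqxx/=.
  have [ik|ik] := eqVneq i k.
    by rewrite mulr1 addr0 addrC addKr; apply: le_lt_trans sd _; lra.
  rewrite mulr0 addr0 addrC addKr; apply: le_lt_trans (normr_coord w 0 i) _.
  by apply: lt_trans wd _; lra.
pose f (s : R) := h (z + s *: e_) - h u0.
have zz : `|h z - h u0| <= C * `|w|.
  apply: le_trans (straight_lip zd _) _; first by rewrite subrr normr0.
  exact: ler_wpM2l.
have wk : `|w 0 k| <= `|w| by exact: normr_coord.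
have fp : w 0 k <= f (d / 2).
  have dd : `|d / 2| <= d / 2 by rewrite gtr0_norm.
  have [s [sd E]] := ball_mean_value zd (ld _ dd).
  have := h_incr sd; rewrite /partial => ge; have := ler_wpM2l (ltW d2) ge.
  move: E zz wk; rewrite /f !ler_norml => E /andP[h1 h2] /andP[h3 h4] h5.
  by move: E h1 h2 h3 h4 h5 wa; move: (h _) (h _) (h _) (`|w|) ('D__ h _) => *; nra.
have fm : f (- (d / 2)) <= w 0 k.
  have dd : `|- (d / 2)| <= d / 2 by rewrite normrN gtr0_norm.
  have [s [sd E]] := ball_mean_value zd (ld _ dd).
  have := h_incr sd; rewrite /partial => ge; have := ler_wpM2l (ltW d2) ge.
  move: E zz wk; rewrite /f !ler_norml => E /andP[h1 h2] /andP[h3 h4] h5.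
  by move: E h1 h2 h3 h4 h5 wa; move: (h _) (h _) (h _) (`|w|) ('D__ h _) => *; nra.
have [|||s] := @IVT R f (- (d / 2)) (d / 2) (w 0 k).
- by lra.
- apply: continuous_on_within => s; rewrite /= in_itv/= -ler_norml => sd.
  apply: contB; last exact: cont_cst.
  apply: differentiable_continuous; apply/derivable1_diffP; apply/derivable_line.
  by apply: diff_derivable; apply: h_diff; exact: ld.
- by rewrite ge_min le_max fm fp orbT.
rewrite in_itv/= -ler_norml => sd fs; exists (z + s *: e_); first exact: ld.
apply/rowP => i; rewrite mxE; have [->|ik] := eqVneq i k; first exact: fs.
by rewrite /z !mxE (negbTE ik) andbF mulr0 addr0 [u0 0 i + _]addrC addrK.
Qed.

Theorem straighten : exists (r : R) (th : 'rV[R]_n -> 'rV[R]_n),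
  [/\ 0 < r,
   forall w, `|w| < r -> `|th w - u0| < d /\ straight (th w) = w,
   forall u, `|u - u0| < d -> `|straight u| < r -> th (straight u) = u &
   forall w w', `|w| < r -> `|w'| < r -> `|th w - th w'| <= lipK * `|w - w'|].
Proof.
have [r r0 surj] := straight_surj.
have /choice[th thP] : forall w, exists u, `|w| < r -> `|u - u0| < d /\ straight u = w.
  move=> w; have [/surj[u u1 u2]|nw] := pselect (`|w| < r); first by exists u.
  by exists 0.
exists r, th; split=> // [u hu su|w w' hw hw'].
  have [h1 h2] := thP _ su; have := straight_inverse_lip h1 hu.
  by rewrite h2 subrr normr0 mulr0 normr_le0 subr_eq0 => /eqP.
have [h1 h2] := thP _ hw; have [h3 h4] := thP _ hw'.
by have := straight_inverse_lip h1 h3; rewrite h2 h4.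
Qed.

(** Joins the two points inside the level of [h] by a path that is Lipschitz because [th] is.
    Subtracting [mu * h], constant on the path, with [mu] a Lagrange multiplier, makes the
    differential vanish, and [is_derive_critical] applies. *)
Lemma critical_level (be : 'rV[R]_n -> R) (r : R) (th : 'rV[R]_n -> 'rV[R]_n) (K : R) :
  (forall w, `|w| < r -> `|th w - u0| < d /\ straight (th w) = w) ->
  (forall w w', `|w| < r -> `|w'| < r -> `|th w - th w'| <= K * `|w - w'|) ->
  (forall u, `|u - u0| < d -> differentiable be u) ->
  (forall u v, `|u - u0| < d -> 'D_v h u = 0 -> 'D_v be u = 0) ->
  forall w w' : 'rV[R]_n, `|w| < r -> `|w'| < r -> w 0 k = w' 0 k -> be (th w) = be (th w').
Proof.
move=> thP lip dbe crit w w' hw hw' e.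
pose p (t : R) := w' + t *: (w - w').
have pr t : 0 <= t <= 1 -> `|p t| < r.
  move=> /andP[t0 t1]; have -> : p t = (1 - t) *: w' + t *: w.
    by rewrite /p scalerBl scale1r scalerBr addrA addrAC.
  apply: le_lt_trans (ler_normD _ _) _; rewrite !normrZ !ger0_norm ?subr_ge0//.
  have t1' : 0 <= 1 - t by rewrite subr_ge0.
  have := ler_wpM2l t0 (ltW hw); have := ler_wpM2l t1' (ltW hw').
  by move: hw hw'; move: (`|_|) (`|_|) => *; nra.
pose cl (t : R) := Num.max 0 (Num.min 1 t).
have cl01 t : 0 <= cl t <= 1 by rewrite /cl le_max lexx/= ge_max ler01/= ge_min lexx.
have clE t : 0 <= t <= 1 -> cl t = t by move=> /andP[t0 t1]; rewrite /cl min_r// max_r.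
have clL s t : `|cl s - cl t| <= `|s - t|.
  have clE' x : [\/ x <= 0 /\ cl x = 0, 0 <= x <= 1 /\ cl x = x | 1 <= x /\ cl x = 1].
    have [x0|x0] := leP x 0; first by constructor 1; rewrite /cl min_r ?max_l//; lra.
    have [x1|x1] := leP x 1; first by constructor 2; rewrite clE ?(ltW x0).
    by constructor 3; rewrite /cl min_l ?max_r//; lra.
  have h1 := ler_norm (s - t); have h2 := ler_norm (t - s); rewrite distrC in h2.
  rewrite ler_norml; move: h1 h2; move: (`|_|) => N.
  by case: (clE' s) => -[+ ->]; case: (clE' t) => -[+ ->]; lra.
pose q t := th (p (cl t)).
have qk t : h (q t) = w' 0 k + h u0.
  have [_ /rowP/(_ k)] := thP _ (pr _ (cl01 t)); rewrite straight_k => /(canRL (subrK _)) ->.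
  by rewrite /p !mxE e subrr mulr0 addr0.
have dq (t : R) : 0 <= t <= 1 -> is_derive t 1 (fun s => be (q s)) 0.
  move=> t01; have [qd _] := thP _ (pr _ (cl01 t)).
  pose mu := partial k be (q t) / partial k h (q t).
  have pk : partial k h (q t) != 0 by rewrite gt_eqF// (lt_le_trans a0)// h_incr.
  have dh := h_diff qd; have db := dbe _ qd.
  pose L u := be u - mu * h u.
  have dL : differentiable L (q t) by apply: differentiableB => //; apply: differentiableM.
  have L0 v : 'D_v L (q t) = 0.
    rewrite deriveB; [|exact: diff_derivable|apply: diff_derivable; exact: differentiableM].
    rewrite deriveZ; last exact: diff_derivable.
    pose c := 'D_v h (q t) / partial k h (q t).
    have cv : 'D_(v - c *: e_) be (q t) = 0.
      apply: crit => //; rewrite deriveB_dir// deriveZ_dir// -/(partial k h _) /c.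
      by rewrite [_ *: _]divfK// subrr.
    move: cv; rewrite deriveB_dir// deriveZ_dir// => /eqP; rewrite subr_eq0 => /eqP ->.
    have swap (x y z : R) : (x / z) *: (y : R^o) - (y / z) *: (x : R^o) = 0.
      by rewrite /GRing.scale/=; ring.
    exact: swap.
  have lq : \forall s \near t, `|q s - q t| <= (`|K| * `|w - w'|) * `|s - t|.
    apply/nbhs_real_normP; exists 1 => // s _; apply: le_trans (lip _ _ (pr _ (cl01 s)) (pr _ (cl01 t))) _.
    have -> : p (cl s) - p (cl t) = (cl s - cl t) *: (w - w').
      by apply/rowP => i; rewrite !mxE; ring.
    apply: (@le_trans _ _ (`|K| * `|(cl s - cl t) *: (w - w')|)).
      by rewrite ler_wpM2r// ler_norm.
    by rewrite normrZ -mulrA ler_wpM2l// mulrC ler_wpM2l.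
  have := is_derive_critical dL L0 lq.
  have -> : (fun s => L (q s)) = (fun s => be (q s)) - cst (mu * (w' 0 k + h u0)).
    by apply/funext => s; rewrite /L qk.
  move=> dd; have -> : (fun s => be (q s)) = (fun s => be (q s)) - cst (mu * (w' 0 k + h u0)) + cst (mu * (w' 0 k + h u0)).
    by rewrite subrK.
  by have := is_deriveD dd (is_derive_cst (mu * (w' 0 k + h u0)) t 1); rewrite addr0.
have := is_derive0_constant ler01 dq; rewrite /q !clE ?lexx ?ler01//.
by rewrite /p scale1r scale0r addr0 addrC subrK.
Qed.

End Straightening.

Lemma primitive_exists (R : realType) (f : R -> R) (r : R) : (forall x, {for x, continuous f}) ->
  exists F : R -> R, forall x : R, `|x| < r -> is_derive x 1 F (f x).
Proof.
move=> cf; pose mu := @lebesgue_measure R.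
exists (fun x => (\int[mu]_(t in [set` Interval (BLeft (- r)) (BRight x)]) (f t))%R).
move=> x; rewrite ltr_norml => /andP[x1 x2].
have int : mu.-integrable [set` Interval (BLeft (- r)) (BRight r)] (EFin \o f).
  apply: (@continuous_compact_integrable R f `[- r, r]%classic); first exact: segment_compact.
  by apply: continuous_on_within => y _; exact: cf.
have [d1 d2] := @continuous_FTC1 R f (BLeft (- r)) x r x2 int x1 (cf x).
by apply: DeriveDef; [exact: d1|rewrite -derive1E; exact: d2].
Qed.

Record monotone_near (R : realType) n (k : 'I_n) (u0 : 'rV[R]_n) (h : 'rV[R]_n -> R) (d a C : R) :
    Prop := MonotoneNear {
  mn_d : 0 < d; mn_a : 0 < a; mn_C : 0 <= C;
  mn_diff : forall u, `|u - u0| < d -> differentiable h u;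
  mn_incr : forall u, `|u - u0| < d -> a <= partial k h u;
  mn_bound : forall u v, `|u - u0| < d -> `|'D_v h u| <= C * `|v| }.

Lemma monotone_near_of_C1 (R : realType) n (k : 'I_n) (u0 : 'rV[R]_n) (h : 'rV[R]_n -> R)
    (U : set 'rV[R]_n) : open U -> Ck 1 U h -> U u0 -> 0 < partial k h u0 ->
  exists d a C, monotone_near k u0 h d a C /\ forall u, `|u - u0| < d -> U u.
Proof.
move=> oU Ch Uu0 pk; have [_ dh] := Ch.
have cp i u : U u -> {for u, continuous (partial i h)} by move=> Uu; have [_ []] := dh i => c _; exact: c.
have n1 : \forall u \near u0, U u by exact: open_near.
have n2 : \forall u \near u0, partial k h u0 / 2 < partial k h u.
  have H : \forall y \near partial k h u0, partial k h u0 / 2 < y.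
    apply/nbhs_real_normP; exists (partial k h u0 / 2); first by rewrite divr_gt0.
    by move=> s; rewrite ltr_norml => /andP[]; move: (partial k h u0) => *; lra.
  exact: (near_comp (cp k u0 Uu0) H).
have n3 : \forall u \near u0, forall i, `|partial i h u| < `|partial i h u0| + 1.
  apply: near_all => i.
  have H : \forall y \near partial i h u0, `|y| < `|partial i h u0| + 1.
    apply/nbhs_real_normP; exists 1 => // s s1; rewrite -(subrK (partial i h u0) s) addrC.
    by apply: le_lt_trans (ler_normD _ _) _; rewrite ltrD2l.
  exact: (near_comp (cp i u0 Uu0) H).
have [d [d0 dP]] : exists d, 0 < d /\ forall u, `|u - u0| < d ->
    [/\ U u, partial k h u0 / 2 < partial k h u & forall i, `|partial i h u| < `|partial i h u0| + 1].
  have : \forall u \near u0, [/\ U u, partial k h u0 / 2 < partial k h u &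
      forall i, `|partial i h u| < `|partial i h u0| + 1].
    by near=> u; split; near: u.
  by move=> /(@near_normP R 'rV[R]_n _ u0)[d d0 H]; exists d.
have dif u : `|u - u0| < d -> differentiable h u.
  by move=> /dP[Uu _ _]; exact: (@Ck_differentiable R n 0 U h u oU Ch Uu).
exists d, (partial k h u0 / 2), (\sum_i (`|partial i h u0| + 1)); split; last by move=> u /dP[].
split=> //; first by rewrite divr_gt0.
- by apply: sumr_ge0 => i _; exact: addr_ge0.
- by move=> u /dP[_ /ltW].
- move=> u v ud; have [_ _ b] := dP u ud; rewrite derive_partial; last exact: dif.
  apply: le_trans (ler_norm_sum _ _ _) _; rewrite mulr_suml; apply: ler_sum => i _.
  rewrite normrM mulrC; apply: ler_pM => //; first exact: ltW.
  exact: normr_coord.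
Unshelve. all: by end_near. Qed.

(* The line [u0 + s e_k] is a section of the level sets of [h], parametrized by the value of [h]. *)
Lemma level_section (R : realType) n (k : 'I_n) (u0 : 'rV[R]_n) (h : 'rV[R]_n -> R) (d a C : R) :
  monotone_near k u0 h d a C -> exists (r d' : R) (g : R -> R),
  let z t := u0 + g t *: delta_mx 0 k in
  [/\ 0 < r, 0 < d' <= d /\ g 0 = 0,
   forall t, `|t| < r -> [/\ `|z t - u0| < d, h (z t) = h u0 + t, {for t, continuous g} &
     is_derive t 1 g (partial k h (z t))^-1],
   forall u, `|u - u0| < d' -> `|h u - h u0| < r &
   forall be : 'rV[R]_n -> R, (forall u, `|u - u0| < d -> differentiable be u) ->
     (forall u v, `|u - u0| < d -> 'D_v h u = 0 -> 'D_v be u = 0) ->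
     forall u, `|u - u0| < d' -> be u = be (z (h u - h u0))].
Proof.
move=> [d0 a0 C0 hd hi hb].
have [r [th [r0 thP thK lip]]] := straighten d0 a0 C0 hd hi hb.
pose st := straight k u0 h.
pose e := delta_mx 0 k : 'rV[R]_n; pose g t := th (t *: e) 0 k - u0 0 k.
have ne t : `|t *: e| <= `|t|.
  apply: norm_mx_le => // i j; rewrite ord1 !mxE eqxx/= normrM.
  by case: (j == k); rewrite ?normr1 ?mulr1// normr0 mulr0.
have ek t : (t *: e) 0 k = t by rewrite !mxE !eqxx mulr1.
have zE t : `|t| < r -> u0 + g t *: e = th (t *: e).
  move=> tr; have [_ /rowP E] := thP _ (le_lt_trans (ne t) tr).
  apply/rowP => i; rewrite !mxE eqxx/=; have [->|ik] := eqVneq i k.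
    by rewrite mulr1 /g addrC subrK.
  have := E i; rewrite straight_i// !mxE eqxx (negbTE ik) mulr0 => /eqP; rewrite subr_eq0 => /eqP ->.
  by rewrite mulr0 addr0.
have zd t : `|t| < r -> `|u0 + g t *: e - u0| < d.
  by move=> tr; rewrite zE//; have [] := thP _ (le_lt_trans (ne t) tr).
have zh t : `|t| < r -> h (u0 + g t *: e) = h u0 + t.
  move=> tr; rewrite zE//; have [_ /rowP/(_ k)] := thP _ (le_lt_trans (ne t) tr).
  by rewrite straight_k ek => /(canRL (subrK _)) ->; rewrite addrC.
have cg t : `|t| < r -> {for t, continuous g}.
  move=> tr; apply: contB; last exact: cont_cst.
  apply: cont_mxE; apply/cvgrPdist_le => eps eps0; rewrite near_simpl; apply/nbhs_real_normP.
  have K0 : 0 < `|lipK a C| + 1 by apply: ltr_wpDl.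
  exists (Num.min (r - `|t|) (eps / (`|lipK a C| + 1))).
    by rewrite lt_min subr_gt0 tr divr_gt0.
  move=> s; rewrite lt_min => /andP[s1 s2].
  have sr : `|s| < r by rewrite -(subrK t s); apply: le_lt_trans (ler_normD _ _) _; rewrite -ltrBrDr.
  have l := lip _ _ (le_lt_trans (ne t) tr) (le_lt_trans (ne s) sr).
  apply: le_trans l _; rewrite -scalerBl.
  have := ne (t - s); rewrite distrC => l2.
  move: s2; rewrite ltr_pdivlMr// => /ltW; rewrite mulrC; apply: le_trans.
  apply: (@le_trans _ _ ((`|lipK a C| + 1) * `|(t - s) *: e|)).
    by rewrite ler_wpM2r//; apply: le_trans (ler_norm _) _; rewrite lerDl.
  by rewrite ler_wpM2l// (ltW K0).
have line_st s : `|s *: e| < d -> st (u0 + s *: e) = (h (u0 + s *: e) - h u0) *: e.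
  move=> sd; apply/rowP => i; rewrite /st mxE [RHS]mxE [e 0 i]mxE eqxx/=.
  case ik: (i == k); first by rewrite mulr1.
  by rewrite !mxE ik andbF mulr0 addr0 subrr mulr0.
have gK s : `|s *: e| < d -> `|h (u0 + s *: e) - h u0| < r -> g (h (u0 + s *: e) - h u0) = s.
  move=> sd hr; rewrite /g -line_st// thK.
  - by rewrite mxE ek [u0 0 k + s]addrC addrK.
  - by rewrite addrC addKr.
  - by rewrite -/st line_st//; apply: le_lt_trans (ne _) hr.
have dg (t : R) : `|t| < r -> is_derive t 1 g (partial k h (u0 + g t *: e))^-1.
  move=> tr; have ud := zd t tr; pose f s := h (u0 + s *: e) - h u0.
  have fg : f (g t) = t by rewrite /f zh// addrC addKr.
  have fc s : `|s *: e| < d -> {for s, continuous f}.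
    move=> sd; apply: contB; last exact: cont_cst.
    apply: differentiable_continuous; apply/derivable1_diffP; apply/derivable_line.
    by apply: diff_derivable; apply: hd; rewrite addrC addKr.
  have gd : `|g t *: e| < d by move: ud; rewrite addrC addKr.
  have cse (s : R) : {for s, continuous (fun s : R => s *: e)} by apply: cvgZr_tmp; exact: cvg_id.
  have nd : \forall s \near g t, `|s *: e| < d.
    have H : \forall w \near g t *: e, `|w| < d.
      apply/(@near_normP R 'rV[R]_n _ (g t *: e)); exists (d - `|g t *: e|); first by rewrite subr_gt0.
      move=> w wd; rewrite -(subrK (g t *: e) w); apply: le_lt_trans (ler_normD _ _) _.
      by rewrite -ltrBrDr.
    exact: (near_comp (cse (g t)) H).
  have nr : \forall s \near g t, `|f s| < r.
    have H : \forall y \near f (g t), `|y| < r.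
      rewrite fg; apply/nbhs_real_normP; exists (r - `|t|); first by rewrite subr_gt0.
      move=> s sd; rewrite -(subrK t s); apply: le_lt_trans (ler_normD _ _) _.
      by rewrite -ltrBrDr.
    exact: (near_comp (fc _ gd) H).
  have H : is_derive (f (g t)) 1 g (partial k h (u0 + g t *: e))^-1.
    apply: is_derive_inverse.
    - by near=> s; apply: gK; near: s.
    - by near=> s; apply: fc; near: s.
    - have H := is_derive_line (diff_derivable (v := e) (hd _ ud)).
      by have := is_deriveB H (is_derive_cst (h u0) (g t) 1); rewrite subr0.
    - by rewrite gt_eqF// (lt_le_trans a0)// hi.
  by rewrite fg in H.
have C1 : 0 < 1 + C by apply: ltr_pwDl.
have r' : 0 < r / (1 + C) by rewrite divr_gt0.
have near_st u : `|u - u0| < d -> `|u - u0| < r / (1 + C) -> `|st u| < r.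
  move=> ud; rewrite ltr_pdivlMr// => ur; apply: le_lt_trans ur.
  have hh : `|h u - h u0| <= C * `|u - u0|.
    have u00 : `|u0 - u0| < d by rewrite subrr normr0.
    exact: (straight_lip hd hb ud u00).
  apply: norm_mx_le => [|i j]; first by rewrite mulr_ge0// ltW.
  rewrite ord1 mxE; case: ifP => _.
    by apply: le_trans hh _; rewrite mulrC ler_wpM2l// lerDr.
  have := normr_coord (u - u0) 0 j; rewrite !mxE => /le_trans; apply.
  by rewrite mulrDr mulr1 lerDl mulr_ge0.
have g0 : g 0 = 0.
  have := gK 0; rewrite scale0r addr0 subrr !normr0; exact.
exists r, (Num.min d (r / (1 + C))), g; split=> //.
- by rewrite lt_min d0 r' ge_min lexx.
- by move=> t tr; split; [exact: zd|exact: zh|exact: cg|exact: dg].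
- move=> u; rewrite lt_min => /andP[u1 u2]; apply: le_lt_trans (near_st u u1 u2).
  by have := normr_coord (st u) 0 k; rewrite /st straight_k.
- move=> be dbe crit u; rewrite lt_min => /andP[u1 u2].
  have su := near_st u u1 u2.
  have hr : `|h u - h u0| < r.
    by apply: le_lt_trans su; have := normr_coord (st u) 0 k; rewrite /st straight_k.
  rewrite -/e zE// -{1}(thK u u1 su).
  apply: (critical_level a0 hd hi thP lip dbe crit) => //.
    by apply: le_lt_trans (ne _) hr.
  by rewrite ek -/st /st straight_k.
Unshelve. all: by end_near. Qed.

(** * Totally geodesic maps of rank one *)

Lemma rank_le1_row (R : realType) n m (X : 'M[R]_(n, m)) k (x : 'rV[R]_n) :
  rank_le1 X -> row k X != 0 -> exists mu, x *m X = mu *: row k X.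
Proof.
move=> r1 /rV0Pn[c]; rewrite mxE => Xc; exists ((x *m X) 0 c / X k c).
apply/rowP => j; rewrite [RHS]mxE row_entry; apply: (mulfI Xc).
rewrite mulrA [X k c * (_ / _)]mulrCA divff// mulr1 !mxE mulr_sumr mulr_suml.
by apply: eq_bigr => i _; rewrite -mulrA r1 mulrCA [X k c * _]mulrC.
Qed.

Lemma derive_real_dir (R : realType) (W : normedModType R) (f : R -> W) (t l : R) :
  differentiable f t -> 'D_l f t = l *: 'D_1 f t.
Proof.
move=> df; rewrite -(@deriveZ_dir R R W f t 1 l df).
by have -> : l *: (1 : R) = l by rewrite /GRing.scale/= mulr1.
Qed.

Lemma bform_sym_sum (R : realType) n (A : 'M[R]_n) (x : 'rV[R]_n) :
  bform (A + A^T) x x = bform A x x *+ 2.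
Proof.
have tr (X : 'M[R]_1) : X 0 0 = X^T 0 0 by rewrite mxE.
by rewrite /bform mulmxDr mulmxDl mxE mulr2n [X in _ + X]tr !trmx_mul !trmxK mulmxA.
Qed.

Lemma is_derive_section (R : realType) (V W : normedModType R) (f : V -> W) (u0 e : V)
    (g : R -> R) (t l : R) : differentiable f (u0 + g t *: e) -> is_derive t 1 g l ->
  is_derive t 1 (fun s : R => f (u0 + g s *: e)) (l *: 'D_e f (u0 + g t *: e)).
Proof.
move=> df dg; have H := is_derive_line (diff_derivable (v := e) df).
have d1 : differentiable (fun s : R => f (u0 + s *: e)) (g t).
  by apply/derivable1_diffP; exact: (@ex_derive _ _ _ _ _ _ _ H).
have d2 : differentiable g t by apply/derivable1_diffP; exact: (@ex_derive _ _ _ _ _ _ _ dg).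
have dc : differentiable (fun s : R => f (u0 + g s *: e)) t.
  exact: (@differentiable_comp _ _ _ _ g (fun s : R => f (u0 + s *: e)) t d2 d1).
apply: DeriveDef; first exact: diff_derivable.
rewrite (derive_comp (1 : R) d2 d1) (@derive_val _ _ _ _ _ _ _ dg).
by rewrite (derive_real_dir l d1) (@derive_val _ _ _ _ _ _ _ H).
Qed.

Lemma is_derive_inv_sqrt (R : realType) (x : R) : 0 < x ->
  is_derive x 1 (fun y => (Num.sqrt y)^-1) (- ((Num.sqrt x)^-1 / x) / 2).
Proof.
move=> x0; have H := is_derive1_sqrt x0; have s0 : Num.sqrt x != 0 by rewrite gt_eqF ?sqrtr_gt0.
have := is_deriveV s0 H.
set a := _ *: _; have -> // : a = - ((Num.sqrt x)^-1 / x) / 2.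
rewrite /a (sqr_sqrtr (ltW x0)) /GRing.scale/= invfM.
by move: (_^-1) (_^-1) (_^-1) => y1 y2 y3; ring.
Qed.

Lemma open_normball (R : realType) n (u0 : 'rV[R]_n) (d : R) : open [set u | `|u - u0| < d].
Proof.
apply: open_local => u /= ud; apply/(@near_normP R 'rV[R]_n _ u); exists (d - `|u - u0|).
  by rewrite subr_gt0.
move=> w wd /=; have -> : w - u0 = (w - u) + (u - u0) by rewrite addrA subrK.
by apply: le_lt_trans (ler_normD _ _) _; rewrite -ltrBrDr.
Qed.

Lemma monotone_nearS (R : realType) n (k : 'I_n) (u0 : 'rV[R]_n) h (d d' a C : R) :
  0 < d' <= d -> monotone_near k u0 h d a C -> monotone_near k u0 h d' a C.
Proof.
move=> /andP[d0 dd] [_ a0 C0 h1 h2 h3]; split=> //.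
- by move=> u ud; apply: h1; exact: lt_le_trans dd.
- by move=> u ud; apply: h2; exact: lt_le_trans dd.
- by move=> u v ud; apply: h3; exact: lt_le_trans dd.
Qed.

Section LocalGeodesic.
Variables (R : realType) (p q p' q' : nat).
Variables (U : set 'rV[R]_(p + q)) (G : 'rV[R]_(p + q) -> 'M[R]_(p + q)).
Variables (O' : set 'rV[R]_(p' + q')) (G' : 'rV[R]_(p' + q') -> 'M[R]_(p' + q')).
Variable F : 'rV[R]_(p + q) -> 'rV[R]_(p' + q').
Hypotheses (cm : chart_metric U G) (cm' : chart_metric O' G') (cF : chart_map U O' F).
Let oU : open U := cm_open cm.
Notation S := (S F).
Notation phi := (tmap F).
Notation Hm := (Hm G' F).
Hypothesis rank1 : forall u, U u -> rank_le1 (S u).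
Hypothesis parallel : forall k u, U u -> IIm G G' F k u = 0.

Section Direction.
Variable k : 'I_q.
Notation e_ := (delta_mx 0 (rshift p k) : 'rV[R]_(p + q)).
Notation s u := (row k (S u)).
Definition speed2 u := bform (Hm u) (s u) (s u).
Definition unit_tangent u := (Num.sqrt (speed2 u))^-1 *: s u.

Lemma speed2E u : speed2 u = (S u *m Hm u *m (S u)^T) k k.
Proof. by rewrite /speed2 bform_rows. Qed.

Lemma speed2_smooth : smooth_on U speed2.
Proof.
have -> : speed2 = fun u => (S u *m Hm u *m (S u)^T) k k by apply/funext => u; exact: speed2E.
have sS := S_smooth cm cF; have sH := Hm_smooth cm cm' cF.
by apply: (mxsmooth_mul oU (mxsmooth_mul oU sS sH)); exact: mxsmooth_tr.
Qed.

Lemma speed2_pos u : U u -> s u != 0 -> 0 < speed2 u.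
Proof. by move=> Uu; apply: (gb_pos cm'); exact: (cmap_dom cF). Qed.

(** By parallelism the derivative of the row is a Christoffel term of Q minus one of Q', and rank
    one makes the former a multiple of the row itself. *)
Lemma derive_tangent u : U u -> s u != 0 ->
  exists mu, row k ('D_e_ S u) = mu *: s u - s u *m Cm G' F k u.
Proof.
move=> Uu s0; have [mu E] := rank_le1_row (row k (Gam G k u)) (rank1 Uu) s0.
exists mu; have := parallel k Uu; rewrite /IIm => /(congr1 (row k)).
rewrite row0 linearB linearD /= !row_mul E => /eqP; rewrite subr_eq0 => /eqP <-.
by rewrite addrK.
Qed.

Lemma derive_speed2 u mu : U u -> row k ('D_e_ S u) = mu *: s u - s u *m Cm G' F k u ->
  'D_e_ speed2 u = mu * speed2 u *+ 2.
Proof.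
move=> Uu E; have dS := mxsmooth_differentiable oU (S_smooth cm cF) Uu.
have dH := mxsmooth_differentiable oU (Hm_smooth cm cm' cF) Uu.
have vS := diff_derivable (v := e_) dS; have vH := diff_derivable (v := e_) dH.
have vSH := derivable_mulmx vS vH; have vT := derivable_trmx vS.
have vP := derivable_mulmx vSH vT.
have -> : speed2 = fun u => (S u *m Hm u *m (S u)^T) k k by apply/funext => w; exact: speed2E.
rewrite -(derive_mxE _ _ vP) (derive_mulmx vSH vT) (derive_mulmx vS vH) (derive_trmx vS).
rewrite (Hm_compat cm cm' cF k Uu) mulmxDl mxE [X in X + _ = _]mxE -!bform_rows -/(speed2 u).
have HT : (Hm u)^T = Hm u by apply: (gbT cm'); exact: (cmap_dom cF).
rewrite [bform (Hm u) (s u) (row k ('D__ _ _))](bformC _ _ HT) E.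
have -> : bform (Cm G' F k u *m Hm u + (Cm G' F k u *m Hm u)^T) (s u) (s u) =
    bform (Hm u) (s u *m Cm G' F k u) (s u) *+ 2.
  by rewrite bform_sym_sum /bform mulmxA.
by rewrite !bformDl !bformNl !bformZl -/(speed2 u); ring.
Qed.

Lemma unit_tangent_derive u : U u -> s u != 0 ->
  differentiable unit_tangent u /\
  'D_e_ unit_tangent u = - ((Num.sqrt (speed2 u))^-1 *: (s u *m Cm G' F k u)).
Proof.
move=> Uu s0; have N0 := speed2_pos Uu s0; have [mu E] := derive_tangent Uu s0.
have dS := mxsmooth_differentiable oU (S_smooth cm cF) Uu.
have dN := smooth_differentiable oU speed2_smooth Uu.
have HQ := is_derive_inv_sqrt N0.
pose Q (y : R) := (Num.sqrt y)^-1.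
have dQ : differentiable Q (speed2 u).
  by apply/derivable1_diffP; exact: (@ex_derive _ _ _ _ _ _ _ HQ).
have dQN : differentiable (fun w => Q (speed2 w)) u.
  exact: (@differentiable_comp _ _ _ _ speed2 Q u dN dQ).
have dM : differentiable (fun w => (Q (speed2 w))%:M : 'M[R]_1) u.
  apply: differentiable_mx => i j; rewrite !ord1.
  by have -> : (fun w => ((Q (speed2 w))%:M : 'M[R]_1) 0 0) = (fun w => Q (speed2 w)) by apply/funext => w; rewrite mxE mulr1n.
have dR : differentiable (fun w => s w) u.
  apply: differentiable_mx => i j.
  have -> : (fun w => s w i j) = (fun w => S w k j) by apply/funext => w; rewrite mxE.
  exact: differentiable_mxE.
have UE : unit_tangent = fun w => (Q (speed2 w))%:M *m s w.
  by apply/funext => w; rewrite mul_scalar_mx.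
have vM := diff_derivable (v := e_) dM; have vR := diff_derivable (v := e_) dR.
have vS := diff_derivable (v := e_) dS.
split.
  rewrite UE; apply: differentiable_mx => i j.
  have -> : (fun w => ((Q (speed2 w))%:M *m s w) i j) = (fun w => Q (speed2 w) * S w k j).
    by apply/funext => w; rewrite mul_scalar_mx !mxE.
  by apply: differentiableM => //; exact: differentiable_mxE.
rewrite UE (derive_mulmx vM vR) mul_scalar_mx.
have -> : 'D_e_ (fun w => s w) u = row k ('D_e_ S u).
  apply/rowP => j; rewrite (derive_mxE _ _ vR) [RHS]mxE (derive_mxE _ _ vS).
  by have -> : (fun w => s w 0 j) = (fun w => S w k j) by apply/funext => w; rewrite mxE.
have -> : 'D_e_ (fun w => (Q (speed2 w))%:M : 'M[R]_1) u = (- (mu * Q (speed2 u)))%:M.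
  apply/matrixP => i j; rewrite !ord1 (derive_mxE _ _ vM) !mxE eqxx mulr1n.
  have -> : (fun w => ((Q (speed2 w))%:M : 'M[R]_1) 0 0) = (fun w => Q (speed2 w)) by apply/funext => w; rewrite mxE mulr1n.
  rewrite (derive_comp e_ dN dQ) (derive_speed2 Uu E).
  rewrite (derive_real_dir _ dQ) (@derive_val _ _ _ _ _ _ _ HQ) -/(Q _) /GRing.scale/=.
  have nz : speed2 u != 0 by rewrite gt_eqF.
  by move: (Q _) nz => y nz; field.
rewrite E mul_scalar_mx scalerBr scalerA addrA -scalerDl [Q _ * mu]mulrC addNr scale0r.
by rewrite add0r.
Qed.

End Direction.

(* Locally [phi = Y o h] with [Y] a geodesic of unit speed, so that [|dh| = |d phi|]. *)
Record geodesic_factor u0 (k : 'I_q) (h : 'rV[R]_(p + q) -> R) (Y : R -> 'rV[R]_q') (d a C : R) :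
    Prop := GeodesicFactor {
  gf_mono : monotone_near (rshift p k) u0 h d a C;
  gf_dom : forall u, `|u - u0| < d -> U u;
  gf_C1 : Ck 1 [set u | `|u - u0| < d] h;
  gf_center : h u0 = 0;
  gf_speed : forall u v, `|u - u0| < d ->
    ('D_v h u) ^+ 2 = bform (Hm u) ('D_v phi u) ('D_v phi u);
  gf_factor : forall u, `|u - u0| < d -> phi u = Y (h u);
  gf_near : \forall t \near (0 : R), derivable Y t 1;
  gf_deriv2 : derivable (derive1 Y) 0 1;
  gf_regular : derive1 Y 0 != 0;
  gf_geodesic : derive1 (derive1 Y) 0 + chris G' (F u0) (derive1 Y 0) (derive1 Y 0) = 0 }.

Section Critical.
Variables (k : 'I_q) (u : 'rV[R]_(p + q)) (Uu : U u).

Lemma phi_entry_differentiable c : differentiable (fun w => phi w 0 c) u.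
Proof. exact: differentiable_mxE (phi_differentiable cm cF Uu). Qed.

Lemma Hm_entry_differentiable i j : differentiable (fun w => Hm w i j) u.
Proof. exact: differentiable_mxE (mxsmooth_differentiable oU (Hm_smooth cm cm' cF) Uu). Qed.

Lemma phi_critical v c : S u k c != 0 -> ('D_v phi u) 0 c = 0 -> 'D_v phi u = 0.
Proof.
move=> Sc; rewrite (derive_phiS cm cF v Uu) => E.
have s0 : row k (S u) != 0 by apply/rV0Pn; exists c; rewrite row_entry.
have [mu Emu] := rank_le1_row (rsubmx v) (rank1 Uu) s0.
move: E; rewrite Emu mxE row_entry => /eqP; rewrite mulf_eq0 (negbTE Sc) orbF => /eqP ->.
by rewrite scale0r.
Qed.

Lemma Hm_critical v : 'D_v phi u = 0 -> 'D_v Hm u = 0.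
Proof.
move=> E; rewrite (derive_comp_basic cm cm' cF v Uu (gb_smooth cm') (cm_bundle_like cm')).
by rewrite E big1// => c _; rewrite mxE scale0r.
Qed.

Lemma phi_entry_critical v c : 'D_v phi u = 0 -> 'D_v (fun w => phi w 0 c) u = 0.
Proof.
move=> E; have vp := diff_derivable (v := v) (phi_differentiable cm cF Uu).
by rewrite -(derive_mxE 0 c vp) E mxE.
Qed.

Lemma Hm_entry_critical v i j : 'D_v phi u = 0 -> 'D_v (fun w => Hm w i j) u = 0.
Proof.
move=> E; have dH := mxsmooth_differentiable oU (Hm_smooth cm cm' cF) Uu.
by rewrite -(derive_mxE i j (diff_derivable (v := v) dH)) (Hm_critical E) mxE.
Qed.

End Critical.

(** By rank one, a component of [phi] with nonzero derivative has the same critical directions as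
    [phi], so [phi] and [Hm] are functions of it. Reparametrized by arc length it becomes [h], and
    [Y] is read off along a section of the levels of [h]. *)
Theorem local_geodesic u0 : U u0 -> S u0 != 0 ->
  exists k h Y d a C, geodesic_factor u0 k h Y d a C.
Proof.
move=> Uu0 S0; have [k [c Skc]] : exists k c, S u0 k c != 0.
  apply: contrapT => H; move/negP: S0; apply; apply/eqP/matrixP => i j; rewrite [RHS]mxE.
  by apply/eqP; apply: contrapT => /negP h; apply: H; exists i, j.
pose e := delta_mx 0 (rshift p k) : 'rV[R]_(p + q).
have eE u : U u -> 'D_e phi u = row k (S u) by move=> Uu; rewrite rowK.
(* As a factor, it makes the derivative of [psi] along [e] positive at [u0], whatever the sign of
   the entry. *)
pose sc := S u0 k c.
have [psi psiE] : {psi : 'rV[R]_(p + q) -> R | psi = fun w => sc * phi w 0 c} by exists (fun w => sc * phi w 0 c).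
have spsi : smooth_on U psi.
  by rewrite psiE; apply: smoothM => //; [exact: smooth_cst|exact: (phi_smooth cm cF 0 c)].
have dpsi u : U u -> differentiable psi u by move=> Uu; exact: (smooth_differentiable oU spsi Uu).
have Dpsi u v : U u -> 'D_v psi u = sc * ('D_v phi u) 0 c.
  move=> Uu; have vp := diff_derivable (v := v) (phi_differentiable cm cF Uu).
  have de := diff_derivable (v := v) (phi_entry_differentiable Uu c).
  by rewrite psiE (derive_mxE 0 c vp) (deriveZ sc de).
have Ppsi u : U u -> partial (rshift p k) psi u = sc * S u k c.
  by move=> Uu; rewrite /partial (Dpsi u _ Uu) -/e (eE u Uu) row_entry.
have pos0 : 0 < partial (rshift p k) psi u0.
  by rewrite (Ppsi u0 Uu0) -expr2 lt_neqAle sqr_ge0 andbT eq_sym sqrf_eq0.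
have C1psi : Ck 1 U psi by exact: (smooth_onP U psi).1.
have [d1 [a1 [C1 [mn1 sub1]]]] := monotone_near_of_C1 oU C1psi Uu0 pos0.
have [r1 [d1' [g1]]] := level_section mn1; set z := fun t => u0 + _.
move=> [r10 [/andP[d1'0 d1'd] g10] zP psi_r lev].
have inU u : `|u - u0| < d1' -> U u by move=> h; apply: sub1; exact: lt_le_trans d1'd.
have crit1 u v : `|u - u0| < d1 -> 'D_v psi u = 0 -> 'D_v phi u = 0.
  move=> ud E; have Uu := sub1 u ud.
  have Sc : S u k c != 0.
    have := lt_le_trans (mn_a mn1) (mn_incr mn1 ud); rewrite (Ppsi u Uu) => /gt_eqF/negbT.
    by rewrite mulf_eq0 negb_or => /andP[].
  apply: (phi_critical Uu Sc).
  move: E; rewrite (Dpsi u v Uu) => /eqP; rewrite mulf_eq0 => /orP[|/eqP //].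
  by rewrite /sc (negbTE Skc).
have phi_z u : `|u - u0| < d1' -> phi u = phi (z (psi u - psi u0)).
  move=> ud; apply/rowP => c'; apply: (lev (fun w => phi w 0 c')) => // w.
    by move=> /sub1 Uw; exact: phi_entry_differentiable.
  by move=> v wd E; apply: (phi_entry_critical (sub1 w wd)); exact: crit1 E.
have Hm_z u : `|u - u0| < d1' -> Hm u = Hm (z (psi u - psi u0)).
  move=> ud; apply/matrixP => i j; apply: (lev (fun w => Hm w i j)) => // w.
    by move=> /sub1 Uw; exact: Hm_entry_differentiable.
  by move=> v wd E; apply: (Hm_entry_critical (sub1 w wd)); exact: crit1 E.
have zU t : `|t| < r1 -> U (z t) by move=> /zP[/sub1].
have zpsi t : `|t| < r1 -> 0 < partial (rshift p k) psi (z t).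
  by move=> /zP[zd _ _ _]; exact: lt_le_trans (mn_a mn1) (mn_incr mn1 zd).
have zs t : `|t| < r1 -> row k (S (z t)) != 0.
  move=> tr; have /gt_eqF/negbT := zpsi t tr; rewrite (Ppsi _ (zU t tr)).
  by rewrite mulf_eq0 negb_or => /andP[_ Sc]; apply/rV0Pn; exists c; rewrite row_entry.
have cz (t : R) : `|t| < r1 -> {for t, continuous z}.
  move=> tr; have [_ _ cg _] := zP t tr; apply: cvgD; first exact: cvg_cst.
  by apply: cvgZr_tmp; exact: cg.
pose N := speed2 k.
(* The length covered by [phi] per unit of [psi] along the section [z]; its primitive is the arc
   length. *)
pose rho t := Num.sqrt (N (z t)) / partial (rshift p k) psi (z t).
have crho (t : R) : `|t| < r1 -> {for t, continuous rho}.
  move=> tr; have Uz := zU t tr; apply: contM.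
    have cN : {for t, continuous (fun s => N (z s))}.
      apply: (@continuous_comp _ _ _ z N); first exact: cz.
      exact: (smooth_continuous (speed2_smooth k) Uz).
    by apply: (@continuous_comp _ _ _ (fun s => N (z s)) Num.sqrt); [exact: cN|exact: sqrt_continuous].
  apply: contV; first by rewrite gt_eqF// zpsi.
  apply: (@continuous_comp _ _ _ z (partial (rshift p k) psi)); first exact: cz.
  exact: (smooth_continuous (smooth_partial (rshift p k) spsi) Uz).
(* Truncation makes the integrand continuous on the whole line, as [primitive_exists] asks. *)
pose cl (t : R) := Num.max (- (r1 / 2)) (Num.min (r1 / 2) t).
have clr t : `|cl t| < r1.
  have h : `|cl t| <= r1 / 2.
    rewrite ler_norml /cl le_max lexx/= ge_max ge_min lexx/= andbT.
    by have := r10; lra.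
  by apply: le_lt_trans h _; rewrite ltr_pdivrMr// ltr_pMr// ltr1n.
have clE t : `|t| < r1 / 2 -> cl t = t.
  by move=> /ltW; rewrite ler_norml => /andP[h1 h2]; rewrite /cl min_r// max_r.
have ccl (t : R) : {for t, continuous cl}.
  apply: continuous_max; first exact: cst_continuous.
  by apply: continuous_min; [exact: cst_continuous|exact: cvg_id].
have crc (t : R) : {for t, continuous (fun s => rho (cl s))}.
  by apply: (@continuous_comp _ _ _ cl rho); [exact: ccl|exact: crho].
have [f fP] := primitive_exists (r1 / 2) crc.
have fD (t : R) : `|t| < r1 / 2 -> is_derive t 1 f (rho t) by move=> th; have := fP t th; rewrite clE.
have [h hE] : {h : 'rV[R]_(p + q) -> R | h = fun u => f (psi u - psi u0) - f 0}.
  by exists (fun u => f (psi u - psi u0) - f 0).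
have r2 : 0 < r1 / 2 by rewrite divr_gt0.
have rr (t : R) : `|t| < r1 / 2 -> `|t| < r1.
  by move=> th; apply: lt_le_trans th _; rewrite ler_pdivrMr// ler_pMr// ler1n.
have [d2 [d20 d2P]] : exists d2, 0 < d2 /\ forall u, `|u - u0| < d2 -> `|u - u0| < d1' /\ `|psi u - psi u0| < r1 / 2.
  have H : \forall y \near psi u0, `|y - psi u0| < r1 / 2 by apply/nbhs_real_normP; exists (r1 / 2).
  have := near_comp (smooth_continuous spsi Uu0) H => /(@near_normP R 'rV[R]_(p + q) _ u0)[d' d'0 dP].
  exists (Num.min d1' d'); rewrite lt_min d1'0 d'0; split=> // u.
  by rewrite lt_min => /andP[-> /dP].
have Dh u v : `|u - u0| < d2 -> is_derive u v h (rho (psi u - psi u0) * 'D_v psi u).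
  move=> /d2P[ud ur]; have Uu := inU u ud; have df := fD _ ur.
  have dps : differentiable (fun w => psi w - psi u0) u by apply: differentiableB => //; exact: dpsi.
  have dif : differentiable f (psi u - psi u0) by apply/derivable1_diffP; exact: (@ex_derive _ _ _ _ _ _ _ df).
  have dc : differentiable (fun w => f (psi w - psi u0)) u.
    exact: (@differentiable_comp _ _ _ _ (fun w => psi w - psi u0) f u dps dif).
  have dh : differentiable h u by rewrite hE; apply: differentiableB.
  apply: DeriveDef; first exact: diff_derivable.
  have -> : 'D_v h u = 'D_v (fun w => f (psi w - psi u0)) u.
    by rewrite hE (deriveB (diff_derivable dc) (derivable_cst _ _ _)) derive_cst subr0.
  have Dps : 'D_v (fun w => psi w - psi u0) u = 'D_v psi u.
    by rewrite (deriveB (diff_derivable (dpsi u Uu)) (derivable_cst _ _ _)) derive_cst subr0.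
  rewrite (derive_comp v dps dif) Dps (derive_real_dir _ dif) (@derive_val _ _ _ _ _ _ _ df).
  by rewrite mulrC.
have C1h : Ck 1 [set u | `|u - u0| < d2] h.
  split=> [u /= ud|i]; last split=> [u /= ud|].
  - have [ud1 ur] := d2P u ud; have Uu := inU u ud1; rewrite hE; apply: contB; last exact: cont_cst.
    apply: (@continuous_comp _ _ _ (fun w => psi w - psi u0) f).
      by apply: contB; [exact: (smooth_continuous spsi Uu)|exact: cont_cst].
    apply: differentiable_continuous; apply/derivable1_diffP.
    by have df := fD _ ur; exact: (@ex_derive _ _ _ _ _ _ _ df).
  - by have dd := Dh u (delta_mx 0 i) ud; exact: (@ex_derive _ _ _ _ _ _ _ dd).
  - split=> // u ud; pose q0 w := rho (psi w - psi u0) * partial i psi w.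
    apply: (@eq_on_continuous _ _ [set u | `|u - u0| < d2] q0) => //; first exact: open_normball.
      by move=> w wd; have dd := Dh w (delta_mx 0 i) wd; rewrite /partial (@derive_val _ _ _ _ _ _ _ dd).
    have [ud1 ur] := d2P u ud; have Uu := inU u ud1; apply: contM.
      apply: (@continuous_comp _ _ _ (fun w => psi w - psi u0) rho).
        by apply: contB; [exact: (smooth_continuous spsi Uu)|exact: cont_cst].
      by apply: crho; exact: rr.
    exact: (smooth_continuous (smooth_partial i spsi) Uu).
have Dphi u v : `|u - u0| < d2 -> let t := psi u - psi u0 in
    'D_v phi u = ('D_v psi u / partial (rshift p k) psi (z t)) *: row k (S (z t)).
  move=> ud t; have [ud1 ur] := d2P u ud; have Uu := inU u ud1; have tr := rr _ ur.
  have [_ _ _ dg] := zP t tr; have Uz := zU t tr.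
  have dA := is_derive_section (phi_differentiable cm cF Uz) dg.
  have dif : differentiable (fun s => phi (z s)) t by apply/derivable1_diffP; exact: (@ex_derive _ _ _ _ _ _ _ dA).
  have dps : differentiable (fun w => psi w - psi u0) u by apply: differentiableB => //; exact: dpsi.
  have Dps : 'D_v (fun w => psi w - psi u0) u = 'D_v psi u.
    by rewrite (deriveB (diff_derivable (dpsi u Uu)) (derivable_cst _ _ _)) derive_cst subr0.
  rewrite (@eq_on_derive _ _ _ [set u | `|u - u0| < d1'] phi (fun w => phi (z (psi w - psi u0))) u v (@open_normball R _ u0 d1') phi_z ud1).
  rewrite (derive_comp v dps dif) Dps (derive_real_dir _ dif) (@derive_val _ _ _ _ _ _ _ dA).
  by rewrite -/e (eE _ Uz) scalerA.
have speed u v : `|u - u0| < d2 -> ('D_v h u) ^+ 2 = bform (Hm u) ('D_v phi u) ('D_v phi u).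
  move=> ud; have [ud1 ur] := d2P u ud; have tr := rr _ ur.
  have dd := Dh u v ud; rewrite (@derive_val _ _ _ _ _ _ _ dd) (Dphi u v ud) (Hm_z u ud1).
  rewrite bformZl bformZr -/(speed2 k (z (psi u - psi u0))) -/N /rho.
  have N0 := speed2_pos (zU _ tr) (zs _ tr).
  have -> : N (z (psi u - psi u0)) = Num.sqrt (N (z (psi u - psi u0))) ^+ 2 by rewrite sqr_sqrtr// ltW.
  rewrite sqrtr_sqr ger0_norm ?sqrtr_ge0//.
  by move: (Num.sqrt _) (_^-1) ('D__ _ _) => x y w; ring.
have u0d2 : `|u0 - u0| < d2 by rewrite subrr normr0.
have hpos : 0 < partial (rshift p k) h u0.
  have r10' : `|(0 : R)| < r1 by rewrite normr0.
  have dd := Dh u0 e u0d2; rewrite /partial -/e (@derive_val _ _ _ _ _ _ _ dd) subrr.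
  rewrite mulr_gt0//; apply: divr_gt0; last exact: zpsi.
  by rewrite sqrtr_gt0; exact: (speed2_pos (zU _ r10') (zs _ r10')).
have [d3 [a3 [C3 [mn3 sub3]]]] := monotone_near_of_C1 (@open_normball R _ u0 d2) C1h u0d2 hpos.
(* A section again, now for [h]: along it [phi] moves with unit speed. *)
have [r3 [d3' [g3]]] := level_section mn3; set z3 := fun t => u0 + _.
move=> [r30 [d3'0 g30] z3P h_r lev3].
have h0 : h u0 = 0 by rewrite hE !subrr.
have inU3 u : `|u - u0| < d3 -> U u by move=> ud; have [] := d2P u (sub3 u ud) => /inU.
have crit3 u v : `|u - u0| < d3 -> 'D_v h u = 0 -> 'D_v phi u = 0.
  move=> ud E; have := speed u v (sub3 u ud); rewrite E expr0n/= => /esym/eqP.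
  have OF := cmap_dom cF (inU3 u ud).
  by rewrite (posdef_eq0 _ (gb_pos cm' OF)) => /eqP.
pose Y t := phi (z3 t).
have phiY u : `|u - u0| < d3' -> phi u = Y (h u).
  move=> ud; apply/rowP => c'; have -> : Y (h u) = phi (z3 (h u - h u0)) by rewrite h0 subr0.
  apply: (lev3 (fun w => phi w 0 c')) => // w; first by move=> /inU3 Uw; exact: phi_entry_differentiable.
  by move=> v wd E; apply: (phi_entry_critical (inU3 w wd)); exact: crit3 E.
have ph t : `|t| < r3 -> [/\ U (z3 t), row k (S (z3 t)) != 0 & partial (rshift p k) h (z3 t) = Num.sqrt (N (z3 t))].
  move=> tr; have [zd _ _ _] := z3P t tr; have Uz := inU3 _ zd.
  have sp := speed _ e (sub3 _ zd); rewrite (eE _ Uz) -/(speed2 k (z3 t)) in sp.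
  have pp : 0 < partial (rshift p k) h (z3 t) by exact: lt_le_trans (mn_a mn3) (mn_incr mn3 zd).
  split=> //; last by rewrite /N -sp sqrtr_sqr gtr0_norm.
  apply/eqP => s0; move: sp; rewrite /speed2 s0 bform0l => /eqP; rewrite sqrf_eq0.
  by rewrite gt_eqF.
have dY (t : R) : `|t| < r3 -> is_derive t 1 Y (unit_tangent k (z3 t)).
  move=> tr; have [Uz _ pE] := ph t tr; have [_ _ _ dg] := z3P t tr.
  have := is_derive_section (phi_differentiable cm cF Uz) dg.
  by rewrite -/e (eE _ Uz) /unit_tangent -/N -pE.
have Y1 t : `|t| < r3 -> derive1 Y t = unit_tangent k (z3 t).
  by move=> tr; have dd := dY t tr; rewrite derive1E (@derive_val _ _ _ _ _ _ _ dd).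
have r3' : `|(0 : R)| < r3 by rewrite normr0.
have z30 : z3 0 = u0 by rewrite /z3 g30 scale0r addr0.
have [Uz s0 pE] := ph 0 r3'; have [_ _ _ dg] := z3P 0 r3'.
have [dxi Dxi] := unit_tangent_derive Uz s0.
have dxiz := is_derive_section dxi dg.
have open3 : open [set t : R | `|t| < r3].
  apply: open_local => t /= tr; apply/nbhs_real_normP; exists (r3 - `|t|); first by rewrite subr_gt0.
  by move=> s sd; rewrite -(subrK t s); apply: le_lt_trans (ler_normD _ _) _; rewrite -ltrBrDr.
have eqY : forall t, [set t : R | `|t| < r3] t -> unit_tangent k (z3 t) = derive1 Y t.
  by move=> t tr; rewrite Y1.
have dY1 : derivable (derive1 Y) 0 1.
  apply: (eq_on_derivable open3 eqY r3'); exact: (@ex_derive _ _ _ _ _ _ _ dxiz).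
have Y2 : derive1 (derive1 Y) 0 = (Num.sqrt (N u0))^-1 *: - ((Num.sqrt (N u0))^-1 *: (row k (S u0) *m Cm G' F k u0)).
  rewrite derive1E -(eq_on_derive (1 : R) open3 eqY r3') (@derive_val _ _ _ _ _ _ _ dxiz) -/e.
  by rewrite Dxi pE z30.
rewrite z30 in s0.
have lam0 : (Num.sqrt (N u0))^-1 != 0.
  by rewrite invr_eq0 gt_eqF// sqrtr_gt0; exact: speed2_pos.
exists k, h, Y, d3', a3, C3; split=> //.
- exact: monotone_nearS mn3.
- by move=> u ud; apply: inU3; apply: lt_le_trans ud _; case/andP: d3'0.
- apply: CkS C1h => u /= ud; apply: sub3; apply: lt_le_trans ud _; by case/andP: d3'0.
- by move=> u v ud; apply: speed; apply: sub3; apply: lt_le_trans ud _; case/andP: d3'0.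
- apply/nbhs_real_normP; exists r3; first exact: r30.
  move=> t; rewrite subr0 => tr.
  by have dd := dY t tr; exact: (@ex_derive _ _ _ _ _ _ _ dd).
- by rewrite Y1// z30 /unit_tangent scaler_eq0 negb_or lam0.
- rewrite Y2 Y1// z30 /unit_tangent -/N (chrisZl cm')//; last exact: (cmap_dom cF).
  rewrite (chrisC cm')//; last exact: (cmap_dom cF).
  rewrite (chrisZl cm')//; last exact: (cmap_dom cF).
  by rewrite (chris_Cm cm' cF k _ Uu0) scalerN addNr.
Qed.

End LocalGeodesic.

(* The differentials agree up to a sign, which is locally constant since they do not vanish. *)
Lemma isometric_functions (R : realType) n (O : set 'rV[R]_n) (f g : 'rV[R]_n -> R) (k : 'I_n) u :
  open O -> O u -> Ck 1 O f -> Ck 1 O g -> partial k f u != 0 ->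
  (forall w v, O w -> ('D_v f w) ^+ 2 = ('D_v g w) ^+ 2) ->
  exists b, \forall w \near u, g w - g u = sg R b * (f w - f u).
Proof.
move=> oO Ou Cf Cg fk sq; pose e := delta_mx 0 k : 'rV[R]_n.
have df w : O w -> differentiable f w by move=> Ow; exact: (Ck_differentiable oO Cf Ow).
have dg w : O w -> differentiable g w by move=> Ow; exact: (Ck_differentiable oO Cg Ow).
have [b gb] : exists b, partial k g u = sg R b * partial k f u.
  have /eqP := sq u e Ou; rewrite -/(partial k f u) -/(partial k g u) eqf_sqr => /orP[/eqP->|/eqP->].
    by exists true; rewrite /sg mul1r.
  by exists false; rewrite /sg mulN1r opprK.
(* Positive at [u], hence nearby, which prevents the sign from switching. *)
exists b; pose q w := sg R b * (partial k g w * partial k f w).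
have cpart (h : 'rV[R]_n -> R) : Ck 1 O h -> {for u, continuous (partial k h)}.
  by move=> [_ /(_ k)[_ [c _]]]; exact: c.
have cq : {for u, continuous q}.
  by apply: contM; [exact: cont_cst|apply: contM; exact: cpart].
have q0 : 0 < q u.
  by rewrite /q gb mulrA mulrA sg_sq mul1r -expr2 lt_neqAle sqr_ge0 andbT eq_sym sqrf_eq0.
have nq : \forall y \near q u, 0 < y.
  by apply/nbhs_real_normP; exists (q u) => // y; rewrite ltr_norml => /andP[]; move: (q u) => *; lra.
have [d d0 dP] : exists2 d, 0 < d & forall w, `|w - u| < d -> O w /\ 0 < q w.
  have n1 := open_near oO Ou; have n2 := near_comp cq nq.
  have : \forall w \near u, O w /\ 0 < q w by near=> w; split; near: w.
  by move=> /(@near_normP R 'rV[R]_n _ u).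
have pk w : `|w - u| < d -> partial k g w = sg R b * partial k f w.
  move=> /dP[Ow]; rewrite /q; have /eqP := sq w e Ow.
  rewrite -/(partial k f w) -/(partial k g w) eqf_sqr => /orP[/eqP->|/eqP->].
    by case: (b); rewrite /sg ?mul1r// mulN1r oppr_gt0 ltNge -expr2 sqr_ge0.
  by case: (b); rewrite /sg ?mulN1r ?opprK// mul1r mulrN oppr_gt0 ltNge -expr2 sqr_ge0.
have fk' w : `|w - u| < d -> partial k f w != 0.
  by move=> /dP[_]; rewrite /q; case: eqP => // ->; rewrite mulr0 mulr0 ltxx.
(* Polarization: the squares agree on [v], [e] and [v + e], hence so do the products, and the sign
   found for [e] extends to every [v]. *)
have Dg w v : `|w - u| < d -> 'D_v g w = sg R b * 'D_v f w.
  move=> wd; have [Ow _] := dP w wd; have := sq w (v + e) Ow.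
  rewrite (deriveD_dir v e (df w Ow)) (deriveD_dir v e (dg w Ow)) !sqrrD (sq w v Ow) (sq w e Ow).
  move=> /addIr/addrI; rewrite -/(partial k f w) -/(partial k g w) pk// => /eqP.
  rewrite eqrMn2r/= => /eqP E.
  have {E} : partial k f w * ('D_v g w * sg R b) = partial k f w * 'D_v f w.
    by rewrite [LHS]mulrC -mulrA -E mulrC.
  by move=> /(mulfI (fk' w wd)) <-; rewrite mulrCA sg_sq mulr1.
apply/(@near_normP R 'rV[R]_n _ u); exists d => // w wd.
pose h z := g z - sg R b * f z.
have sd (s : R) : `|s| <= `|(1 : R)| -> `|u + s *: (w - u) - u| < d.
  by rewrite normr1 addrAC subrr add0r normrZ => s1; apply: le_lt_trans wd; rewrite ler_piMl.
have dsf z : O z -> differentiable (fun z => sg R b * f z) z.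
  by move=> Oz; apply: differentiableM => //; exact: df.
have dh z : O z -> differentiable h z.
  by move=> Oz; apply: differentiableB; [exact: dg|exact: dsf].
have [s s1] := @mean_value_line R 'rV[R]_n h u (w - u) 1 (fun s s1 => diff_derivable (dh _ (dP _ (sd s s1)).1)).
have [Oz _] := dP _ (sd s s1).
have -> : 'D_(w - u) h (u + s *: (w - u)) = 0.
  rewrite /h (deriveB (diff_derivable (dg _ Oz)) (diff_derivable (dsf _ Oz))) (Dg _ _ (sd s s1)).
  by rewrite (deriveZ (sg R b) (diff_derivable (df _ Oz))) subrr.
rewrite scale1r [u + _]addrC subrK mulr0 /h => /eqP; rewrite subr_eq0 => /eqP E.
by rewrite mulrBr; move: E; move: (g w) (g u) (sg R b * f w) (sg R b * f u) => *; lra.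
Unshelve. all: by end_near. Qed.

(** The second derivative does not see the sign, and neither does a quadratic term in the first, so
    a geodesic may be run in either direction. *)
Lemma reparametrized_derivatives (R : realType) (W : normedModType R) (Y y : R -> W) (t : R) b :
  (\forall s \near (0 : R), derivable Y s 1) -> derivable (derive1 Y) 0 1 ->
  (\forall s \near t, y s = Y (sg R b * (s - t))) ->
  [/\ \forall s \near t, derivable y s 1, derivable (derive1 y) t 1,
      derive1 y t = sg R b *: derive1 Y 0 & derive1 (derive1 y) t = derive1 (derive1 Y) 0].
Proof.
move=> nY dY2 ny; pose a (s : R) : R := sg R b * (s - t).
have da (s : R) : is_derive s 1 a (sg R b).
  have h1 : is_derive s 1 (fun s : R => s - t) 1.
    by have := is_deriveB (is_derive_id s (1 : R)) (is_derive_cst t s 1); rewrite subr0.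
  by have := is_deriveZ (sg R b) h1; rewrite [_ *: 1]mulr1.
have a0 : a t = 0 by rewrite /a subrr mulr0.
have difa (s : R) : differentiable a s.
  by apply/derivable1_diffP; exact: (@ex_derive _ _ _ _ _ _ _ (da s)).
have comp (Z : R -> W) (s : R) : derivable Z (a s) 1 ->
    is_derive s 1 (fun s => Z (a s)) (sg R b *: 'D_1 Z (a s)).
  move=> dZ; have difZ : differentiable Z (a s) by apply/derivable1_diffP.
  have dc : differentiable (fun s => Z (a s)) s by exact: (@differentiable_comp _ _ _ _ a Z s (difa s) difZ).
  apply: DeriveDef; first exact: diff_derivable.
  by rewrite (derive_comp (1 : R) (difa s) difZ) (@derive_val _ _ _ _ _ _ _ (da s)) (derive_real_dir _ difZ).
move: nY ny => /nbhs_real_normP[d1 d10 h1] /nbhs_real_normP[d2 d20 h2].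
pose d := Num.min d1 d2; have d0 : 0 < d by rewrite lt_min d10.
pose O := [set s : R | `|s - t| < d].
have oO : open O.
  apply: open_local => s /= sd; apply/nbhs_real_normP; exists (d - `|s - t|); first by rewrite subr_gt0.
  move=> w wd; rewrite /O /=; have -> : w - t = (w - s) + (s - t) by rewrite addrA subrK.
  by apply: le_lt_trans (ler_normD _ _) _; rewrite -ltrBrDr.
have Ot : O t by rewrite /O /= subrr normr0.
have eqy s : O s -> Y (a s) = y s.
  by rewrite /O /= lt_min => /andP[_ /h2 ->].
have dYa s : O s -> derivable Y (a s) 1.
  rewrite /O /= lt_min => /andP[sd _]; apply: h1.
  by rewrite subr0 /a normrM norm_sg mul1r.
have eqy1 s : O s -> sg R b *: derive1 Y (a s) = derive1 y s.
  move=> Os; rewrite !derive1E -(eq_on_derive (1 : R) oO eqy Os).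
  by have dd := comp Y s (dYa s Os); rewrite (@derive_val _ _ _ _ _ _ _ dd).
have dY2a : derivable (derive1 Y) (a t) 1 by rewrite a0.
have dd2 := comp (derive1 Y) t dY2a.
have dsc := is_deriveZ (sg R b) dd2.
have tt : sg R b *: (sg R b *: 'D_1 (derive1 Y) (a t)) = derive1 (derive1 Y) 0.
  by rewrite scalerA sg_sq scale1r a0 derive1E.
split.
- apply/nbhs_real_normP; exists d; first exact: d0.
  move=> s sd; apply: (eq_on_derivable oO eqy sd).
  by have dd := comp Y s (dYa s sd); exact: (@ex_derive _ _ _ _ _ _ _ dd).
- by apply: (eq_on_derivable oO eqy1 Ot); exact: (@ex_derive _ _ _ _ _ _ _ dsc).
- by rewrite -(eqy1 t Ot) a0.
- by rewrite derive1E -(eq_on_derive (1 : R) oO eqy1 Ot) (@derive_val _ _ _ _ _ _ _ dsc) tt.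
Qed.

Lemma lipschitz_at_continuous (R : realType) (V W : normedModType R) (f : V -> W) (w : V) (d K : R) :
  0 < d -> (forall w', `|w' - w| < d -> `|f w - f w'| <= K * `|w - w'|) -> {for w, continuous f}.
Proof.
move=> d0 lip; apply/cvgrPdist_le => e e0; rewrite near_simpl; apply/near_normP.
have K0 : 0 < `|K| + 1 by apply: ltr_wpDl.
exists (Num.min d (e / (`|K| + 1))); first by rewrite lt_min d0 divr_gt0.
move=> s; rewrite lt_min => /andP[/lip l]; rewrite ltr_pdivlMr// => /ltW le.
apply: le_trans l _; apply: le_trans le; rewrite distrC mulrC ler_wpM2l//.
by apply: le_trans (ler_norm _) _; rewrite lerDl.
Qed.

(** * Chart boxes on the manifold and the closed geodesic *)

Section ClosedGeodesic.
Variables (R : realType) (p q p' q' : nat).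
Variables (M : foliated_riemannian_manifold R p q).
Variables (M' : foliated_riemannian_manifold R p' q').
Variable phi : M -> M'.
Hypotheses (phi_smooth : smooth_mapping phi) (phi_foliated : foliated_mapping phi).
Notation F := (local_rep phi).
Notation D := (local_dom phi).
Hypothesis phi_rank1 : forall i j u, D i j u -> rank_le1 (S (F i j) u).
Hypothesis phi_parallel : forall i j u, D i j u ->
  forall k, IIm (metric M i) (metric M' j) (F i j) k u = 0.
Hypothesis phi_regular : forall i j u, D i j u -> S (F i j) u != 0.

(* The image of the domain is contained in a ball of the chart, so that points of the image with
   equal transverse coordinates lie on a plaque. *)
Definition box_domain i j x (eps : R) : set 'rV[R]_(p + q) :=
  [set u | D i j u /\ `|F i j u - F i j (chart M i x)| < eps].

Lemma box_domain_open i j x eps : open (box_domain i j x eps).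
Proof.
apply: open_local => u [Du ue]; have oD := @local_dom_open _ _ _ _ _ _ _ _ phi_smooth i j.
have n1 := open_near oD Du.
have dF := F_differentiable (local_metric phi_smooth i j) (local_map phi_smooth phi_foliated i j) Du.
have n2 : \forall y \near F i j u, `|y - F i j (chart M i x)| < eps.
  exact: open_near (@open_normball R _ (F i j (chart M i x)) eps) ue.
have n3 := near_comp (differentiable_continuous dF) n2.
by near=> w; split; near: w.
Unshelve. all: by end_near. Qed.

Record chart_box (x : M) i j (eps : R) k (h : 'rV[R]_(p + q) -> R) (Y : R -> 'rV[R]_q') (d a C : R) :
    Prop := ChartBox {
  cb_dom : dom M i x;
  cb_ball : forall w, `|w - F i j (chart M i x)| < eps -> cod M' j w;
  cb_factor : geodesic_factor (box_domain i j x eps) (metric M' j) (F i j) (chart M i x) k h Y d a C }.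

Lemma chart_box_exists x i j : dom M i x -> dom M' j (phi x) ->
  exists eps k h Y d a C, chart_box x i j eps k h Y d a C.
Proof.
move=> dx dx'; have Dx := chart_local dx dx'.
have cM := local_metric phi_smooth i j; have cF := local_map phi_smooth phi_foliated i j.
have [eps eps0 ball] := near_ball_sub (@cod_open _ _ _ M' j) (cmap_dom cF Dx).
have sub : box_domain i j x eps `<=` D i j by move=> u [].
have cM' := chart_metricS (@box_domain_open i j x eps) sub cM.
have cF' : chart_map (box_domain i j x eps) (cod M' j) (F i j).
  split; [|by move=> u /sub Du; exact: (cmap_dom cF)|by move=> u v /sub Du; exact: (cmap_foliated cF)].
  move=> l; apply/smooth_onP => m; apply: (CkS sub); exact: (smooth_onP _ _).1 (cmap_smooth cF l) m.
have Ux : box_domain i j x eps (chart M i x) by split=> //; rewrite subrr normr0.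
have [k [h [Y [d [a [C gf]]]]]] := local_geodesic cM' (metric_chart j) cF'
  (fun u Uu => phi_rank1 (sub u Uu)) (fun k u Uu => phi_parallel (sub u Uu) k) Ux (phi_regular Dx).
by exists eps, k, h, Y, d, a, C.
Qed.

(** Expresses the square of [dh] by the pulled-back metric, which transforms as a tensor; this makes
    the functions [h] of different boxes comparable. *)
Lemma chart_box_speed x i j eps k h Y d a C u v : chart_box x i j eps k h Y d a C ->
  `|u - chart M i x| < d -> ('D_v h u) ^+ 2 = bform (pulled_form phi i j u) (rsubmx v) (rsubmx v).
Proof.
move=> cb ud; have gf := cb_factor cb; have [Du _] := gf_dom gf ud.
have cM := local_metric phi_smooth i j; have cF := local_map phi_smooth phi_foliated i j.
rewrite (gf_speed gf v ud) (derive_phiS cM cF v Du) bform_mul.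
by rewrite /pulled_form bformE.
Qed.

Lemma chart_box_compat x i j eps k h Y d a C x2 i2 j2 eps2 k2 h2 Y2 d2 a2 C2 z :
  chart_box x i j eps k h Y d a C -> chart_box x2 i2 j2 eps2 k2 h2 Y2 d2 a2 C2 ->
  dom M i z -> dom M i2 z -> `|chart M i z - chart M i x| < d ->
  `|chart M i2 z - chart M i2 x2| < d2 ->
  exists b, \forall w \near z, h2 (chart M i2 w) - h2 (chart M i2 z) =
    sg R b * (h (chart M i w) - h (chart M i z)).
Proof.
move=> cb cb2 dz dz2 zd zd2; have gf := cb_factor cb; have gf2 := cb_factor cb2.
set u := chart M i z; pose t := transition i i2.
have tu : t u = chart M i2 z by rewrite /t /transition /= chartK.
pose B := [set w | `|w - chart M i x| < d]; pose B2 := [set w | `|w - chart M i2 x2| < d2].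
pose O := B `&` (overlap i i2 `&` t @^-1` B2).
have ovu : overlap i i2 u by split; [exact: chart_cod|rewrite chartK].
have Ou : O u by split=> //; split=> //; rewrite /B2 /= tu.
have oO : open O.
  apply: openI; first exact: open_normball.
  apply: open_local => w [ow Bw]; have n1 := open_near (@overlap_open _ _ _ _ i i2) ow.
  have n2 := near_comp (differentiable_continuous (transition_differentiable ow))
    (open_near (@open_normball R _ (chart M i2 x2) d2) Bw).
  by near=> w'; split; near: w'.
have subB : O `<=` B by move=> w [].
have subO : O `<=` overlap i i2 by move=> w [_ []].
have Cf := CkS subB (gf_C1 gf).
have Ct l : Ck 1 O (fun w => t w 0 l).
  apply: (CkS subO); exact: (smooth_onP _ _).1 (@transition_smooth _ _ _ M i i2 l) 1%N.
have Cg : Ck 1 O (fun w => h2 (t w)).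
  apply: (Ck_comp oO (@open_normball R _ (chart M i2 x2) d2) _ Ct (gf_C1 gf2)).
  by move=> w [_ []].
have fk : partial (rshift p k) h u != 0.
  by rewrite gt_eqF// (lt_le_trans (mn_a (gf_mono gf)))// (mn_incr (gf_mono gf)).
have sq w v : O w -> ('D_v h w) ^+ 2 = ('D_v (fun w => h2 (t w)) w) ^+ 2.
  move=> [Bw [ow B2w]]; have dt := transition_differentiable ow.
  have dh2 := mn_diff (gf_mono gf2) B2w.
  have [Dw _] := gf_dom gf Bw; have [D2w _] := gf_dom gf2 B2w.
  have dp : dom M' j2 (phi (param M i w)).
    by have [_] := D2w; rewrite /t /transition /= chartK//; have [] := ow.
  have [J [_ JE _ pfE]] := pulled_form_transition phi_smooth phi_foliated Dw ow dp.
  rewrite (chart_box_speed v cb Bw) (derive_comp v dt dh2) (chart_box_speed _ cb2 B2w).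
  rewrite JE pfE [RHS]bform_mul bformE; congr ((_ *m _ *m _) 0 0); exact: mulmxA.
have [b nb] := isometric_functions oO Ou Cf Cg fk sq.
exists b; have n1 := near_comp (chart_continuous dz) nb.
have n2 := open_near (@dom_open _ _ _ M i) dz.
near=> w; have dw : dom M i w by near: w; exact: n2.
have : h2 (t (chart M i w)) - h2 (t u) = sg R b * (h (chart M i w) - h u) by near: w; exact: n1.
by rewrite tu /t /transition /= chartK.
Unshelve. all: by end_near. Qed.

(** The data of a straightened chart box in one record, so that a single choice function provides
    them for all points. *)
Record box := Box { bi : chart_index M; bj : chart_index M'; beps : R; bk : 'I_q;
  bh : 'rV[R]_(p + q) -> R; bY : R -> 'rV[R]_q'; bd : R; ba : R; bC : R; br : R;
  bth : 'rV[R]_(p + q) -> 'rV[R]_(p + q) }.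

Definition box_straight (x : M) b := straight (rshift p (bk b)) (chart M (bi b) x) (bh b).

Record box_at (x : M) (b : box) : Prop := BoxAt {
  bx_box : chart_box x (bi b) (bj b) (beps b) (bk b) (bh b) (bY b) (bd b) (ba b) (bC b);
  bx_pos : 0 < br b;
  bx_th : forall w, `|w| < br b ->
    `|bth b w - chart M (bi b) x| < bd b /\ box_straight x b (bth b w) = w;
  bx_thK : forall u, `|u - chart M (bi b) x| < bd b -> `|box_straight x b u| < br b ->
    bth b (box_straight x b u) = u;
  bx_lip : forall w w', `|w| < br b -> `|w'| < br b ->
    `|bth b w - bth b w'| <= lipK (ba b) (bC b) * `|w - w'| }.

Lemma boxes_exist : exists B : M -> box, forall x, box_at x (B x).
Proof.
suff /choice[B BP] : forall x : M, exists b, box_at x b by exists B.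
move=> x; have [i [j [dx dx']]] := charts_at phi x.
have [eps [k [h [Y [d [a [C cb]]]]]]] := chart_box_exists dx dx'.
have [d0 a0 C0 h1 h2 h3] := gf_mono (cb_factor cb).
have [r [th [r0 th1 th2 th3]]] := straighten d0 a0 C0 h1 h2 h3.
by exists (Box i j eps k h Y d a C r th).
Qed.

Section Boxes.
Variables (B : M -> box) (BP : forall x, box_at x (B x)).

Definition box_set x : set M := [set z | dom M (bi (B x)) z /\
  (`|chart M (bi (B x)) z - chart M (bi (B x)) x| < bd (B x) /\
   `|box_straight x (B x) (chart M (bi (B x)) z)| < br (B x))].
Definition box_kap x z := box_straight x (B x) (chart M (bi (B x)) z).
Definition box_the x w := param M (bi (B x)) (bth (B x) w).
Definition box_axis x := rshift p (bk (B x)).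
Notation radius := (fun x => br (B x)).

Lemma box_straight_continuous x u : `|u - chart M (bi (B x)) x| < bd (B x) ->
  {for u, continuous (box_straight x (B x))}.
Proof.
move=> ud; apply: cont_mx => i j; have cb := bx_box (BP x).
have ch := Ck_continuous (gf_C1 (cb_factor cb)) ud.
have [e|ne] := eqVneq j (rshift p (bk (B x))).
  have -> : (fun w => box_straight x (B x) w i j) = (fun w => bh (B x) w - bh (B x) (chart M (bi (B x)) x)).
    by apply/funext => w; rewrite /box_straight /straight mxE e eqxx.
  by apply: contB; [exact: ch|exact: cont_cst].
have -> : (fun w => box_straight x (B x) w i j) = (fun w => w 0 j - chart M (bi (B x)) x 0 j).
  by apply/funext => w; rewrite /box_straight /straight mxE (negbTE ne).
by apply: contB; [apply: cont_mxE; exact: cvg_id|exact: cont_cst].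
Qed.

Lemma box_height x z : height box_kap box_axis x z = bh (B x) (chart M (bi (B x)) z).
Proof.
rewrite /height /box_kap /box_axis /box_straight straight_k.
by rewrite (gf_center (cb_factor (bx_box (BP x)))) subr0.
Qed.

Lemma box_center x : box_set x x /\ box_kap x x = 0.
Proof.
have cb := bx_box (BP x); have gf := cb_factor cb.
have k0 : box_straight x (B x) (chart M (bi (B x)) x) = 0.
  by apply/rowP => l; rewrite /box_straight /straight !mxE !subrr; case: ifP.
split=> //; split; first exact: (cb_dom cb).
by rewrite subrr k0 !normr0; split; [exact: (mn_d (gf_mono gf))|exact: (bx_pos (BP x))].
Qed.

Lemma box_the_in x w : `|w| < br (B x) -> [/\ box_set x (box_the x w), box_kap x (box_the x w) = w &
  cod M (bi (B x)) (bth (B x) w)].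
Proof.
move=> wr; have [td ts] := bx_th (BP x) wr; have cb := bx_box (BP x).
have [[cu du] _] := gf_dom (cb_factor cb) td.
have e : chart M (bi (B x)) (box_the x w) = bth (B x) w by exact: paramK.
split=> //; last by rewrite /box_kap e.
by split; [exact: param_dom|rewrite e ts].
Qed.

Lemma box_open x : open (box_set x).
Proof.
apply: open_local => z [dz [zd zr]]; set i := bi (B x) in dz zd zr *.
have n0 := open_near (@dom_open _ _ _ M i) dz.
have n1 := near_comp (chart_continuous dz) (open_near (@open_normball R _ (chart M i x) (bd (B x))) zd).
have n2 : \forall w \near box_straight x (B x) (chart M i z), `|w| < br (B x).
  have zr' : [set w : 'rV[R]_(p + q) | `|w - 0| < br (B x)] (box_straight x (B x) (chart M i z)).
    by rewrite /= subr0.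
  by have := open_near (@open_normball R _ 0 (br (B x))) zr'; apply: filterS => w /=; rewrite subr0.
have n3 := near_comp (chart_continuous dz) (near_comp (box_straight_continuous zd) n2).
by near=> w; split; [near: w|split; near: w].
Unshelve. all: by end_near. Qed.

Lemma flow_boxes_manifold : flow_boxes box_set radius box_kap box_the.
Proof.
split.
- exact: box_open.
- exact: box_center.
- by move=> x; exact: (bx_pos (BP x)).
- by move=> x z [_ []].
- move=> x z [dz [zd _]].
  apply: (@continuous_comp _ _ _ (chart M (bi (B x))) (box_straight x (B x))).
    exact: chart_continuous.
  exact: box_straight_continuous.
- by move=> x w /box_the_in[].
- by move=> x w /box_the_in[].
- move=> x w wr; have [_ _ cw] := box_the_in wr.
  apply: (@continuous_comp _ _ _ (bth (B x)) (param M (bi (B x)))); last exact: param_continuous.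
  have rw : 0 < br (B x) - `|w| by rewrite subr_gt0.
  apply: (@lipschitz_at_continuous R 'rV[R]_(p + q) 'rV[R]_(p + q) (bth (B x)) w _
    (lipK (ba (B x)) (bC (B x))) rw) => w' w1.
  apply: (bx_lip (BP x) wr); rewrite -(subrK w w'); apply: le_lt_trans (ler_normD _ _) _.
  by rewrite -ltrBrDr.
- move=> x z [dz [zd zr]]; rewrite /box_the /box_kap (bx_thK (BP x) zd zr).
  exact: chartK.
Qed.

Lemma box_height_compat x y z : box_set x z -> box_set y z -> exists b, \forall w \near z,
  height box_kap box_axis y w - height box_kap box_axis y z =
  sg R b * (height box_kap box_axis x w - height box_kap box_axis x z).
Proof.
move=> [dz [zd _]] [dz2 [zd2 _]].
have [b nb] := chart_box_compat (bx_box (BP x)) (bx_box (BP y)) dz dz2 zd zd2.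
by exists b; apply: filterS nb => w; rewrite !box_height.
Qed.

(** The factorization of [phi] through [h] gives the images equal transverse coordinates, and the
    ball containing them is convex, so the segment between them stays in the chart. *)
Lemma box_same_leaf x z z' : box_set x z -> box_set x z' ->
  height box_kap box_axis x z = height box_kap box_axis x z' -> same_leaf (phi z) (phi z').
Proof.
move=> [dz [zd _]] [dz' [zd' _]]; rewrite !box_height => eh.
have cb := bx_box (BP x); have gf := cb_factor cb.
have [Dz ze] := gf_dom gf zd; have [Dz' ze'] := gf_dom gf zd'.
have eF w : dom M (bi (B x)) w -> F (bi (B x)) (bj (B x)) (chart M (bi (B x)) w) = chart M' (bj (B x)) (phi w).
  by move=> dw; rewrite /local_rep chartK.
have e1 := gf_factor gf zd; have e2 := gf_factor gf zd'; have eFx := eF x (cb_dom cb).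
rewrite /tmap !eF// in e1 e2; rewrite eF// eFx in ze; rewrite eF// eFx in ze'.
have [_ dp] := Dz; have [_ dp'] := Dz'; rewrite chartK// in dp; rewrite chartK// in dp'.
apply: rst_step; exists (bj (B x)); split=> //; first by rewrite e1 e2 eh.
move=> t /andP[t0 t1]; apply: (cb_ball cb); rewrite (eF x (cb_dom cb)).
set c0 := chart M' _ (phi x) in ze ze' *; set c1 := chart M' _ (phi z) in ze *; set c2 := chart M' _ (phi z') in ze' *.
have -> : (1 - t) *: c1 + t *: c2 - c0 = (1 - t) *: (c1 - c0) + t *: (c2 - c0).
  by apply/rowP => l; rewrite !mxE; ring.
apply: le_lt_trans (ler_normD _ _) _; rewrite !normrZ !ger0_norm ?subr_ge0//.
have t1' : 0 <= 1 - t by rewrite subr_ge0.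
have := ler_wpM2l t0 (ltW ze'); have := ler_wpM2l t1' (ltW ze).
by move: ze ze'; move: (`|_|) (`|_|) => *; nra.
Qed.

(** At each time [t] a fresh chart box centered at [mu t] is compared with the box given by
    admissibility, so the geodesic equation is used only at the parameter 0 of [Y]. *)
Lemma admissible_transverse_geodesic mu :
  admissible box_set box_kap box_axis mu -> transverse_geodesic (phi \o mu) /\
  transversally_regular (phi \o mu).
Proof.
move=> [cmu omu].
have loc j t : dom M' j (phi (mu t)) -> let y : R -> 'rV[R]_q' := fun s => rsubmx (chart M' j (phi (mu s))) in
    [/\ \forall s \near t, derivable y s 1, derivable (derive1 y) t 1, derive1 y t != 0 &
        derive1 (derive1 y) t + chris (metric M' j) (chart M' j (phi (mu t))) (derive1 y t) (derive1 y t) = 0].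
  move=> dj y; have [i di] := dom_cover (mu t).
  have [eps [k [h [Y [d [a [C cb]]]]]]] := chart_box_exists di dj; have gf := cb_factor cb.
  have [x [b [Vx ox]]] := omu t; have [dx [xd _]] := Vx.
  have self : `|chart M i (mu t) - chart M i (mu t)| < d by rewrite subrr normr0; exact: (mn_d (gf_mono gf)).
  have [b' nb] := chart_box_compat (bx_box (BP x)) cb dx di xd self.
  have n1 := near_translate (cmu t) nb.
  have n2 : \forall w \near mu t, dom M i w /\ `|chart M i w - chart M i (mu t)| < d.
    exact: near_chart_ball di (mn_d (gf_mono gf)).
  have n3 := near_translate (cmu t) n2.
  have ny0 : \forall s \near (0 : R), y (t + s) = Y (sg R (b' == b) * s).
    near=> s; have e1 : height box_kap box_axis x (mu (t + s)) = height box_kap box_axis x (mu (t + 0)) + sg R b * s.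
      by near: s; exact: ox.
    have e2 : h (chart M i (mu (t + s))) - h (chart M i (mu t)) =
        sg R b' * (bh (B x) (chart M (bi (B x)) (mu (t + s))) - bh (B x) (chart M (bi (B x)) (mu t))).
      by near: s; exact: n1.
    have [dw wd] : dom M i (mu (t + s)) /\ `|chart M i (mu (t + s)) - chart M i (mu t)| < d.
      by near: s; exact: n3.
    rewrite !box_height addr0 in e1; rewrite e1 (gf_center gf) subr0 addrAC subrr add0r mulrA sg_mul in e2.
    by rewrite -e2 -(gf_factor gf wd) /tmap /local_rep chartK.
  have ny : \forall s \near t, y s = Y (sg R (b' == b) * (s - t)).
    move: ny0 => /nbhs_real_normP[e e0 H]; apply/nbhs_real_normP; exists e => // s se.
    by have := H (s - t); rewrite subr0 [t + _]addrC subrK; exact.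
  have [r1 r2 r3 r4] := reparametrized_derivatives (gf_near gf) (gf_deriv2 gf) ny.
  have eF : F i j (chart M i (mu t)) = chart M' j (phi (mu t)) by rewrite /local_rep chartK.
  have Oj := chart_cod dj; have cm' := metric_chart (M := M') j.
  split; [exact: r1|exact: r2| |].
    rewrite r3 scaler_eq0 negb_or (gf_regular gf) andbT -normr_eq0 norm_sg.
    exact: oner_neq0.
  rewrite r4 r3 (chrisZl cm' _ _ _ Oj) (chrisC cm' _ _ Oj) (chrisZl cm' _ _ _ Oj) scalerA sg_sq scale1r.
  by have := gf_geodesic gf; rewrite eF.
split; last by move=> j t dj; have [] := loc j t dj.
split; last by move=> j t dj y; have [r1 r2 _ r4] := loc j t dj.
by move=> t; apply: (@continuous_comp _ _ _ mu phi); [exact: cmu|exact: phi_smooth.1].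
Unshelve. all: by end_near. Qed.

End Boxes.

Theorem closed_geodesic : compact [set: M] -> connected [set: M] ->
  transversally_geodesic_closed_curve (range phi).
Proof.
move=> Mc Mconn; have [B BP] := boxes_exist.
(* Recurrence is taken modulo the leaves of [M']: a level in a box lies in a single class. *)
pose sim (z z' : M) := same_leaf (phi z) (phi z').
have sim_refl z : sim z z by exact: rst_refl.
have sim_trans z z' z'' : sim z z' -> sim z' z'' -> sim z z'' by exact: rst_trans.
have [mu [T [am T0 per reach]]] := recurrent_flow (flow_boxes_manifold BP) (box_height_compat BP)
  Mc Mconn (@fspace_hausdorff _ _ _ M) sim_refl sim_trans (box_same_leaf BP).
have [geo reg] := admissible_transverse_geodesic BP am.
exists (phi \o mu), T; split=> //; apply/seteqP; split=> y [_ [x _ <-]] xy.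
  have [t tx] := reach x; exists (phi (mu t)); first by exists t.
  exact: rst_trans tx xy.
by exists (phi (mu x)) => //; exists (mu x).
Qed.

End ClosedGeodesic.

Theorem theorem5p3 (R : realType) (p q p' q' : nat)
    (M : foliated_riemannian_manifold R p q)
    (M' : foliated_riemannian_manifold R p' q')
    (M_compact : compact [set: M]) (M_connected : connected [set: M])
    (M_ricci : forall x : M, transverse_ricci_nonneg_at x)
    (M'_sectional : forall x' : M', transverse_sectional_nonpos_at x')
    (phi : M -> M')
    (phi_smooth : smooth_mapping phi) (phi_foliated : foliated_mapping phi)
    (phi_harmonic : transversally_harmonic phi) :
  [/\ transversally_totally_geodesic phi,
      transversally_constant phi <->
        (exists x' : M', range phi `<=` leaf x'),
      (exists x : M, transverse_ricci_pos_at x) ->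
        transversally_constant phi &
      (exists x : M, transverse_sectional_neg_at (phi x)) ->
        transversally_constant phi \/
        transversally_geodesic_closed_curve (range phi)].
Proof.
have const_iff := transversally_constantP phi_smooth phi_foliated M_compact M_connected
  M_ricci M'_sectional phi_harmonic.
split.
- exact: totally_geodesic.
- split=> [const|[x' sub]]; first exact: constant_in_leaf.
  apply/const_iff; have [i [j [dx dx']]] := charts_at phi point.
  have Dx := chart_local dx dx'; exists i, j, (chart M i point).
  by split=> //; exact: in_leaf_derivative0 sub Dx.
- by move=> [x pos]; exact: (ricci_pos_constant phi_smooth phi_foliated M_compact M_connected
    M_ricci M'_sectional phi_harmonic pos).
- move=> [x neg]; have [const|nconst] := pselect (transversally_constant phi); first by left.
  right; apply: (closed_geodesic phi_smooth phi_foliated) => // i j u Du.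
  + exact: (rank_le1_global phi_smooth phi_foliated M_compact M_connected
      M_ricci M'_sectional phi_harmonic neg Du).
  + by have [] := bochner_local phi_smooth phi_foliated M_compact M_connected
      M_ricci M'_sectional phi_harmonic Du.
  (* A single zero of [S] would already make [phi] transversally constant. *)
  + by apply/eqP => S0; apply: nconst; apply/const_iff; exists i, j, u.
Qed.
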